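(* For every $n\ge 3$ the symmetrized polydisc $\mathbb G_n$ is not a Lu Qi-Keng domain; that is, there are points $z,w\in\mathbb G_n$ such that the Bergman kernel satisfies $K_{\mathbb G_n}(z,w)=0$.
   Context: Let $\mathbb D$ be the open unit disc and $\sigma=(\sigma_1,\dots,\sigma_n):\mathbb C^n\to\mathbb C^n$, $\sigma_k(z_1,\dots,z_n)=\sum_{1\le j_1<\dots<j_k\le n}z_{j_1}\cdots z_{j_k}$. The symmetrized polydisc is $\mathbb G_n=\sigma(\mathbb D^n)$. For a domain $D\subset\mathbb C^n$, $K_D(z,w)$ denotes the Bergman kernel, i.e. the reproducing kernel of the Hilbert space of square-integrable holomorphic functions on $D$. A domain is called a Lu Qi-Keng domain if its Bergman kernel has no zeroes on $D\times D$. *)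

(* Defs.v *)
From HB Require Import structures.
From mathcomp Require Import all_boot all_order all_algebra complex.
From mathcomp Require Import ring.
From mathcomp Require Import all_classical all_reals all_analysis.

Set Implicit Arguments.
Unset Strict Implicit.
Unset Printing Implicit Defensive.

Import Order.TTheory GRing.Theory Num.Theory.
Import numFieldNormedType.Exports.

Local Open Scope classical_set_scope.
Local Open Scope ring_scope.
Local Open Scope complex_scope.

(* The plane R * R, as a measurable space, stands for C = R[i]. *)
Notation plane R := (measurableTypeR R * measurableTypeR R)%type.

Section lebesgue_measure_Cn.
Context {R : realType}.
Local Open Scope ereal_scope.

Definition tuple_cons n (p : plane R * n.-tuple (plane R)) :
  n.+1.-tuple (plane R) := [tuple of p.1 :: p.2].

Fixpoint lebesgue_Cn (n : nat) : set (n.-tuple (plane R)) -> \bar R :=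
  match n with
  | 0 => \d_[tuple]
  | n'.+1 =>
      pushforward ((lebesgue_measure \x lebesgue_measure) \x @lebesgue_Cn n')
                  (@tuple_cons n')
  end.

Lemma measurable_tuple_cons n : measurable_fun [set: _] (@tuple_cons n).
Proof. by apply: measurable_cons; [exact: measurable_fst|exact: measurable_snd]. Qed.

Let tuple_uncons n (t : n.+1.-tuple (plane R)) : plane R * n.-tuple (plane R) :=
  (thead t, [tuple of behead t]).

Let measurable_tuple_uncons n : measurable_fun [set: _] (@tuple_uncons n).
Proof.
apply: measurable_fun_pair; last exact: measurable_behead.
exact: (measurable_tnth ord0).
Qed.

Section packing.
Context d (T : measurableType d) (nu : set T -> \bar R).
Hypotheses (nu0 : nu set0 = 0) (nu_ge0 : forall A, 0 <= nu A)
  (nu_sigma : semi_sigma_additive nu) (nu_sf : sigma_finite setT nu).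

Lemma sigma_finite_packing :
  exists m : {sigma_finite_measure set T -> \bar R}, nu = m.
Proof.
pose m0 := isMeasure.Build _ _ _ nu nu0 nu_ge0 nu_sigma.
pose m : measure T R := HB.pack nu m0.
pose m1 := @Measure_isSigmaFinite.Build _ _ _ m nu_sf.
by pose m' : sigma_finite_measure T R := HB.pack nu m0 m1; exists m'.
Qed.
End packing.

Let sigma_finite_product d1 d2 (T1 : measurableType d1) (T2 : measurableType d2)
    (m1 : sigma_finite_measure T1 R) (m2 : sigma_finite_measure T2 R) :
  exists m : sigma_finite_measure (T1 * T2)%type R, m1 \x m2 = m.
Proof.
apply: sigma_finite_packing.
- exact: measure0.
- by move=> A; exact: measure_ge0.
- exact: measure_semi_sigma_additive.
have /sigma_finiteP[F [TF ndF Foo]] := sigma_finiteT m1.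
have /sigma_finiteP[G [TG ndG Goo]] := sigma_finiteT m2.
exists (fun n => F n `*` G n).
  rewrite -setXTT TF TG predeqE => -[x y]; split.
    move=> [/= [n _ Fnx] [k _ Gky]]; exists (maxn n k) => //; split.
    - by move: x Fnx; exact/subsetPset/ndF/leq_maxl.
    - by move: y Gky; exact/subsetPset/ndG/leq_maxr.
  by move=> [n _ []/= ? ?]; split; exists n.
move=> k; have [? ?] := Foo k; have [? ?] := Goo k.
split; first exact: measurableX.
by rewrite product_measure1E// lte_mul_pinfty// ge0_fin_numE.
Qed.

Let lebesgue_Cn_facts n :
  exists m : {sigma_finite_measure set (n.-tuple (plane R)) -> \bar R},
    @lebesgue_Cn n = m.
Proof.
elim: n => [|n [m mE]].
  by exists (\d_[tuple] : {finite_measure set _ -> \bar R}).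
have [mu2 mu2E] := sigma_finite_product (@lebesgue_measure R) (@lebesgue_measure R).
have [mu muE] := sigma_finite_product mu2 m.
pose p := measure_function_pushforward__canonical__measure_function_Measure
  mu (@measurable_tuple_cons n).
have pE : @lebesgue_Cn n.+1 = p
  by rewrite /= mE mu2E muE.
rewrite pE; apply: sigma_finite_packing.
- exact: measure0.
- by move=> A; exact: measure_ge0.
- exact: measure_semi_sigma_additive.
- have [F FT Foo] := sigma_finiteT mu.
  exists (fun k => @tuple_uncons n @^-1` F k).
    by rewrite -preimage_bigcup -FT preimage_setT.
  move=> k; have [mFk Fkoo] := Foo k; split.
    by rewrite -[X in measurable X]setTI; exact: measurable_tuple_uncons.
  rewrite /= /pushforward -comp_preimage.
  rewrite (_ : _ \o _ = idfun) ?preimage_id//.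
  by apply/funext => -[x t]; rewrite /tuple_uncons /=; congr pair; exact/val_inj.
Qed.

Let lebesgue_Cn0 n : @lebesgue_Cn n set0 = 0.
Proof. by have [m ->] := lebesgue_Cn_facts n; exact: measure0. Qed.

Let lebesgue_Cn_ge0 n A : 0 <= @lebesgue_Cn n A.
Proof. by have [m ->] := lebesgue_Cn_facts n; exact: measure_ge0. Qed.

Let lebesgue_Cn_semi_sigma_additive n : semi_sigma_additive (@lebesgue_Cn n).
Proof.
by have [m ->] := lebesgue_Cn_facts n; exact: measure_semi_sigma_additive.
Qed.

Let lebesgue_Cn_sigma_finite n : sigma_finite setT (@lebesgue_Cn n).
Proof. by have [m ->] := lebesgue_Cn_facts n; exact: sigma_finiteT. Qed.

HB.instance Definition _ n := isMeasure.Build _ _ _ (@lebesgue_Cn n)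
  (@lebesgue_Cn0 n) (@lebesgue_Cn_ge0 n) (@lebesgue_Cn_semi_sigma_additive n).
HB.instance Definition _ n := Measure_isSigmaFinite.Build _ _ _
  (@lebesgue_Cn n) (@lebesgue_Cn_sigma_finite n).

Lemma lebesgue_Cn_box n (A : 'I_n -> set (plane R)) :
  (forall i, measurable (A i)) ->
  lebesgue_Cn [set t | forall i, A i (tnth t i)] =
    \prod_(i < n) (lebesgue_measure \x lebesgue_measure) (A i).
Proof.
elim: n A => [|n IH] A mA.
  by rewrite big_ord0 /= diracE mem_set//= => -[].
rewrite big_ord_recl -IH//= /pushforward.
rewrite -[RHS]product_measure1E//=; last first.
  rewrite (_ : mkset _ = \bigcap_(i in [set: 'I_n])
      (fun t => tnth t i) @^-1` A (lift ord0 i)); last first.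
    by apply/seteqP; split=> t /= At i; [move=> _; exact: At|exact: At].
  apply: fin_bigcap_measurable => // i _.
  by rewrite -[X in measurable X]setTI; exact: measurable_tnth.
congr product_measure1; apply/seteqP; split => -[x t] /= At.
  by split; [exact: (At ord0)|move=> i; have := At (lift ord0 i); rewrite tnthS].
move=> i; have [->|[j ->]] : i = ord0 \/ exists j, i = lift ord0 j.
- by case: (unliftP ord0 i) => [j ->|->]; [right; exists j|left].
- exact: At.1.
- by rewrite tnthS; exact: At.2.
Qed.

End lebesgue_measure_Cn.

(* The usual normed topology on R[i], viewed as a normed space over itself. *)
Section complex_topology.
Variable R : rcfType.
HB.instance Definition _ := PseudoPointedMetric.copy R[i] R[i]^o.
HB.instance Definition _ := GRing.ComAlgebra.copy R[i] R[i]^o.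
HB.instance Definition _ := Vector.copy R[i] R[i]^o.
HB.instance Definition _ := NormedModule.copy R[i] R[i]^o.
End complex_topology.

Section bergman.
Context {R : realType} {n : nat}.
Local Notation C := R[i].
Implicit Types (D : set 'rV[C]_n) (f g : 'rV[C]_n -> C).

Definition Cn_of_tuple (t : n.-tuple (plane R)) : 'rV[C]_n :=
  \row_j ((tnth t j).1 +i* (tnth t j).2).

(* Integral over D of a complex-valued function against the Lebesgue measure of
   C^n, taken separately on real and imaginary parts. *)
Definition Cintegral D f : C :=
  (\int[@lebesgue_Cn R n]_(t in Cn_of_tuple @^-1` D) complex.Re (f (Cn_of_tuple t))) +i*
  (\int[@lebesgue_Cn R n]_(t in Cn_of_tuple @^-1` D) complex.Im (f (Cn_of_tuple t))).

(* Differentiability is over the scalar field C, hence complex. *)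
Definition holomorphic_on D f : Prop :=
  forall z, D z -> differentiable f z.

(* The square-integrable holomorphic functions on an open set D; values of f
   outside D are irrelevant. *)
Definition bergman_space D : set ('rV[C]_n -> C) :=
  [set f | holomorphic_on D f /\
    (\int[@lebesgue_Cn R n]_(t in Cn_of_tuple @^-1` D)
       ((complex.Re `|f (Cn_of_tuple t)|) ^+ 2)%:E < +oo)%E].

Definition L2_inner D f g : C := Cintegral D (fun z => f z * (g z)^*).

Definition is_bergman_kernel D (K : 'rV[C]_n -> 'rV[C]_n -> C) : Prop :=
  (forall w, D w -> bergman_space D (K ^~ w)) /\
  (forall f w, bergman_space D f -> D w -> f w = L2_inner D f (K ^~ w)).

Lemma L2_innerC D f g : L2_inner D g f = (L2_inner D f g)^*.
Proof.
have reE z : complex.Re (g z * (f z)^*) = complex.Re (f z * (g z)^*).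
  by case: (f z) (g z) => a b [c d] /=; ring.
have imE z : complex.Im (g z * (f z)^*) = - complex.Im (f z * (g z)^*).
  by case: (f z) (g z) => a b [c d] /=; ring.
rewrite /L2_inner /Cintegral; congr Complex.
  by apply: eq_Rintegral => t _; rewrite reE.
rewrite /Rintegral -fineN; under eq_integral do rewrite imE EFinN.
rewrite integralE [in RHS]integralE funeposN funenegN.
by case: (integral _ _ _) => [x| |]; case: (integral _ _ _) => [y| |] //=;
  rewrite opprB.
Qed.

Lemma bergman_kernel_unique D K K' :
  is_bergman_kernel D K -> is_bergman_kernel D K' ->
  forall z w, D z -> D w -> K z w = K' z w.
Proof.
move=> [KB Krep] [KB' Krep'] z w Dz Dw.
have -> : K' z w = (K' w z)^*.
  by rewrite (Krep' _ _ (KB' _ Dw) Dz) (Krep' _ _ (KB' _ Dz) Dw) L2_innerC.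
by rewrite (Krep' _ _ (KB _ Dw) Dz) (Krep _ _ (KB' _ Dz) Dw) L2_innerC.
Qed.

(* By [bergman_kernel_unique] the quantification over K ranges over the Bergman
   kernel of D only. It is universal so that a set without Bergman kernel does
   not refute the predicate. *)
Definition lu_qi_keng D : Prop := forall K, is_bergman_kernel D K ->
  forall z w, D z -> D w -> K z w != 0.

Definition elementary_symmetric (z : 'rV[C]_n) (k : nat) : C :=
  \sum_(J : {set 'I_n} | #|J| == k) \prod_(j in J) z ord0 j.

(* The coordinate of index k : 'I_n (counted from 0) is sigma_{k+1}. *)
Definition symmetrization (z : 'rV[C]_n) : 'rV[C]_n :=
  \row_(k < n) elementary_symmetric z k.+1.

Definition polydisc : set 'rV[C]_n := [set z | forall j, `|z ord0 j| < 1].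

Definition symmetrized_polydisc : set 'rV[C]_n := symmetrization @` polydisc.

End bergman.

Arguments symmetrized_polydisc R n : clear implicits.

(* Main.v *)
Require Import Defs.
From HB Require Import structures.
From mathcomp Require Import all_boot all_order all_fingroup all_algebra complex.
From mathcomp Require Import ring lra zify.

Set Implicit Arguments.
Unset Strict Implicit.
Unset Printing Implicit Defensive.

Import Order.TTheory GRing.Theory Num.Theory.
Local Open Scope ring_scope.

(** Let [s] be the symmetrization map of [C^n] and [V] the Vandermonde product
    [vdm], its Jacobian determinant up to sign. At the images of [y] and [a] the
    Bergman kernel of the symmetrized polydisc is a nonzero constant times
      [perm (1 / (1 - y_j * conj a_k)) / prod_(j, k) (1 - y_j * conj a_k)],
    so its zeros are those of a permanent.

    Why this is the kernel. If [f] is holomorphic on the symmetrized polydisc,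
    then [F = (f o s) * V] is holomorphic on the polydisc and antisymmetric. The
    product kernel reproduces [F] ([bergman_polydisc]); antisymmetrizing it
    replaces it by [det ((1 - a_j * conj y_k)^-2)], and the identities of
    Borchardt and Cauchy factor this determinant into the two Vandermonde
    products and the function above ([det_bergman_factor]). The factor
    [conj V(y)] completes [|V|^2], the real Jacobian, and the integral over the
    polydisc becomes one over the symmetrized polydisc. This gives the
    reproducing property where [V(a)] does not vanish and no [a_j] is zero
    ([repro_generic]), and everywhere by continuity ([repro]). As a function of
    its first argument the kernel is symmetric in [y]: Ryser's formula writes
    the permanent through products over the entries of [y], which are resultants
    and so polynomials in the symmetrization ([sker], [skerE]).

    The analysis is kept elementary. Everything holomorphic goes back to one
    form of Stokes' theorem in the plane, proved by Goursat's bisection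
    ([goursat], [dbar_integral0]). It yields the kernel of the disc
    ([bergman_disc]) and also the change of variables ([sig_integral]), without
    inverse functions or a count of preimages: the fields [V * d/ds_m] lift
    to the polydisc as fields with polynomial coefficients and divergence zero
    ([vfield_coef], [vfield_div]); hence the image of the measure [|V|^2 dy]
    annihilates derivatives of test functions ([dbar_symm], [tfun0]), is a
    multiple of Lebesgue measure on boxes ([box_integral]) and so on all
    measurable sets ([sig_measure]). That the multiple [kap] is not zero
    follows by reproducing the function 1 ([kap_neq0]).

    Where the kernel vanishes. For [n >= 3] take [y] proportional to
    [(-1, 1, 0, ..., 0)] in a disc and [a] with two nonzero entries. The
    permanent then involves two rows only; it vanishes when Newton's map
    [z - p / p'] of [p = z^(n-2) * (z^2 - 1)] takes the same value at the two
    poles [A] and [B] ([newton_condition]). This has a solution with [A] and [B]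
    just below the real axis, and a large disc centred far up the imaginary axis
    contains the zeros of [p] but neither pole. Rescaled to the unit disc, this
    is the configuration of [permanent_zero]. *)

(** * Vandermonde products and permanents *)

Section VandermondeProduct.

Definition vdm (R : comNzRingType) n (y : 'I_n -> R) : R :=
  \prod_(i < n) \prod_(j < n | (i < j)%N) (y j - y i).

Lemma poly_eq_on (R : idomainType) n (x : 'I_n -> R) (p q : {poly R}) : injective x ->
  (size p <= n)%N -> (size q <= n)%N -> (forall j, p.[x j] = q.[x j]) -> p = q.
Proof.
move=> xI sp sq pq; apply/eqP; rewrite -subr_eq0; apply/eqP.
apply: (@roots_geq_poly_eq0 _ _ (codom x)).
- by apply/allP => _ /codomP[j ->]; rewrite rootE !hornerE pq subrr.
- by rewrite map_inj_uniq ?enum_uniq.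
- rewrite size_codom card_ord (leq_trans (size_polyD _ _)) // size_polyN.
  by rewrite geq_max sp.
Qed.

End VandermondeProduct.

Section Permanent.
Variable F : comPzRingType.

Definition permanent n (A : 'M[F]_n) : F := \sum_(s : 'S_n) \prod_i A i (s i).

Lemma expand_permanent n (A : 'M[F]_n.+1) :
  permanent A = \sum_j A ord0 j * permanent (row' ord0 (col' j A)).
Proof.
rewrite /permanent (partition_big (fun s : 'S_n.+1 => s ord0) predT) //=.
apply: eq_bigr => j _; rewrite big_distrr /=.
pose f (s : 'S_n.+1) (k : 'I_n) := odflt k (unlift (s ord0) (s (lift ord0 k))).
have fK (s : 'S_n.+1) k : lift (s ord0) (f s k) = s (lift ord0 k).
  rewrite /f; have := neq_lift ord0 k.
  by rewrite -(inj_eq (@perm_inj _ s)) => /unlift_some[? ? ->].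
have f_inj (s : 'S_n.+1) : injective (f s).
  move=> k k' /(congr1 (lift (s ord0))); rewrite !fK.
  by move/perm_inj/lift_inj.
rewrite (reindex (lift_perm ord0 j)) /=.
  rewrite (eq_bigl predT) => [|s]; last by rewrite lift_perm_id eqxx.
  apply: eq_bigr => s _; rewrite big_ord_recl lift_perm_id; congr (_ * _).
  by apply: eq_bigr => k _; rewrite lift_perm_lift !mxE.
exists (fun s => perm (@f_inj s)) => [s _ | s /eqP sj]; apply/permP => k.
  by rewrite permE /f lift_perm_id lift_perm_lift liftK.
case: (unliftP ord0 k) => [k' ->|->]; last by rewrite lift_perm_id sj.
by rewrite lift_perm_lift permE -sj fK.
Qed.

(** Ryser's formula. Expanding the products, a map [f] contributes the signed
    count of the sets that contain its image, which is zero unless [f] is onto. *)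
Lemma permanent_Ryser n (A : 'M[F]_n) :
  permanent A =
  \sum_(S : {set 'I_n}) (-1) ^+ #|~: S| * \prod_j \sum_(k in S) A j k.
Proof.
under eq_bigr do rewrite (bigA_distr_big_dep (fun _ k => k \in _)) big_distrr /=.
rewrite (exchange_big_dep predT) //=.
pose G (f : {ffun 'I_n -> 'I_n}) := \prod_i A i (f i).
have sgnsum (T : {set 'I_n}) :
    \sum_(S : {set 'I_n} | T \subset S) (-1) ^+ #|~: S| = (T == setT)%:R :> F.
  have [->|/eqP TnT] := eqVneq T setT.
    rewrite (big_pred1 setT) ?setCT ?cards0 // => S.
    by rewrite /= eqEsubset subsetT.
  have [x xT] : exists x, x \notin T.
    by apply/existsP; rewrite -negb_forall; apply/forallP => TT; case: TnT;
       apply/setP => x; rewrite inE TT.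
  rewrite (bigID (fun S : {set 'I_n} => x \in S)) /=.
  rewrite [X in _ + X](reindex_onto (fun S : {set 'I_n} => S :\ x)
     (fun S => x |: S)) /=; last first.
    by move=> S /andP[_ xS]; rewrite setU1K.
  rewrite [X in _ + X](eq_bigl (fun S : {set 'I_n} => (T \subset S) && (x \in S))).
    rewrite -big_split big1 //= => S /andP[_ xS].
    rewrite setCD setUC cardsU1 inE xS.
    by rewrite exprS mulN1r subrr.
  move=> S; rewrite setD11 andbT.
  apply/andP/andP => [[TS /eqP xS]|[TS xS]].
    by split; [exact: subset_trans TS (subsetDl _ _)|rewrite -xS setU11].
  by rewrite setD1K // subsetD1 TS xT.
have -> : \sum_(f : {ffun 'I_n -> 'I_n})
    \sum_(S : {set 'I_n} | f \in family (fun=> [in S])) (-1) ^+ #|~: S| * G f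
   = \sum_(f : {ffun 'I_n -> 'I_n}) (injectiveb f)%:R * G f.
  apply: eq_bigr => f _; rewrite -big_distrl /=; congr (_ * _).
  rewrite (eq_bigl (fun S : {set 'I_n} => [set f i | i in 'I_n] \subset S)).
    rewrite sgnsum; congr (_%:R); congr nat_of_bool; apply/eqP/injectiveP.
      move=> fT x y; have /imset_injP fI : #|[set f i | i in 'I_n]| == #|'I_n|.
        by rewrite fT cardsT.
      exact: fI.
    move=> finj; apply/eqP; rewrite eqEcard subsetT card_imset //.
    by rewrite cardsT; exact: leqnn.
  move=> S /=; apply/familyP/subsetP => /= H.
    by move=> y /imsetP[i _ ->]; exact: H.
  by move=> i; apply: H; rewrite imset_f.
rewrite (bigID (fun f : {ffun 'I_n -> 'I_n} => injectiveb f)) /=.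
rewrite [X in _ + X]big1 ?addr0; last by move=> f /negbTE ->; rewrite mul0r.
rewrite (reindex_onto (fun s : 'S_n => pval s) (fun f => insubd (1%g : 'S_n) f)) /=.
  apply: eq_big => [s|s _].
    rewrite (valP s) /=; apply/esym/eqP; apply: val_inj.
    by rewrite /= insubdK //; exact: (valP s).
  by rewrite (valP s) mul1r; apply: eq_bigr => i _; rewrite pvalE.
by move=> f fi; rewrite insubdK.
Qed.

End Permanent.

(** * The identities of Borchardt and Cauchy *)

Section BorchardtCauchy.
Variable F : fieldType.

Lemma logderiv (I : Type) (r : seq I) (P : pred I) (f : I -> F) a :
  (forall i, P i -> a != f i) ->
  (\prod_(i <- r | P i) ('X - (f i)%:P))^`().[a] =
  (\prod_(i <- r | P i) (a - f i)) * \sum_(i <- r | P i) (a - f i)^-1.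
Proof.
move=> af; elim: r => [|i r IH]; first by rewrite !big_nil derivC horner0 mulr0.
rewrite !big_cons; case: ifP => // Pi.
rewrite derivM derivXsubC !hornerE IH horner_prod.
under [X in X + _ = _]eq_bigr do rewrite !hornerE.
by field; rewrite subr_eq0 af.
Qed.

(** The matrix of the operator [- d/dX] on the span of the functions
    [1 / (X - y)], in the basis that interpolates at the nodes [x]; a diagonal
    conjugation has been removed. *)
Definition gaudin n (x : 'I_n -> F) (ys : seq F) : 'M[F]_n :=
  \matrix_(j, l) if j == l
    then \sum_(y <- ys) (x j - y)^-1 - \sum_(i | i != j) (x j - x i)^-1
    else (x l - x j)^-1.

Definition interp_weight n (x : 'I_n -> F) (ys : seq F) l :=
  (\prod_(y <- ys) (x l - y)) / \prod_(i | i != l) (x l - x i).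

(** Lagrange interpolation of [prod (X - y)], differentiated at a node. *)
Lemma gaudin_mul n (x : 'I_n -> F) (ys : seq F) j : injective x ->
  (size ys < n)%N -> (forall j, x j \notin ys) ->
  \sum_l gaudin x ys j l * interp_weight x ys l = 0.
Proof.
move=> xI sys xys.
pose q := \prod_(y <- ys) ('X - y%:P).
pose ell l := \prod_(i | i != l) ('X - (x i)%:P).
have Pn0 l : \prod_(i | i != l) (x l - x i) != 0.
  by apply/prodf_neq0 => i il; rewrite subr_eq0 (inj_eq xI) eq_sym.
have ellE l a : (ell l).[a] = \prod_(i | i != l) (a - x i).
  by rewrite horner_prod; apply: eq_bigr => i _; rewrite !hornerE.
have ell0 l k : k != l -> (ell l).[x k] = 0.
  by move=> kl; rewrite ellE (bigD1 k) //= subrr mul0r.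
have qE a : q.[a] = \prod_(y <- ys) (a - y).
  by rewrite horner_prod; apply: eq_bigr => i _; rewrite !hornerE.
have -> : \sum_l gaudin x ys j l * interp_weight x ys l =
   ((\sum_l interp_weight x ys l *: ell l)^`().[x j] - q^`().[x j])
     * - (\prod_(i | i != j) (x j - x i))^-1.
  have q' : q^`().[x j] = q.[x j] * \sum_(y <- ys) (x j - y)^-1.
    rewrite qE !(big_seq _ _ ys) /q (big_seq _ _ ys) logderiv // => y yys.
    by apply: contraTneq yys => <-.
  rewrite raddf_sum horner_sum q' (bigD1 j) //= [in RHS](bigD1 j) //=.
  rewrite derivZ hornerZ logderiv => [|i ij]; last first.
    by rewrite (inj_eq xI) eq_sym.
  rewrite mxE eqxx qE.
  have -> : \sum_(i < n | i != j) (interp_weight x ys i *: ell i)^`().[x j] =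
     - (\prod_(i | i != j) (x j - x i)) *
       \sum_(l | l != j) gaudin x ys j l * interp_weight x ys l.
    rewrite big_distrr /=; apply: eq_bigr => l lj.
    rewrite derivZ hornerZ mxE eq_sym (negbTE lj) /ell (bigD1 j) 1?eq_sym //=.
    rewrite derivM derivXsubC mul1r !hornerE subrr mul0r addr0.
    rewrite [in RHS](bigD1 l) //= horner_prod.
    under [X in _ * X = _]eq_bigr do rewrite !hornerE.
    under [in LHS]eq_bigl do rewrite andbC.
    have : x j - x l != 0 by rewrite subr_eq0 (inj_eq xI) eq_sym.
    have : x l - x j != 0 by rewrite subr_eq0 (inj_eq xI).
    move: (Pn0 l) => Pl h1 h2; rewrite /interp_weight; by field; rewrite Pl h1.
  move: (Pn0 j).
  move: (\sum_(l | l != j) gaudin x ys j l * interp_weight x ys l) => S.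
  rewrite /interp_weight.
  set B := \sum_(i | i != j) (x j - x i)^-1.
  set P := \prod_(i | i != j) (x j - x i); set Q := \prod_(y <- ys) (x j - y).
  set A := \sum_(y <- ys) (x j - y)^-1 => P0.
  by field.
suff -> : \sum_l interp_weight x ys l *: ell l = q by rewrite subrr mul0r.
apply: (poly_eq_on xI) => [||k].
- apply: (leq_trans (size_sum _ _ _)); apply/bigmax_leqP => l _.
  apply: (leq_trans (size_scale_leq _ _)).
  rewrite /ell -big_filter size_prod_XsubC size_filter -sum1_count sum1_card.
  have := cardC1 l; rewrite card_ord => ->.
  by rewrite prednK // (leq_ltn_trans _ (ltn_ord l)).
- by rewrite size_prod_XsubC.
rewrite horner_sum (bigD1 k) //= big1 => [|l lk]; last first.
  by rewrite hornerZ ell0 1?eq_sym // mulr0.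
by rewrite addr0 hornerZ ellE qE divfK.
Qed.

(** Both sides are functions of the first pole [y]. Cleared of denominators
    they are polynomials, of degree less than the number of nodes because
    without [y] the matrix is singular ([gaudin_mul]); at [y = x j] they agree
    by induction. *)
Lemma det_gaudin n (x : 'I_n -> F) (ys : seq F) : injective x ->
  size ys = n -> (forall j, x j \notin ys) ->
  \det (gaudin x ys) = permanent (\matrix_(k < n, j < n) (x j - ys`_k)^-1).
Proof.
elim: n x ys => [|n IH] x ys xI sys xys.
  rewrite det_mx00 /permanent (big_pred1 1%g) ?big_ord0 // => s /=.
  by apply/esym/eqP/permP => -[].
case: ys sys xys => // y ys /= [sys] xys.
have xy j : x j - y != 0.
  by rewrite subr_eq0; have := xys j; rewrite inE negb_or => /andP[].
have {}xys j : x j \notin ys.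
  by have := xys j; rewrite inE negb_or => /andP[].
pose perm_ (j : 'I_n.+1) := permanent (\matrix_(k < n, i < n) (x (lift j i) - ys`_k)^-1).
have -> : permanent (\matrix_(k < n.+1, j < n.+1) (x j - (y :: ys)`_k)^-1)
    = \sum_j (x j - y)^-1 * perm_ j.
  rewrite expand_permanent; apply: eq_bigr => j _; rewrite mxE /=.
  by congr (_ * permanent _); apply/matrixP => k i; rewrite !mxE.
pose N' := gaudin x ys.
pose u := interp_weight x ys.
have u0 : u ord0 != 0.
  rewrite mulf_eq0 invr_eq0 negb_or; apply/andP; split.
    rewrite prodf_seq_neq0; apply/allP => z zys; rewrite /= subr_eq0.
    by apply: contraTneq zys => <-.
  by apply/prodf_neq0 => i il; rewrite subr_eq0 (inj_eq xI) eq_sym.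
pose Qm : 'M[{poly F}]_n.+1 :=
  \matrix_(j, l) (((x j)%:P - 'X) * (N' j l)%:P + (j == l)%:R).
pose Qm' : 'M[{poly F}]_n.+1 :=
  \matrix_(j, l) if l == ord0 then (u j)%:P else Qm j l.
have QmE j l : Qm j l = ((x j)%:P - 'X) * (N' j l)%:P + (j == l)%:R.
  by rewrite mxE.
have detQm' : \det Qm' = (u ord0)%:P * \det Qm.
  pose E : 'M[{poly F}]_n.+1 :=
    \matrix_(j, l) if l == ord0 then (u j)%:P else (j == l)%:R.
  have -> : Qm' = Qm *m E.
    have EE j l : E j l = if l == ord0 then (u j)%:P else (j == l)%:R.
      by rewrite mxE.
    apply/matrixP => j l; rewrite mxE [RHS]mxE.
    have [->|l0] := eqVneq l ord0; last first.
      rewrite (bigD1 l) //= EE (negbTE l0) eqxx mulr1 big1 ?addr0 //.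
      by move=> k kl; rewrite EE (negbTE l0) (negbTE kl) mulr0.
    under eq_bigr => k _ do rewrite EE QmE eqxx mulrDl -mulrA -polyCM.
    rewrite big_split /= -mulr_sumr -raddf_sum gaudin_mul ?sys // mulr0 add0r.
    rewrite (bigD1 j) //= eqxx mul1r big1 ?addr0 // => k kj.
    by rewrite eq_sym (negbTE kj) mul0r.
  rewrite det_mulmx mulrC; congr (_ * _); rewrite det_trig.
    rewrite big_ord_recl mxE eqxx big1 ?mulr1 // => i _.
    by rewrite mxE eqxx.
  apply/is_trig_mxP => i j ij; rewrite mxE (negbTE (_ : j != ord0)).
    by rewrite -(inj_eq val_inj) /= ltn_eqF.
  by rewrite -(inj_eq val_inj) /= -lt0n (leq_ltn_trans _ ij).
have hornerQm a : (\det Qm).[a] =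
    \det (\matrix_(j, l) ((x j - a) * N' j l + (j == l)%:R)).
  rewrite -horner_evalE -det_map_mx; congr (\det _); apply/matrixP => j l.
  rewrite mxE QmE [RHS]mxE; apply: (etrans (horner_evalE _ _)); rewrite !hornerE.
  by case: (j == l); rewrite ?hornerE.
pose R := (u ord0)%:P *
  \sum_j (\prod_(i | i != j) ((x i)%:P - 'X)) * (perm_ j)%:P.
suff QR : \det Qm' = R.
  have := congr1 (horner^~ y) QR; rewrite detQm' /R !hornerM !hornerC.
  move/(mulfI u0); rewrite hornerQm.
  have -> : \matrix_(j, l) ((x j - y) * N' j l + (j == l)%:R) =
      diag_mx (\row_j (x j - y)) *m gaudin x (y :: ys).
    have consE j l :
        gaudin x (y :: ys) j l = N' j l + (x j - y)^-1 *+ (j == l).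
      rewrite !mxE big_cons; case: eqVneq => _; last by rewrite addr0.
      by rewrite mulr1n -addrA addrC.
    have rowE j : (\row_j (x j - y)) 0 j = x j - y by rewrite mxE.
    apply/matrixP => j l; rewrite mul_diag_mx mxE [RHS]mxE rowE consE mulrDr.
    by case: eqVneq => _; rewrite ?mulr1n ?mulr0n ?mulfV ?mulr0.
  rewrite det_mulmx det_diag.
  under eq_bigr do rewrite mxE.
  have P0 : \prod_i (x i - y) != 0 by apply/prodf_neq0 => i _.
  move=> H; apply: (mulfI P0); rewrite H horner_sum big_distrr /=.
  apply: eq_bigr => j _; rewrite !hornerM hornerC horner_prod mulrA.
  congr (_ * _); rewrite [in RHS](bigD1 j) //= mulrAC mulfV // mul1r.
  by apply: eq_bigr => i _; rewrite !hornerE.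
apply: (poly_eq_on xI) => [||j].
- rewrite /determinant; apply: (leq_trans (size_sum _ _ _)).
  apply/bigmax_leqP => s _.
  have -> (P : {poly F}) : size ((-1) ^+ odd_perm s * P) = size P.
    by case: (odd_perm s); rewrite ?mulN1r ?size_polyN ?mul1r.
  apply: (leq_trans (size_prod_leq _ _)); rewrite card_ord leq_subLR.
  have size2 i l : (size (Qm i l) <= 2)%N.
    rewrite QmE (leq_trans (size_polyD _ _)) // geq_max; apply/andP; split.
      rewrite mulrC mul_polyC (leq_trans (size_scale_leq _ _)) //.
      by rewrite -opprB size_polyN size_XsubC.
    by case: (i == l); rewrite ?size_poly0 // size_poly1.
  rewrite (bigD1 (s^-1%g ord0)) //= mxE permKV eqxx.
  apply: (@leq_trans (1 + \sum_(i < n.+1 | i != s^-1%g ord0) 2).+1).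
    rewrite ltnS leq_add ?size_polyC_leq1 //; apply: leq_sum => i _.
    by rewrite mxE; case: ifP => // _; rewrite (leq_trans (size_polyC_leq1 _)).
  rewrite sum_nat_const; have := cardC1 (s^-1%g ord0).
  rewrite card_ord /= => ->.
  by rewrite muln2 -addnn; lia.
- rewrite /R mul_polyC (leq_trans (size_scale_leq _ _)) //.
  apply: (leq_trans (size_sum _ _ _)); apply/bigmax_leqP => j _.
  rewrite mulrC mul_polyC (leq_trans (size_scale_leq _ _)) //.
  apply: (leq_trans (size_prod_leq _ _)); rewrite leq_subLR.
  have -> : \sum_(i < n.+1 | i != j) size ((x i)%:P - 'X) =
      \sum_(i < n.+1 | i != j) 2.
    by apply: eq_bigr => i _; rewrite -opprB size_polyN size_XsubC.
  have C1 : #|[pred i | i != j]| = n by have := cardC1 j; rewrite card_ord.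
  by rewrite sum_nat_const C1; lia.
rewrite detQm' /R !hornerM !hornerC; congr (_ * _); rewrite hornerQm.
rewrite (expand_det_row _ j) (bigD1 j) //= mxE subrr mul0r add0r eqxx mul1r.
rewrite big1 ?addr0 => [|l lj]; last first.
  by rewrite mxE subrr mul0r add0r eq_sym (negbTE lj) mul0r.
rewrite horner_sum (bigD1 j) //= [X in _ = _ + X]big1 ?addr0 => [|l lj].
  rewrite /cofactor addnn -signr_odd odd_double mul1r hornerM hornerC.
  pose x' i := x (lift j i).
  have -> : row' j (col' j (\matrix_(i, l) ((x i - x j) * N' i l + (i == l)%:R)))
      = diag_mx (\row_i (x' i - x j)) *m gaudin x' ys.
    apply/matrixP => i l; rewrite mul_diag_mx !mxE (inj_eq lift_inj) /x'.
    have [_|il] := eqVneq i l; last by rewrite addr0.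
    rewrite (@bigD1_ord _ _ _ _ j) ?neq_lift //=.
    rewrite (eq_bigl (fun i0 => i0 != i)) => [|i0]; last first.
      by rewrite (inj_eq (@lift_inj n.+1 j)).
    have : x (lift j i) - x j != 0.
      by rewrite subr_eq0 (inj_eq xI) eq_sym neq_lift.
    set a := x _ - x j; set S := \sum_(_ <- _) _; set T := \sum_(_ | _) _ => a0.
    by field.
  rewrite det_mulmx det_diag IH //; last 2 first.
  - by move=> a b /xI/lift_inj.
  - by move=> i; exact: xys.
  congr (_ * _); rewrite horner_prod.
  rewrite [RHS]big_mkcond [RHS](@bigD1_ord _ _ _ _ j) //= eqxx mul1r.
  by apply: eq_bigr => i _; rewrite mxE eq_sym neq_lift !hornerE.
rewrite hornerM horner_prod (bigD1 j) 1?eq_sym //=.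
by rewrite !hornerE subrr !mul0r.
Qed.

(** In the basis that interpolates at [x], differentiation turns the
    Cauchy matrix into the matrix of squares; so the quotient of the two
    determinants is the determinant of [gaudin], a permanent by [det_gaudin]. *)
Lemma borchardt n (x y : 'I_n -> F) : injective x ->
  (forall j k, x j - y k != 0) ->
  \det (\matrix_(j, k) (x j - y k)^-1 ^+ 2) =
  \det (\matrix_(j, k) (x j - y k)^-1) *
  permanent (\matrix_(k, j) (x j - y k)^-1).
Proof.
move=> xI xy.
pose ys := [seq y m | m <- enum 'I_n].
have sys : size ys = n by rewrite size_map size_enum_ord.
have nys (k : 'I_n) : ys`_k = y k.
  by rewrite (nth_map k) ?size_enum_ord // nth_ord_enum.
pose W l := (\prod_m (x l - y m)) / \prod_(i | i != l) (x l - x i).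
have W0 l : W l != 0.
  rewrite mulf_neq0 ?invr_neq0 //; apply/prodf_neq0 => i il //.
  by rewrite subr_eq0 (inj_eq xI) eq_sym.
pose G := gaudin x ys.
have GW j k : \sum_l G j l * (W l * (x l - y k)^-1) = W j * (x j - y k)^-1 ^+ 2.
  pose yk := [seq y m | m <- enum 'I_n & m != k].
  have w l : interp_weight x yk l = W l * (x l - y k)^-1.
    rewrite /interp_weight /W big_map big_filter big_enum_cond /=.
    rewrite [in RHS](bigD1 k) //= [RHS]mulrAC; congr (_ / _).
    by rewrite mulrAC mulfV ?mul1r.
  have g l : gaudin x yk j l = G j l - (x j - y k)^-1 *+ (j == l).
    rewrite !mxE; case: eqVneq => _; last by rewrite subr0.
    rewrite /ys [in RHS]big_map big_enum /= [in RHS](bigD1 k) //=.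
    by rewrite /yk big_map big_filter big_enum_cond /= mulr1n; ring.
  have : \sum_l gaudin x yk j l * interp_weight x yk l = 0.
    apply: gaudin_mul => // [|i].
      rewrite size_map size_filter -sum1_count big_enum_cond sum1_card.
      have := cardC1 k; rewrite card_ord => ->.
      by rewrite prednK // (leq_ltn_trans _ (ltn_ord k)).
    by apply/mapP => -[m _ xm]; have := xy i m; rewrite xm subrr eqxx.
  under eq_bigr do rewrite g w mulrBl.
  rewrite sumrB => /eqP; rewrite subr_eq0 => /eqP ->.
  rewrite (bigD1 j) //= eqxx big1 ?addr0 => [|l lj].
    by rewrite mulr1n expr2 mulrCA.
  by rewrite eq_sym (negbTE lj) mul0r.
have E : G *m (diag_mx (\row_l W l) *m \matrix_(j, k) (x j - y k)^-1) =
    diag_mx (\row_l W l) *m \matrix_(j, k) (x j - y k)^-1 ^+ 2.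
  apply/matrixP => j k; rewrite [LHS]mxE [in RHS]mul_diag_mx !mxE -GW.
  by apply: eq_bigr => l _; congr (_ * _); rewrite mul_diag_mx !mxE.
have := congr1 determinant E; rewrite !det_mulmx det_diag.
have : \prod_i (\row_l W l) 0 i != 0.
  by apply/prodf_neq0 => i _; rewrite mxE.
set P := \prod_i _ => P0; rewrite mulrCA => /(mulfI P0) <-.
rewrite det_gaudin // => [|j]; last first.
  by apply/mapP => -[m _ xm]; have := xy j m; rewrite xm subrr eqxx.
rewrite mulrC; congr (_ * permanent _); apply/matrixP => k j.
by rewrite !mxE nys.
Qed.

Lemma vdm_neq0 n (y : 'I_n -> F) : injective y -> vdm y != 0.
Proof.
move=> yI; apply/prodf_neq0 => i _; apply/prodf_neq0 => j ij.
by rewrite subr_eq0 (inj_eq yI) -(inj_eq val_inj) gtn_eqF.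
Qed.

Lemma prod_pairs n (G : 'I_n -> 'I_n -> F) :
  \prod_k \prod_(m | m != k) G k m =
  \prod_(i < n) \prod_(j < n | (i < j)%N) (G i j * G j i).
Proof.
under [RHS]eq_bigr do rewrite big_split /=.
rewrite big_split /= [X in _ = _ * X](exchange_big_dep predT) //= -big_split /=.
apply: eq_bigr => k _; rewrite (bigID (fun m : 'I_n => (k < m)%N)) /=.
by congr (_ * _); apply: eq_bigl => m; rewrite -(inj_eq val_inj) /=; lia.
Qed.

Lemma vdmE n (y : 'I_n -> F) : vdm y = \det (Vandermonde n (\row_j y j)).
Proof.
rewrite det_Vandermonde; apply: eq_bigr => i _; apply: eq_bigr => j _.
by rewrite !mxE.
Qed.

Lemma vdm_eq0 n (y : 'I_n -> F) : vdm y = 0 -> exists i j, i != j /\ y i = y j.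
Proof.
move=> /eqP; rewrite prodf_seq_eq0 => /hasP[i _ /=].
rewrite prodf_seq_eq0 => /hasP[j _ /= /andP[ij]].
by rewrite subr_eq0 => /eqP yij; exists i, j; rewrite -(inj_eq val_inj) /= ltn_eqF.
Qed.

Definition sgn_pairs n : F := \prod_(i < n) \prod_(j < n | (i < j)%N) (-1).

(** The coefficients of the polynomials [prod_(m != k) (X - y m)] form a matrix
    [Q]: multiplied by the Vandermonde matrix of [x] it gives the Cauchy matrix
    up to a diagonal factor, by that of [y] a diagonal matrix. *)
Lemma cauchy_det n (x y : 'I_n -> F) : (forall j k, x j - y k != 0) ->
  \det (\matrix_(j, k) (x j - y k)^-1) * \prod_j \prod_k (x j - y k) =
  sgn_pairs n * vdm x * vdm y.
Proof.
move=> xy; have [y0|y0] := eqVneq (vdm y) 0.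
  rewrite y0 mulr0; have [i [j [ij yij]]] := vdm_eq0 y0.
  rewrite -det_tr (determinant_alternate ij) ?mul0r // => k.
  by rewrite !mxE yij.
pose q k := \prod_(m | m != k) ('X - (y m)%:P).
have sq k : (size (q k) <= n)%N.
  rewrite /q -big_filter size_prod_XsubC size_filter -sum1_count sum1_card.
  have := cardC1 k; rewrite card_ord => ->.
  by rewrite prednK // (leq_ltn_trans _ (ltn_ord k)).
pose Q : 'M[F]_n := \matrix_(k, i) (q k)`_i.
have QV (z : 'I_n -> F) : Q *m Vandermonde n (\row_j z j) = \matrix_(k, j) (q k).[z j].
  apply/matrixP => k j; rewrite !mxE (horner_coef_wide _ (sq k)).
  by apply: eq_bigr => i _; rewrite !mxE.
have qE k a : (q k).[a] = \prod_(m | m != k) (a - y m).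
  by rewrite horner_prod; apply: eq_bigr => i _; rewrite !hornerE.
have detQ : \det Q = sgn_pairs n * vdm y.
  apply: (mulIf y0); rewrite {1}vdmE -det_mulmx QV.
  have -> : (\matrix_(k, j) (q k).[y j]) = diag_mx (\row_k (q k).[y k]).
    apply/matrixP => k j; rewrite !mxE; case: eqVneq => [->//|kj].
    by rewrite qE (bigD1 j) 1?eq_sym //= subrr mul0r.
  rewrite det_diag; under eq_bigr do rewrite mxE qE.
  rewrite prod_pairs /sgn_pairs /vdm -!big_split /=.
  apply: eq_bigr => i _; rewrite -!big_split /=; apply: eq_bigr => j _.
  by ring.
have := congr1 determinant (QV x); rewrite det_mulmx detQ -vdmE.
have -> : (\matrix_(k, j) (q k).[x j]) =
    ((diag_mx (\row_j \prod_k (x j - y k))) *m \matrix_(j, k) (x j - y k)^-1)^T.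
  apply/matrixP => k j; rewrite mxE mul_diag_mx !mxE qE [in RHS](bigD1 k) //=.
  by rewrite mulrAC mulfV ?mul1r.
rewrite det_tr det_mulmx det_diag; under [X in _ = X * _]eq_bigr do rewrite mxE.
by rewrite [RHS]mulrC => <-; rewrite mulrAC.
Qed.

(** The antisymmetrization of the Bergman kernel of the polydisc is the product
    of the two Vandermonde products with the kernel of the symmetrized one. *)
Lemma det_bergman_factor n (m l : 'I_n -> F) : injective m ->
  (forall j, m j != 0) -> (forall j k, 1 - m j * l k != 0) ->
  \det (\matrix_(j, k) (1 - m j * l k)^-1 ^+ 2) =
  vdm m * vdm l * (permanent (\matrix_(k, j) (1 - m j * l k)^-1)
    / \prod_j \prod_k (1 - m j * l k)).
Proof.
move=> mI m0 ml; pose x j := (m j)^-1.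
have xE j k : 1 - m j * l k = m j * (x j - l k) by rewrite mulrBr mulfV.
have xI : injective x by move=> j k /invr_inj/mI.
have xl j k : x j - l k != 0.
  by have := ml j k; rewrite xE mulf_eq0 negb_or => /andP[].
have P0 : \prod_j \prod_k (x j - l k) != 0.
  by apply/prodf_neq0 => j _; apply/prodf_neq0.
have M0 : \prod_j m j != 0 by apply/prodf_neq0.
have vx : vdm m = sgn_pairs n * vdm x * (\prod_j m j) ^+ n.-1.
  have -> : (\prod_j m j) ^+ n.-1 = \prod_k \prod_(i | i != k) m k.
    rewrite -prodrXl; apply: eq_bigr => k _; rewrite prodr_const.
    by have := cardC1 k; rewrite card_ord => ->.
  rewrite prod_pairs /sgn_pairs /vdm -!big_split /=.
  apply: eq_bigr => i _; rewrite -!big_split /=; apply: eq_bigr => j _.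
  by rewrite /x; field; rewrite !m0.
have detE e : \det (\matrix_(j, k) (1 - m j * l k)^-1 ^+ e) =
    (\prod_j m j) ^- e * \det (\matrix_(j, k) (x j - l k)^-1 ^+ e).
  have -> : \matrix_(j, k) (1 - m j * l k)^-1 ^+ e =
      diag_mx (\row_j (m j)^-1 ^+ e) *m \matrix_(j, k) (x j - l k)^-1 ^+ e.
    apply/matrixP => j k; rewrite mul_diag_mx !mxE xE invfM.
    by rewrite exprMn.
  rewrite det_mulmx det_diag; congr (_ * _).
  by under eq_bigr do rewrite mxE; rewrite prodrXl prodfV exprVn.
have permE : permanent (\matrix_(k, j) (1 - m j * l k)^-1) =
    (\prod_j m j)^-1 * permanent (\matrix_(k, j) (x j - l k)^-1).
  rewrite /permanent big_distrr /=; apply: eq_bigr => s _.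
  under eq_bigr do rewrite mxE xE invfM.
  rewrite big_split /=; congr (_ * _); last by apply: eq_bigr => i _; rewrite mxE.
  by rewrite prodfV; congr (_^-1); rewrite [RHS](reindex_inj (@perm_inj _ s)).
have prodE : \prod_j \prod_k (1 - m j * l k) =
    (\prod_j m j) ^+ n * \prod_j \prod_k (x j - l k).
  rewrite -prodrXl -big_split /=; apply: eq_bigr => j _.
  under eq_bigr do rewrite xE.
  by rewrite big_split /= prodr_const card_ord.
rewrite detE borchardt // permE prodE vx.
have C := cauchy_det xl.
have -> : \det (\matrix_(j, k) (x j - l k)^-1) =
    sgn_pairs n * vdm x * vdm l / \prod_j \prod_k (x j - l k).
  by rewrite -C mulfK.
have -> : (\prod_j m j) ^+ n = (\prod_j m j) ^+ n.-1 * \prod_j m j.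
  have [n0|n0] := posnP n; last by rewrite -exprSr prednK.
  have -> : \prod_j m j = 1.
    by apply: big1 => i _; have := ltn_ord i; rewrite {2}n0.
  by rewrite !expr1n mul1r.
have Mn : (\prod_j m j) ^+ n.-1 != 0 by rewrite expf_neq0.
move: (permanent _) Mn M0 P0 => p.
move: (\prod_j _) (\prod_j m j) (_ ^+ n.-1) => P M E E0 M0 P0.
by field; rewrite E0 M0 P0.
Qed.

End BorchardtCauchy.

(** * Lifting the coordinate fields through the symmetrization map *)

Section SymmetrizationField.

Section Ring.
Variable R : comNzRingType.
Variable n : nat.
Implicit Types (y : 'I_n -> R) (j : 'I_n).

(** The coefficients are the elementary symmetric functions of [y], without
    signs. *)
Definition vpol y : {poly R} := \prod_l ('X + (y l)%:P).
Definition vpol' y j : {poly R} := \prod_(l | l != j) ('X + (y l)%:P).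

(** The factor of [vdm] complementary to the differences with [y j]: it
    equals [vdm y / prod (y l - y j)] wherever this quotient makes sense
    ([vcofE]), but is a polynomial in the other entries only, so that it is
    constant along the [j]-th axis. *)
Definition vcof y j : R := (-1) ^+ j *
  \prod_(i < n | i != j) \prod_(l < n | (i < l)%N && (l != j)) (y l - y i).

Lemma vpolE y j : vpol y = ('X + (y j)%:P) * vpol' y j.
Proof. by rewrite /vpol (bigD1 j). Qed.

Lemma vpol'_monic y j : vpol' y j \is monic.
Proof.
apply: monic_prod => l _; rewrite -[(y l)%:P]opprK -polyCN; exact: monicXsubC.
Qed.

Lemma size_vpol' y j : size (vpol' y j) = n.
Proof.
have E : vpol' y j = \prod_(l <- [seq l <- index_enum 'I_n | l != j]) ('X - (- y l)%:P).
  rewrite big_filter; apply: eq_bigr => l _; by rewrite polyCN opprK.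
rewrite E size_prod_XsubC size_filter -sum1_count.
rewrite -(@eq_bigl _ _ _ _ _ (fun l => l \in predC1 j)); last by move=> l.
rewrite sum1_card cardC1 card_ord prednK //; exact: leq_ltn_trans (ltn_ord j).
Qed.

Lemma vcofE y j : vcof y j * \prod_(l | l != j) (y l - y j) = vdm y.
Proof.
rewrite [in RHS]/vdm [in RHS](bigD1 j) //=.
have -> : \prod_(i < n | i != j) \prod_(l < n | (i < l)%N) (y l - y i) =
  (\prod_(i < n | i != j) \prod_(l < n | (i < l)%N && (l != j)) (y l - y i)) *
  \prod_(i < n | (i < j)%N) (y j - y i).
  transitivity (\prod_(i < n | i != j) (\prod_(l < n | (i < l)%N && (l != j)) (y l - y i)
     * (if (i < j)%N then y j - y i else 1))).
    apply: eq_bigr => i ij; case: ifP => ij'.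
      by rewrite (bigD1 j) //= mulrC.
    rewrite mulr1; apply: eq_bigl => l; case: eqVneq => [->|]; by rewrite ?ij' ?andbT.
  rewrite big_split /= -big_mkcondr; congr (_ * _); apply: eq_bigl => i.
  by rewrite -(inj_eq val_inj) /=; lia.
rewrite (bigID (fun l : 'I_n => (j < l)%N)) /=.
have -> : \prod_(l < n | (l != j) && ~~ (j < l)%N) (y l - y j) =
   (-1) ^+ j * \prod_(l < n | (l < j)%N) (y j - y l).
  transitivity (\prod_(l < n | (l < j)%N) (-1 * (y j - y l))).
    apply: eq_big => [l|l _]; last by ring.
    by rewrite -(inj_eq val_inj) /=; lia.
  rewrite big_split /=; congr (_ * _); rewrite prodr_const; congr (_ ^+ _).
  rewrite -sum1_card (eq_bigl (fun l : 'I_n => (l < j)%N)) //.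
  by rewrite (big_ord_narrow (ltnW (ltn_ord j))) sum1_card card_ord.
have -> : \prod_(l < n | (l != j) && (j < l)%N) (y l - y j) = \prod_(l < n | (j < l)%N) (y l - y j).
  by apply: eq_bigl => l; rewrite -(inj_eq val_inj) /=; lia.
rewrite /vcof; have := signrMK j (1 : R); rewrite mulr1.
by move: ((-1) ^+ j) (\prod_(i < n | i != j) _) (\prod_(l < n | (j < l)%N) _) (\prod_(l < n | (l < j)%N) _) => a b c d aa; rewrite -[RHS]mul1r -[in RHS]aa; ring.
Qed.

Lemma vcof_const y y' j : (forall l, l != j -> y' l = y l) -> vcof y' j = vcof y j.
Proof.
move=> yy; congr (_ * _); apply: eq_bigr => i ij; apply: eq_bigr => l /andP[_ lj].
by rewrite !yy.
Qed.

Lemma vpol'_const y y' j : (forall l, l != j -> y' l = y l) -> vpol' y' j = vpol' y j.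
Proof. by move=> yy; apply: eq_bigr => i ij; rewrite yy. Qed.

End Ring.

Section Idomain.
Variables (R : idomainType) (n : nat).

(** Lagrange interpolation of [X^m] at the nodes [- y j]. *)
Lemma vfield_inj (y : 'I_n -> R) m : injective y -> (m < n)%N ->
  \sum_j ((- y j) ^+ m * vcof y j)%:P * vpol' y j = (vdm y)%:P * 'X^m.
Proof.
move=> yI mn; apply: (@poly_eq_on _ n (fun j => - y j)).
- by move=> i j /oppr_inj /yI.
- apply: (leq_trans (size_sum _ _ _)); apply/bigmax_leqP => j _.
  by apply: leq_trans (size_polyMleq _ _) _; rewrite size_vpol' size_polyC; case: eqP => //= _; lia.
- apply: leq_trans (size_polyMleq _ _) _; rewrite size_polyXn size_polyC; case: eqP => //= _; lia.
move=> k; rewrite horner_sum (bigD1 k) //= big1 ?addr0 => [|j jk].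
  rewrite hornerM hornerC hornerCM hornerXn horner_prod -(vcofE y k).
  have -> : \prod_(l | l != k) ('X + (y l)%:P).[- y k] = \prod_(l | l != k) (y l - y k).
    by apply: eq_bigr => l _; rewrite !hornerE addrC.
  by move: (\prod_(l | l != k) _) (vcof y k) => a b; ring.
have kj : k != j by rewrite eq_sym.
by rewrite hornerM horner_prod (bigD1 k kj) /= !(hornerD, hornerX, hornerC) addNr mul0r mulr0.
Qed.
End Idomain.

Section Field.
Variables (F : fieldType) (n : nat).
Implicit Type y : 'I_n -> F.

(** Both sides are polynomial in [y], so it suffices to treat the generic point
    [y j + X^j.+1], which has distinct coordinates. *)
Lemma vfield y m : (m < n)%N ->
  \sum_j ((- y j) ^+ m * vcof y j)%:P * vpol' y j = (vdm y)%:P * 'X^m.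
Proof.
move=> mn; pose Y j : {poly F} := (y j)%:P + 'X^(j.+1).
have YI : injective Y.
  move=> i j /(congr1 (fun p : {poly F} => p`_(i.+1))).
  rewrite !coefD !coefC !coefXn eqxx !add0r eqSS (inj_eq val_inj).
  by case: (i =P j) => // _ /eqP; rewrite oner_eq0.
have [h hY] : exists h : {rmorphism {poly F} -> F}, forall j, h (Y j) = y j.
  exists (horner_eval 0) => j.
  by rewrite /= /horner_eval hornerD hornerC hornerXn expr0n addr0.
have := congr1 (map_poly h) (vfield_inj YI mn).
rewrite (rmorphM (map_poly h)) /= map_polyXn (map_polyC h) (rmorph_sum (map_poly h)) /=.
have -> : h (vdm Y) = vdm y.
  rewrite rmorph_prod; apply: eq_bigr => i _; rewrite rmorph_prod; apply: eq_bigr => j _.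
  by rewrite rmorphB !hY.
move=> <-; apply: eq_bigr => j _.
rewrite (rmorphM (map_poly h)) /= (map_polyC h) /=; congr (_ * _).
  congr (_%:P); rewrite rmorphM; congr (_ * _); first by rewrite rmorphXn rmorphN hY.
  rewrite rmorphM rmorphXn rmorphN1; congr (_ * _); rewrite rmorph_prod.
  apply: eq_bigr => i _; rewrite rmorph_prod; apply: eq_bigr => l _.
  by rewrite rmorphB !hY.
rewrite rmorph_prod; apply: eq_bigr => l _.
by rewrite rmorphD /= map_polyX map_polyC /= hY.
Qed.

(** As [vpol' y j] is the derivative of [vpol y] in the direction [j],
    the field with components [(- y j)^m * vcof y j] maps to [vdm y] times the
    [m]-th coordinate field. *)
Lemma vfield_coef y m i : (m < n)%N ->
  \sum_j (- y j) ^+ m * vcof y j * (vpol' y j)`_i = vdm y *+ (i == m).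
Proof.
move=> mn; have := congr1 (fun p : {poly F} => p`_i) (vfield y mn).
rewrite coef_sum coefCM coefXn => E; rewrite mulr_natr in E; rewrite -E.
by apply: eq_bigr => j _; rewrite coefCM.
Qed.

(** The coefficient of degree [n.-1] of the previous identity: the field has
    divergence zero. *)
Lemma vfield_div y m : (m.+1 < n)%N -> \sum_j (- y j) ^+ m * vcof y j = 0.
Proof.
move=> mn; have := @vfield_coef y m n.-1 (ltnW mn).
have -> : (n.-1 == m) = false by lia.
rewrite mulr0n => H; rewrite -[RHS]H; apply: eq_bigr => j _; have /monicP := vpol'_monic y j.
by rewrite lead_coefE size_vpol' => ->; rewrite mulr1.
Qed.

Lemma coef_vpol y j i : (vpol y)`_i.+1 = (vpol' y j)`_i + y j * (vpol' y j)`_i.+1.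
Proof. by rewrite (vpolE y j) mulrDl coefD coefXM coefCM. Qed.
Lemma coef_vpol0 y j : (vpol y)`_0 = y j * (vpol' y j)`_0.
Proof. by rewrite (vpolE y j) mulrDl coefD coefXM coefCM /= add0r. Qed.

End Field.
End SymmetrizationField.

(** * Permanents with two nonconstant rows *)

Section PermanentTwoRows.
Variable F : fieldType.

Lemma permanent_tr n (A : 'M[F]_n) : permanent A^T = permanent A.
Proof.
rewrite /permanent (reindex_inj invg_inj) /=; apply: eq_bigr => s _.
rewrite (reindex_inj (@perm_inj _ s)) /=; apply: eq_bigr => i _.
by rewrite mxE permK.
Qed.

Lemma permanent_one_row n (v : 'I_n.+1 -> F) (A : 'M[F]_n.+1) :
  (forall j, A ord0 j = v j) -> (forall i j, i != ord0 -> A i j = 1) ->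
  permanent A = permanent (const_mx 1 : 'M[F]_n) * \sum_j v j.
Proof.
move=> A0 A1; rewrite expand_permanent mulr_sumr; apply: eq_bigr => j _.
rewrite A0 mulrC; congr (permanent _ * _); apply/matrixP => i k.
by rewrite !mxE A1.
Qed.

(** Choosing distinct columns for the two rows gives a product
    of sums minus the sum of products on the diagonal. *)
Lemma permanent_two_rows n (u v : 'I_n.+2 -> F) (A : 'M[F]_n.+2) :
  (forall j, A ord0 j = u j) -> (forall j, A (lift ord0 ord0) j = v j) ->
  (forall i j, i != ord0 -> i != lift ord0 ord0 -> A i j = 1) ->
  permanent A = permanent (const_mx 1 : 'M[F]_n) *
    ((\sum_j u j) * (\sum_j v j) - \sum_j u j * v j).
Proof.
move=> A0 A1 A2; rewrite expand_permanent.
rewrite [in X in _ = _ * (X - _)]mulr_suml -sumrB [RHS]mulr_sumr.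
apply: eq_bigr => j _; rewrite A0.
rewrite (@permanent_one_row _ (fun k => v (lift j k))); last 2 first.
- by move=> k; rewrite !mxE A1.
- by move=> i k i0; rewrite !mxE A2 // (inj_eq lift_inj).
rewrite -mulrBr [in RHS](bigD1_ord j) //= [v j + _]addrC addrK.
by rewrite !mulrA [u j * _]mulrC.
Qed.

End PermanentTwoRows.

From mathcomp Require Import all_classical all_reals all_analysis measurable_realfun.

Import numFieldNormedType.Exports.
Local Open Scope classical_set_scope.
Local Open Scope ring_scope.
Local Open Scope complex_scope.
Local Open Scope ring_scope.

(** * Continuous functions on the plane *)

Section PlaneFunctions.
Context {R : realType}.
Implicit Types (f P Q : plane R -> R) (p q : plane R).
Notation mu := (@lebesgue_measure R).
Notation mu2 := (mu \x mu)%E.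

Lemma countable_cover_measurable d (T : measurableType d) (I : countType)
    (B : I -> set T) (O : set T) : (forall i, measurable (B i)) ->
  (forall t, O t -> exists i, B i t /\ B i `<=` O) -> measurable O.
Proof.
move=> mB OB.
have -> : O = \bigcup_(i in [set: I]) (if pselect (B i `<=` O) then B i else set0).
  apply/seteqP; split => [t /OB[i [Bt BO]]|t [i _]].
    by exists i => //; case: (pselect (B i `<=` O)).
  by case: (pselect (B i `<=` O)) => // BO; exact: BO.
apply: countable_bigcupT_measurable => [|i]; first exact: countableP.
by case: (pselect (B i `<=` O)) => ? /=; [exact: mB|exact: measurable0].
Qed.

Definition box p e : set (plane R) :=
  [set q | `|q.1 - p.1| < e /\ `|q.2 - p.2| < e].

Lemma ball_itvE (a e : R) : [set x : R | `|x - a| < e] = `]a - e, a + e[%classic.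
Proof.
by apply/seteqP; split => x /=; rewrite in_itv /= ltr_distl.
Qed.

Lemma measurable_box p e : measurable (box p e).
Proof.
have -> : box p e = `]p.1 - e, p.1 + e[%classic `*` `]p.2 - e, p.2 + e[%classic.
  by rewrite -!ball_itvE.
by apply: measurableX; exact: measurable_itv.
Qed.

Lemma rat_approx (x e : R) : 0 < e -> exists q : rat, `|x - ratr q| < e.
Proof.
move=> e0; have : x - e < x + e by lra.
move=> /rat_in_itvoo[q]; rewrite in_itv /= => /andP[q1 q2]; exists q.
by rewrite ltr_distl; lra.
Qed.

Lemma inv_approx (e : R) : 0 < e -> exists k : nat, k.+1%:R^-1 < e.
Proof.
move=> e0; exists (Num.truncn e^-1); rewrite invf_plt ?posrE ?ltr0n //.
by rewrite truncnS_gt.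
Qed.

Lemma dist_lt_half (x y z k e : R) :
  `|x - y| < k -> `|z - y| < k -> k < e / 2 -> `|x - z| < e.
Proof.
by move=> xy zy ke; have := ler_distD y x z; rewrite (distrC y); lra.
Qed.

(** An open set of the plane is a union of boxes with rational
    centres and radii of the form [1 / k]. *)
Lemma box_open_measurable (O : set (plane R)) :
  (forall p, O p -> exists2 e, 0 < e & box p e `<=` O) -> measurable O.
Proof.
move=> OO.
pose B (i : rat * rat * nat) := box (ratr i.1.1, ratr i.1.2) i.2.+1%:R^-1.
apply: (@countable_cover_measurable _ _ _ B) => [i|p /OO[e e0 pO]].
  exact: measurable_box.
have [k ke] : exists k : nat, k.+1%:R^-1 < e / 2 by apply: inv_approx; lra.
have k0 : 0 < k.+1%:R^-1 :> R by rewrite invr_gt0 ltr0n.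
have [a pa] := rat_approx p.1 k0; have [b pb] := rat_approx p.2 k0.
exists (a, b, k); split => //= q [/= qa qb]; apply: pO; split.
  exact: dist_lt_half qa pa ke.
exact: dist_lt_half qb pb ke.
Qed.

(** Continuity for the sup norm, in a form that suits integrals over boxes. *)
Definition cont2 f := forall p e, 0 < e -> exists2 d, 0 < d &
  forall q, box p d q -> `|f q - f p| < e.

Lemma measurable_open_preimage d (T : measurableType d) (D : set T) (f : T -> R) :
  measurable D ->
  (forall U : set R, open U -> measurable (D `&` f @^-1` U)) ->
  measurable_fun D f.
Proof.
move=> mD fU _; apply: (measurability _ (measurable_realfun.RGenOInfty.measurableE R)) => //.
move=> _ [_ [x ->] <-]; apply: fU; exact: interval_open.
Qed.

Lemma cont2_measurable f : cont2 f -> measurable_fun setT f.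
Proof.
move=> cf; apply: measurable_open_preimage => // U oU; rewrite setTI.
apply: box_open_measurable => p /= Up.
have := open_nbhs_nbhs (conj oU Up) => /nbhs_ballP[e /= e0 eU].
have [d d0 pd] := cf p _ e0; exists d => // q /pd qp; apply: eU.
by rewrite /ball /= distrC.
Qed.

Lemma cont2_continuous f : cont2 f -> continuous (f : R * R -> R).
Proof.
move=> cf p; apply/cvgrPdist_lt => e e0; have [d d0 pd] := cf p _ e0.
apply/(@nbhs_ballP R (R * R)%type); exists d => // q [/= q1 q2].
by rewrite distrC; apply: pd; split; rewrite distrC.
Qed.

Lemma cont2_slice1 f x : cont2 f -> continuous (fun t => f (x, t)).
Proof.
move=> cf t; apply/cvgrPdist_lt => e e0; have [d d0 pd] := cf (x, t) _ e0.
apply/nbhs_ballP; exists d => // u ut.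
by rewrite distrC; apply: pd; split => /=; rewrite ?subrr ?normr0 // distrC.
Qed.

Lemma cont2_bounded f M : cont2 f ->
  exists C, forall p, `|p.1| <= M -> `|p.2| <= M -> `|f p| <= C.
Proof.
move=> /cont2_continuous cf.
have : compact (f @` (`[- M, M]%classic `*` `[- M, M]%classic)).
  apply: (@continuous_compact (R * R)%type R f); first exact: continuous_subspaceT.
  by apply: compact_setX; exact: segment_compact.
move=> /compact_bounded[C [_ HC]].
exists (C + 1) => p p1 p2; apply: (HC (C + 1)); first by lra.
by exists p => //; split; rewrite /= in_itv /= -ler_norml.
Qed.

Definition supported M f := forall p, M <= `|p.1| \/ M <= `|p.2| -> f p = 0.

Lemma cont2_supported_bounded f M : cont2 f -> supported M f ->
  exists C, forall p, `|f p| <= C.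
Proof.
move=> cf sf; have [C HC] := cont2_bounded M cf.
have C0 : 0 <= C \/ C < 0 by lra.
exists (Num.max C 0) => p; rewrite le_max.
have [p1|p1] := leP M `|p.1|; first by rewrite sf ?normr0 ?lexx ?orbT //; left.
have [p2|p2] := leP M `|p.2|; first by rewrite sf ?normr0 ?lexx ?orbT //; right.
by rewrite HC // ltW.
Qed.

Lemma mu2_box_fin p e : (mu2 (box p e) < +oo)%E.
Proof.
have -> : box p e = `]p.1 - e, p.1 + e[%classic `*` `]p.2 - e, p.2 + e[%classic.
  by rewrite -!ball_itvE.
rewrite product_measure1E; [|exact: measurable_itv..].
have fin (a b : R) : (mu `]a, b[%classic < +oo)%E.
  by rewrite lebesgue_measure_itv /=; case: ifP => _; rewrite -?EFinB ltry.
apply: lte_mul_pinfty; [exact: measure_ge0| |exact: fin].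
by rewrite ge0_fin_numE ?measure_ge0 //; exact: fin.
Qed.

Lemma cont2_integrable f M : cont2 f -> supported M f ->
  mu2.-integrable setT (EFin \o f).
Proof.
move=> cf sf; have [C HC] := cont2_supported_bounded cf sf.
have -> : EFin \o f = (EFin \o f) \_ (box (0, 0) M).
  apply/funext => p; rewrite patchE; case: ifPn => //= np.
  rewrite sf //; have [p1|p1] := leP M `|p.1|; [by left|right].
  rewrite leNgt; apply: contra np => p2; rewrite inE /box /=.
  by rewrite !subr0.
rewrite -integrable_mkcond; last exact: measurable_box.
apply: measurable_bounded_integrable; first exact: measurable_box.
- exact: mu2_box_fin.
- exact: measurable_funTS (cont2_measurable cf).
- exists C; split; first exact: num_real.
  by move=> x Cx p _; apply: le_trans (HC p) (ltW Cx).
Qed.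

Lemma slice_integrable1 f M x : cont2 f -> supported M f ->
  mu.-integrable setT (EFin \o (fun t => f (x, t))).
Proof.
move=> cf sf.
have -> : EFin \o (fun t => f (x, t)) =
    (EFin \o (fun t => f (x, t))) \_ `[- M, M]%classic.
  apply/funext => t; rewrite patchE; case: ifPn => //= nt; rewrite sf //; right.
  by move: nt; rewrite notin_setE /= in_itv /= -ler_norml => /negP; rewrite -ltNge => /ltW.
rewrite -integrable_mkcond; last exact: measurable_itv.
apply: continuous_compact_integrable; first exact: segment_compact.
by apply: continuous_subspaceT; exact: cont2_slice1.
Qed.

Lemma slice_integrable2 f M y : cont2 f -> supported M f ->
  mu.-integrable setT (EFin \o (fun t => f (t, y))).
Proof.
move=> cf sf; pose g (p : plane R) := f (p.2, p.1).
have : mu.-integrable setT (EFin \o (fun t => g (y, t))).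
  apply: (@slice_integrable1 g M) => [p e e0|p [] ?]; last 2 first.
  - by apply: sf; right.
  - by apply: sf; left.
  have [d d0 pd] := cf (p.2, p.1) _ e0; exists d => // q [? ?].
  by apply: pd; split.
by [].
Qed.

End PlaneFunctions.

(** * The divergence theorem for compactly supported fields *)

Section Goursat.
Context {R : realType}.
Notation mu := (@lebesgue_measure R).
Notation mu2 := (mu \x mu)%E.

(** Total differentiability, with partial derivatives [a] and [b]. *)
Definition rdiff (P : plane R -> R) (p : plane R) (a b : R) :=
  forall e, 0 < e -> exists2 d, 0 < d & forall q, box p d q ->
   `|P q - P p - a * (q.1 - p.1) - b * (q.2 - p.2)| <=
     e * (`|q.1 - p.1| + `|q.2 - p.2|).

Lemma Rintegral_itv_split (f : measurableTypeR R -> R) (y h k : R) :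
  mu.-integrable setT (EFin \o f) -> 0 <= h -> 0 <= k ->
  \int[mu]_(t in `]y, (y + (h + k))]) f t =
  \int[mu]_(t in `]y, (y + h)]) f t + \int[mu]_(t in `](y + h), (y + h + k)]) f t.
Proof.
move=> intf h0 k0; rewrite addrA -Rintegral_setU.
- congr Rintegral; apply/seteqP; split => t /=; rewrite !in_itv /=.
    by case: (lerP t (y + h)) => ? /andP[? ?]; [left|right]; apply/andP; split.
  by move=> [] /andP[? ?]; lra.
- exact: measurable_itv.
- exact: measurable_itv.
- by apply: integrableS intf => //; apply: measurableU; exact: measurable_itv.
- apply/disj_setPS => t [] /=; rewrite !in_itv /= => ? ?; lra.
Qed.

Lemma integrable_cst_fin d' (T : measurableType d')
    (m : {measure set T -> \bar R}) (A : set T) (k : R) :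
  measurable A -> (m A < +oo)%E -> m.-integrable A (EFin \o cst k).
Proof.
move=> mA Afin; apply: measurable_bounded_integrable => //.
exact: bounded_cst.
Qed.

Lemma Rintegral0_eq d' (T : measurableType d')
    (m : {measure set T -> \bar R}) (A : set T) (f : T -> R) :
  (forall t, A t -> f t = 0) -> \int[m]_(t in A) f t = 0.
Proof.
by move=> f0; rewrite /Rintegral integral0_eq // => t At; rewrite f0.
Qed.

Variables (P Q d : plane R -> R) (M : R).
Hypotheses (M0 : 0 < M) (cP : cont2 P) (cQ : cont2 Q) (cd : cont2 d).
Hypotheses (sP : supported M P) (sQ : supported M Q) (sd : supported M d).
Hypothesis div : forall p, exists a b a' b',
  [/\ rdiff P p a b, rdiff Q p a' b' & a + b' = d p].

Let IP x y h := \int[mu]_(t in `]y, (y + h)]) P (x, t).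
Let IQ x y h := \int[mu]_(t in `]x, (x + h)]) Q (t, y).
Let rect x y h : set (plane R) := `]x, (x + h)] `*` `]y, (y + h)].
Let Id x y h := \int[mu2]_(p in rect x y h) d p.
Let E x y h := IP (x + h) y h - IP x y h + (IQ x (y + h) h - IQ x y h) - Id x y h.

Let mrect x y h : measurable (rect x y h).
Proof. by apply: measurableX; exact: measurable_itv. Qed.

Let E_split x y k : 0 <= k -> E x y (k + k) =
  E x y k + E (x + k) y k + E x (y + k) k + E (x + k) (y + k) k.
Proof.
move=> k0; rewrite /E.
have IPs z : IP z y (k + k) = IP z y k + IP z (y + k) k.
  by apply: Rintegral_itv_split => //; exact: slice_integrable1 cP sP.
have IQs z : IQ x z (k + k) = IQ x z k + IQ (x + k) z k.
  by apply: Rintegral_itv_split => //; exact: slice_integrable2 cQ sQ.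
rewrite !IPs !IQs !addrA.
have -> : Id x y (k + k) = Id x y k + Id (x + k) y k + Id x (y + k) k
    + Id (x + k) (y + k) k.
  have id D : measurable D -> mu2.-integrable D (EFin \o d).
    by move=> mD; apply: integrableS (cont2_integrable cd sd).
  rewrite /Id -Rintegral_setU //; last 2 first.
  - by apply: id; exact: measurableU.
  - by rewrite /rect; apply/disj_setPS => -[t u] [] /= []; rewrite !in_itv /=; lra.
  rewrite -Rintegral_setU //; last 3 first.
  - exact: measurableU.
  - by apply: id; do ?apply: measurableU.
  - by rewrite /rect; apply/disj_setPS => -[t u] [] /= [] []; rewrite !in_itv /=; lra.
  rewrite -Rintegral_setU //; last 3 first.
  - by do ?apply: measurableU.
  - by apply: id; do ?apply: measurableU.
  - by rewrite /rect; apply/disj_setPS => -[t u] [] /= [[]|] []; rewrite !in_itv /=; lra.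
  congr Rintegral; apply/seteqP; split => [[t u]|[t u]]; rewrite /rect /= !in_itv /=.
    move=> [/andP[t1 t2] /andP[u1 u2]].
    case: (lerP t (x + k)) => tk; case: (lerP u (y + k)) => uk.
    - by do 3 left; split; apply/andP; split.
    - by left; right; split; apply/andP; split => //; lra.
    - by do 2 left; right; split; apply/andP; split => //; lra.
    - by right; split; apply/andP; split => //; lra.
  by move=> [[[]|]|] [/andP[? ?] /andP[? ?]]; split; apply/andP; split; lra.
lra.
Qed.

Let itv_mu (y h : R) : 0 <= h -> fine (mu `]y, (y + h)]%classic) = h.
Proof.
move=> h0; rewrite lebesgue_measure_itv /=; case: ifP => [_|]; first by rewrite /=; lra.
by rewrite lte_fin ltrDl => /negbT; rewrite -leNgt /=; lra.
Qed.

Let itv_fin (y h : R) : (mu `]y, (y + h)%R]%classic < +oo)%E.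
Proof. by rewrite lebesgue_measure_itv /=; case: ifP => _; rewrite -?EFinB ltry. Qed.

Let rect_mu x y h : 0 <= h -> mu2 (rect x y h) = (h * h)%:E.
Proof.
move=> h0; rewrite product_measure1E; [|exact: measurable_itv..].
rewrite EFinM -[X in (X * _)%E]fineK -1?[X in (_ * X)%E]fineK ?itv_mu //.
  by rewrite ge0_fin_numE ?measure_ge0 //; exact: itv_fin.
by rewrite ge0_fin_numE ?measure_ge0 //; exact: itv_fin.
Qed.

Lemma Rintegral_near d' (T : measurableType d')
    (m : {measure set T -> \bar R}) (D : set T) (f : T -> R) (c r : R) :
  measurable D -> (m D < +oo)%E -> m.-integrable D (EFin \o f) ->
  (forall t, D t -> `|f t - c| <= r) ->
  `|\int[m]_(t in D) f t - c * fine (m D)| <= r * fine (m D).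
Proof.
move=> mD Dfin intf fc.
have ic a : m.-integrable D (EFin \o cst a) by exact: integrable_cst_fin.
have ifc : m.-integrable D (EFin \o (fun t => f t - c)).
  exact: (integrableB mD intf (ic c)).
rewrite -Rintegral_cst // -RintegralB //; last exact: (ic c).
apply: le_trans (le_normr_Rintegral mD ifc) _.
rewrite -Rintegral_cst //; apply: le_Rintegral => //.
  by have := integrable_abse ifc.
exact: (ic r).
Qed.

Let int1_near (f : measurableTypeR R -> R) (y h c r : R) :
  mu.-integrable setT (EFin \o f) -> 0 <= h ->
  (forall t, y < t <= y + h -> `|f t - c| <= r) ->
  `|\int[mu]_(t in `]y, (y + h)]) f t - c * h| <= r * h.
Proof.
move=> intf h0 fc.
have := @Rintegral_near _ _ mu `]y, (y + h)]%classic f c r.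
rewrite itv_mu // => H; apply: H.
- exact: measurable_itv.
- exact: itv_fin.
- by apply: integrableS intf => //; exact: measurable_itv.
- by move=> t; rewrite /= in_itv /= => /fc.
Qed.

Let diff_bound (v1 v0 v2 a b u1 u2 s1 s2 h e : R) : 0 < e ->
  `|s1| <= h -> `|s2| <= h -> `|u1| <= h -> `|u2| <= h ->
  `|v1 - v0 - a * s1 - b * u1| <= e * (`|s1| + `|u1|) ->
  `|v2 - v0 - a * s2 - b * u2| <= e * (`|s2| + `|u2|) ->
  `|v1 - v2 - (a * (s1 - s2) + b * (u1 - u2))| <= 4 * e * h.
Proof.
move=> e0 s1h s2h u1h u2h H1 H2.
have -> : v1 - v2 - (a * (s1 - s2) + b * (u1 - u2)) =
  (v1 - v0 - a * s1 - b * u1) - (v2 - v0 - a * s2 - b * u2) by ring.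
apply: le_trans (ler_normB _ _) _.
have -> : 4 * e * h = e * (h + h) + e * (h + h) by ring.
by apply: lerD; [apply: le_trans H1 _|apply: le_trans H2 _];
  rewrite ler_pM2l // lerD.
Qed.

(** Near a point of differentiability the affine parts of [P] and [Q] satisfy
    the divergence theorem exactly, and the remainders contribute less than any
    multiple of the area. *)
Let E_near p x y h e D : 0 < h -> 0 < e -> h < D ->
  x <= p.1 <= x + h -> y <= p.2 <= y + h ->
  (exists a b a' b', [/\ a + b' = d p,
    forall q, box p D q -> `|P q - P p - a * (q.1 - p.1) - b * (q.2 - p.2)| <=
      e * (`|q.1 - p.1| + `|q.2 - p.2|),
    forall q, box p D q -> `|Q q - Q p - a' * (q.1 - p.1) - b' * (q.2 - p.2)| <=
      e * (`|q.1 - p.1| + `|q.2 - p.2|) &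
    forall q, box p D q -> `|d q - d p| <= e]) ->
  `|E x y h| <= 9 * e * (h * h).
Proof.
case: p => p1 p2 /= h0 e0 hD px py [a [b [a' [b' [abd Pp Qp dp]]]]].
have near1 (z w : R) : z <= w <= z + h -> forall t, z <= t <= z + h -> `|t - w| <= h.
  by move=> zw t zt; rewrite ler_norml; lra.
have xx : x <= x <= x + h by lra.
have xh : x <= x + h <= x + h by lra.
have yy : y <= y <= y + h by lra.
have yh : y <= y + h <= y + h by lra.
have inb t u : x <= t <= x + h -> y <= u <= y + h -> box (p1, p2) D (t, u).
  by move=> /(near1 _ _ px) ? /(near1 _ _ py) ?; split; apply: le_lt_trans hD.
have EP : `|(IP (x + h) y h - IP x y h) - (a * h) * h| <= (4 * e * h) * h.
  have i z := slice_integrable1 z cP sP.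
  have mI := measurable_itv `]y, (y + h)] : measurable (_ : set (measurableTypeR R)).
  have iD z : mu.-integrable `]y, (y + h)]%classic (EFin \o (fun t => P (z, t))).
    by apply: integrableS (i z).
  rewrite /IP -RintegralB //.
  apply: int1_near; [exact: (integrableB _ (i _) (i _))|exact: ltW|].
  move=> t /andP[/ltW t1 t2]; have yt : y <= t <= y + h by rewrite t1.
  have := @diff_bound (P (x + h, t)) (P (p1, p2)) (P (x, t)) a b (t - p2) (t - p2)
    (x + h - p1) (x - p1) h e e0.
  have -> : a * (x + h - p1 - (x - p1)) + b * (t - p2 - (t - p2)) = a * h by ring.
  move=> H; apply: (H (near1 _ _ px _ xh) (near1 _ _ px _ xx) (near1 _ _ py _ yt)
    (near1 _ _ py _ yt) (Pp (x + h, t) _) (Pp (x, t) _)); exact: inb.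
have EQ : `|(IQ x (y + h) h - IQ x y h) - (b' * h) * h| <= (4 * e * h) * h.
  have i z := slice_integrable2 z cQ sQ.
  have mI := measurable_itv `]x, (x + h)] : measurable (_ : set (measurableTypeR R)).
  have iD z : mu.-integrable `]x, (x + h)]%classic (EFin \o (fun t => Q (t, z))).
    by apply: integrableS (i z).
  rewrite /IQ -RintegralB //.
  apply: int1_near; [exact: (integrableB _ (i _) (i _))|exact: ltW|].
  move=> t /andP[/ltW t1 t2]; have xt : x <= t <= x + h by rewrite t1.
  have := @diff_bound (Q (t, y + h)) (Q (p1, p2)) (Q (t, y)) b' a' (t - p1) (t - p1)
    (y + h - p2) (y - p2) h e e0.
  have -> : b' * (y + h - p2 - (y - p2)) + a' * (t - p1 - (t - p1)) = b' * h by ring.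
  move=> H; apply: (H (near1 _ _ py _ yh) (near1 _ _ py _ yy) (near1 _ _ px _ xt)
    (near1 _ _ px _ xt) _ _).
  - by rewrite [X in `|X|]addrAC [X in e * X]addrC; apply: (Qp (t, y + h)); exact: inb.
  - by rewrite [X in `|X|]addrAC [X in e * X]addrC; apply: (Qp (t, y)); exact: inb.
have ED : `|Id x y h - d (p1, p2) * (h * h)| <= e * (h * h).
  have muE := rect_mu x y (ltW h0).
  rewrite -[h * h]/(fine (h * h)%:E) -muE; apply: Rintegral_near.
  - exact: mrect.
  - by apply: le_lt_trans (ltry (h * h)); rewrite -muE.
  - by apply: integrableS (cont2_integrable cd sd) => //; exact: mrect.
  - case=> t u [] /=; rewrite !in_itv /= => /andP[/ltW ? ?] /andP[/ltW ? ?].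
    by apply: dp; apply: inb; apply/andP; split.
have EE : E x y h = (IP (x + h) y h - IP x y h - (a * h) * h)
   + (IQ x (y + h) h - IQ x y h - (b' * h) * h) - (Id x y h - d (p1, p2) * (h * h)).
  by rewrite /E -abd; ring.
rewrite EE; apply: le_trans (ler_normB _ _) _.
have -> : 9 * e * (h * h) = 4 * e * h * h + 4 * e * h * h + e * (h * h) by ring.
by apply: lerD => //; apply: le_trans (ler_normD _ _) _; apply: lerD.
Qed.

(** Goursat's argument, in which bisection stands in for continuity of the
    single partial derivatives. The defect [E] of the divergence
    theorem is additive under subdivision of squares. Starting with a square
    that contains the supports, bisection yields squares of side [h] shrinking
    to a point where the defect is at least a constant times [h ^ 2];
    differentiability there makes it smaller than any such multiple. *)
Lemma goursat : \int[mu2]_p d p = 0.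
Proof.
have [//|I0] := eqVneq (\int[mu2]_p d p) 0; exfalso.
(* A state is a lower left corner and a side; [next] selects a quarter that keeps
   at least a quarter of the defect. *)
pose next (s : R * R * R) : R * R * R :=
  let k := s.2 / 2 in let x := s.1.1 in let y := s.1.2 in
  let big s := `|E x y s.2| <= 4 * `|E s.1.1 s.1.2 k| in
  if `|E x y s.2| <= 4 * `|E x y k| then (x, y, k) else
  if `|E x y s.2| <= 4 * `|E (x + k) y k| then (x + k, y, k) else
  if `|E x y s.2| <= 4 * `|E x (y + k) k| then (x, y + k, k) else
  (x + k, y + k, k).
pose s m := iter m next (- M, - M, 2 * M).
pose Es (s : R * R * R) := E s.1.1 s.1.2 s.2.
have nextP t : 0 <= t.2 -> [/\ (next t).2 = t.2 / 2,
    t.1.1 <= (next t).1.1 <= t.1.1 + t.2 / 2,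
    t.1.2 <= (next t).1.2 <= t.1.2 + t.2 / 2 &
    `|Es t| <= 4 * `|Es (next t)|].
  case: t => [[x y] h] /= h0; have k0 : 0 <= h / 2 by lra.
  have := E_split x y k0; rewrite -splitr /next /Es /= => Eh.
  case: ifPn => [c|n1] /=; first by split=> //; lra.
  case: ifPn => [c|n2] /=; first by split=> //; lra.
  case: ifPn => [c|n3] /=; first by split=> //; lra.
  split=> //; [lra|lra|].
  move: n1 n2 n3; rewrite -!ltNge => n1 n2 n3.
  have := ler_normD (E x y (h / 2) + E (x + h / 2) y (h / 2) + E x (y + h / 2) (h / 2)) (E (x + h / 2) (y + h / 2) (h / 2)).
  have := ler_normD (E x y (h / 2) + E (x + h / 2) y (h / 2)) (E x (y + h / 2) (h / 2)).
  have := ler_normD (E x y (h / 2)) (E (x + h / 2) y (h / 2)).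
  rewrite -Eh; lra.
have hs m : (s m).2 = 2 * M / 2 ^+ m.
  elim: m => [|m IH]; first by rewrite expr0 divr1.
  have h0 : 0 <= (s m).2.
    by rewrite IH divr_ge0 ?exprn_ge0 // mulr_ge0 // ltW.
  have [-> _ _ _] := nextP _ h0; rewrite IH exprS.
  by field; rewrite expf_neq0 // pnatr_eq0.
have hs0 m : 0 < (s m).2 by rewrite hs divr_gt0 ?exprn_gt0 // mulr_gt0.
have stepP m := nextP (s m) (ltW (hs0 m)).
have Es0 m : `|Es (s 0%N)| <= 4 ^+ m * `|Es (s m)|.
  elim: m => [|m IH]; first by rewrite expr0 mul1r.
  have [_ _ _ Em] := stepP m; apply: le_trans IH _.
  by rewrite exprSr -mulrA ler_pM2l ?exprn_gt0.
have lim1 (f : nat -> R) (fh : forall m, f m <= f m.+1 <= f m + (s m).2 / 2) :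
    exists l, forall m, f m <= l <= f m + (s m).2.
  have fmono m k : f m <= f (m + k)%N.
    elim: k => [|k IH]; first by rewrite addn0.
    by rewrite addnS; have /andP[? _] := fh (m + k)%N; exact: le_trans IH _.
  have ub m k : f (m + k)%N + (s (m + k)%N).2 <= f m + (s m).2.
    elim: k => [|k IH]; first by rewrite addn0.
    apply: le_trans IH; rewrite addnS; have /andP[_ ?] := fh (m + k)%N.
    have [-> _ _ _] := stepP (m + k)%N; lra.
  have fub m : ubound (range f) (f m + (s m).2).
    move=> _ [k _ <-]; have [mk|/ltnW km] := leqP m k.
      by rewrite -(subnKC mk); have := ub m (k - m)%N; have := hs0 (m + (k - m))%N; lra.
    by rewrite -(subnKC km); have := fmono k (m - k)%N; have := hs0 (k + (m - k))%N; lra.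
  exists (sup (range f)) => m; apply/andP; split.
    apply: ub_le_sup; first by exists (f m + (s m).2); exact: fub.
    by exists m.
  by apply: ge_sup; [exists (f 0%N), 0%N|exact: fub].
have [p1 p1P] : exists l, forall m, (s m).1.1 <= l <= (s m).1.1 + (s m).2.
  by apply: lim1 => m; have [_ ? _ _] := stepP m.
have [p2 p2P] : exists l, forall m, (s m).1.2 <= l <= (s m).1.2 + (s m).2.
  by apply: lim1 => m; have [_ _ ? _] := stepP m.
pose p : plane R := (p1, p2).
have Es0E : Es (s 0%N) = - \int[mu2]_p d p.
  rewrite /Es /= /E.
  have IP0 x : `|x| = M -> IP x (- M) (2 * M) = 0.
    by move=> xM; apply: Rintegral0_eq => t _; apply: sP; left; rewrite /= xM.
  have IQ0 x : `|x| = M -> IQ (- M) x (2 * M) = 0.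
    by move=> xM; apply: Rintegral0_eq => t _; apply: sQ; right; rewrite /= xM.
  have e : - M + 2 * M = M by lra.
  have nM : `|- M| = M by rewrite normrN gtr0_norm.
  have pM : `|M| = M by rewrite gtr0_norm.
  rewrite e !IP0 // !IQ0 // subrr addr0 sub0r; congr (- _).
  rewrite /Id Rintegral_mkcond; apply: eq_Rintegral => q _.
  rewrite patchE; case: ifPn => // nq; rewrite sd //.
  have [q1|q1] := leP M `|q.1|; [by left|right].
  rewrite leNgt; apply: contra nq => q2; rewrite inE /rect /= !in_itv /= e.
  by move: q1 q2; rewrite !ltr_norml; lra.
have eta0 : 0 < `|\int[mu2]_p d p| by rewrite normr_gt0.
set eta := `|_| in eta0.
pose e := eta / (40 * M * M).
have e0 : 0 < e by rewrite divr_gt0 // !mulr_gt0.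
have [a [b [a' [b' [Pp Qp abd]]]]] := div p.
have [D1 D10 P1] := Pp _ e0; have [D2 D20 Q1] := Qp _ e0.
have [D3 D30 d1] := cd p e0.
have [m hm] : exists m, (s m).2 < Num.min D1 (Num.min D2 D3).
  have : 0 < Num.min D1 (Num.min D2 D3) / (2 * M).
    by rewrite divr_gt0 ?mulr_gt0 // !lt_min D10 D20.
  move=> /inv_approx[k kD]; exists k; rewrite hs.
  move: kD; rewrite ltr_pdivlMr ?mulr_gt0 // mulrC; apply: le_lt_trans.
  rewrite ler_pM2l ?mulr_gt0 // lef_pV2 ?posrE ?exprn_gt0 ?ltr0n //.
  by rewrite -natrX ler_nat ltn_expl.
have : `|E (s m).1.1 (s m).1.2 (s m).2| <= 9 * e * ((s m).2 * (s m).2).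
  apply: (@E_near p _ _ _ _ (Num.min D1 (Num.min D2 D3))) => //.
  exists a, b, a', b'; split => // q [/=]; rewrite !lt_min.
  - by move=> /and3P[? ? ?] /and3P[? ? ?]; apply: P1.
  - by move=> /and3P[? ? ?] /and3P[? ? ?]; apply: Q1.
  - by move=> /and3P[? ? ?] /and3P[? ? ?]; apply/ltW/d1.
have := Es0 m; rewrite Es0E normrN -/eta /Es => e1 e2.
have : eta <= 4 ^+ m * (9 * e * ((s m).2 * (s m).2)).
  by apply: le_trans e1 _; rewrite ler_pM2l // exprn_gt0.
rewrite hs.
have -> : 4 ^+ m * (9 * e * (2 * M / 2 ^+ m * (2 * M / 2 ^+ m))) = (36 / 40) * eta.
  have -> : 4 ^+ m = 2 ^+ m * 2 ^+ m :> R by rewrite -exprMn; congr (_ ^+ _); lra.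
  have : 2 ^+ m != 0 :> R by rewrite expf_neq0 // pnatr_eq0.
  move: (2 ^+ m) => c c0; rewrite /e; field.
  by rewrite c0 gt_eqF.
lra.
Qed.

End Goursat.

(** * Wirtinger derivatives *)

Section Wirtinger.
Context {R : realType}.
Local Notation C := R[i].
Implicit Types (z w : C) (f g H : C -> C).
Notation mu := (@lebesgue_measure R).
Notation mu2 := (mu \x mu)%E.

Lemma conjM z w : (z * w)^* = z^* * w^*. Proof. exact: rmorphM. Qed.
Lemma conjD z w : (z + w)^* = z^* + w^*. Proof. exact: rmorphD. Qed.
Lemma conjB z w : (z - w)^* = z^* - w^*. Proof. exact: rmorphB. Qed.

Definition cabs z : R := complex.Re `|z|.

Lemma normC_cabs z : `|z| = (cabs z)%:C.
Proof. by rewrite /cabs normc_def. Qed.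

Lemma cabsE z : cabs z = Num.sqrt (complex.Re z ^+ 2 + complex.Im z ^+ 2).
Proof. by rewrite /cabs normc_def. Qed.

Lemma cabs_ge0 z : 0 <= cabs z. Proof. by rewrite cabsE sqrtr_ge0. Qed.
Hint Resolve cabs_ge0 : core.

Lemma cabs0 : cabs 0 = 0. Proof. by rewrite /cabs normr0. Qed.
Lemma cabs1 : cabs 1 = 1. Proof. by rewrite /cabs normr1. Qed.
Lemma cabsN z : cabs (- z) = cabs z. Proof. by rewrite /cabs normrN. Qed.
Lemma cabsM z w : cabs (z * w) = cabs z * cabs w.
Proof. by apply: complexI; rewrite rmorphM /= -!normC_cabs normrM. Qed.
Lemma cabsX z n : cabs (z ^+ n) = cabs z ^+ n.
Proof. by elim: n => [|n IH]; rewrite ?expr0 ?cabs1 // !exprS cabsM IH. Qed.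
Lemma cabsV z : cabs z^-1 = (cabs z)^-1.
Proof. by apply: complexI; rewrite fmorphV /= -!normC_cabs normfV. Qed.
Lemma cabsJ z : cabs z^* = cabs z. Proof. by rewrite /cabs; congr complex.Re; exact: normcJ. Qed.
Lemma cabsD z w : cabs (z + w) <= cabs z + cabs w.
Proof. by rewrite -lecR rmorphD /= -!normC_cabs ler_normD. Qed.
Lemma cabsB z w : cabs (z - w) <= cabs z + cabs w.
Proof. by rewrite -(cabsN w) cabsD. Qed.
Lemma cabs_distC z w : cabs (z - w) = cabs (w - z).
Proof. by rewrite -cabsN opprB. Qed.
Lemma cabs_eq0 z : (cabs z == 0) = (z == 0).
Proof. by rewrite -(inj_eq (@complexI R)) -normC_cabs normr_eq0. Qed.
Lemma cabs_gt0 z : (0 < cabs z) = (z != 0).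
Proof. by rewrite lt_def cabs_ge0 cabs_eq0 andbT. Qed.
Lemma cabs_real (x : R) : cabs x%:C = `|x|.
Proof. by rewrite cabsE /= expr0n /= addr0 sqrtr_sqr. Qed.
Lemma cabs_sqr z : cabs z ^+ 2 = complex.Re z ^+ 2 + complex.Im z ^+ 2.
Proof. by rewrite cabsE sqr_sqrtr // addr_ge0 ?sqr_ge0. Qed.
Lemma mulJ_cabs z : z * z^* = (cabs z ^+ 2)%:C.
Proof. by rewrite -normCK normC_cabs rmorphXn. Qed.
Lemma abs_Re_le z : `|complex.Re z| <= cabs z.
Proof. by rewrite -lecR -normC_cabs normc_ge_Re. Qed.
Lemma abs_Im_le z : `|complex.Im z| <= cabs z.
Proof.
by rewrite -[`|_|]sqrtr_sqr cabsE ler_wsqrtr // lerDr sqr_ge0.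
Qed.
Lemma cabs_le_ReIm z : cabs z <= `|complex.Re z| + `|complex.Im z|.
Proof.
rewrite -(@ler_pXn2r _ 2) ?nnegrE ?addr_ge0 // cabs_sqr.
rewrite -(real_normK (num_real (complex.Re z))) -(real_normK (num_real (complex.Im z))).
have := normr_ge0 (complex.Re z); have := normr_ge0 (complex.Im z); nra.
Qed.
Lemma cabs_lt1 z : (cabs z < 1) = (`|z| < 1).
Proof. by rewrite normC_cabs -(ltcR _ 1). Qed.

Definition ccont_at f z := forall e, 0 < e -> exists2 d, 0 < d &
  forall w, cabs (w - z) < d -> cabs (f w - f z) < e.

Let cancelK (K x t : R) : 0 < K ->
  [/\ x / K * t * K = x * t, K * (x / K * t) = x * t,
    K * t * (x / K) = x * t & x / K * (K * t) = x * t].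
Proof. by move=> K0; split; field; rewrite gt_eqF. Qed.

(** [a] and [b] are the Wirtinger derivatives of [f] at [z]. *)
Definition wirt f z a b := forall e, 0 < e -> exists2 d, 0 < d &
  forall w, cabs (w - z) < d ->
    cabs (f w - f z - a * (w - z) - b * (w - z)^*) <= e * cabs (w - z).

Lemma wirt_cont f z a b : wirt f z a b -> ccont_at f z.
Proof.
move=> fz e e0; have [d d0 zd] := fz 1 ltr01.
pose K := cabs a + cabs b + 1.
have K0 : 0 < K by rewrite /K ltr_wpDl ?addr_ge0.
exists (Num.min d (e / K)) => [|w]; first by rewrite lt_min d0 divr_gt0.
rewrite lt_min ltr_pdivlMr // => /andP[/zd wd we].
apply: le_lt_trans we.
have -> : f w - f z = (f w - f z - a * (w - z) - b * (w - z)^*)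
   + (a * (w - z) + b * (w - z)^*) by ring.
apply: le_trans (cabsD _ _) _; rewrite [leRHS]mulrC /K mulrDl addrC.
apply: lerD => //; apply: le_trans (cabsD _ _) _.
by rewrite !cabsM cabsJ mulrDl.
Qed.

Lemma wirt_eq f g z a b d : 0 < d -> (forall w, cabs (w - z) < d -> f w = g w) ->
  wirt g z a b -> wirt f z a b.
Proof.
move=> d0 fg gz e e0; have [d' d'0 zd'] := gz e e0.
exists (Num.min d d') => [|w]; first by rewrite lt_min d0.
rewrite lt_min => /andP[/fg -> /zd']; rewrite fg //.
by rewrite subrr cabs0.
Qed.

Lemma wirt_cst c z : wirt (cst c) z 0 0.
Proof.
move=> e e0; exists 1 => // w _.
by rewrite subrr !mul0r !subr0 cabs0 mulr_ge0 // ltW.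
Qed.

Lemma wirt_id z : wirt id z 1 0.
Proof.
move=> e e0; exists 1 => // w _.
by rewrite mul1r mul0r subrr subr0 cabs0 mulr_ge0 // ltW.
Qed.

Lemma wirt_conj f z a b : wirt f z a b -> wirt (fun w => (f w)^*) z b^* a^*.
Proof.
move=> fz e /fz[d d0 zd]; exists d => // w /zd; rewrite -cabsJ.
move: (w - z) => t; rewrite !conjB !conjM conjCK.
by rewrite [X in cabs X]addrAC.
Qed.

Lemma wirtD f g z a b a' b' : wirt f z a b -> wirt g z a' b' ->
  wirt (fun w => f w + g w) z (a + a') (b + b').
Proof.
move=> fz gz e e0; have e20 : 0 < e / 2 by rewrite divr_gt0.
have [d d0 fd] := fz _ e20; have [d' d'0 gd] := gz _ e20.
exists (Num.min d d') => [|w]; first by rewrite lt_min d0.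
rewrite lt_min => /andP[/fd fw /gd gw].
have -> : f w + g w - (f z + g z) - (a + a') * (w - z) - (b + b') * (w - z)^* =
  (f w - f z - a * (w - z) - b * (w - z)^*) +
  (g w - g z - a' * (w - z) - b' * (w - z)^*) by ring.
apply: le_trans (cabsD _ _) _; rewrite [e]splitr mulrDl; exact: lerD.
Qed.

(** The remainder of the product is split so that each summand has one small
    factor; the others are bounded near [z]. *)
Lemma wirtM f g z a b a' b' : wirt f z a b -> wirt g z a' b' ->
  wirt (fun w => f w * g w) z (a * g z + f z * a') (b * g z + f z * b').
Proof.
move=> fz gz e e0.
pose Kf := cabs (f z) + 1; pose Kg := cabs (g z) + 1; pose Kd := cabs a + cabs b + 1.
have Kf0 : 0 < Kf by rewrite /Kf ltr_wpDl.
have Kg0 : 0 < Kg by rewrite /Kg ltr_wpDl.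
have Kd0 : 0 < Kd by rewrite /Kd ltr_wpDl ?addr_ge0.
have [d1 d10 fd] := fz (e / 3 / Kg) (divr_gt0 (divr_gt0 e0 (ltr0Sn _ 2)) Kg0).
have [d2 d20 gd] := gz (e / 3 / Kf) (divr_gt0 (divr_gt0 e0 (ltr0Sn _ 2)) Kf0).
have [d3 d30 gc] := wirt_cont gz (divr_gt0 (divr_gt0 e0 (ltr0Sn _ 2)) Kd0).
have [d4 d40 gc1] := wirt_cont gz ltr01.
exists (Num.min (Num.min d1 d2) (Num.min d3 d4)) => [|w].
  by rewrite !lt_min d10 d20 d30.
rewrite !lt_min => /andP[/andP[/fd fw /gd gw] /andP[/gc cw /gc1 cw1]].
set t := w - z in fw gw *; set r := f w - _ - _ - _ in fw; set s := g w - _ - _ - _ in gw.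
have -> : f w * g w - f z * g z - (a * g z + f z * a') * t - (b * g z + f z * b') * t^* =
  r * g w + f z * s + (a * t + b * t^*) * (g w - g z) by rewrite /r /s; ring.
have gwK : cabs (g w) <= Kg.
  have -> : g w = g z + (g w - g z) by ring.
  by apply: le_trans (cabsD _ _) _; rewrite lerD2l ltW.
have e3 : e * cabs t = e / 3 * cabs t + e / 3 * cabs t + e / 3 * cabs t by field.
rewrite e3; apply: le_trans (cabsD _ _) _; apply: lerD.
  apply: le_trans (cabsD _ _) _; apply: lerD; rewrite cabsM.
    apply: (@le_trans _ _ (e / 3 / Kg * cabs t * Kg)); first exact: ler_pM.
    by have [-> _ _ _] := cancelK (e / 3) (cabs t) Kg0.
  apply: (@le_trans _ _ (Kf * (e / 3 / Kf * cabs t))).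
    by apply: ler_pM => //; rewrite /Kf lerDl.
  by have [_ -> _ _] := cancelK (e / 3) (cabs t) Kf0.
rewrite cabsM; apply: (@le_trans _ _ (Kd * cabs t * (e / 3 / Kd))).
  apply: ler_pM => //; last exact: ltW.
  apply: le_trans (cabsD _ _) _; rewrite !cabsM cabsJ -mulrDl.
  by apply: ler_wpM2r => //; rewrite /Kd lerDl.
by have [_ _ -> _] := cancelK (e / 3) (cabs t) Kd0.
Qed.

Definition cdiff f z l := wirt f z l 0.

Lemma wirt_comp f g z a b l m : wirt f (g z) a b -> wirt g z l m ->
  wirt (fun w => f (g w)) z (a * l + b * m^*) (a * m + b * l^*).
Proof.
move=> fz gz e e0.
pose K := cabs l + cabs m + 1; pose Kd := cabs a + cabs b + 1.
have K0 : 0 < K by rewrite /K ltr_wpDl ?addr_ge0.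
have Kd0 : 0 < Kd by rewrite /Kd ltr_wpDl ?addr_ge0.
have [d1 d10 fd] := fz (e / 2 / K) (divr_gt0 (divr_gt0 e0 (ltr0Sn _ 1)) K0).
have [d2 d20 gd] := gz (e / 2 / Kd) (divr_gt0 (divr_gt0 e0 (ltr0Sn _ 1)) Kd0).
have [d3 d30 gd1] := gz 1 ltr01.
have [d4 d40 gc] := wirt_cont gz d10.
exists (Num.min (Num.min d2 d3) d4) => [|w]; first by rewrite !lt_min d20 d30.
rewrite !lt_min => /andP[/andP[/gd gw /gd1 gw1] /gc/fd fw].
set t := w - z in gw gw1 *; set u := g w - g z in gw gw1 fw.
have uK : cabs u <= K * cabs t.
  have -> : u = (u - l * t - m * t^*) + (l * t + m * t^*) by ring.
  apply: le_trans (cabsD _ _) _; rewrite /K mulrDl addrC; apply: lerD => //.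
  by apply: le_trans (cabsD _ _) _; rewrite !cabsM cabsJ mulrDl.
have -> : f (g w) - f (g z) - (a * l + b * m^*) * t - (a * m + b * l^*) * t^* =
   (f (g w) - f (g z) - a * u - b * u^*)
   + (a * (u - l * t - m * t^*) + b * (u - l * t - m * t^*)^*).
  move: u t {gw gw1 fw uK} => u t; rewrite !conjB !conjM conjCK; ring.
rewrite [e]splitr mulrDl; apply: le_trans (cabsD _ _) _; apply: lerD.
  apply: le_trans fw _; apply: (@le_trans _ _ (e / 2 / K * (K * cabs t))).
    by rewrite ler_pM2l // !divr_gt0.
  by have [_ _ _ ->] := cancelK (e / 2) (cabs t) K0.
apply: (@le_trans _ _ (Kd * (e / 2 / Kd * cabs t))).
  apply: le_trans (cabsD _ _) _; rewrite !cabsM cabsJ -mulrDl.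
  by apply: ler_pM; rewrite ?addr_ge0 // /Kd lerDl.
by have [_ -> _ _] := cancelK (e / 2) (cabs t) Kd0.
Qed.

Lemma wirt_Re (k : R -> R) z k' :
  (forall e, 0 < e -> exists2 d, 0 < d & forall y, `|y - complex.Re z| < d ->
     `|k y - k (complex.Re z) - k' * (y - complex.Re z)| <= e * `|y - complex.Re z|) ->
  wirt (fun w => (k (complex.Re w))%:C) z (k' / 2)%:C (k' / 2)%:C.
Proof.
move=> kz e e0; have [d d0 zd] := kz e e0; exists d => // w wd.
have Rwz : complex.Re w - complex.Re z = complex.Re (w - z) by case: (w) (z) => ? ? [].
have -> : (k (complex.Re w))%:C - (k (complex.Re z))%:C - (k' / 2)%:C * (w - z)
   - (k' / 2)%:C * (w - z)^* =
   (k (complex.Re w) - k (complex.Re z) - k' * (complex.Re w - complex.Re z))%:C.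
  rewrite Rwz; case: (w - z) => x y /=.
  by apply/eqP; rewrite eq_complex /=; apply/andP; split; apply/eqP; field.
rewrite cabs_real; apply: le_trans (zd _ _) _; rewrite Rwz.
  by apply: le_lt_trans (abs_Re_le _) wd.
by rewrite ler_pM2l // abs_Re_le.
Qed.

Lemma ccont_atM f g z : ccont_at f z -> ccont_at g z ->
  ccont_at (fun w => f w * g w) z.
Proof.
move=> fz gz e e0.
have Kf0 : 0 < cabs (f z) + 1 by rewrite ltr_wpDl.
have Kg0 : 0 < cabs (g z) + 1 by rewrite ltr_wpDl.
have [d1 d10 fd] := fz (e / 2 / (cabs (g z) + 1)) (divr_gt0 (divr_gt0 e0 (ltr0Sn _ 1)) Kg0).
have [d2 d20 gd] := gz (e / 2 / (cabs (f z) + 1)) (divr_gt0 (divr_gt0 e0 (ltr0Sn _ 1)) Kf0).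
have [d3 d30 gd1] := gz 1 ltr01.
exists (Num.min (Num.min d1 d2) d3) => [|w]; first by rewrite !lt_min d10 d20.
rewrite !lt_min => /andP[/andP[/fd fw /gd gw] /gd1 gw1].
have -> : f w * g w - f z * g z = (f w - f z) * g w + f z * (g w - g z) by ring.
apply: le_lt_trans (cabsD _ _) _; rewrite [e]splitr !cabsM; apply: ltrD.
  have gwK : cabs (g w) <= cabs (g z) + 1.
    have -> : g w = g z + (g w - g z) by ring.
    by apply: le_trans (cabsD _ _) _; rewrite lerD2l ltW.
  by rewrite -(divfK (lt0r_neq0 Kg0) (e / 2)); apply: le_lt_trans
    (ler_wpM2l (cabs_ge0 _) gwK) _; rewrite ltr_pM2r.
rewrite -(divfK (lt0r_neq0 Kf0) (e / 2)) mulrC.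
apply: le_lt_trans (_ : cabs (g w - g z) * (cabs (f z) + 1) < _).
  by rewrite ler_wpM2l // lerDl.
by rewrite ltr_pM2r.
Qed.

Lemma ccont_at_lip (k : R -> R) K f z : (forall x y, `|k y - k x| <= K * `|y - x|) ->
  ccont_at f z -> ccont_at (fun w => (k (complex.Re (f w)))%:C) z.
Proof.
move=> kL fz e e0.
have K0 : 0 < Num.max K 0 + 1 by rewrite ltr_wpDl // le_max lexx orbT.
have [d d0 zd] := fz _ (divr_gt0 e0 K0); exists d => // w /zd wd.
rewrite -rmorphB cabs_real; apply: le_lt_trans (kL _ _) _.
apply: (@le_lt_trans _ _ ((Num.max K 0 + 1) * cabs (f w - f z))).
  apply: (@le_trans _ _ ((Num.max K 0 + 1) * `|complex.Re (f w) - complex.Re (f z)|)).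
    apply: ler_wpM2r => //; apply: (@le_trans _ _ (Num.max K 0)).
      by rewrite le_max lexx.
    by rewrite lerDl.
  rewrite ler_pM2l //; apply: le_trans (abs_Re_le _).
  by case: (f w) (f z) => ? ? [].
by rewrite mulrC -ltr_pdivlMr.
Qed.

Lemma ccont_atJ f z : ccont_at f z -> ccont_at (fun w => (f w)^*) z.
Proof.
by move=> fz e /fz[d d0 zd]; exists d => // w /zd; rewrite -conjB cabsJ.
Qed.

Lemma ccont_at_eq f g z d : 0 < d -> (forall w, cabs (w - z) < d -> f w = g w) ->
  ccont_at g z -> ccont_at f z.
Proof.
move=> d0 fg gz e e0; have [d' d'0 zd'] := gz e e0.
exists (Num.min d d') => [|w]; first by rewrite lt_min d0.
by rewrite lt_min => /andP[/fg -> /zd']; rewrite fg // subrr cabs0.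
Qed.

Lemma cdiffM f g z l m : cdiff f z l -> cdiff g z m ->
  cdiff (fun w => f w * g w) z (l * g z + f z * m).
Proof. by move=> fz gz; have := wirtM fz gz; rewrite mul0r mulr0 addr0. Qed.

Lemma cdiffD f g z l m : cdiff f z l -> cdiff g z m ->
  cdiff (fun w => f w + g w) z (l + m).
Proof. by move=> fz gz; have := wirtD fz gz; rewrite addr0. Qed.

Lemma cdiff_comp f g z l m : cdiff f (g z) l -> cdiff g z m ->
  cdiff (fun w => f (g w)) z (l * m).
Proof. by move=> fz gz; have := wirt_comp fz gz;
  rewrite conjC0 !mulr0 mul0r !addr0. Qed.

Lemma cdiffV_id z : z != 0 -> cdiff (fun w => w^-1) z (- z^-1 ^+ 2).
Proof.
move=> z0 e e0; have cz : 0 < cabs z by rewrite cabs_gt0.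
pose k := cabs z ^+ 3 / 2.
exists (Num.min (cabs z / 2) (e * k)) => [|w].
  by rewrite lt_min !divr_gt0 // mulr_gt0 // divr_gt0 // exprn_gt0.
rewrite lt_min => /andP[w1 w2].
have cw : cabs z / 2 <= cabs w.
  have : cabs z <= cabs w + cabs (w - z).
    have -> : z = w - (w - z) by ring.
    by apply: le_trans (cabsB _ _) _; rewrite opprB addrCA subrr addr0.
  lra.
have w0 : w != 0 by rewrite -cabs_gt0; apply: lt_le_trans cw; rewrite divr_gt0.
have -> : w^-1 - z^-1 - - z^-1 ^+ 2 * (w - z) - 0 * (w - z)^* =
  (w - z) * (w - z) / (w * z ^+ 2).
  by field; rewrite w0 z0.
rewrite !cabsM cabsV cabsM cabsX -mulrA mulrC ler_wpM2r //.
have D0 : 0 < cabs w * cabs z ^+ 2 by rewrite mulr_gt0 ?exprn_gt0 ?cabs_gt0.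
rewrite ler_pdivrMr //; apply: le_trans (ltW w2) _.
rewrite ler_pM2l // /k exprS mulrAC.
by rewrite ler_pM2r // exprn_gt0.
Qed.

Lemma cdiffV f z l : f z != 0 -> cdiff f z l ->
  cdiff (fun w => (f w)^-1) z (- (f z)^-1 ^+ 2 * l).
Proof. by move=> fz0 fz; exact: cdiff_comp (cdiffV_id fz0) fz. Qed.

Lemma cdiff_poly (p : {poly C}) z : cdiff (fun w => p.[w]) z p^`().[z].
Proof.
elim/poly_ind: p => [|p c IH].
  rewrite deriv0 horner0; have := wirt_cst 0 z.
  by apply: wirt_eq (ltr01) _ => w _; rewrite horner0.
rewrite derivD derivC addr0 derivM derivX mulr1 !hornerE.
have := cdiffD (cdiffM IH (wirt_id z)) (wirt_cst c z).
rewrite addr0 mulr1 addrC.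
by apply: wirt_eq (ltr01) _ => w _; rewrite !hornerE.
Qed.

End Wirtinger.

(** * Complex integrals *)

Section ComplexIntegral.
Context {R : realType}.
Local Notation C := R[i].
Hint Extern 0 (is_true (0 <= cabs _)) => (exact: cabs_ge0) : core.

Definition cint d (T : measurableType d) (m : {measure set T -> \bar R})
    (D : set T) (f : T -> C) : C :=
  ((\int[m]_(x in D) complex.Re (f x)) +i* (\int[m]_(x in D) complex.Im (f x)))%C.

Definition cmeasurable d (T : measurableType d) (D : set T) (f : T -> C) :=
  measurable_fun D (fun x => complex.Re (f x)) /\
  measurable_fun D (fun x => complex.Im (f x)).

Definition cintegrable d (T : measurableType d) (m : {measure set T -> \bar R})
    (D : set T) (f : T -> C) :=
  m.-integrable D (EFin \o (fun x => complex.Re (f x))) /\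
  m.-integrable D (EFin \o (fun x => complex.Im (f x))).

Lemma ReM (z w : C) : complex.Re (z * w) =
  complex.Re z * complex.Re w - complex.Im z * complex.Im w.
Proof. by case: z => a b; case: w. Qed.
Lemma ImM (z w : C) : complex.Im (z * w) =
  complex.Re z * complex.Im w + complex.Im z * complex.Re w.
Proof. by case: z => a b; case: w. Qed.
Lemma ReD (z w : C) : complex.Re (z + w) = complex.Re z + complex.Re w.
Proof. by case: z => a b; case: w. Qed.
Lemma ImD (z w : C) : complex.Im (z + w) = complex.Im z + complex.Im w.
Proof. by case: z => a b; case: w. Qed.
Lemma ReN (z : C) : complex.Re (- z) = - complex.Re z. Proof. by case: z. Qed.
Lemma ImN (z : C) : complex.Im (- z) = - complex.Im z. Proof. by case: z. Qed.
Lemma ReJ (z : C) : complex.Re z^* = complex.Re z. Proof. by case: z. Qed.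
Lemma ImJ (z : C) : complex.Im z^* = - complex.Im z. Proof. by case: z. Qed.
Lemma eq_ReIm (z w : C) : complex.Re z = complex.Re w -> complex.Im z = complex.Im w ->
  z = w.
Proof. by case: z w => a b [c d] /= -> ->. Qed.

Section onmeasure.
Context d (T : measurableType d) (m : {measure set T -> \bar R}) (D : set T).
Hypothesis mD : measurable D.
Implicit Types f g : T -> C.

Lemma cmeasurable_cst (c : C) : cmeasurable D (cst c).
Proof. by split; exact: measurable_cst. Qed.

Lemma cmeasurableD f g : cmeasurable D f -> cmeasurable D g ->
  cmeasurable D (fun x => f x + g x).
Proof.
move=> [f1 f2] [g1 g2]; split; under eq_fun do rewrite ?ReD ?ImD.
  exact: measurable_funD.
exact: measurable_funD.
Qed.

Lemma cmeasurableM f g : cmeasurable D f -> cmeasurable D g ->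
  cmeasurable D (fun x => f x * g x).
Proof.
move=> [f1 f2] [g1 g2]; split; under eq_fun do rewrite ?ReM ?ImM.
  by apply: measurable_funB; exact: measurable_funM.
by apply: measurable_funD; exact: measurable_funM.
Qed.

Lemma cmeasurableN f : cmeasurable D f -> cmeasurable D (fun x => - f x).
Proof.
move=> [f1 f2]; split; under eq_fun do rewrite ?ReN ?ImN.
  exact: (measurable_funN f1).
exact: (measurable_funN f2).
Qed.

Lemma cmeasurableJ f : cmeasurable D f -> cmeasurable D (fun x => (f x)^*).
Proof.
move=> [f1 f2]; split; first by under eq_fun do rewrite ReJ.
by under eq_fun do rewrite ImJ; exact: (measurable_funN f2).
Qed.

Lemma cmeasurable_prod (I : Type) (s : seq I) (P : pred I) (f : I -> T -> C) :
  (forall i, P i -> cmeasurable D (f i)) ->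
  cmeasurable D (fun x => \prod_(i <- s | P i) f i x).
Proof.
move=> fm; elim: s => [|i s IH].
  by rewrite (_ : (fun _ => _) = cst 1) ?funeqE => [|x];
    [exact: cmeasurable_cst|rewrite big_nil].
have [Pi|nPi] := boolP (P i).
  rewrite (_ : (fun _ => _) = (fun x => f i x * \prod_(j <- s | P j) f j x)).
    by apply: cmeasurableM => //; exact: fm.
  by apply/funext => x; rewrite big_cons Pi.
by rewrite (_ : (fun _ => _) = (fun x => \prod_(j <- s | P j) f j x)) //;
  apply/funext => x; rewrite big_cons (negbTE nPi).
Qed.

Lemma measurable_cabs f : cmeasurable D f -> measurable_fun D (fun x => cabs (f x)).
Proof.
move=> [f1 f2]; under eq_fun do rewrite cabsE.
apply: (@measurableT_comp _ _ _ _ _ _ (@Num.sqrt R)).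
  by apply: continuous_measurable_fun; exact: sqrt_continuous.
by apply: measurable_funD; exact: measurable_funX.
Qed.

Lemma cintegrable_measurable f : cintegrable m D f -> cmeasurable D f.
Proof.
by move=> [/integrableP[/measurable_EFinP ? _] /integrableP[/measurable_EFinP ? _]].
Qed.

Lemma cintegrable_le f (g : T -> R) : cmeasurable D f ->
  m.-integrable D (EFin \o g) -> (forall x, D x -> cabs (f x) <= g x) ->
  cintegrable m D f.
Proof.
move=> [f1 f2] ig fg; split; apply: le_integrable ig => //;
  try exact/measurable_EFinP.
  move=> x Dx /=; rewrite lee_fin (le_trans (abs_Re_le _)) //.
  by rewrite (le_trans (fg _ Dx)) // ler_norm.
move=> x Dx /=; rewrite lee_fin (le_trans (abs_Im_le _)) //.
by rewrite (le_trans (fg _ Dx)) // ler_norm.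
Qed.

Lemma integrable_cabs f : cintegrable m D f ->
  m.-integrable D (EFin \o (fun x => cabs (f x))).
Proof.
move=> fi; have [f1 f2] := fi; have fm := cintegrable_measurable fi.
have := integrableD mD (integrable_abse f1) (integrable_abse f2).
apply: le_integrable => //; first exact/measurable_EFinP/measurable_cabs.
move=> x Dx /=; rewrite lee_fin [leLHS]ger0_norm ?cabs_ge0 //.
exact: le_trans (cabs_le_ReIm _) (ler_norm _).
Qed.

Lemma cintegrableM_bounded f g K : cintegrable m D f -> cmeasurable D g ->
  (forall x, D x -> cabs (g x) <= K) -> cintegrable m D (fun x => f x * g x).
Proof.
move=> fi gm gK; have fm := cintegrable_measurable fi.
have iK : m.-integrable D (EFin \o (fun x => K * cabs (f x))).
  exact: (integrableZl mD K (integrable_cabs fi)).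
apply: cintegrable_le iK _; first exact: cmeasurableM.
by move=> x Dx; rewrite cabsM mulrC ler_wpM2r // gK.
Qed.

Lemma cintegrableD f g : cintegrable m D f -> cintegrable m D g ->
  cintegrable m D (fun x => f x + g x).
Proof.
move=> [f1 f2] [g1 g2]; split.
  by under eq_fun do rewrite ReD; exact: (integrableD mD f1 g1).
by under eq_fun do rewrite ImD; exact: (integrableD mD f2 g2).
Qed.

Lemma cintegrableZ (c : C) f : cintegrable m D f -> cintegrable m D (fun x => c * f x).
Proof.
move=> fi; under eq_fun do rewrite mulrC.
by apply: (@cintegrableM_bounded f (cst c) (cabs c)) => //; exact: cmeasurable_cst.
Qed.

Lemma cintegrable_sum (I : Type) (s : seq I) (P : pred I) (f : I -> T -> C) :
  (forall i, P i -> cintegrable m D (f i)) ->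
  cintegrable m D (fun x => \sum_(i <- s | P i) f i x).
Proof.
move=> fi; elim: s => [|i s IH].
  by rewrite (_ : (fun _ => _) = cst 0) ?funeqE => [|x];
    [split; exact: integrable0|rewrite big_nil].
have [Pi|nPi] := boolP (P i).
  rewrite (_ : (fun _ => _) = (fun x => f i x + \sum_(j <- s | P j) f j x)).
    by apply: cintegrableD => //; exact: fi.
  by apply/funext => x; rewrite big_cons Pi.
by rewrite (_ : (fun _ => _) = (fun x => \sum_(j <- s | P j) f j x)) //;
  apply/funext => x; rewrite big_cons (negbTE nPi).
Qed.

Lemma eq_cint f g : (forall x, D x -> f x = g x) -> cint m D f = cint m D g.
Proof.
move=> fg; congr Complex; apply: eq_Rintegral => x /set_mem Dx; by rewrite fg.
Qed.

Lemma cintD f g : cintegrable m D f -> cintegrable m D g ->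
  cint m D (fun x => f x + g x) = cint m D f + cint m D g.
Proof.
move=> [f1 f2] [g1 g2]; apply: eq_ReIm; rewrite ?ReD ?ImD /=.
  by rewrite -RintegralD //; apply: eq_Rintegral => x _; rewrite ReD.
by rewrite -RintegralD //; apply: eq_Rintegral => x _; rewrite ImD.
Qed.

Lemma cintZ (c : C) f : cintegrable m D f ->
  cint m D (fun x => c * f x) = c * cint m D f.
Proof.
move=> [f1 f2].
have Z (k : R) (h : T -> R) : m.-integrable D (EFin \o h) ->
    m.-integrable D (EFin \o (fun x => k * h x)).
  by move=> hi; exact: (integrableZl mD k hi).
apply: eq_ReIm; rewrite ?ReM ?ImM /=.
  rewrite -!RintegralZl // -RintegralB //; [|exact: Z..].
  by apply: eq_Rintegral => x _; rewrite ReM.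
rewrite -!RintegralZl // -RintegralD //; [|exact: Z..].
by apply: eq_Rintegral => x _; rewrite ImM.
Qed.

Lemma cint_sum (I : Type) (s : seq I) (P : pred I) (f : I -> T -> C) :
  (forall i, P i -> cintegrable m D (f i)) ->
  cint m D (fun x => \sum_(i <- s | P i) f i x) =
  \sum_(i <- s | P i) cint m D (f i).
Proof.
move=> fi; elim: s => [|i s IH].
  rewrite big_nil; apply: eq_ReIm => /=; apply: Rintegral0_eq => t _;
  by rewrite big_nil.
rewrite big_cons -IH; case: ifP => Pi; last first.
  by apply: eq_cint => x _; rewrite big_cons Pi.
rewrite -cintD; [|exact: fi|exact: cintegrable_sum].
by apply: eq_cint => x _; rewrite big_cons Pi.
Qed.

Lemma cintJ f : cintegrable m D f ->
  cint m D (fun x => (f x)^*) = (cint m D f)^*.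
Proof.
move=> [f1 f2]; apply: eq_ReIm; rewrite ?ReJ ?ImJ /=.
  by apply: eq_Rintegral => x _; rewrite ReJ.
rewrite -mulN1r -RintegralZl //; apply: eq_Rintegral => x _.
by rewrite ImJ mulN1r.
Qed.

Lemma dominated_Rint (f_ : nat -> T -> R) (f g : T -> R) :
  (forall k, measurable_fun D (f_ k)) -> measurable_fun D f ->
  m.-integrable D (EFin \o g) ->
  (forall k x, D x -> `|f_ k x| <= g x) ->
  (forall x, D x -> f_ ^~ x @ \oo --> f x) ->
  (fun k => \int[m]_(x in D) f_ k x) @ \oo --> \int[m]_(x in D) f x.
Proof.
move=> fm fm0 ig fg fcv.
have fE k : measurable_fun D (EFin \o f_ k) by exact/measurable_EFinP.
have f0E : measurable_fun D (EFin \o f) by exact/measurable_EFinP.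
have [||fi _ cv] := @dominated_convergence _ _ _ m D mD _ _ _ fE f0E _ ig _.
- by apply: aeW => x Dx; apply: cvg_EFin; [exact: nearW|exact: fcv].
- by apply: aeW => x k Dx; rewrite /= lee_fin fg.
apply: fine_cvg; rewrite fineK; last exact: integrable_fin_num.
exact: cv.
Qed.

Definition ccvg (u : nat -> C) (l : C) :=
  forall e, 0 < e -> exists N, forall k, (N <= k)%N -> cabs (u k - l) < e.

Lemma ccvg_ReIm u l : ccvg u l ->
  ((fun k => complex.Re (u k)) @ \oo --> complex.Re l) /\
  ((fun k => complex.Im (u k)) @ \oo --> complex.Im l).
Proof.
move=> ul; split; apply/cvgrPdist_lt => e /ul[N HN]; exists N => // k /= Nk.
  by rewrite -ReN -ReD (le_lt_trans (abs_Re_le _)) // cabs_distC HN.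
by rewrite -ImN -ImD (le_lt_trans (abs_Im_le _)) // cabs_distC HN.
Qed.

(** The uniqueness of limits is built into the statement: it compares the limit
    of the integrals with the integral of the limit. *)
Lemma dominated_cint (f_ : nat -> T -> C) (f : T -> C) (g : T -> R) (l : C) :
  (forall k, cmeasurable D (f_ k)) -> cmeasurable D f ->
  m.-integrable D (EFin \o g) ->
  (forall k x, D x -> cabs (f_ k x) <= g x) ->
  (forall x, D x -> ccvg (f_ ^~ x) (f x)) ->
  ccvg (fun k => cint m D (f_ k)) l -> cint m D f = l.
Proof.
move=> fm fm0 ig fg fcv /ccvg_ReIm[l1 l2]; apply: eq_ReIm => /=.
  rewrite -(cvg_lim (@norm_hausdorff _ R^o) l1); apply/esym/cvg_lim => //.
  apply: (dominated_Rint _ _ ig) => [k||k x Dx|x Dx].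
  - exact: (fm k).1.
  - exact: fm0.1.
  - exact: le_trans (abs_Re_le _) (fg _ _ Dx).
  - exact: (ccvg_ReIm (fcv _ Dx)).1.
rewrite -(cvg_lim (@norm_hausdorff _ R^o) l2); apply/esym/cvg_lim => //.
apply: (dominated_Rint _ _ ig) => [k||k x Dx|x Dx].
- exact: (fm k).2.
- exact: fm0.2.
- exact: le_trans (abs_Im_le _) (fg _ _ Dx).
- exact: (ccvg_ReIm (fcv _ Dx)).2.
Qed.

End onmeasure.

End ComplexIntegral.

(** * Integrals of antiholomorphic derivatives *)

Section Weak.
Context {R : realType}.
Local Notation C := R[i].
Notation mu := (@lebesgue_measure R).
Notation mu2 := (mu \x mu)%E.
Hint Extern 0 (is_true (0 <= cabs _)) => (exact: cabs_ge0) : core.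

Definition cp (p : plane R) : C := (p.1 +i* p.2)%C.

Definition ccont (f : C -> C) := forall z, ccont_at f z.

Lemma cpB_lt (p q : plane R) d : box p (d / 2) q -> cabs (cp q - cp p) < d.
Proof.
move=> [q1 q2]; apply: le_lt_trans (cabs_le_ReIm _) _.
by rewrite [d]splitr; apply: ltrD.
Qed.

Lemma cont2_Re f : ccont f -> cont2 (fun p => complex.Re (f (cp p))).
Proof.
move=> cf p e /(cf (cp p))[d d0 pd]; exists (d / 2) => [|q /cpB_lt/pd qp].
  by rewrite divr_gt0.
by rewrite -ReN -ReD; apply: le_lt_trans (abs_Re_le _) qp.
Qed.

Lemma cont2_Im f : ccont f -> cont2 (fun p => complex.Im (f (cp p))).
Proof.
move=> cf p e /(cf (cp p))[d d0 pd]; exists (d / 2) => [|q /cpB_lt/pd qp].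
  by rewrite divr_gt0.
by rewrite -ImN -ImD; apply: le_lt_trans (abs_Im_le _) qp.
Qed.

Definition csupported M (f : C -> C) := forall z, M <= cabs z -> f z = 0.

Lemma supp_cp M (p : plane R) : M <= `|p.1| \/ M <= `|p.2| -> M <= cabs (cp p).
Proof.
move=> [] Mp; apply: le_trans Mp _.
  exact: (abs_Re_le (cp p)).
exact: (abs_Im_le (cp p)).
Qed.

Lemma ccont_measurable f : ccont f -> cmeasurable setT (fun p => f (cp p)).
Proof.
by move=> cf; split; apply: cont2_measurable; [exact: cont2_Re|exact: cont2_Im].
Qed.

Lemma ccont_integrable f M : ccont f -> csupported M f ->
  cintegrable mu2 setT (fun p => f (cp p)).
Proof.
move=> cf sf; split.
  by apply: (@cont2_integrable R _ M (cont2_Re cf)) => p /supp_cp/sf ->.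
by apply: (@cont2_integrable R _ M (cont2_Im cf)) => p /supp_cp/sf ->.
Qed.

Let Re_lin (v w a b : C) (x y : R) :
  complex.Re w - complex.Re v - complex.Re (a + b) * x
    - (complex.Im b - complex.Im a) * y =
  complex.Re (w - v - a * (x +i* y)%C - b * ((x +i* y)%C)^*).
Proof. by case: v w a b => ? ? [? ?] [? ?] [? ?] /=; ring. Qed.

Let Im_lin (v w a b : C) (x y : R) :
  complex.Im w - complex.Im v - complex.Im (a + b) * x
    - (complex.Re a - complex.Re b) * y =
  complex.Im (w - v - a * (x +i* y)%C - b * ((x +i* y)%C)^*).
Proof. by case: v w a b => ? ? [? ?] [? ?] [? ?] /=; ring. Qed.

Lemma wirt_rdiff_Re H p a b : wirt H (cp p) a b ->
  rdiff (fun q => complex.Re (H (cp q))) p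
    (complex.Re (a + b)) (complex.Im b - complex.Im a).
Proof.
move=> Hp e e0; have [d d0 pd] := Hp e e0; exists (d / 2) => [|q /cpB_lt/pd Hq].
  by rewrite divr_gt0.
have -> : complex.Re (H (cp q)) - complex.Re (H (cp p))
   - complex.Re (a + b) * (q.1 - p.1) - (complex.Im b - complex.Im a) * (q.2 - p.2)
   = complex.Re (H (cp q) - H (cp p) - a * (cp q - cp p) - b * (cp q - cp p)^*).
  exact: Re_lin.
apply: le_trans (abs_Re_le _) _; apply: le_trans Hq _.
by rewrite ler_pM2l //; exact: (cabs_le_ReIm (cp q - cp p)).
Qed.

Lemma wirt_rdiff_Im H p a b : wirt H (cp p) a b ->
  rdiff (fun q => complex.Im (H (cp q))) p
    (complex.Im (a + b)) (complex.Re a - complex.Re b).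
Proof.
move=> Hp e e0; have [d d0 pd] := Hp e e0; exists (d / 2) => [|q /cpB_lt/pd Hq].
  by rewrite divr_gt0.
have -> : complex.Im (H (cp q)) - complex.Im (H (cp p))
   - complex.Im (a + b) * (q.1 - p.1) - (complex.Re a - complex.Re b) * (q.2 - p.2)
   = complex.Im (H (cp q) - H (cp p) - a * (cp q - cp p) - b * (cp q - cp p)^*).
  exact: Im_lin.
apply: le_trans (abs_Im_le _) _; apply: le_trans Hq _.
by rewrite ler_pM2l //; exact: (cabs_le_ReIm (cp q - cp p)).
Qed.

Lemma rdiffN (f : plane R -> R) p a b :
  rdiff f p a b -> rdiff (fun q => - f q) p (- a) (- b).
Proof.
move=> fp e /fp[d d0 pd]; exists d => // q /pd; rewrite -normrN.
by apply: le_trans; rewrite le_eqVlt; apply/orP; left; apply/eqP; congr `|_|; ring.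
Qed.

Lemma wirt_ccont H (k : C -> C) :
  (forall z, exists a, wirt H z a (k z)) -> ccont H.
Proof. by move=> Hk z; have [a /wirt_cont] := Hk z. Qed.

(** Stokes' theorem without boundary term; the two real components of [k] are
    the divergences of two real vector fields. *)
Lemma dbar_integral0 (H k : C -> C) M : 0 < M ->
  (forall z, exists a, wirt H z a (k z)) -> ccont k ->
  csupported M H -> csupported M k -> cint mu2 setT (fun p => k (cp p)) = 0.
Proof.
move=> M0 Hk ck sH sk; have cH := wirt_ccont Hk.
have cN (f : plane R -> R) : cont2 f -> cont2 (fun q => - f q).
  move=> cf p e /(cf p)[d d0 pd]; exists d => // q /pd.
  by rewrite -opprD normrN.
have c2 (f : plane R -> R) : cont2 f -> cont2 (fun q => 2 * f q).
  move=> cf p e e0; have [d d0 pd] := cf p (e / 2) (divr_gt0 e0 (ltr0Sn _ 1)).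
  exists d => // q /pd; rewrite -mulrBr normrM ger0_norm //; lra.
have key (f : plane R -> R) : cont2 f -> supported M f ->
    \int[mu2]_p (2 * f p) = 0 -> \int[mu2]_p f p = 0.
  move=> cf sf; rewrite RintegralZl //; last exact: (cont2_integrable cf sf).
  by move=> /eqP; rewrite mulf_eq0 pnatr_eq0 /= => /eqP.
have sRe f : csupported M f -> supported M (fun p => complex.Re (f (cp p))).
  by move=> sf p /supp_cp/sf ->.
have sIm f : csupported M f -> supported M (fun p => complex.Im (f (cp p))).
  by move=> sf p /supp_cp/sf ->.
apply: eq_ReIm => /=.
  apply: key (cont2_Re ck) (sRe _ sk) _.
  apply: (@goursat R (fun p => complex.Re (H (cp p)))
     (fun p => - complex.Im (H (cp p))) _ M M0).
  - exact: cont2_Re.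
  - by apply: cN; exact: cont2_Im.
  - by apply: c2; exact: cont2_Re.
  - exact: sRe.
  - by move=> p pM; rewrite (sIm _ sH) ?oppr0.
  - by move=> p pM; rewrite (sRe _ sk) ?mulr0.
  move=> p; have [a Ha] := Hk (cp p).
  exists (complex.Re (a + k (cp p))), (complex.Im (k (cp p)) - complex.Im a).
  exists (- complex.Im (a + k (cp p))), (- (complex.Re a - complex.Re (k (cp p)))).
  split; [exact: wirt_rdiff_Re|by apply: rdiffN; exact: wirt_rdiff_Im|].
  by rewrite ReD; ring.
apply: key (cont2_Im ck) (sIm _ sk) _.
apply: (@goursat R (fun p => complex.Im (H (cp p)))
   (fun p => complex.Re (H (cp p))) _ M M0).
- exact: cont2_Im.
- exact: cont2_Re.
- by apply: c2; exact: cont2_Im.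
- exact: sIm.
- exact: sRe.
- by move=> p pM; rewrite (sIm _ sk) ?mulr0.
move=> p; have [a Ha] := Hk (cp p).
exists (complex.Im (a + k (cp p))), (complex.Re a - complex.Re (k (cp p))).
exists (complex.Re (a + k (cp p))), (complex.Im (k (cp p)) - complex.Im a).
split; [exact: wirt_rdiff_Im|exact: wirt_rdiff_Re|].
by rewrite ImD; ring.
Qed.

End Weak.

(** * The Bergman kernel of the disc *)

Section Disc.
Context {R : realType}.
Local Notation C := R[i].
Notation mu := (@lebesgue_measure R).
Notation mu2 := (mu \x mu)%E.
Hint Extern 0 (is_true (0 <= cabs _)) => (exact: cabs_ge0) : core.

Definition disc : set (plane R) := [set p | cabs (cp p) < 1].

Lemma ccont_on_measurable (D : set (plane R)) (f : C -> C) :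
  (forall p, D p -> exists2 e, 0 < e & box p e `<=` D) ->
  (forall p, D p -> ccont_at f (cp p)) -> cmeasurable D (fun p => f (cp p)).
Proof.
move=> oD cf; have mD := box_open_measurable oD.
suff key (h : plane R -> R) : (forall p e, D p -> 0 < e -> exists2 d, 0 < d &
    forall q, box p d q -> `|h q - h p| < e) -> measurable_fun D h.
  split; apply: key => p e Dp /(cf p Dp)[d d0 pd].
    exists (d / 2) => [|q /cpB_lt/pd qp]; first by rewrite divr_gt0.
    by rewrite -ReN -ReD; apply: le_lt_trans (abs_Re_le _) qp.
  exists (d / 2) => [|q /cpB_lt/pd qp]; first by rewrite divr_gt0.
  by rewrite -ImN -ImD; apply: le_lt_trans (abs_Im_le _) qp.
move=> ch; apply: measurable_open_preimage => // U oU.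
apply: box_open_measurable => p /= [Dp Up].
have := open_nbhs_nbhs (conj oU Up) => /nbhs_ballP[e /= e0 eU].
have [d d0 pd] := ch p _ Dp e0; have [d' d'0 pd'] := oD p Dp.
exists (Num.min d d'); first by rewrite lt_min d0.
move=> q [q1 q2]; move: q1 q2; rewrite !lt_min => /andP[? ?] /andP[? ?]; split.
  exact: pd'.
by apply: eU; rewrite /ball /= distrC; exact: pd.
Qed.

Lemma disc_open p : disc p -> exists2 e, 0 < e & box p e `<=` disc.
Proof.
rewrite /disc /= => p1; exists ((1 - cabs (cp p)) / 2) => [|q /cpB_lt qp /=].
  by rewrite divr_gt0 // subr_gt0.
have -> : cp q = cp p + (cp q - cp p) by rewrite addrCA subrr addr0.
by apply: le_lt_trans (cabsD _ _) _; rewrite -ltrBrDl.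
Qed.

Lemma measurable_disc : measurable disc.
Proof. by apply: box_open_measurable => p; exact: disc_open. Qed.

Lemma disc_fin : (mu2 disc < +oo)%E.
Proof.
apply: le_lt_trans (mu2_box_fin (0, 0) 1).
apply: le_measure; rewrite ?inE; [exact: measurable_disc|exact: measurable_box|].
move=> p /= p1; split; rewrite /= subr0; apply: le_lt_trans p1.
  exact: (abs_Re_le (cp p)).
exact: (abs_Im_le (cp p)).
Qed.

Lemma cint_mkcond (D : set (plane R)) (f : plane R -> C) : measurable D ->
  cint mu2 D f = cint mu2 setT (fun p => if p \in D then f p else 0).
Proof.
move=> mD; apply: eq_ReIm; rewrite /= Rintegral_mkcond; apply: eq_Rintegral => p _;
by rewrite patchE; case: ifP.
Qed.

(** Truncation at height [b], decreasing in [t]. Its square is continuously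
    differentiable, so it can cut off a vector field in Stokes' theorem. *)
Definition pos_part (b t : R) := Num.max (b - t) 0.

Lemma pos_part_quad b x y :
  `|pos_part b y ^+ 2 - pos_part b x ^+ 2 - (- 2 * pos_part b x) * (y - x)| <= (y - x) ^+ 2.
Proof.
have -> : y - x = (b - x) - (b - y) by ring.
rewrite /pos_part; move: (b - x) (b - y) => u v.
have [v0|v0] := lerP v 0; have [u0|u0] := lerP u 0;
rewrite ler_norml; have := sqr_ge0 (u - v); have := sqr_ge0 u; have := sqr_ge0 v;
rewrite ?expr0n /= => h1 h2 h3; apply/andP; split; rewrite ?expr2 in h1 h2 h3 *; nra.
Qed.

Lemma pos_part_lip b x y : `|pos_part b y - pos_part b x| <= `|y - x|.
Proof.
rewrite /pos_part; case: (lerP (b - y) 0) => by0; case: (lerP (b - x) 0) => bx0;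
case: (lerP 0 (y - x)) => yx; rewrite ?(ger0_norm yx) ?(ltr0_norm yx) ler_norml;
apply/andP; split; lra.
Qed.

Lemma pos_part_ge0 b t : 0 <= pos_part b t.
Proof. by rewrite le_max lexx orbT. Qed.

Variable a : C.
Hypothesis a1 : cabs a < 1.

Let den z := 1 - a^* * z.
Let phi z := (z - a) / den z.
Let dphi z := (1 - cabs a ^+ 2)%:C * (den z)^-1 ^+ 2.
Let s z := complex.Re (phi z * (phi z)^*).

Let den_ge z : cabs z <= 1 -> 1 - cabs a <= cabs (den z).
Proof.
move=> z1; have : cabs 1 <= cabs (den z) + cabs (a^* * z).
  have -> : (1 : C) = den z + a^* * z by rewrite /den subrK.
  exact: cabsD.
rewrite cabs1 cabsM cabsJ => h; have : cabs a * cabs z <= cabs a by rewrite ler_piMr.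
lra.
Qed.

Let den_neq0 z : cabs z <= 1 -> den z != 0.
Proof. by move=> /den_ge h; rewrite -cabs_gt0 (lt_le_trans _ h) // subr_gt0. Qed.

Let sE z : s z = cabs (phi z) ^+ 2.
Proof. by rewrite /s mulJ_cabs. Qed.

Let s_ge0 z : 0 <= s z. Proof. by rewrite sE sqr_ge0. Qed.

Let one_sub_s z : cabs z <= 1 ->
  (1 - s z) * cabs (den z) ^+ 2 = (1 - cabs a ^+ 2) * (1 - cabs z ^+ 2).
Proof.
move=> z1; have d0 := den_neq0 z1.
rewrite sE /phi cabsM cabsV exprMn exprVn mulrBl mul1r divfK; last first.
  by rewrite expf_neq0 // cabs_eq0.
rewrite !cabs_sqr /den; case: (a) (z) => [p q] [x y] /=; ring.
Qed.

Let s_lt1 z : cabs z < 1 -> s z < 1.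
Proof.
move=> z1; have z1' := ltW z1; have := one_sub_s z1'.
have D0 : 0 < cabs (den z) ^+ 2 by rewrite exprn_gt0 // cabs_gt0 den_neq0.
have : 0 < (1 - cabs a ^+ 2) * (1 - cabs z ^+ 2).
  by rewrite mulr_gt0 // subr_gt0 exprn_ilt1.
by move=> + e; rewrite -e pmulr_lgt0 // subr_gt0.
Qed.

(** The factor [1 - s] vanishes on the unit circle, so the cut-offs
    below vanish near it. *)
Let s_boundary z B : 1 <= cabs z -> B < 1 -> exists2 d, 0 < d &
  forall w, cabs (w - z) < d -> cabs w < 1 -> B < s w.
Proof.
move=> z1 B1; exists ((1 - B) * (1 - cabs a) / 4) => [|w wz w1].
  by rewrite divr_gt0 // mulr_gt0 // subr_gt0.
have E := one_sub_s (ltW w1); have D := den_ge (ltW w1).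
have zw : cabs z <= cabs w + cabs (w - z).
  have -> : z = w - (w - z) by rewrite opprB addrCA subrr addr0.
  by apply: le_trans (cabsB _ _) _; rewrite opprB addrCA subrr addr0.
have S1 := s_lt1 w1.
have D2 : (1 - cabs a) ^+ 2 <= cabs (den w) ^+ 2.
  by rewrite ler_pXn2r ?nnegrE ?subr_ge0 // ltW.
have H : (1 - s w) * (1 - cabs a) ^+ 2 <= (1 - cabs a ^+ 2) * (1 - cabs w ^+ 2).
  by rewrite -E ler_wpM2l // subr_ge0 ltW.
have a0 := cabs_ge0 a; have w0 := cabs_ge0 w.
have H1 : (1 - s w) * (1 - cabs a) <= (1 + cabs a) * (1 - cabs w ^+ 2).
  rewrite -(@ler_pM2r _ (1 - cabs a)) ?subr_gt0 //.
  by apply: le_trans (_ : (1 - s w) * (1 - cabs a) ^+ 2 <= _);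
     [rewrite le_eqVlt; apply/orP; left; apply/eqP; ring|apply: le_trans H _];
     rewrite le_eqVlt; apply/orP; left; apply/eqP; ring.
have H2 : 1 - cabs w ^+ 2 <= 2 * (1 - cabs w) by nra.
have H3 : (1 + cabs a) * (1 - cabs w ^+ 2) < 2 * (2 * ((1 - B) * (1 - cabs a) / 4)).
  by nra.
have H4 : (1 - s w) * (1 - cabs a) < (1 - B) * (1 - cabs a) by lra.
by move: H4; rewrite ltr_pM2r ?subr_gt0 // ltrD2l ltrN2.
Qed.

Let cdiff_den z : cdiff den z (- a^*).
Proof.
rewrite /den; have := cdiffD (wirt_cst 1 z) (cdiffM (wirt_cst (- a^*) z) (wirt_id z)).
rewrite mul0r mulr1 !add0r.
by apply: wirt_eq ltr01 _ => w _; rewrite mulNr.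
Qed.

Let cdiff_phi z : cabs z <= 1 -> cdiff phi z (dphi z).
Proof.
move=> z1; have d0 := den_neq0 z1.
have := cdiffM (cdiffD (wirt_id z) (wirt_cst (- a) z)) (cdiffV d0 (cdiff_den z)).
congr (wirt _ _ _ _); rewrite /dphi /= addr0 mul1r.
have -> : (1 - cabs a ^+ 2)%:C = 1 - a * a^* by rewrite mulJ_cabs rmorphB.
by move: d0; rewrite /den => d0; field; exact: d0.
Qed.

Let phia : phi a = 0. Proof. by rewrite /phi subrr mul0r. Qed.

Let phi_neq0 z : cabs z <= 1 -> z != a -> phi z != 0.
Proof. by move=> z1 za; rewrite mulf_neq0 ?subr_eq0 // invr_neq0 // den_neq0. Qed.

Let wirt_sigma z : cabs z <= 1 -> wirt (fun w => phi w * (phi w)^*) z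
  (dphi z * (phi z)^*) (phi z * (dphi z)^*).
Proof.
move=> z1; have P := cdiff_phi z1.
by have := wirtM P (wirt_conj P); rewrite conjC0 mul0r mulr0 add0r addr0.
Qed.

Section step.
Variables (f : C -> C) (b e : R).
Hypothesis holf : forall z, cabs z < 1 -> exists l, cdiff f z l.
Hypotheses (b0 : 0 < b) (b1 : b < 1) (e0 : 0 < e) (e1 : e < 1).

Let N t := pos_part b t ^+ 2 / b ^+ 2 - pos_part e t ^+ 2 / e ^+ 2.
Let N' t := 2 * (pos_part e t / e ^+ 2 - pos_part b t / b ^+ 2).

Let N_diff x eps : 0 < eps -> exists2 d, 0 < d & forall y, `|y - x| < d ->
  `|N y - N x - N' x * (y - x)| <= eps * `|y - x|.
Proof.
pose K := (b ^+ 2)^-1 + (e ^+ 2)^-1.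
have K0 : 0 < K by rewrite addr_gt0 ?invr_gt0 ?exprn_gt0.
move=> eps0; exists (eps / K) => [|y yx]; first by rewrite divr_gt0.
have -> : N y - N x - N' x * (y - x) =
  (pos_part b y ^+ 2 - pos_part b x ^+ 2 - (- 2 * pos_part b x) * (y - x)) / b ^+ 2 -
  (pos_part e y ^+ 2 - pos_part e x ^+ 2 - (- 2 * pos_part e x) * (y - x)) / e ^+ 2.
  by rewrite /N /N'; field; rewrite !gt_eqF.
apply: (@le_trans _ _ (K * `|y - x| ^+ 2)).
  apply: le_trans (ler_normB _ _) _; rewrite !normrM real_normK ?num_real // /K mulrDl.
  by apply: lerD; rewrite mulrC ger0_norm ?invr_ge0 ?sqr_ge0 // ler_wpM2l ?invr_ge0
    ?sqr_ge0 // pos_part_quad.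
rewrite expr2 mulrA ler_wpM2r // mulrC -ler_pdivlMr //; exact: ltW.
Qed.

Let N'_lip x y : `|N' y - N' x| <= 2 * ((e ^+ 2)^-1 + (b ^+ 2)^-1) * `|y - x|.
Proof.
have -> : N' y - N' x = 2 * ((pos_part e y - pos_part e x) / e ^+ 2
    - (pos_part b y - pos_part b x) / b ^+ 2) by rewrite /N'; ring.
rewrite normrM ger0_norm // -mulrA ler_pM2l // [leRHS]mulrDl.
apply: le_trans (ler_normB _ _) _; rewrite !normrM.
by apply: lerD; rewrite mulrC ger0_norm ?invr_ge0 ?sqr_ge0 // ler_wpM2l ?invr_ge0
  ?sqr_ge0 // pos_part_lip.
Qed.

Let N0 t : b <= t -> e <= t -> N t = 0.
Proof.
move=> bt et; rewrite /N /pos_part !max_r ?subr_le0 //.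
by rewrite expr0n /= !mul0r subrr.
Qed.

Let N'0 t : b <= t -> e <= t -> N' t = 0.
Proof.
move=> bt et; rewrite /N' /pos_part !max_r ?subr_le0 //.
by rewrite !mul0r subrr mulr0.
Qed.

Let c1 := 2 / e - 2 / b.
Let c2 := (b ^+ 2)^-1 - (e ^+ 2)^-1.

Let N_near0 t : t <= b -> t <= e -> N t = t * (c1 + c2 * t).
Proof.
move=> bt et; rewrite /N /pos_part !max_l ?subr_ge0 //.
by rewrite /c1 /c2; field; rewrite !gt_eqF.
Qed.

Let N'00 : N' 0 = c1.
Proof.
rewrite /N' /pos_part !subr0 !max_l ?ltW //.
by rewrite /c1; field; rewrite !gt_eqF.
Qed.

Let H z := if cabs z < 1 then f z * ((N (s z))%:C * (phi z)^-1) else 0.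
Let k z := if cabs z < 1 then f z * ((N' (s z))%:C * (dphi z)^*) else 0.

Let near_disc (z : C) : cabs z < 1 -> exists2 d, 0 < d &
  forall w : C, cabs (w - z) < d -> cabs w < 1.
Proof.
move=> z1; exists (1 - cabs z); first by rewrite subr_gt0.
move=> w wz; have -> : w = z + (w - z) by rewrite addrCA subrr addr0.
by apply: le_lt_trans (cabsD _ _) _; rewrite -ltrBrDl.
Qed.

Let wirt_Ns z : cabs z <= 1 -> wirt (fun w => (N (s w))%:C) z
  ((N' (s z))%:C * (dphi z * (phi z)^*)) ((N' (s z))%:C * (phi z * (dphi z)^*)).
Proof.
move=> z1.
have := wirt_comp (@wirt_Re _ N _ (N' (s z)) _) (wirt_sigma z1).
move=> /(_ (fun eps => @N_diff (s z) eps)).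
have uu : (N' (s z))%:C = (N' (s z) / 2)%:C + (N' (s z) / 2)%:C.
  by rewrite -rmorphD -splitr.
congr (wirt _ _ _ _); rewrite uu; move: (phi z) (dphi z) => P D;
by rewrite !conjM conjCK; ring.
Qed.

(** At [a] the pole of [1 / phi] is cancelled because [N] vanishes to first
    order at 0; this is why two truncations are subtracted. *)
Let wirt_H z : exists al, wirt H z al (k z).
Proof.
have [z1|z1] := ltP (cabs z) 1; last first.
  have B1 : Num.max b e < 1 by rewrite gt_max b1.
  have [d d0 zd] := s_boundary z1 B1.
  exists 0; rewrite /k ltNge z1 /=.
  apply: (@wirt_eq _ _ (cst 0) _ _ _ d) => // [w wz|].
    rewrite /H; case: (boolP (cabs w < 1)) => // w1; have := zd w wz w1.
    move=> h; rewrite N0 ?mul0r ?mulr0 //; move: h; rewrite gt_max => /andP[? ?];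
    exact: ltW.
  exact: wirt_cst.
have [d d0 zd] := near_disc z1.
have [l fl] := holf z1.
have [za|za] := eqVneq z a; last first.
  eexists; apply: (wirt_eq d0 (g := fun w => f w * ((N (s w))%:C * (phi w)^-1))).
    by move=> w /zd w1; rewrite /H w1.
  have p0 := phi_neq0 (ltW z1) za.
  have := wirtM fl (wirtM (wirt_Ns (ltW z1)) (cdiffV p0 (cdiff_phi (ltW z1)))).
  rewrite /k z1 mul0r add0r mulr0 addr0.
  set al := (X in wirt _ _ X _); set be := (X in wirt _ _ _ X).
  have -> : be = f z * ((N' (s z))%:C * (dphi z)^*).
    rewrite /be; move: p0; move: ((N' (s z))%:C) (phi z) ((dphi z)^*) => n P D p0.
    by field.
  exact.
have sa0 : s z = 0 by rewrite sE za phia cabs0 expr0n.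
pose S w := phi w * (phi w)^*.
have wS : wirt (fun w => (phi w)^* * (c1%:C + c2%:C * S w)) z
    (0 * (c1%:C + c2%:C * S z) + (phi z)^* * (0 + (0 * S z + c2%:C * (dphi z * (phi z)^*))))
    ((dphi z)^* * (c1%:C + c2%:C * S z) + (phi z)^* * (0 + (0 * S z + c2%:C * (phi z * (dphi z)^*)))).
  have P := wirt_conj (cdiff_phi (ltW z1)); rewrite conjC0 in P.
  apply: (wirtM P); apply: wirtD; first exact: wirt_cst.
  by apply: wirtM; [exact: wirt_cst|exact: wirt_sigma (ltW z1)].
have cS : ccont_at S z by exact: wirt_cont (wirt_sigma (ltW z1)).
have m0 : 0 < Num.min b e by rewrite lt_min b0.
have [d' d'0 zd'] := cS _ m0.
have W := wirtM fl wS.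
have pz : phi z = 0 by rewrite za.
set be := (X in wirt _ _ _ X) in W.
have -> : k z = be.
  by rewrite /k z1 sa0 N'00 /be /S pz conjC0; ring.
eexists; apply: (@wirt_eq _ _ _ _ _ _ (Num.min d d')) W; first by rewrite lt_min d0.
move=> w; rewrite lt_min => /andP[/zd w1 /zd' wS'].
rewrite /H w1; congr (_ * _).
have sw : s w < Num.min b e.
  apply: le_lt_trans wS'; rewrite {2}/S pz mul0r subr0.
  by apply: le_trans (abs_Re_le _); rewrite -/(S w) -/(s w) ler_norm.
move: sw; rewrite lt_min => /andP[sb se].
rewrite N_near0 ?ltW // rmorphM rmorphD rmorphM /=.
have -> : (s w)%:C = phi w * (phi w)^* by rewrite mulJ_cabs -sE.
have [->|p0] := eqVneq (phi w) 0; first by rewrite conjC0 !mul0r.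
by rewrite /S; move: (phi w) p0 => P p0; field.
Qed.

Let cont_k : ccont k.
Proof.
move=> z; have [z1|z1] := ltP (cabs z) 1; last first.
  have B1 : Num.max b e < 1 by rewrite gt_max b1.
  have [d d0 zd] := s_boundary z1 B1.
  apply: (@ccont_at_eq _ _ (cst 0) _ d) => // [w wz|].
    rewrite /k; case: (boolP (cabs w < 1)) => // w1; have := zd w wz w1.
    move=> h; rewrite N'0 ?mul0r ?mulr0 //; move: h; rewrite gt_max => /andP[? ?];
    exact: ltW.
  exact: wirt_cont (wirt_cst 0 z).
have [d d0 zd] := near_disc z1.
apply: (ccont_at_eq d0 (g := fun w => f w * ((N' (s w))%:C * (dphi w)^*))).
  by move=> w /zd w1; rewrite /k w1.
have [l fl] := holf z1.
apply: ccont_atM; first exact: wirt_cont fl.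
apply: ccont_atM.
  by apply: (ccont_at_lip N'_lip); exact: wirt_cont (wirt_sigma (ltW z1)).
apply: ccont_atJ; apply: ccont_atM; first exact: wirt_cont (wirt_cst _ z).
have d0' := den_neq0 (ltW z1).
have V := cdiffV d0' (cdiff_den z).
exact: wirt_cont (cdiffM V V).
Qed.

(** Stokes for [H = f * N(s) / phi], where [phi] is the automorphism of
    the disc that maps [a] to 0 and [s = |phi|^2]; away from [a] the
    antiholomorphic derivative of [H] falls on [N(s)] only. *)
Lemma dbar_step :
  cint mu2 disc (fun p => f (cp p) * ((N' (s (cp p)))%:C * (dphi (cp p))^*)) = 0.
Proof.
rewrite cint_mkcond; last exact: measurable_disc.
apply: etrans (@dbar_integral0 _ H k 1 ltr01 wirt_H cont_k _ _).
- apply: eq_cint => p _.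
  have -> // : (p \in disc) = (cabs (cp p) < 1).
  by apply/idP/idP => [/set_mem|?]; [exact: id|exact/mem_set].
- by move=> z z1; rewrite /H ltNge z1.
- by move=> z z1; rewrite /k ltNge z1.
Qed.

End step.

(** The factor of the area of the disc is left out. *)
Definition bkernel z : C := (1 - a * z^*)^-1 ^+ 2.

Let bkernelE z : bkernel z = ((den z)^-1 ^+ 2)^*.
Proof. by rewrite /bkernel /den conjM !fmorphV /= conjB conjC1 conjM conjCK expr2. Qed.

Let bkernel_cont z : cabs z <= 1 -> ccont_at bkernel z.
Proof.
move=> /den_neq0 d0; have V := cdiffV d0 (cdiff_den z).
apply: (@ccont_at_eq _ _ (fun w => ((den w)^-1 * (den w)^-1)^*) _ 1 ltr01).
  by move=> w _; rewrite bkernelE expr2.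
by apply: ccont_atJ; exact: wirt_cont (cdiffM V V).
Qed.

Lemma bkernel_measurable : cmeasurable disc (fun p => bkernel (cp p)).
Proof.
apply: ccont_on_measurable => p; first exact: disc_open.
by move=> /ltW; exact: bkernel_cont.
Qed.

Lemma bkernel_bounded z : cabs z < 1 -> cabs (bkernel z) <= (1 - cabs a)^-1 ^+ 2.
Proof.
move=> z1; have d := den_ge (ltW z1).
rewrite bkernelE cabsJ cabsX cabsV ler_pXn2r ?nnegrE ?invr_ge0 ?subr_ge0 ?(ltW a1) //.
by rewrite lef_pV2 // posrE ?subr_gt0 // (lt_le_trans _ d) // subr_gt0.
Qed.

Let pos_s_meas b : cmeasurable disc (fun p => (pos_part b (s (cp p)))%:C).
Proof.
apply: (@ccont_on_measurable _ (fun z => (pos_part b (s z))%:C)) => p.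
  exact: disc_open.
move=> p1; apply: (@ccont_at_lip _ (pos_part b) 1 _ _ _).
  by move=> x y; rewrite mul1r; exact: pos_part_lip.
exact: wirt_cont (wirt_sigma (ltW p1)).
Qed.

Let pos_s_bound b z : 0 < b -> b < 1 -> cabs (pos_part b (s z))%:C <= 1.
Proof.
move=> b0 b1; rewrite cabs_real ger0_norm ?pos_part_ge0 // ge_max ler01 andbT.
by have := s_ge0 z; lra.
Qed.

Let J f b := cint mu2 disc (fun p => f (cp p) * bkernel (cp p) *
  (pos_part b (s (cp p)))%:C).

Let J_int f b : 0 < b -> b < 1 -> cintegrable mu2 disc (fun p => f (cp p)) ->
  cintegrable mu2 disc (fun p => f (cp p) * bkernel (cp p) * (pos_part b (s (cp p)))%:C).
Proof.
move=> b0 b1 fi; have mD := measurable_disc.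
apply: (cintegrableM_bounded mD _ (pos_s_meas b) (K := 1)); last first.
  by move=> p _; exact: pos_s_bound.
apply: (cintegrableM_bounded mD fi bkernel_measurable) => p p1.
exact: bkernel_bounded.
Qed.

(** The mean value property in the coordinate [phi]: the weighted means of
    [f] over the discs [s < b] do not depend on [b]. *)
Let J_scale f b e : (forall z, cabs z < 1 -> exists l, cdiff f z l) ->
  0 < b -> b < 1 -> 0 < e -> e < 1 ->
  cintegrable mu2 disc (fun p => f (cp p)) ->
  (b ^+ 2)%:C * J f e = (e ^+ 2)%:C * J f b.
Proof.
move=> hf b0 b1 e0 e1 fi; have mD := measurable_disc.
have ib := J_int b0 b1 fi; have ie := J_int e0 e1 fi.
have := dbar_step hf b0 b1 e0 e1.
pose A : C := (2 * (1 - cabs a ^+ 2))%:C.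
rewrite (@eq_cint _ _ _ _ _ _ (fun p =>
   (A * (e ^+ 2)^-1%:C) * (f (cp p) * bkernel (cp p) * (pos_part e (s (cp p)))%:C) +
   (- A * (b ^+ 2)^-1%:C) * (f (cp p) * bkernel (cp p) * (pos_part b (s (cp p)))%:C))).
  rewrite cintD ?cintZ //; [|exact: cintegrableZ..].
  have A0 : A != 0.
    apply: contraTneq a1 => /(congr1 (@complex.Re R)) /= A0.
    have : cabs a ^+ 2 = 1 by lra.
    move=> /eqP; rewrite sqrp_eq1 ?cabs_ge0 // => /eqP ->; by rewrite ltxx.
  rewrite -/(J f e) -/(J f b) => E.
  have b20 : (b ^+ 2)%:C != 0 :> C by rewrite -(rmorph0 (real_complex R)) (inj_eq (@complexI R)) gt_eqF ?exprn_gt0.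
  have e20 : (e ^+ 2)%:C != 0 :> C by rewrite -(rmorph0 (real_complex R)) (inj_eq (@complexI R)) gt_eqF ?exprn_gt0.
  have iV (x : R) : (x^-1)%:C = (x%:C)^-1 :> C by rewrite fmorphV.
  rewrite !iV in E; move: E A0 b20 e20.
  move: A (b ^+ 2)%:C (e ^+ 2)%:C (J f e) (J f b) => A B E X Y H A0 b20 e20.
  apply/eqP; rewrite -subr_eq0; apply/eqP.
  have -> : B * X - E * Y = B * E / A * (A * E^-1 * X + - A * B^-1 * Y).
    by field; rewrite A0 b20 e20.
  by rewrite H mulr0.
move=> p p1; rewrite /dphi conjM -bkernelE /A.
have -> : ((1 - cabs a ^+ 2)%:C)^* = (1 - cabs a ^+ 2)%:C :> C by exact: conjc_real.
rewrite !rmorphM !rmorphB !rmorphM /=; ring.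
Qed.

Let realCM (x y : R) : (x * y)%:C = x%:C * y%:C :> C.
Proof. exact: rmorphM. Qed.

Let den_le z : cabs z <= 1 -> cabs (den z) <= 2.
Proof.
move=> z1; apply: le_trans (cabsB _ _) _; rewrite cabs1 cabsM cabsJ.
have := cabs_ge0 a; have := cabs_ge0 z; move: (cabs z) (cabs a) z1 a1 => x y; nra.
Qed.

Let Rr b := \int[mu2]_(p in disc)
  (cabs (bkernel (cp p)) ^+ 2 * pos_part b (s (cp p))).

Let fstar z := (den z)^-1 ^+ 2.

Let fstar_hol z : cabs z < 1 -> exists l, cdiff fstar z l.
Proof.
move=> /ltW/den_neq0 d0; have V := cdiffV d0 (cdiff_den z); have := cdiffM V V.
by set l := (X in cdiff _ _ X); exists l; apply: wirt_eq ltr01 _ H => w _; rewrite /fstar expr2.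
Qed.

Let fstar_int : cintegrable mu2 disc (fun p => fstar (cp p)).
Proof.
have := cmeasurableJ bkernel_measurable; rewrite (_ : (fun _ => _) = (fun p => fstar (cp p))).
  move=> fm; apply: (cintegrable_le measurable_disc fm
    (integrable_cst_fin ((1 - cabs a)^-1 ^+ 2) measurable_disc disc_fin)).
  move=> p /= p1; apply: le_trans (bkernel_bounded p1).
  by rewrite bkernelE cabsJ.
by apply/funext => p; rewrite bkernelE conjCK.
Qed.

Let fstarE z b : fstar z * bkernel z * (pos_part b (s z))%:C =
  (cabs (bkernel z) ^+ 2 * pos_part b (s z))%:C.
Proof.
have -> : fstar z = (bkernel z)^* by rewrite bkernelE conjCK.
by rewrite realCM -mulJ_cabs [_^* * _]mulrC.
Qed.

Let J_fstar b : J fstar b = (Rr b)%:C.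
Proof.
apply: eq_ReIm => /=.
  by apply: eq_Rintegral => p _; rewrite fstarE.
by apply: Rintegral0_eq => p _; rewrite fstarE.
Qed.

Let Rr_int b : 0 < b -> b < 1 -> mu2.-integrable disc
  (EFin \o (fun p => cabs (bkernel (cp p)) ^+ 2 * pos_part b (s (cp p)))).
Proof.
move=> b0 b1; have [i _] := J_int b0 b1 fstar_int.
by apply: eq_integrable i => [|p _]; [exact: measurable_disc|rewrite /= fstarE].
Qed.

Let Rr_scale b e : 0 < b -> b < 1 -> 0 < e -> e < 1 -> b ^+ 2 * Rr e = e ^+ 2 * Rr b.
Proof.
move=> b0 b1 e0 e1; have := J_scale fstar_hol b0 b1 e0 e1 fstar_int.
by rewrite !J_fstar -!realCM => /complexI.
Qed.

Let Rr_ge0 b : 0 <= Rr b.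
Proof.
by apply: Rintegral_ge0 => p _; rewrite mulr_ge0 ?sqr_ge0 ?pos_part_ge0.
Qed.

(** As the discs shrink to [a], where [f] vanishes, the means tend to zero;
    by [J_scale] they are all equal. The comparison weight [Rr] is the same mean
    of a function that makes the integrand nonnegative. *)
Let J_zero f b : (forall z, cabs z < 1 -> exists l, cdiff f z l) ->
  cintegrable mu2 disc (fun p => f (cp p)) -> f a = 0 -> 0 < b -> b < 1 ->
  J f b = 0.
Proof.
move=> hf fi fa b0 b1; have mD := measurable_disc.
suff key eta : 0 < eta -> cabs (J f b) <= eta * (2 * Rr b).
  apply/eqP; rewrite -cabs_eq0; apply/negPn/negP => J0.
  have {}J0 : 0 < cabs (J f b) by rewrite lt_def J0 cabs_ge0.
  have R0 := Rr_ge0 b.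
  have D0 : 0 < 2 * Rr b + 1 by lra.
  have := key _ (divr_gt0 J0 D0).
  by rewrite mulrAC ler_pdivlMr // ler_pM2l //; lra.
move=> eta0; have [l fl] := hf a a1.
have [d d0 fd] := wirt_cont fl (divr_gt0 eta0 (ltr0Sn _ 3)).
pose e := Num.min (d ^+ 2 / 4) (1 / 2).
have e0 : 0 < e by rewrite lt_min !divr_gt0 // exprn_gt0.
have e1 : e < 1 by rewrite gt_min; apply/orP; right; lra.
have bound p : disc p -> cabs (f (cp p) * bkernel (cp p) * (pos_part e (s (cp p)))%:C) <=
    eta * (cabs (bkernel (cp p)) ^+ 2 * pos_part e (s (cp p))).
  rewrite /disc /= => p1; rewrite cabsM (cabsM (f (cp p))) cabs_real ger0_norm ?pos_part_ge0 //.
  have k4 : 1 / 4 <= cabs (bkernel (cp p)).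
    rewrite bkernelE cabsJ cabsX cabsV.
    have D2 := den_le (ltW p1); have D0 : 0 < cabs (den (cp p)).
      by rewrite cabs_gt0 den_neq0 // ltW.
    have : 1 / 2 <= (cabs (den (cp p)))^-1 by rewrite mul1r lef_pV2 ?posrE.
    move: (cabs _)^-1 => u u2; rewrite expr2; nra.
  have [se|se] := leP e (s (cp p)).
    by rewrite /pos_part max_r ?subr_le0 // !mulr0.
  have k0 := cabs_ge0 (bkernel (cp p)).
  move: (cabs (bkernel (cp p))) k0 k4 => kk k0 k4.
  rewrite expr2 !mulrA ler_wpM2r ?pos_part_ge0 //.
    apply: ler_wpM2r => //; apply: (@le_trans _ _ (eta / 4)); last first.
      by rewrite ler_pM2l // -[4^-1]mul1r.
    apply: ltW; rewrite -[f (cp p)]subr0 -fa; apply: fd.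
    rewrite -(@ltr_pXn2r _ 2) ?nnegrE ?(ltW d0) //.
    have -> : cp p - a = phi (cp p) * den (cp p).
      by rewrite /phi divfK // den_neq0 // ltW.
    rewrite cabsM exprMn -sE.
    have D4 : cabs (den (cp p)) ^+ 2 <= 4.
      have := den_le (ltW p1); have := cabs_ge0 (den (cp p)).
      by move: (cabs _) => u u0 u2; rewrite expr2; nra.
    have : s (cp p) < d ^+ 2 / 4 by apply: lt_le_trans se _; rewrite ge_min lexx.
    have := s_ge0 (cp p); move: D4; move: (cabs _ ^+ 2) (s _) (d ^+ 2) => u v w; nra.
have bint := J_int e0 e1 fi.
have half (h : C -> R) : (forall z, `|h z| <= cabs z) ->
    mu2.-integrable disc (EFin \o (fun p => h (f (cp p) * bkernel (cp p) * (pos_part e (s (cp p)))%:C))) ->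
    `|\int[mu2]_(p in disc) h (f (cp p) * bkernel (cp p) * (pos_part e (s (cp p)))%:C)|
      <= eta * Rr e.
  move=> hc hi; apply: le_trans (le_normr_Rintegral mD hi) _.
  rewrite /Rr -RintegralZl //; last exact: Rr_int.
  apply: le_Rintegral => //.
  - by have := integrable_abse hi.
  - by have := integrableZl mD eta (Rr_int e0 e1).
  - by move=> q q1; apply: le_trans (bound q q1).
have Je : cabs (J f e) <= eta * (2 * Rr e).
  apply: le_trans (cabs_le_ReIm _) _.
  have -> : eta * (2 * Rr e) = eta * Rr e + eta * Rr e by ring.
  by apply: lerD; [apply: (half _ abs_Re_le); exact: bint.1|
     apply: (half _ abs_Im_le); exact: bint.2].
have := congr1 cabs (J_scale hf b0 b1 e0 e1 fi); rewrite !cabsM !cabs_real.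
rewrite !ger0_norm ?sqr_ge0 // => JE.
rewrite -(@ler_pM2l _ (e ^+ 2)) ?exprn_gt0 // -JE.
have -> : e ^+ 2 * (eta * (2 * Rr b)) = b ^+ 2 * (eta * (2 * Rr e)).
  have -> : e ^+ 2 * (eta * (2 * Rr b)) = eta * 2 * (e ^+ 2 * Rr b) by ring.
  by rewrite -(Rr_scale b0 b1 e0 e1); ring.
by rewrite ler_pM2l // exprn_gt0.
Qed.

(** Difference quotients in the height of the truncation are weights
    between 0 and 1 that tend to 1 on the whole disc; dominated convergence
    removes them. *)
Lemma bergman_disc0 f : (forall z, cabs z < 1 -> exists l, cdiff f z l) ->
  cintegrable mu2 disc (fun p => f (cp p)) -> f a = 0 ->
  cint mu2 disc (fun p => f (cp p) * bkernel (cp p)) = 0.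
Proof.
move=> hf fi fa; have mD := measurable_disc.
pose h (n : nat) : R := n.+3%:R^-1.
have h0 n : 0 < h n by rewrite invr_gt0 ltr0n.
have h3 n : h n <= 3^-1 by rewrite lef_pV2 ?posrE ?ltr0n // ler_nat.
pose b n := 1 - 2 * h n.
have bb n : [/\ 0 < b n, b n < 1, 0 < b n + h n & b n + h n < 1].
  by have := h0 n; have := h3 n; rewrite /b; split; lra.
pose w n t := (pos_part (b n + h n) t - pos_part (b n) t) / h n.
have fk : cintegrable mu2 disc (fun p => f (cp p) * bkernel (cp p)).
  by apply: (cintegrableM_bounded mD fi bkernel_measurable) => p; exact: bkernel_bounded.
have fkm := cintegrable_measurable fk.
have wE n p : f (cp p) * bkernel (cp p) * (w n (s (cp p)))%:C =
    ((h n)^-1)%:C * (f (cp p) * bkernel (cp p) * (pos_part (b n + h n) (s (cp p)))%:C)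
    + (- (h n)^-1)%:C * (f (cp p) * bkernel (cp p) * (pos_part (b n) (s (cp p)))%:C).
  by rewrite /w rmorphM rmorphB rmorphN /=; ring.
have int0 n : cint mu2 disc (fun p => f (cp p) * bkernel (cp p) * (w n (s (cp p)))%:C) = 0.
  have [? ? ? ?] := bb n.
  under eq_cint do rewrite wE.
  rewrite cintD ?cintZ //; do ?[apply: cintegrableZ => //]; do ?exact: J_int.
  by rewrite -/(J f (b n + h n)) -/(J f (b n)) !J_zero // !mulr0 addr0.
apply: (@dominated_cint _ _ _ mu2 disc mD
   (fun n p => f (cp p) * bkernel (cp p) * (w n (s (cp p)))%:C) _
   (fun p => cabs (f (cp p) * bkernel (cp p)))) => //.
- move=> n; apply: cmeasurableM => //.
  have wm : cmeasurable disc (fun p => ((h n)^-1)%:C *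
      ((pos_part (b n + h n) (s (cp p)))%:C + - (pos_part (b n) (s (cp p)))%:C)).
    apply: cmeasurableM; first exact: cmeasurable_cst.
    by apply: cmeasurableD; [|apply: cmeasurableN]; exact: pos_s_meas.
  move: wm; rewrite (_ : (fun _ => _) = (fun p => (w n (s (cp p)))%:C)) //.
  by apply/funext => p; rewrite /w rmorphM rmorphB mulrC.
- exact: integrable_cabs.
- move=> n p _; rewrite cabsM cabs_real ler_piMr //.
  rewrite /w normrM normfV (gtr0_norm (h0 n)) ler_pdivrMr // mul1r.
  have -> : pos_part (b n + h n) (s (cp p)) - pos_part (b n) (s (cp p)) =
     pos_part (b n) (s (cp p) - h n) - pos_part (b n) (s (cp p)).
    by rewrite /pos_part; congr (Num.max _ 0 - _); ring.
  apply: le_trans (pos_part_lip _ _ _) _.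
  by rewrite addrAC subrr add0r normrN gtr0_norm.
- move=> p p1 e e0; have s1 : 0 < (1 - s (cp p)) / 2.
    by rewrite divr_gt0 // subr_gt0 s_lt1.
  have [N HN] := inv_approx s1; exists N => n Nn.
  have hn : h n < (1 - s (cp p)) / 2.
    by apply: le_lt_trans HN; rewrite lef_pV2 ?posrE ?ltr0n // ler_nat !ltnS leqW // leqW.
  have -> : w n (s (cp p)) = 1.
    have H0 := h0 n; rewrite /w /pos_part !max_l; [|rewrite /b; lra..].
    have -> : b n + h n - s (cp p) - (b n - s (cp p)) = h n by ring.
    by rewrite mulfV // gt_eqF.
  by rewrite mulr1 subrr cabs0.
- by move=> e e0; exists 0%N => n _; rewrite int0 subrr cabs0.
Qed.

End Disc.

Section Reproducing.
Context {R : realType}.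
Local Notation C := R[i].
Notation mu := (@lebesgue_measure R).
Notation mu2 := (mu \x mu)%E.
Hint Extern 0 (is_true (0 <= cabs _)) => (exact: cabs_ge0) : core.

Definition disc_area : C := (fine (mu2 (@disc R)))%:C.

Lemma cintegrable_cst (c : C) : cintegrable mu2 disc (fun=> c).
Proof.
by split; apply: (integrable_cst_fin _ measurable_disc disc_fin).
Qed.

Lemma cint_cst_disc (c : C) : cint mu2 (@disc R) (fun=> c) = c * disc_area.
Proof.
by case: c => x y; apply: eq_ReIm => /=;
  rewrite (Rintegral_cst mu2 measurable_disc); ring.
Qed.

(** The conjugate of the kernel minus 1 is holomorphic and vanishes at 0;
    its integral is zero by [bergman_disc0] at 0, where the kernel is constant. *)
Lemma cint_bkernel (a : C) : cabs a < 1 ->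
  cint mu2 disc (fun p => bkernel a (cp p)) = disc_area.
Proof.
move=> a1; have mD := @measurable_disc R.
have ki : cintegrable mu2 disc (fun p => bkernel a (cp p)).
  apply: (cintegrable_le mD (bkernel_measurable a1)
    (integrable_cst_fin ((1 - cabs a)^-1 ^+ 2) mD disc_fin)).
  by move=> p; exact: bkernel_bounded.
pose f z : C := (1 - a^* * z)^-1 ^+ 2 - 1.
have fE z : f z = (bkernel a z)^* - 1.
  by rewrite /f /bkernel !expr2 conjM !fmorphV /= conjB conjC1 conjM conjCK.
have hf z : cabs z < 1 -> exists l, cdiff f z l.
  move=> z1; have d0 : 1 - a^* * z != 0.
    rewrite subr_eq0; apply: contraTneq z1 => az; rewrite -leNgt.
    have : cabs (a^* * z) = 1 by rewrite -az cabs1.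
    rewrite cabsM cabsJ => az1; have := cabs_ge0 z; have := cabs_ge0 a.
    move: (cabs a) (cabs z) a1 az1 => x y; nra.
  have dd : cdiff (fun w => 1 - a^* * w) z (- a^*).
    have := cdiffD (wirt_cst 1 z) (cdiffM (wirt_cst (- a^*) z) (wirt_id z)).
    rewrite mul0r mulr1 !add0r.
    by apply: wirt_eq ltr01 _ => w _; rewrite mulNr.
  have V := cdiffV (f := fun w => 1 - a^* * w) d0 dd.
  have := cdiffD (cdiffM V V) (wirt_cst (- 1) z).
  set l := (X in cdiff _ _ X) => H; exists l; apply: wirt_eq ltr01 _ H => w _.
  by rewrite /f expr2.
have fi : cintegrable mu2 disc (fun p => f (cp p)).
  have := cintegrableD mD (cintegrable_le mD (cmeasurableJ (bkernel_measurable a1))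
    (integrable_cst_fin ((1 - cabs a)^-1 ^+ 2) mD disc_fin) _) (cintegrable_cst (- 1)).
  rewrite (_ : (fun _ => _) = (fun p => f (cp p))); last first.
    by apply/funext => p; rewrite fE.
  by apply => p p1; rewrite cabsJ; exact: bkernel_bounded.
have z1 : cabs (0 : C) < 1 by rewrite cabs0.
have := bergman_disc0 z1 hf fi; rewrite /f mulr0 subr0 invr1 expr1n subrr.
move=> /(_ erefl).
rewrite (@eq_cint _ _ _ _ _ _ (fun p => (bkernel a (cp p))^* + -1)); last first.
  by move=> p _; rewrite -/(f (cp p)) fE /bkernel mul0r subr0 invr1 expr1n mulr1.
rewrite cintD //; last 2 first.
- apply: (cintegrable_le mD (cmeasurableJ (bkernel_measurable a1))
    (integrable_cst_fin ((1 - cabs a)^-1 ^+ 2) mD disc_fin)).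
  by move=> p p1; rewrite cabsJ; exact: bkernel_bounded.
- exact: cintegrable_cst.
rewrite cintJ // cint_cst_disc mulN1r => /eqP; rewrite subr_eq0 => /eqP E.
rewrite -[LHS]conjCK E /disc_area; exact: conjc_real.
Qed.

(** The case of a zero at [a], applied to [f - f a], leaves the integral
    of the kernel. *)
Lemma bergman_disc (a : C) (f : C -> C) : cabs a < 1 ->
  (forall z, cabs z < 1 -> exists l, cdiff f z l) ->
  cintegrable mu2 disc (fun p => f (cp p)) ->
  cint mu2 disc (fun p => f (cp p) * bkernel a (cp p)) = f a * disc_area.
Proof.
move=> a1 hf fi; have mD := @measurable_disc R.
have ki : cintegrable mu2 disc (fun p => bkernel a (cp p)).
  apply: (cintegrable_le mD (bkernel_measurable a1)
    (integrable_cst_fin ((1 - cabs a)^-1 ^+ 2) mD disc_fin)).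
  by move=> p; exact: bkernel_bounded.
pose g z := f z + - f a.
have hg z : cabs z < 1 -> exists l, cdiff g z l.
  by move=> /hf[l fl]; exists (l + 0); exact: cdiffD fl (wirt_cst _ _).
have gi : cintegrable mu2 disc (fun p => g (cp p)).
  exact: (cintegrableD mD fi (cintegrable_cst (- f a))).
have ga : g a = 0 by rewrite /g subrr.
have := bergman_disc0 a1 hg gi ga.
rewrite -(cint_bkernel a1) -cintZ //.
have gk : cintegrable mu2 disc (fun p => g (cp p) * bkernel a (cp p)).
  apply: (cintegrableM_bounded mD gi (bkernel_measurable a1)) => p.
  exact: bkernel_bounded.
move=> E; rewrite -[RHS]add0r -E -cintD //; last exact: cintegrableZ.
by apply: eq_cint => p _; rewrite /g; ring.
Qed.

End Reproducing.

(** * Test functions on the line *)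

Section Splines.
Context {R : realType}.
Implicit Types (P Q : R -> R) (x y : R).

(** Pointwise derivatives given by estimates, so that they combine with
    [wirt] directly. *)
Definition rderiv P x d := forall e, 0 < e -> exists2 del, 0 < del &
  forall y, `|y - x| < del -> `|P y - P x - d * (y - x)| <= e * `|y - x|.

Definition rcont P x := forall e, 0 < e -> exists2 del, 0 < del &
  forall y, `|y - x| < del -> `|P y - P x| < e.

Lemma rderiv_quad P x d K del : 0 < del ->
  (forall y, `|y - x| < del -> `|P y - P x - d * (y - x)| <= K * (y - x) ^+ 2) ->
  rderiv P x d.
Proof.
move=> del0 H e e0; have K0 : 0 < `|K| + 1 by rewrite ltr_wpDl.
exists (Num.min del (e / (`|K| + 1))) => [|y].
  by rewrite lt_min del0 divr_gt0.
rewrite lt_min => /andP[/H yK ye]; apply: le_trans yK _.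
rewrite -real_normK ?num_real // expr2 mulrA ler_wpM2r //.
apply: (@le_trans _ _ ((`|K| + 1) * `|y - x|)).
  by rewrite ler_wpM2r // (le_trans (ler_norm K)) // lerDl.
by rewrite mulrC -ler_pdivlMr // ltW.
Qed.

Lemma rderiv_cont P x d : rderiv P x d -> rcont P x.
Proof.
move=> Px e e0; have [del del0 H] := Px 1 ltr01.
have K0 : 0 < 1 + `|d| by rewrite ltr_pwDl.
exists (Num.min del (e / (1 + `|d|))) => [|y].
  by rewrite lt_min del0 divr_gt0.
rewrite lt_min ltr_pdivlMr // => /andP[/H yK ye].
apply: le_lt_trans ye; have -> : P y - P x = (P y - P x - d * (y - x)) + d * (y - x) by ring.
apply: le_trans (ler_normD _ _) _; rewrite normrM.
by rewrite [leRHS]mulrDr mulr1 [in leRHS]mulrC lerD2r -[leRHS]mul1r.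
Qed.

Lemma rderivD P Q x d d' : rderiv P x d -> rderiv Q x d' ->
  rderiv (fun y => P y + Q y) x (d + d').
Proof.
move=> Px Qx e e0; have e2 : 0 < e / 2 by rewrite divr_gt0.
have [a a0 Ha] := Px _ e2; have [b b0 Hb] := Qx _ e2.
exists (Num.min a b) => [|y]; first by rewrite lt_min a0.
rewrite lt_min => /andP[/Ha h1 /Hb h2].
have -> : P y + Q y - (P x + Q x) - (d + d') * (y - x) =
  (P y - P x - d * (y - x)) + (Q y - Q x - d' * (y - x)) by ring.
by apply: le_trans (ler_normD _ _) _; rewrite [e]splitr mulrDl lerD.
Qed.

Lemma rderivZ P x d c : rderiv P x d -> rderiv (fun y => c * P y) x (c * d).
Proof.
move=> Px e e0; have K0 : 0 < `|c| + 1 by rewrite ltr_wpDl.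
have [a a0 Ha] := Px _ (divr_gt0 e0 K0); exists a => // y /Ha H.
have -> : c * P y - c * P x - c * d * (y - x) = c * (P y - P x - d * (y - x)) by ring.
rewrite normrM; apply: (@le_trans _ _ ((`|c| + 1) * (e / (`|c| + 1) * `|y - x|))).
  by apply: ler_pM => //; rewrite lerDl.
by rewrite le_eqVlt; apply/orP; left; apply/eqP; field; rewrite gt_eqF.
Qed.

Lemma rderiv_aff P x d a c : c != 0 -> rderiv P (c * x + a) d ->
  rderiv (fun y => P (c * y + a)) x (d * c).
Proof.
move=> c0 Px e e0; have K0 : 0 < `|c| by rewrite normr_gt0.
have [b b0 Hb] := Px _ (divr_gt0 e0 K0); exists (b / `|c|) => [|y].
  by rewrite divr_gt0.
rewrite ltr_pdivlMr // mulrC -normrM => yx.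
have E : c * y + a - (c * x + a) = c * (y - x) by ring.
have := Hb (c * y + a); rewrite E => /(_ yx).
by rewrite [`|c * (y - x)|]normrM [leRHS]mulrA (divfK (negbT (gt_eqF K0))) mulrA.
Qed.

Lemma rcontD P Q x : rcont P x -> rcont Q x -> rcont (fun y => P y + Q y) x.
Proof.
move=> Px Qx e e0; have e2 : 0 < e / 2 by rewrite divr_gt0.
have [a a0 Ha] := Px _ e2; have [b b0 Hb] := Qx _ e2.
exists (Num.min a b) => [|y]; first by rewrite lt_min a0.
rewrite lt_min => /andP[/Ha h1 /Hb h2].
have -> : P y + Q y - (P x + Q x) = (P y - P x) + (Q y - Q x) by ring.
by apply: le_lt_trans (ler_normD _ _) _; rewrite [e]splitr ltrD.
Qed.

Lemma rcont_lip P K x : (forall y, `|P y - P x| <= K * `|y - x|) -> rcont P x.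
Proof.
move=> H e e0; have K0 : 0 < `|K| + 1 by rewrite ltr_wpDl.
exists (e / (`|K| + 1)) => [|y]; first by rewrite divr_gt0.
rewrite ltr_pdivlMr // => ye; apply: le_lt_trans (H y) _; apply: le_lt_trans ye.
by rewrite mulrC ler_wpM2l // (le_trans (ler_norm K)) // lerDl.
Qed.

Definition pp x := Num.max x 0.

Lemma pp_pos x : 0 <= x -> pp x = x. Proof. exact: max_l. Qed.
Lemma pp_neg x : x <= 0 -> pp x = 0. Proof. exact: max_r. Qed.

Lemma pp_lip x y : `|pp y - pp x| <= `|y - x|.
Proof.
have [x0|/ltW x0] := leP x 0; have [y0|/ltW y0] := leP y 0;
  rewrite ?(pp_neg x0) ?(pp_neg y0) ?(pp_pos x0) ?(pp_pos y0) //.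
- by rewrite subrr normr0.
- by rewrite subr0 !ger0_norm ?subr_ge0 //; lra.
- by rewrite sub0r normrN (ger0_norm x0) ler0_norm; lra.
Qed.

Lemma pp_sqr_quad x y : `|pp y ^+ 2 - pp x ^+ 2 - 2 * pp x * (y - x)| <= (y - x) ^+ 2.
Proof.
have [x0|/ltW x0] := leP x 0; have [y0|/ltW y0] := leP y 0;
  rewrite ?(pp_neg x0) ?(pp_neg y0) ?(pp_pos x0) ?(pp_pos y0) ?expr0n /=;
  rewrite ler_norml; have := sqr_ge0 (y - x); have := sqr_ge0 y; have := sqr_ge0 x;
  rewrite ?expr2 => h1 h2 h3; apply/andP; split; nra.
Qed.

Lemma pp_sqr_deriv x : rderiv (fun y => pp y ^+ 2) x (2 * pp x).
Proof.
apply: (@rderiv_quad _ _ _ 1 1) => // y _; rewrite mul1r; exact: pp_sqr_quad.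
Qed.

Lemma pp_cube_deriv x : rderiv (fun y => pp y ^+ 3) x (3 * pp x ^+ 2).
Proof.
apply: (@rderiv_quad _ _ _ (3 * (`|x| + 1)) 1) => // y yx.
have xb := ler_norm x; have xb' := ler_norm (- x); rewrite normrN in xb'.
move: `|x| xb xb' yx => X xb xb'; rewrite ltr_norml => /andP[y1 y2].
have [x0|/ltW x0] := leP x 0; have [y0|/ltW y0] := leP y 0;
  rewrite ?(pp_neg x0) ?(pp_neg y0) ?(pp_pos x0) ?(pp_pos y0) ?expr0n /=.
- by rewrite mulr0 mul0r !subr0 normr0 mulr_ge0 ?sqr_ge0 // mulr_ge0 //; lra.
- rewrite mulr0 mul0r !subr0 ger0_norm ?exprn_ge0 //.
  have : y ^+ 2 <= (y - x) ^+ 2 by rewrite !expr2; nra.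
  have := sqr_ge0 y; rewrite exprS; move: (y ^+ 2) ((y - x) ^+ 2) => u v; nra.
- have -> : 0 - x ^+ 3 - 3 * x ^+ 2 * (y - x) = x ^+ 2 * (2 * x - 3 * y) by ring.
  rewrite ger0_norm; last by rewrite mulr_ge0 ?sqr_ge0 //; lra.
  have : x ^+ 2 <= (y - x) ^+ 2 by rewrite !expr2; nra.
  have := sqr_ge0 x; move: (x ^+ 2) ((y - x) ^+ 2) => u v; nra.
- have -> : y ^+ 3 - x ^+ 3 - 3 * x ^+ 2 * (y - x) = (y - x) ^+ 2 * (2 * x + y) by ring.
  rewrite normrM ger0_norm ?sqr_ge0 // mulrC ler_wpM2r ?sqr_ge0 //.
  by rewrite ger0_norm; lra.
Qed.

(** A step from 0 to 1 over the unit interval. Being piecewise quadratic it is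
    C^1 with Lipschitz derivative [stp'] and has the explicit primitive [istp]. *)
Definition stp x := 2 * pp x ^+ 2 + (- 4 * pp (x - 2^-1) ^+ 2 + 2 * pp (x - 1) ^+ 2).
Definition stp' x := 4 * pp x + (- 8 * pp (x - 2^-1) + 4 * pp (x - 1)).
Definition istp x := 2 / 3 * pp x ^+ 3 + (- (4 / 3) * pp (x - 2^-1) ^+ 3 + 2 / 3 * pp (x - 1) ^+ 3).

Let shiftE c x : 1 * x + - c = x - c. Proof. by rewrite mul1r. Qed.

Let deriv_shift P d c x : (forall y, rderiv P y (d y)) -> rderiv (fun y => P (y - c)) x (d (x - c)).
Proof.
move=> Pd; have := @rderiv_aff P x (d (x - c)) (- c) 1 (oner_neq0 _).
rewrite shiftE mulr1 => /(_ (Pd _)) H e /H[del del0 Hd]; exists del => // y /Hd.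
by rewrite !shiftE.
Qed.

Lemma stp_deriv x : rderiv stp x (stp' x).
Proof.
have D := pp_sqr_deriv.
have := rderivD (rderivZ 2 (D x)) (rderivD (rderivZ (- 4) (deriv_shift 2^-1 x D))
   (rderivZ 2 (deriv_shift 1 x D))).
by congr rderiv; rewrite /stp'; ring.
Qed.

Lemma istp_deriv x : rderiv istp x (stp x).
Proof.
have D := pp_cube_deriv.
have := rderivD (rderivZ (2 / 3) (D x)) (rderivD (rderivZ (- (4 / 3)) (deriv_shift 2^-1 x D))
   (rderivZ (2 / 3) (deriv_shift 1 x D))).
by congr rderiv; rewrite /stp; field.
Qed.

Lemma stp'_lip x y : `|stp' y - stp' x| <= 16 * `|y - x|.
Proof.
have -> : stp' y - stp' x = 4 * (pp y - pp x) - 8 * (pp (y - 2^-1) - pp (x - 2^-1))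
  + 4 * (pp (y - 1) - pp (x - 1)) by rewrite /stp'; ring.
have s c : `|pp (y - c) - pp (x - c)| <= `|y - x|.
  by apply: le_trans (pp_lip _ _) _; rewrite opprB addrA subrK.
apply: le_trans (ler_normD _ _) _; apply: le_trans (lerD (ler_normB _ _) (lexx _)) _.
have n4 : `|4 : R| = 4 by rewrite ger0_norm.
have n8 : `|8 : R| = 8 by rewrite ger0_norm.
rewrite !normrM n4 n8; have := pp_lip x y; have := s 2^-1; have := s 1; lra.
Qed.

Lemma stp_le0 x : x <= 0 -> stp x = 0.
Proof. by move=> x0; rewrite /stp !pp_neg ?expr0n /=; lra. Qed.

Lemma istp_le0 x : x <= 0 -> istp x = 0.
Proof. by move=> x0; rewrite /istp !pp_neg ?expr0n /=; lra. Qed.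

Lemma stp_ge1 x : 1 <= x -> stp x = 1.
Proof. by move=> x0; rewrite /stp !pp_pos; [field|lra..]. Qed.

Lemma istp_ge1 x : 1 <= x -> istp x = x - 2^-1.
Proof. by move=> x0; rewrite /istp !pp_pos; [field|lra..]. Qed.

Lemma stp_01 x : 0 <= stp x <= 1.
Proof.
have [x0|/ltW x0] := leP x 0; first by rewrite stp_le0 // lexx ler01.
have [x1|/ltW x1] := leP 1 x; first by rewrite stp_ge1 // ler01 lexx.
rewrite /stp (pp_pos x0) (@pp_neg (x - 1)) ?subr_le0 // expr0n /=.
have [x2|/ltW x2] := leP x 2^-1.
  rewrite pp_neg ?subr_le0 // expr0n /= expr2; apply/andP; split; nra.
by rewrite pp_pos ?subr_ge0 // !expr2; apply/andP; split; nra.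
Qed.

(** A C^1 function [al] supported in [lo, hi]. Its integral [I] is recorded as
    the value of the primitive [A] to the right of the support, so that [A] has
    compact support when [I] is zero. *)
Record test (al al' A : R -> R) (I lo hi : R) : Prop := Test {
  test_deriv : forall x, rderiv al x (al' x);
  test_cont : forall x, rcont al' x;
  test_anti : forall x, rderiv A x (al x);
  test_lo : forall x, x <= lo -> al x = 0 /\ A x = 0;
  test_hi : forall x, hi <= x -> al x = 0 /\ A x = I }.

(** The indicator of [[a, b]] with both edges smoothed over a length [h]; the
    integral is [b - a - h] whatever the shape of the edges. *)
Definition trap a b h x := stp (h^-1 * x + - (h^-1 * a)) + - 1 * stp (h^-1 * x + (1 - h^-1 * b)).

Lemma trap_test a b h : 0 < h -> h <= b - a -> exists al' A,
  test (trap a b h) al' A (b - a - h) a b.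
Proof.
move=> h0 hab; have hi0 : h^-1 != 0 by rewrite invr_eq0 gt_eqF.
pose c1 := - (h^-1 * a); pose c2 := 1 - h^-1 * b.
exists (fun x => stp' (h^-1 * x + c1) * h^-1 + - 1 * (stp' (h^-1 * x + c2) * h^-1)).
exists (fun x => h * istp (h^-1 * x + c1) + - h * istp (h^-1 * x + c2)).
have e1 x : h^-1 * x + c1 = (x - a) / h by rewrite /c1; ring.
have e2 x : h^-1 * x + c2 = (x - b) / h + 1 by rewrite /c2; ring.
have hh : h / h = 1 by rewrite mulfV // gt_eqF.
split=> x.
- by apply: rderivD; [|apply: rderivZ]; apply: rderiv_aff => //; exact: stp_deriv.
- apply: rcontD.
    apply: (@rcont_lip _ (16 * `|h^-1| * `|h^-1|)) => y.
    rewrite -mulrBl normrM mulrAC ler_wpM2r //; apply: le_trans (stp'_lip _ _) _.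
    by rewrite -mulrA -normrM; have -> : h^-1 * y + c1 - (h^-1 * x + c1) = h^-1 * (y - x) by ring.
  apply: (@rcont_lip _ (16 * `|h^-1| * `|h^-1|)) => y.
  rewrite -mulrBr normrM normrN1 mul1r -mulrBl normrM mulrAC ler_wpM2r //.
  apply: le_trans (stp'_lip _ _) _.
  by rewrite -mulrA -normrM; have -> : h^-1 * y + c2 - (h^-1 * x + c2) = h^-1 * (y - x) by ring.
- have := rderivD (rderivZ h (rderiv_aff hi0 (istp_deriv (h^-1 * x + c1))))
    (rderivZ (- h) (rderiv_aff hi0 (istp_deriv (h^-1 * x + c2)))).
  congr rderiv; rewrite /trap -/c1 -/c2.
  by move: (stp _) (stp _) => u v; field; rewrite gt_eqF.
- move=> xa; rewrite /trap -/c1 -/c2 !e1 !e2.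
  have x1 : (x - a) / h <= 0 by rewrite pmulr_lle0 ?invr_gt0 // subr_le0.
  have x2 : (x - b) / h + 1 <= 0.
    by rewrite -hh -mulrDl pmulr_lle0 ?invr_gt0 //; lra.
  by rewrite !stp_le0 // !istp_le0 // !mulr0 addr0.
- move=> xb; rewrite /trap -/c1 -/c2 !e1 !e2.
  have x1 : 1 <= (x - a) / h by rewrite ler_pdivlMr // mul1r; lra.
  have x2 : 1 <= (x - b) / h + 1 by rewrite lerDr divr_ge0 ?subr_ge0 // ltW.
  rewrite !stp_ge1 // !istp_ge1 //; split; first by ring.
  by field; rewrite gt_eqF.
Qed.

Lemma trap_bound a b h x : `|trap a b h x| <= 1.
Proof.
rewrite /trap; have := stp_01 (h^-1 * x + - (h^-1 * a)).
have := stp_01 (h^-1 * x + (1 - h^-1 * b)); move: (stp _) (stp _) => u v.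
by move=> /andP[? ?] /andP[? ?]; rewrite ler_norml; apply/andP; split; lra.
Qed.

Lemma trap_plateau a b h x : 0 < h -> a + h <= x -> x <= b - h -> trap a b h x = 1.
Proof.
move=> h0 ax xb; rewrite /trap.
have -> : h^-1 * x + - (h^-1 * a) = (x - a) / h by ring.
have -> : h^-1 * x + (1 - h^-1 * b) = (x - b + h) / h.
  by field; rewrite gt_eqF.
rewrite stp_ge1; last by rewrite ler_pdivlMr // mul1r; lra.
by rewrite stp_le0 ?mulr0 ?addr0 // pmulr_lle0 ?invr_gt0 //; lra.
Qed.

End Splines.

(** * Integration over tuples *)

Section FubiniZero.
Context {R : realType}.
Local Notation mu := (@lebesgue_measure R).

(** Equips an iterated product with the structure that
    Fubini's theorem asks for. *)
Lemma product_sigma_finite d1 d2 (T1 : measurableType d1) (T2 : measurableType d2)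
    (m1 : {sigma_finite_measure set T1 -> \bar R})
    (m2 : {sigma_finite_measure set T2 -> \bar R}) :
  exists m : {sigma_finite_measure set (T1 * T2)%type -> \bar R}, (m1 \x m2)%E = m.
Proof.
apply: sigma_finite_packing.
- exact: measure0.
- by move=> A; exact: measure_ge0.
- exact: measure_semi_sigma_additive.
have /sigma_finiteP[F [TF ndF Foo]] := sigma_finiteT m1.
have /sigma_finiteP[G [TG ndG Goo]] := sigma_finiteT m2.
exists (fun n => F n `*` G n).
  rewrite -setXTT TF TG predeqE => -[x y]; split.
    move=> [/= [n _ Fnx] [k _ Gky]]; exists (maxn n k) => //; split.
    - by move: x Fnx; exact/subsetPset/ndF/leq_maxl.
    - by move: y Gky; exact/subsetPset/ndG/leq_maxr.
  by move=> [n _ []/= ? ?]; split; exists n.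
move=> k; have [? ?] := Foo k; have [? ?] := Goo k.
split; first exact: measurableX.
by rewrite product_measure1E// lte_mul_pinfty// ge0_fin_numE.
Qed.

Lemma mu2_sigma_finite : exists m : {sigma_finite_measure set (plane R) -> \bar R},
  (mu \x mu)%E = m :> (set (plane R) -> \bar R).
Proof. exact: product_sigma_finite. Qed.

Context d1 d2 (T1 : measurableType d1) (T2 : measurableType d2).
Variables (m1 : {sigma_finite_measure set T1 -> \bar R}).
Variables (m2 : {sigma_finite_measure set T2 -> \bar R}).

Lemma fubini_zero1 (f : T1 * T2 -> \bar R) : (m1 \x m2)%E.-integrable setT f ->
  (forall x, \int[m2]_y f (x, y) = 0)%E -> (\int[m1 \x m2]_p f p = 0)%E.
Proof.
move=> intf f0; apply: (etrans (esym (integral12_prod_meas1 intf))).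
by apply: integral0_eq => x _; exact: f0.
Qed.

Lemma fubini_zero2 (f : T1 * T2 -> \bar R) : (m1 \x m2)%E.-integrable setT f ->
  (forall y, \int[m1]_x f (x, y) = 0)%E -> (\int[m1 \x m2]_p f p = 0)%E.
Proof.
move=> intf f0; apply: (etrans (esym (integral21_prod_meas1 intf))).
by apply: integral0_eq => x _; exact: f0.
Qed.
End FubiniZero.

Section TupleIntegral.
Context {R : realType}.
Local Notation C := R[i].
Local Notation mu := (@lebesgue_measure R).
Local Notation mu2 := (mu \x mu)%E.
Local Notation L n := (@lebesgue_Cn R n).
Local Hint Extern 0 (is_true (0 <= cabs _)) => (exact: cabs_ge0) : core.

Definition lam n (t : n.-tuple (plane R)) : 'I_n -> C := fun j => cp (tnth t j).

Let push n := measure_function_pushforward__canonical__measure_function_Measure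
  (mu2 \x L n)%E (@measurable_tuple_cons R n).

Let pushE n (f : n.+1.-tuple (plane R) -> \bar R) :
  (\int[L n.+1]_t f t = \int[push n]_t f t)%E.
Proof. exact: eq_measure_integral. Qed.

Lemma ge0_integral_tuple_cons n (f : n.+1.-tuple (plane R) -> \bar R) :
  measurable_fun setT f -> (forall t, 0 <= f t)%E ->
  (\int[L n.+1]_t f t = \int[mu2 \x L n]_p f (tuple_cons p))%E.
Proof.
move=> mf f0; rewrite pushE.
have H : {in [set: _], forall y, 0 <= f y}%E by move=> y _; exact: f0.
have := ge0_integral_pushforward (@measurable_tuple_cons R n) (mu2 \x L n)%E measurableT mf H.
by rewrite preimage_setT.
Qed.

Lemma integral_tuple_cons n (f : n.+1.-tuple (plane R) -> \bar R) :
  (L n.+1).-integrable setT f ->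
  (mu2 \x L n)%E.-integrable setT (f \o (@tuple_cons R n)) /\
  (\int[L n.+1]_t f t = \int[mu2 \x L n]_p f (tuple_cons p))%E.
Proof.
move=> intf; have mf : measurable_fun setT f by case/integrableP: intf.
have int1 : (mu2 \x L n)%E.-integrable setT (f \o (@tuple_cons R n)).
  apply/integrableP; split; first exact: (measurableT_comp mf (@measurable_tuple_cons R n)).
  rewrite -(@ge0_integral_tuple_cons _ (abse \o f)).
  - by case/integrableP: intf.
  - exact: measurableT_comp.
  - by move=> t; exact: abse_ge0.
split=> //; rewrite pushE.
have := @integral_pushforward _ _ _ _ _ _ (@measurable_tuple_cons R n)
  (mu2 \x L n)%E setT f mf.
by rewrite preimage_setT => /(_ int1 measurableT).
Qed.

(** Measurable, bounded and of bounded support: integrable, and stable under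
    fixing variables. *)
Definition tame n (f : n.-tuple (plane R) -> R) := measurable_fun setT f /\
  exists M, 0 < M /\ (forall t, `|f t| <= M) /\
    (forall t i, M <= cabs (lam t i) -> f t = 0).

Lemma measurable_lam_box n M :
  measurable [set t : n.-tuple (plane R) | forall i, box (0, 0) M (tnth t i)].
Proof.
rewrite (_ : mkset _ = \bigcap_(i in [set: 'I_n])
    (fun t => tnth t i) @^-1` box (0, 0) M); last first.
  by apply/seteqP; split=> /= t At i; [move=> _; exact: At|exact: At].
apply: fin_bigcap_measurable => // i _.
rewrite -[X in measurable X]setTI; apply: measurable_tnth => //.
exact: measurable_box.
Qed.

Lemma lam_box_fin n M :
  (L n [set t : n.-tuple (plane R) | forall i, box (0, 0)%R M (tnth t i)] < +oo)%E.
Proof.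
rewrite (@lebesgue_Cn_box R n (fun=> box (0, 0) M)); last by move=> _; exact: measurable_box.
rewrite -ge0_fin_numE; last by apply: prode_ge0 => *; exact: measure_ge0.
apply: prode_fin_num => i _; rewrite ge0_fin_numE ?measure_ge0 //; exact: mu2_box_fin.
Qed.

Lemma lam_boxN n M (t : n.-tuple (plane R)) :
  t \notin [set t | forall i, box (0, 0) M (tnth t i)] -> exists i, M <= cabs (lam t i).
Proof.
rewrite notin_setE /= => H; apply: contrapT => N; apply: H => i.
rewrite /box /= !subr0; split; rewrite ltNge; apply/negP => Mi; apply: N; exists i;
  rewrite /lam; apply: supp_cp; by [left|right].
Qed.

Lemma tame_integrable n (f : n.-tuple (plane R) -> R) : tame f ->
  (L n).-integrable setT (EFin \o f).
Proof.
move=> [mf [M [M0 [fM sf]]]].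
have mB := @measurable_lam_box n M.
have E : (EFin \o f) \_ [set t | forall i, box (0, 0) M (tnth t i)] = EFin \o f.
  apply/funext => t; rewrite patchE; case: ifPn => // H.
  by have [i Mi] := lam_boxN H; rewrite /= (sf t i).
have : (L n).-integrable [set t | forall i, box (0, 0) M (tnth t i)] (EFin \o f); last first.
  by move/(iffLR (integrable_mkcond _ mB)); rewrite E.
apply: measurable_bounded_integrable; first exact: measurable_lam_box.
- exact: lam_box_fin.
- exact: measurable_funTS mf.
- exists M; split; first exact: num_real.
  by move=> x Cx p _; apply: le_trans (fM p) (ltW Cx).
Qed.

Definition tset n (t : n.-tuple (plane R)) j (z : plane R) : n.-tuple (plane R) :=
  [tuple if i == j then z else tnth t i | i < n].

Lemma tnth_tset n (t : n.-tuple (plane R)) j z i :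
  tnth (tset t j z) i = if i == j then z else tnth t i.
Proof. by rewrite tnth_mktuple. Qed.

Lemma tset_cons0 n z0 z (t : n.-tuple (plane R)) :
  tset (tuple_cons (z0, t)) ord0 z = tuple_cons (z, t).
Proof.
apply: eq_from_tnth => i; rewrite tnth_tset; case: (unliftP ord0 i) => [j ->|->].
  by rewrite -[_ == _]/false /= !tnthS.
by rewrite eqxx.
Qed.

Lemma tset_consS n z0 z (t : n.-tuple (plane R)) j :
  tset (tuple_cons (z0, t)) (lift ord0 j) z = tuple_cons (z0, tset t j z).
Proof.
apply: eq_from_tnth => i; rewrite tnth_tset; case: (unliftP ord0 i) => [k ->|->].
  by rewrite (inj_eq lift_inj) /= !tnthS tnth_tset.
by rewrite -[_ == _]/false.
Qed.

(** Fubini's theorem, with the [j]-th variable integrated first. *)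
Lemma coord_integral0 n (f : n.-tuple (plane R) -> R) j : tame f ->
  (forall t, \int[mu2]_z (f (tset t j z))%:E = 0)%E -> (\int[L n]_t (f t)%:E = 0)%E.
Proof.
elim: n f j => [|n IH] f j; first by case: j.
move=> tf f0; have intf := tame_integrable tf.
have [int1 E] := integral_tuple_cons intf; apply: (etrans E) => {E}.
case: (unliftP ord0 j) f0 => [k ->|->] f0.
  move: int1; have [m mE] := @mu2_sigma_finite R; rewrite mE => int1.
  apply: (fubini_zero1 int1) => z; apply: (IH (fun t => f (tuple_cons (z, t))) k) => [|t]; last first.
    by rewrite -[RHS](f0 (tuple_cons (z, t))) mE; apply: eq_integral => w _; rewrite tset_consS.
  have [mf [M [M0 [fM sf]]]] := tf; split.
    have mc : measurable_fun setT (fun t : n.-tuple (plane R) => tuple_cons (z, t)).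
      exact: (measurableT_comp (@measurable_tuple_cons R n) (pair1_measurable z)).
    exact: (measurableT_comp mf mc).
  exists M; split=> //; split=> // t i Mt; apply: (sf _ (lift ord0 i)).
  by rewrite /lam tnthS.
move: int1 f0; have [m mE] := @mu2_sigma_finite R; rewrite mE => int1 f0.
apply: (fubini_zero2 int1) => t; rewrite -[RHS](f0 (tuple_cons ((0, 0) : plane R, t))).
by apply: eq_integral => w _; rewrite tset_cons0.
Qed.

End TupleIntegral.

(** * Functions to which Stokes applies in each variable *)

Section Nice.
Context {R : realType}.
Local Notation C := R[i].
Local Notation mu := (@lebesgue_measure R).
Local Notation mu2 := (mu \x mu)%E.
Local Notation L n := (@lebesgue_Cn R n).
Local Hint Extern 0 (is_true (0 <= cabs _)) => (exact: cabs_ge0) : core.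

(** The inverse of [cp]. *)
Definition pc (z : C) : plane R := (complex.Re z, complex.Im z).
Lemma pcK p : pc (cp p) = p. Proof. by case: p. Qed.
Lemma cpK z : cp (pc z) = z. Proof. by case: z. Qed.

Lemma lam_tset n (t : n.-tuple (plane R)) j z i :
  lam (tset t j (pc z)) i = if i == j then z else lam t i.
Proof. by rewrite /lam tnth_tset; case: ifP => // _; rewrite cpK. Qed.

Lemma ccont_atD (f g : C -> C) z : ccont_at f z -> ccont_at g z ->
  ccont_at (fun w => f w + g w) z.
Proof.
move=> fz gz e e0; have e2 : 0 < e / 2 by rewrite divr_gt0.
have [a a0 Ha] := fz _ e2; have [b b0 Hb] := gz _ e2.
exists (Num.min a b) => [|w]; first by rewrite lt_min a0.
rewrite lt_min => /andP[/Ha h1 /Hb h2].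
have -> : f w + g w - (f z + g z) = (f w - f z) + (g w - g z) by ring.
by apply: le_lt_trans (cabsD _ _) _; rewrite [e]splitr ltrD.
Qed.

Lemma ccont_at_cst (c : C) z : ccont_at (fun=> c) z.
Proof. by move=> e e0; exists 1 => // w _; rewrite subrr cabs0. Qed.

Lemma ccont_at_comp (f g : C -> C) z : ccont_at f (g z) -> ccont_at g z ->
  ccont_at (fun w => f (g w)) z.
Proof.
move=> fz gz e /fz[d d0 Hd]; have [b b0 Hb] := gz _ d0; exists b => // w /Hb; exact: Hd.
Qed.

Definition loc_bounded n (g : n.-tuple (plane R) -> C) :=
  forall r, exists K, forall t, (forall i, cabs (lam t i) <= r) -> cabs (g t) <= K.

(** A class stable under ring operations that contains the polynomials. For
    members of bounded support, integrals exist and Stokes' theorem applies in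
    each variable separately. *)
Definition nice n (g : n.-tuple (plane R) -> C) := [/\ cmeasurable setT g,
  loc_bounded g & forall t j, ccont (fun z => g (tset t j (pc z)))].

Section closure.
Variable n : nat.
Implicit Types f g : n.-tuple (plane R) -> C.

Lemma nice_cst c : nice (fun _ : n.-tuple (plane R) => c).
Proof.
split; first exact: cmeasurable_cst; last by move=> t j z; exact: ccont_at_cst.
by move=> r; exists (cabs c).
Qed.

Lemma nice_lam j : nice (fun t : n.-tuple (plane R) => lam t j).
Proof.
split.
- have mj := @measurable_tnth _ (plane R) n j.
  by split; [apply: (measurableT_comp measurable_fst mj)|apply: (measurableT_comp measurable_snd mj)].
- by move=> r; exists r => t; exact.
- move=> t k z; case: (eqVneq j k) => [jk|jk] e e0; exists e => // w; rewrite !lam_tset.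
    by rewrite jk eqxx.
  by rewrite (negbTE jk) subrr cabs0.
Qed.

Lemma niceD f g : nice f -> nice g -> nice (fun t => f t + g t).
Proof.
move=> [mf bf cf] [mg bg cg]; split; first exact: cmeasurableD.
  move=> r; have [K HK] := bf r; have [K' HK'] := bg r; exists (K + K') => t Ht.
  by apply: le_trans (cabsD _ _) _; rewrite lerD ?HK ?HK'.
by move=> t j z; apply: ccont_atD; [exact: cf|exact: cg].
Qed.

Lemma niceM f g : nice f -> nice g -> nice (fun t => f t * g t).
Proof.
move=> [mf bf cf] [mg bg cg]; split; first exact: cmeasurableM.
  move=> r; have [K HK] := bf r; have [K' HK'] := bg r; exists (K * K') => t Ht.
  by rewrite cabsM ler_pM ?HK ?HK'.
by move=> t j z; apply: ccont_atM; [exact: cf|exact: cg].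
Qed.

Lemma niceJ f : nice f -> nice (fun t => (f t)^*).
Proof.
move=> [mf bf cf]; split; first exact: cmeasurableJ.
  by move=> r; have [K HK] := bf r; exists K => t Ht; rewrite cabsJ HK.
by move=> t j z; apply: ccont_atJ; exact: cf.
Qed.

Lemma nice_sum (I : Type) (s : seq I) (P : pred I) (f : I -> n.-tuple (plane R) -> C) :
  (forall i, P i -> nice (f i)) -> nice (fun t => \sum_(i <- s | P i) f i t).
Proof.
move=> Pf; elim: s => [|i s IH].
  by under eq_fun do rewrite big_nil; exact: nice_cst.
case Pi: (P i); under eq_fun do rewrite big_cons Pi; last exact: IH.
exact: niceD (Pf i Pi) IH.
Qed.

Lemma nice_prod (I : Type) (s : seq I) (P : pred I) (f : I -> n.-tuple (plane R) -> C) :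
  (forall i, P i -> nice (f i)) -> nice (fun t => \prod_(i <- s | P i) f i t).
Proof.
move=> Pf; elim: s => [|i s IH].
  by under eq_fun do rewrite big_nil; exact: nice_cst.
case Pi: (P i); under eq_fun do rewrite big_cons Pi; last exact: IH.
exact: niceM (Pf i Pi) IH.
Qed.

Lemma nice_exp f m : nice f -> nice (fun t => f t ^+ m).
Proof.
move=> nf; elim: m => [|m IH]; first exact: (nice_cst 1).
under eq_fun do rewrite exprS; exact: niceM.
Qed.

Lemma niceN f : nice f -> nice (fun t => - f t).
Proof. by move=> nf; under eq_fun do rewrite -mulN1r; apply: niceM => //; exact: nice_cst. Qed.

Lemma nice_comp (phi : C -> C) f M : ccont phi -> csupported M phi -> nice f ->
  nice (fun t => phi (f t)).
Proof.
move=> cphi sphi [mf _ cf]; split.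
- have [mR mI] := ccont_measurable cphi.
  have mp : measurable_fun setT (fun t => pc (f t)).
    by apply/measurable_fun_pairP; exact: mf.
  have -> : (fun t => phi (f t)) = (fun t => phi (cp (pc (f t)))).
    by apply/funext => t; rewrite cpK.
  by split; [exact: (measurableT_comp mR mp)|exact: (measurableT_comp mI mp)].
- have sR : supported M (fun p => complex.Re (phi (cp p))).
    by move=> p Mp; rewrite (sphi _ (supp_cp Mp)).
  have sI : supported M (fun p => complex.Im (phi (cp p))).
    by move=> p Mp; rewrite (sphi _ (supp_cp Mp)).
  have [K1 H1] := cont2_supported_bounded (cont2_Re cphi) sR.
  have [K2 H2] := cont2_supported_bounded (cont2_Im cphi) sI.
  move=> r; exists (K1 + K2) => t _; apply: le_trans (cabs_le_ReIm _) _.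
  by have := H1 (pc (f t)); have := H2 (pc (f t)); rewrite cpK => ? ?; rewrite lerD.
- by move=> t j z; apply: (@ccont_at_comp phi); [exact: cphi|exact: cf].
Qed.

Lemma nice_tame f M : 0 < M -> nice f -> (forall t i, M <= cabs (lam t i) -> f t = 0) ->
  tame (fun t => complex.Re (f t)) /\ tame (fun t => complex.Im (f t)).
Proof.
move=> M0 [[mR mI] bf _] sf; have [K HK] := bf M.
have fK t : cabs (f t) <= `|K|.
  have [[i Mi]|H] := pselect (exists i, M <= cabs (lam t i)).
    by rewrite (sf _ _ Mi) cabs0.
  apply: le_trans (ler_norm K); apply: HK => i; rewrite leNgt; apply/negP => Mi.
  by apply: H; exists i; exact: ltW.
have N0 : 0 < M + `|K| by rewrite ltr_pwDl.
split; split=> //; exists (M + `|K|); split=> //; split=> t.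
- by apply: le_trans (abs_Re_le _) _; apply: le_trans (fK t) _; rewrite lerDr ltW.
- by move=> i Mi; rewrite (sf t i) // (le_trans _ Mi) // lerDl.
- by apply: le_trans (abs_Im_le _) _; apply: le_trans (fK t) _; rewrite lerDr ltW.
- by move=> i Mi; rewrite (sf t i) // (le_trans _ Mi) // lerDl.
Qed.

Lemma nice_integrable f M : 0 < M -> nice f ->
  (forall t i, M <= cabs (lam t i) -> f t = 0) -> cintegrable (L n) setT f.
Proof. by move=> M0 nf sf; have [tR tI] := nice_tame M0 nf sf; split; exact: tame_integrable. Qed.

(** If one variable integrates to zero, by Stokes in that variable. *)
Lemma dbar_coord0 f M (H : n.-tuple (plane R) -> C) j : 0 < M -> nice f ->
  (forall t i, M <= cabs (lam t i) -> f t = 0) ->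
  (forall t i, M <= cabs (lam t i) -> H t = 0) ->
  (forall t z, exists a, wirt (fun w => H (tset t j (pc w))) z a (f (tset t j (pc z)))) ->
  cint (L n) setT f = 0.
Proof.
move=> M0 nf sf sH HH; have [tR tI] := nice_tame M0 nf sf.
have key t : cint mu2 setT (fun p => f (tset t j p)) = 0.
  have [_ _ cf] := nf.
  have s g : (forall t i, M <= cabs (lam t i) -> g t = 0) ->
      csupported M (fun z => g (tset t j (pc z))).
    by move=> sg z Mz; apply: (sg _ j); rewrite lam_tset eqxx.
  rewrite -[RHS](dbar_integral0 M0 (HH t) (cf t j) (s _ sH) (s _ sf)).
  by apply: eq_cint => p _; rewrite pcK.
have intf t := nice_integrable M0 nf sf.
have slice t : cintegrable mu2 setT (fun p => f (tset t j p)).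
  have [_ _ cf] := nf.
  have -> : (fun p => f (tset t j p)) = (fun p => f (tset t j (pc (cp p)))).
    by apply/funext => p; rewrite pcK.
  apply: (@ccont_integrable _ (fun z => f (tset t j (pc z))) M (cf t j)).
  by move=> z Mz; apply: (sf _ j); rewrite lam_tset eqxx.
have [kR kI] : (forall t, \int[mu2]_p (complex.Re (f (tset t j p)))%:E = 0)%E /\
    (forall t, \int[mu2]_p (complex.Im (f (tset t j p)))%:E = 0)%E.
  split=> t; have := key t; rewrite /cint /Rintegral => -[e1 e2];
    have [i1 i2] := slice t.
    by rewrite -[LHS]fineK ?e1 // integrable_fin_num.
  by rewrite -[LHS]fineK ?e2 // integrable_fin_num.
by rewrite /cint /Rintegral (coord_integral0 tR kR) (coord_integral0 tI kI).
Qed.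

End closure.
End Nice.

(** * Integration by parts along the lifted fields *)

Section SymmetrizationCalculus.
Context {R : realType}.
Local Notation C := R[i].
Local Notation mu := (@lebesgue_measure R).
Local Notation mu2 := (mu \x mu)%E.
Local Notation L n := (@lebesgue_Cn R n).
Local Hint Extern 0 (is_true (0 <= cabs _)) => (exact: cabs_ge0) : core.

Lemma cabs_sum (I : Type) (s : seq I) (P : pred I) (f : I -> C) :
  cabs (\sum_(i <- s | P i) f i) <= \sum_(i <- s | P i) cabs (f i).
Proof.
elim/big_rec2: _ => [|i y x _ H]; first by rewrite cabs0.
by apply: le_trans (cabsD _ _) _; rewrite lerD2l.
Qed.

Lemma conj_sum (I : Type) (s : seq I) (P : pred I) (f : I -> C) :
  (\sum_(i <- s | P i) f i)^* = \sum_(i <- s | P i) (f i)^*.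
Proof. by apply: big_morph; [move=> x y; exact: conjD|exact: conjC0]. Qed.

Lemma wirt_prod (I : finType) (f : I -> C -> C) (b : I -> C) z :
  (forall i, exists a, wirt (f i) z a (b i)) ->
  exists a, wirt (fun w => \prod_i f i w) z a (\sum_i b i * \prod_(i' | i' != i) f i' z).
Proof.
move=> fb; have := index_enum_uniq I; elim: (index_enum I) => [_|x s IH /= /andP[xs /IH[a Ha]]].
  by exists 0; rewrite big_nil; under eq_fun do rewrite big_nil; exact: wirt_cst.
have [c Hc] := fb x; eexists; under eq_fun do rewrite big_cons.
rewrite big_cons big_cons eqxx /=; have := wirtM Hc Ha; congr wirt; congr (_ * _ + _).
  rewrite big_seq [RHS]big_seq_cond; apply: eq_bigl => i; rewrite /=.
  by case: (boolP (i \in s)) => //= si; apply/esym; apply: contraNneq xs => <-.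
rewrite big_distrr /=; apply: eq_big_seq => i si; rewrite big_cons.
have -> : x != i by apply: contraNneq xs => ->.
by rewrite mulrCA.
Qed.

Lemma cdiff_prod (I : Type) (s : seq I) (P : pred I) (f : I -> C -> C) z :
  (forall i, P i -> exists l, cdiff (f i) z l) ->
  exists l, cdiff (fun w => \prod_(i <- s | P i) f i w) z l.
Proof.
move=> fb; elim: s => [|x s [l Hl]].
  by exists 0; under eq_fun do rewrite big_nil; exact: wirt_cst.
case Px: (P x); last by exists l; under eq_fun do rewrite big_cons Px.
have [m Hm] := fb x Px; eexists; under eq_fun do rewrite big_cons Px.
exact: cdiffM Hm Hl.
Qed.

Lemma cdiff_lin (a b : C) z : cdiff (fun w => a + w * b) z b.
Proof.
have := cdiffD (wirt_cst a z) (cdiffM (wirt_id z) (wirt_cst b z)).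
by rewrite /= mul1r mulr0 addr0 add0r.
Qed.

Section coordinates.
Variable n : nat.
Implicit Types (t : n.-tuple (plane R)) (y : 'I_n -> C).

(** The [m]-th coefficient of [vpol]: a coordinate of the target, in the order
    opposite to that of the symmetrization map. *)
Definition sco m t : C := (vpol (lam t))`_m.

Lemma lam_tset_neq t j z l : l != j -> lam (tset t j (pc z)) l = lam t l.
Proof. by move=> lj; rewrite lam_tset (negbTE lj). Qed.

Lemma cdiff_sco t j m z :
  cdiff (fun w => sco m (tset t j (pc w))) z (vpol' (lam t) j)`_m.
Proof.
have E w : vpol' (lam (tset t j (pc w))) j = vpol' (lam t) j.
  by apply: vpol'_const => l lj; exact: lam_tset_neq.
rewrite /sco; case: m => [|m].
  under eq_fun do rewrite (coef_vpol0 _ j) E lam_tset eqxx -[_ * _]add0r.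
  exact: cdiff_lin.
under eq_fun do rewrite (coef_vpol _ j) E lam_tset eqxx.
exact: cdiff_lin.
Qed.

Lemma cdiff_vdm t j z : exists l, cdiff (fun w => vdm (lam (tset t j (pc w)))) z l.
Proof.
have D i : exists l, cdiff (fun w => lam (tset t j (pc w)) i) z l.
  case: (eqVneq i j) => ij.
    by exists 1; under eq_fun do rewrite lam_tset ij eqxx; exact: wirt_id.
  by exists 0; under eq_fun do rewrite (lam_tset_neq _ _ ij); exact: wirt_cst.
apply: cdiff_prod => i _; apply: cdiff_prod => l _.
have [a Ha] := D l; have [b Hb] := D i; exists (a + (0 * lam (tset t j (pc z)) i + -1 * b)).
have := cdiffD Ha (cdiffM (wirt_cst (-1) z) Hb).
by congr cdiff; apply/funext => w; rewrite /= mulN1r.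
Qed.

Definition pnice (p : n.-tuple (plane R) -> {poly C}) := forall i, nice (fun t => (p t)`_i).

Lemma pniceM p q : pnice p -> pnice q -> pnice (fun t => p t * q t).
Proof.
move=> np nq i; under eq_fun do rewrite coefM.
by apply: nice_sum => j _; exact: niceM.
Qed.

Lemma pnice_prod (P : pred 'I_n) :
  pnice (fun t => \prod_(l | P l) ('X + (lam t l)%:P)).
Proof.
elim: (index_enum 'I_n) => [|x s IH].
  by move=> i; under eq_fun do rewrite big_nil coef1; exact: nice_cst.
case Px: (P x); under eq_fun do rewrite big_cons Px; last exact: IH.
apply: pniceM => // k; under eq_fun do rewrite coefD coefX coefC.
apply: niceD; first exact: nice_cst.
by case: eqP => _; [exact: nice_lam|exact: nice_cst].
Qed.

Lemma nice_sco m : nice (sco m). Proof. exact: (pnice_prod predT). Qed.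
Lemma nice_vpol' j i : nice (fun t => (vpol' (lam t) j)`_i). Proof. exact: pnice_prod. Qed.

Lemma nice_diff i j : nice (fun t : n.-tuple (plane R) => lam t i - lam t j).
Proof. by apply: niceD; [exact: nice_lam|apply: niceN; exact: nice_lam]. Qed.

Lemma nice_vdm : nice (fun t : n.-tuple (plane R) => vdm (lam t)).
Proof. by apply: nice_prod => i _; apply: nice_prod => j _; exact: nice_diff. Qed.

Lemma nice_vcof j : nice (fun t => vcof (lam t) j).
Proof.
apply: niceM; first exact: nice_cst.
by apply: nice_prod => i _; apply: nice_prod => l _; exact: nice_diff.
Qed.

(** Cauchy's bound on the roots: the symmetrization map is proper. *)
Lemma root_bound y M : 0 < M -> (forall m : 'I_n, cabs (vpol y)`_m < M) ->
  forall i, cabs (y i) < n%:R * M + 1.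
Proof.
move=> M0 yM i; rewrite ltNge; apply/negP => big.
have n0 : (0 < n)%N by exact: leq_ltn_trans (ltn_ord i).
have y1 : 1 <= cabs (y i) by apply: le_trans big; rewrite lerDr mulr_ge0 // ltW.
have vm : vpol y \is monic.
  by apply: monic_prod => l _; rewrite -[(y l)%:P]opprK -polyCN; exact: monicXsubC.
have sv : size (vpol y) = n.+1.
  rewrite (vpolE y i) size_monicM ?vpol'_monic //; last first.
    by rewrite -size_poly_eq0 size_vpol' -lt0n.
    by rewrite -[(y i)%:P]opprK -polyCN; exact: monicXsubC.
  by rewrite -[(y i)%:P]opprK -polyCN size_XsubC size_vpol'.
have root0 : (vpol y).[- y i] = 0.
  by rewrite (vpolE y i) hornerM !(hornerD, hornerX, hornerC) addNr mul0r.
move: root0; rewrite horner_coef sv big_ord_recr /=.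
have -> : (vpol y)`_n = 1 by move/monicP: vm; rewrite lead_coefE sv.
rewrite mul1r => /eqP; rewrite addr_eq0 eq_sym => /eqP /(congr1 (@cabs R)).
rewrite cabsN cabsX cabsN => E.
have : cabs (y i) ^+ n <= n%:R * M * cabs (y i) ^+ n.-1.
  rewrite E; apply: le_trans (cabs_sum _ _ _) _.
  rewrite -mulrA -[n in n%:R]card_ord -sum1_card natr_sum mulr_suml.
  apply: ler_sum => k _; rewrite mul1r cabsM ler_pM //; first exact: ltW (yM k).
  by rewrite cabsX cabsN ler_weXn2l // -ltnS prednK.
rewrite -{1}(prednK n0) exprS ler_pM2r; last by rewrite exprn_gt0 // (lt_le_trans ltr01).
by move/(le_trans big); rewrite gerDl ler10.
Qed.

Lemma sco_support t M : 0 < M -> forall i, n%:R * M + 1 <= cabs (lam t i) ->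
  exists m : 'I_n, M <= cabs (sco m t).
Proof.
move=> M0 i Mi; apply: contrapT => N; have := @root_bound (lam t) M M0.
have H (m : 'I_n) : cabs (vpol (lam t))`_m < M.
  by rewrite ltNge; apply/negP => Mm; apply: N; exists m.
by move=> /(_ H i); rewrite ltNge Mi.
Qed.

(** The vector fields [\sum_j w_j d/d lambda_j] below are [vdm] times the
    coordinate fields of the target; they have divergence zero, so integrating
    by parts along them moves a derivative in the target. *)
Lemma dbar_symm (phi beta : 'I_n -> C -> C) M (m : 'I_n) : 0 < M ->
  (forall i z, exists a, wirt (phi i) z a (beta i z)) ->
  (forall i, ccont (beta i)) ->
  (forall i, csupported M (phi i)) -> (forall i, csupported M (beta i)) ->
  cint (L n) setT (fun t => beta m (sco m t) * (\prod_(i | i != m) phi i (sco i t)) *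
    (vdm (lam t) * (vdm (lam t))^*)) = 0.
Proof.
move=> M0 wphi cbeta sphi sbeta.
have cphi i : ccont (phi i) by apply: wirt_ccont (wphi i).
pose V t := vdm (lam t).
pose P t := \prod_i phi i (sco i t).
pose B i t := beta i (sco i t) * \prod_(i' | i' != i) phi i' (sco i' t).
pose w j t := (- lam t j) ^+ m * vcof (lam t) j.
pose w' j t := - (m%:R * (- lam t j) ^+ m.-1 * vcof (lam t) j).
pose c' (i : 'I_n) j t := (vpol' (lam t) j)`_(nat_of_ord i).
pose k j t := (\sum_i B i t * (c' i j t)^*) * ((w j t)^* * V t) + P t * ((w' j t)^* * V t).
have nphi i : nice (fun t => phi i (sco i t)).
  by apply: (nice_comp (cphi i) (sphi i)); exact: nice_sco.
have nB i : nice (B i).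
  by apply: niceM; [apply: (nice_comp (cbeta i) (sbeta i)); exact: nice_sco|apply: nice_prod].
have nlamX j e : nice (fun t => (- lam t j) ^+ e).
  by apply: nice_exp; apply: niceN; exact: nice_lam.
have nV : nice V by exact: nice_vdm.
have nk j : nice (k j).
  apply: niceD; apply: niceM.
  - by apply: nice_sum => i _; apply: niceM => //; apply: niceJ; exact: nice_vpol'.
  - by apply: niceM => //; apply: niceJ; apply: niceM; [exact: nlamX|exact: nice_vcof].
  - exact: nice_prod.
  - apply: niceM => //; apply: niceJ; apply: niceN; apply: niceM; last exact: nice_vcof.
    by apply: niceM; [exact: nice_cst|exact: nlamX].
pose M' := n%:R * M + 1; have M'0 : 0 < M' by rewrite ltr_wpDl // mulr_ge0 // ltW.
have sP t i : M' <= cabs (lam t i) -> P t = 0.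
  by move=> /(sco_support M0)[l Ml]; rewrite /P (bigD1 l) //= (sphi l) ?mul0r.
have sB t l i : M' <= cabs (lam t i) -> B l t = 0.
  move=> /(sco_support M0)[h Mh]; rewrite /B; case: (eqVneq h l) => [<-|hl].
    by rewrite (sbeta h) ?mul0r.
  by rewrite (bigD1 h) //= (sphi h) ?mul0r ?mulr0.
have sk j t i : M' <= cabs (lam t i) -> k j t = 0.
  move=> Mi; rewrite /k (sP t i) // mul0r addr0 big1 ?mul0r // => l _.
  by rewrite (sB t l i) ?mul0r.
have k0 j : cint (L n) setT (k j) = 0.
  apply: (@dbar_coord0 R n (k j) M' (fun t => P t * ((w j t)^* * V t)) j M'0 (nk j) (sk j)).
    by move=> t i Mi; rewrite (sP t i) ?mul0r.
  move=> t z.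
  have [aP HP] : exists a, wirt (fun u => P (tset t j (pc u))) z a
      (\sum_i B i (tset t j (pc z)) * (c' i j (tset t j (pc z)))^*).
    have [|a Ha] := @wirt_prod _ (fun i u => phi i (sco i (tset t j (pc u))))
       (fun i => beta i (sco i (tset t j (pc z))) * (c' i j (tset t j (pc z)))^*) z.
      move=> i; have [a Ha] := wphi i (sco i (tset t j (pc z))).
      have := wirt_comp Ha (cdiff_sco t j i z); rewrite mulr0 add0r => Hc.
      have -> : c' i j (tset t j (pc z)) = c' i j t.
        have vE : vpol' (lam (tset t j (pc z))) j = vpol' (lam t) j.
          by apply: vpol'_const => l lj; exact: lam_tset_neq.
        by rewrite /c' vE.
      by eexists; exact: Hc.
    exists a; move: Ha; congr wirt; apply: eq_bigr => i _; rewrite /B; exact: mulrAC.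
  have [v Hv] := cdiff_vdm t j z.
  have Hw : cdiff (fun u => w j (tset t j (pc u))) z (w' j (tset t j (pc z))).
    have vE u : vcof (lam (tset t j (pc u))) j = vcof (lam t) j.
      by apply: vcof_const => l lj; rewrite lam_tset_neq.
    have := cdiff_poly ((- 'X) ^+ m * (vcof (lam t) j)%:P) z; congr wirt.
      by apply/funext => u; rewrite /w vE lam_tset eqxx hornerM hornerC horner_exp hornerN hornerX.
    rewrite /w' vE lam_tset eqxx derivM derivC mulr0 addr0 hornerM hornerC deriv_exp derivN derivX.
    rewrite hornerMn hornerM horner_exp !hornerN hornerX hornerC -mulNr; congr (_ * _).
    by rewrite mulN1r mulNrn mulr_natl.
  have := wirtM HP (wirtM (wirt_conj Hw) Hv).
  by rewrite mulr0 addr0 => H; eexists; exact: H.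
have E t : beta m (sco m t) * (\prod_(i | i != m) phi i (sco i t)) *
    (vdm (lam t) * (vdm (lam t))^*) = \sum_j k j t.
  rewrite big_split /= -mulr_sumr.
  have -> : \sum_j (w' j t)^* * V t = 0.
    rewrite -mulr_suml -conj_sum /w' sumrN.
    have -> : \sum_j (m%:R * (- lam t j) ^+ m.-1 * vcof (lam t) j) = 0.
      under eq_bigr do rewrite -mulrA; rewrite -mulr_sumr.
      have [->|m0] := eqVneq (nat_of_ord m) 0%N; first by rewrite mul0r.
      by rewrite vfield_div ?mulr0 // prednK ?lt0n.
    by rewrite oppr0 conjC0 mul0r.
  rewrite mulr0 addr0.
  under [RHS]eq_bigr do rewrite mulr_suml.
  rewrite [RHS]exchange_big /= [RHS](bigD1 m) //= [X in _ = _ + X]big1 ?addr0.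
    transitivity (B m t * V t * (\sum_j w j t * c' m j t)^*).
      rewrite (vfield_coef _ _ (ltn_ord m)) eqxx mulr1n /B /V; ring.
    rewrite conj_sum mulr_sumr; apply: eq_bigr => j _; rewrite [(w j t * _)^*]conjM.
    by move: (B m t) (V t) ((w j t)^*) ((c' m j t)^*) => a b c d; ring.
  move=> i im; transitivity (B i t * V t * (\sum_j w j t * c' i j t)^*).
    rewrite conj_sum mulr_sumr; apply: eq_bigr => j _; rewrite [(w j t * _)^*]conjM.
    by move: (B i t) (V t) ((w j t)^*) ((c' i j t)^*) => a b c d; ring.
  by rewrite (vfield_coef _ _ (ltn_ord m)) (inj_eq val_inj) (negbTE im) mulr0n conjC0 mulr0.
transitivity (cint (L n) setT (fun t => \sum_j k j t)).
  by apply: eq_cint => t _; exact: E.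
rewrite (cint_sum measurableT); first by rewrite big1.
by move=> j _; exact: (nice_integrable M'0 (nk j) (sk j)).
Qed.

End coordinates.
End SymmetrizationCalculus.

(** * Translation invariance of the image measure *)

Section TensorTests.
Context {R : realType}.
Local Notation C := R[i].
Local Notation mu := (@lebesgue_measure R).
Local Notation mu2 := (mu \x mu)%E.
Local Notation L n := (@lebesgue_Cn R n).
Local Hint Extern 0 (is_true (0 <= cabs _)) => (exact: cabs_ge0) : core.
Implicit Types (z c : C).

Definition iC : C := (0 +i* 1)%C.

Lemma Re_MiC z : complex.Re (- iC * z) = complex.Im z.
Proof. by case: z => a b; rewrite /iC /=; ring. Qed.

Lemma conj_MiC : (- iC)^* = iC.
Proof. by apply: eq_ReIm; rewrite ?ReJ ?ImJ /=; ring. Qed.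

Lemma ccont_Re (al : R -> R) : (forall x, rcont al x) -> ccont (fun z => (al (complex.Re z))%:C).
Proof.
move=> cal z e e0; have [d d0 Hd] := cal (complex.Re z) _ e0; exists d => // w wz.
rewrite -(rmorphB (real_complex R)) /= cabs_real; apply: Hd.
by apply: le_lt_trans wz; have := abs_Re_le (w - z); rewrite ReD ReN.
Qed.

Lemma ccont_Im (al : R -> R) : (forall x, rcont al x) -> ccont (fun z => (al (complex.Im z))%:C).
Proof.
move=> cal z e e0; have [d d0 Hd] := cal (complex.Im z) _ e0; exists d => // w wz.
rewrite -(rmorphB (real_complex R)) /= cabs_real; apply: Hd.
by apply: le_lt_trans wz; have := abs_Im_le (w - z); rewrite ImD ImN.
Qed.

Lemma wirt_Im (al : R -> R) z a : rderiv al (complex.Im z) a ->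
  wirt (fun w => (al (complex.Im w))%:C) z ((a / 2)%:C * - iC) ((a / 2)%:C * iC).
Proof.
move=> Ha.
have g : cdiff (fun w => - iC * w) z (- iC).
  have := cdiffM (wirt_cst (- iC) z) (wirt_id z).
  by rewrite /= mul0r add0r mulr1.
have f : wirt (fun w => (al (complex.Re w))%:C) (- iC * z) (a / 2)%:C (a / 2)%:C.
  by apply: wirt_Re; rewrite Re_MiC; exact: Ha.
have := wirt_comp f g; rewrite conjC0 !mulr0 addr0 add0r conj_MiC.
by under eq_fun do rewrite Re_MiC.
Qed.

Definition tens (al be : R -> R) c : C := (al (complex.Re c))%:C * (be (complex.Im c))%:C.

Lemma ccont_tens (al be : R -> R) : (forall x, rcont al x) -> (forall x, rcont be x) -> ccont (tens al be).
Proof. by move=> ca cb z; apply: ccont_atM; [exact: ccont_Re|exact: ccont_Im]. Qed.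

Lemma wirt_tens (al be : R -> R) z (da db : R) :
  rderiv al (complex.Re z) da -> rderiv be (complex.Im z) db ->
  exists a, wirt (tens al be) z a ((da / 2)%:C * (be (complex.Im z))%:C +
    (al (complex.Re z))%:C * ((db / 2)%:C * iC)).
Proof. by move=> ha hb; eexists; exact: wirtM (wirt_Re ha) (wirt_Im hb). Qed.

Lemma tens_support (al be : R -> R) M : 0 < M -> (forall x, M <= `|x| -> al x = 0) ->
  (forall x, M <= `|x| -> be x = 0) -> csupported (M + M) (tens al be).
Proof.
move=> M0 sa sb z Mz; rewrite /tens.
have [Ma|Ma] := leP M `|complex.Re z|; first by rewrite sa ?mul0r.
have [Mb|Mb] := leP M `|complex.Im z|; first by rewrite sb ?mulr0.
by have := le_lt_trans (le_trans Mz (cabs_le_ReIm z)) (ltrD Ma Mb); rewrite ltxx.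
Qed.

Definition is_test (al : R -> R) (I : R) := exists al' A M, 0 < M /\ test al al' A I (- M) M.

Lemma test_widen (al al' A : R -> R) I lo hi lo' hi' : lo' <= lo -> hi <= hi' ->
  test al al' A I lo hi -> test al al' A I lo' hi'.
Proof.
move=> h1 h2 [a b c d e]; split=> // x hx; first by apply: d; exact: le_trans hx h1.
by apply: e; exact: le_trans h2 hx.
Qed.

Lemma is_test_of (al al' A : R -> R) I lo hi : test al al' A I lo hi -> is_test al I.
Proof.
move=> t; exists al', A, (1 + `|lo| + `|hi|); split; first by rewrite -addrA ltr_pwDl // addr_ge0.
have h1 := ler_norm (- lo); have h2 := ler_norm hi; rewrite normrN in h1.
by apply: test_widen t; have := normr_ge0 lo; have := normr_ge0 hi; lra.
Qed.

Lemma is_testD (al be : R -> R) I J : is_test al I -> is_test be J ->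
  is_test (fun x => al x + be x) (I + J).
Proof.
move=> [al' [A [M [M0 ta]]]] [be' [B [N [N0 tb]]]].
have [a1 a2 a3 a4 a5] := ta; have [b1 b2 b3 b4 b5] := tb.
exists (fun x => al' x + be' x), (fun x => A x + B x), (M + N); split; first exact: addr_gt0.
split=> x.
- exact: rderivD.
- exact: rcontD.
- exact: rderivD.
- by move=> hx; have [] := a4 x; [lra|move=> -> ->]; have [] := b4 x; [lra|move=> -> ->]; rewrite addr0.
- by move=> hx; have [] := a5 x; [lra|move=> -> ->]; have [] := b5 x; [lra|move=> -> ->]; rewrite addr0.
Qed.

Lemma rcontZ (P : R -> R) x k : rcont P x -> rcont (fun y => k * P y) x.
Proof.
move=> Px e e0; have K0 : 0 < `|k| + 1 by rewrite ltr_wpDl.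
have [d d0 Hd] := Px _ (divr_gt0 e0 K0); exists d => // y /Hd.
rewrite ltr_pdivlMr // => H; rewrite -mulrBr normrM; apply: le_lt_trans H.
by rewrite mulrC ler_wpM2l // lerDl.
Qed.

Lemma is_testZ k (al : R -> R) I : is_test al I -> is_test (fun x => k * al x) (k * I).
Proof.
move=> [al' [A [M [M0 [a1 a2 a3 a4 a5]]]]].
exists (fun x => k * al' x), (fun x => k * A x), M; split=> //; split=> x.
- exact: rderivZ.
- exact: rcontZ.
- exact: rderivZ.
- by move=> /a4[-> ->]; rewrite mulr0.
- by move=> /a5[-> ->]; rewrite mulr0.
Qed.

Section functional.
Variable n : nat.
Local Notation K := ('I_n * bool)%type.

Definition tprod (al : K -> R -> R) (t : n.-tuple (plane R)) : C :=
  \prod_(i < n) tens (al (i, false)) (al (i, true)) (sco i t).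

Definition dens (t : n.-tuple (plane R)) : C := vdm (lam t) * (vdm (lam t))^*.

(** The integral of a product test function of the real target coordinates
    against the image of the measure [|vdm|^2]. *)
Definition tfun (al : K -> R -> R) : C := cint (L n) setT (fun t => tprod al t * dens t).

Lemma dens_real t : dens t = (cabs (vdm (lam t)) ^+ 2)%:C.
Proof. by rewrite /dens mulJ_cabs. Qed.

Definition tupd (al : K -> R -> R) (x : K) (p : R -> R) : K -> R -> R := fun y => if y == x then p else al y.

Lemma tests_uniform (al : K -> R -> R) (I : K -> R) : (forall x, is_test (al x) (I x)) ->
  exists M, 0 < M /\ exists al' A, forall x, test (al x) (al' x) (A x) (I x) (- M) M.
Proof.
move=> tal.
have [f Hf] := choice (fun x => tal x).
have [g Hg] := choice (fun x => Hf x).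
have [h Hh] := choice (fun x => Hg x).
exists (1 + \sum_x h x); have h0 x : 0 < h x by case: (Hh x).
split; first by rewrite ltr_pwDl // sumr_ge0 // => x _; exact: ltW.
exists f, g => x; have [_] := Hh x.
have hx : h x <= 1 + \sum_y h y.
  rewrite (bigD1 x) //= addrCA lerDl addr_ge0 // sumr_ge0 // => y _; exact: ltW.
by apply: test_widen => //; rewrite lerN2.
Qed.

Lemma tests_support (al : K -> R -> R) (I : K -> R) al' A M : (forall x, test (al x) (al' x) (A x) (I x) (- M) M) ->
  forall x y, M <= `|y| -> al x y = 0.
Proof.
move=> tal x y; case: (tal x) => _ _ _ a4 a5.
have [y0|y0] := leP 0 y => h; first by rewrite ger0_norm // in h; case: (a5 y h).
by rewrite ltr0_norm // in h; case: (a4 y) => //; rewrite lerNr.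
Qed.

Lemma tfun_integrable (al : K -> R -> R) I : (forall x, is_test (al x) (I x)) ->
  cintegrable (L n) setT (fun t => tprod al t * dens t).
Proof.
move=> /tests_uniform[M [M0 [al' [A tal]]]].
have s := tests_support tal.
have st i : csupported (M + M) (tens (al (i, false)) (al (i, true))).
  by apply: tens_support => // x; exact: s.
have ct i : ccont (tens (al (i, false)) (al (i, true))).
  apply: ccont_tens => x; apply: rderiv_cont;
    [have [h _ _ _ _] := tal (i, false); exact: h|have [h _ _ _ _] := tal (i, true); exact: h].
have M2 : 0 < M + M by rewrite addr_gt0.
have M3 : 0 < n%:R * (M + M) + 1 by rewrite ltr_wpDl // mulr_ge0 // ltW.
apply: (nice_integrable M3).
  apply: niceM; last by apply: niceM; [exact: nice_vdm|apply: niceJ; exact: nice_vdm].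
  by apply: nice_prod => i _; apply: (nice_comp (ct i) (st i)); exact: nice_sco.
move=> t i /(sco_support M2)[m Mm].
by rewrite /tprod (bigD1 m) //= (st m) ?mul0r.
Qed.

(** The derivative at an edge of the support, computed from the outside. *)
Lemma rderiv_edge (P : R -> R) M x d : (forall y, M <= `|y| -> P y = 0) -> M <= `|x| ->
  rderiv P x d -> d = 0.
Proof.
move=> P0 Mx Px; apply: contrapT => /eqP; rewrite -normr_gt0 => d0.
have [del del0 H] := Px _ (divr_gt0 d0 (ltr0Sn R 1)).
pose s : R := if 0 <= x then 1 else -1.
have s1 : `|s| = 1 by rewrite /s; case: ifP => _; rewrite ?normrN normr1.
have My : M <= `|x + s * (del / 2)|.
  apply: le_trans Mx _; rewrite /s; have := ltW (divr_gt0 del0 (ltr0Sn R 1)).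
  move: (del / 2) => h h0; case: (leP 0 x) => x0.
    by rewrite mul1r !ger0_norm ?addr_ge0 // lerDl.
  by rewrite mulN1r !ler0_norm; lra.
have := H (x + s * (del / 2)); rewrite addrC addKr (P0 _ My) (P0 _ Mx) subrr sub0r normrN.
have h2 : 0 < del / 2 by rewrite divr_gt0.
have n2 : `|s * (del / 2)| = del / 2 by rewrite normrM s1 mul1r gtr0_norm.
rewrite (normrM d) n2.
move=> /(_ _); have -> : del / 2 < del by rewrite ltr_pdivrMr // ltr_pMr // ltr1n.
by move=> /(_ isT); rewrite ler_pM2r // leNgt ltr_pdivrMr // ltr_pMr // ltr1n.
Qed.

Lemma tens_real (al be : R -> R) c : tens al be c = (al (complex.Re c) * be (complex.Im c))%:C.
Proof. by rewrite /tens -(rmorphM (real_complex R)). Qed.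

(** A test function of integral zero has a compactly supported primitive [A]; the
    derivative of [A] in the corresponding target coordinate is moved away by
    parts. *)
Lemma tfun0 (al : K -> R -> R) I x : (forall y, is_test (al y) (I y)) -> I x = 0 -> tfun al = 0.
Proof.
move=> tst I0; have intf := tfun_integrable tst.
have [M [M0 [al' [A tal]]]] := tests_uniform tst.
have s := tests_support tal; have M2 : 0 < M + M by rewrite addr_gt0.
have sA y : M <= `|y| -> A x y = 0.
  case: (tal x) => _ _ _ a4 a5; rewrite I0 in a5.
  by have [y0|y0] := leP 0 y => h; [rewrite ger0_norm // in h; case: (a5 y h)
    |rewrite ltr0_norm // in h; case: (a4 y) => //; rewrite lerNr].
pose F (y : K) := if y == x then A y else al y.
pose F' (y : K) := if y == x then al y else al' y.
have dF y u : rderiv (F y) u (F' y u).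
  by rewrite /F /F'; case: eqP => _; case: (tal y).
have cF y u : rcont (F y) u by exact: rderiv_cont (dF y u).
have cF' y u : rcont (F' y) u.
  by rewrite /F'; case: eqP => _; case: (tal y) => // h *; exact: rderiv_cont (h u).
have sF y u : M <= `|u| -> F y u = 0.
  by rewrite /F; case: eqP => [->|_]; [exact: sA|exact: s].
have sF' y u : M <= `|u| -> F' y u = 0.
  by move=> Mu; exact: (rderiv_edge (sF y) Mu (dF y u)).
pose phi i := tens (F (i, false)) (F (i, true)).
pose beta i (c : C) : C :=
  (F' (i, false) (complex.Re c) / 2)%:C * (F (i, true) (complex.Im c))%:C +
  (F (i, false) (complex.Re c))%:C * ((F' (i, true) (complex.Im c) / 2)%:C * iC).
have cR (P : R -> R) : (forall u, rcont P u) -> ccont (fun c => (P (complex.Re c) / 2)%:C).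
  move=> cP; apply: (@ccont_Re (fun u => P u / 2)) => u.
  by have := rcontZ 2^-1 (cP u); under eq_fun do rewrite mulrC.
have cI (P : R -> R) : (forall u, rcont P u) -> ccont (fun c => (P (complex.Im c) / 2)%:C).
  move=> cP; apply: (@ccont_Im (fun u => P u / 2)) => u.
  by have := rcontZ 2^-1 (cP u); under eq_fun do rewrite mulrC.
have Z0 := @dbar_symm R n phi beta (M + M) x.1 M2 _ _ _ _.
have {Z0} Z0 : cint (L n) setT (fun t => beta x.1 (sco x.1 t) *
    (\prod_(i | i != x.1) phi i (sco i t)) * dens t) = 0.
  apply: Z0 => i.
  - by move=> z; apply: wirt_tens; exact: dF.
  - move=> z; apply: ccont_atD; apply: ccont_atM.
    + exact: (cR _ (cF' (i, false))).
    + exact: (ccont_Im (cF (i, true))).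
    + exact: (ccont_Re (cF (i, false))).
    + by apply: ccont_atM; [exact: (cI _ (cF' (i, true)))|exact: ccont_at_cst].
  - by apply: tens_support => // u; exact: sF.
  - move=> z Mz; rewrite /beta.
    have [Ma|Ma] := leP M `|complex.Re z|.
      by rewrite (sF _ _ Ma) (sF' _ _ Ma) !mul0r addr0.
    have [Mb|Mb] := leP M `|complex.Im z|.
      by rewrite (sF _ _ Mb) (sF' _ _ Mb) !(mul0r, mulr0) addr0.
    by have := le_lt_trans (le_trans Mz (cabs_le_ReIm z)) (ltrD Ma Mb); rewrite ltxx.
have re t : exists r : R, (\prod_(i | i != x.1) phi i (sco i t)) * dens t = r%:C /\
    tprod al t * dens t = (al (x.1, false) (complex.Re (sco x.1 t)) *
      al (x.1, true) (complex.Im (sco x.1 t)) * r)%:C.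
  have [q qE] : exists q : R, \prod_(i | i != x.1) phi i (sco i t) = q%:C.
    elim/big_rec: _ => [|i y _ [q ->]]; first by exists 1.
    by eexists; rewrite /phi tens_real -(rmorphM (real_complex R)).
  exists (q * cabs (vdm (lam t)) ^+ 2); split.
    by rewrite qE dens_real -(rmorphM (real_complex R)).
  rewrite /tprod (bigD1 x.1) //= tens_real dens_real.
  have -> : \prod_(i | i != x.1) tens (al (i, false)) (al (i, true)) (sco i t) = q%:C.
    rewrite -qE; apply: eq_bigr => i ix; rewrite /phi /F.
    have nx b : ((i, b) == x) = false.
      by apply/negbTE; apply: contraNneq ix => <-.
    by rewrite !nx.
  by rewrite -!(rmorphM (real_complex R)) /=; congr (_%:C)%C; ring.
have ImE t : complex.Im (tprod al t * dens t) = 0 by have [r [_ ->]] := re t.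
have ReE : (\int[L n]_t complex.Re (tprod al t * dens t))%R = 0; last first.
  rewrite /tfun; apply: eq_ReIm; first exact: ReE.
  by rewrite /cint /=; apply: Rintegral0_eq => t _; exact: ImE.
have half (g : n.-tuple (plane R) -> R) : (\int[L n]_t g t)%R = 0 ->
    (forall t, g t = 2^-1 * complex.Re (tprod al t * dens t)) ->
    (\int[L n]_t complex.Re (tprod al t * dens t))%R = 0.
  move=> g0 gE; have := g0; rewrite (eq_Rintegral _ (fun t _ => gE t)).
  rewrite RintegralZl //; last by case: intf.
  by move/eqP; rewrite mulf_eq0 invr_eq0 pnatr_eq0 /= => /eqP.
have := Z0; rewrite /cint => -[ZR ZI].
case: (boolP x.2) => xb; [apply: (half _ ZI)|apply: (half _ ZR)] => t;
  have [r [rE ->]] := re t; rewrite -mulrA rE /beta /F /F'; have xE : x = (x.1, x.2) by case: (x).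
- have e1 : ((x.1, true) == x) = true by rewrite [X in _ == X]xE xb eqxx.
  have e2 : ((x.1, false) == x) = false by rewrite [X in _ == X]xE xb; apply/eqP => -[].
  by rewrite e1 e2 /iC /=; ring.
- have e1 : ((x.1, false) == x) = true by rewrite [X in _ == X]xE (negbTE xb) eqxx.
  have e2 : ((x.1, true) == x) = false by rewrite [X in _ == X]xE (negbTE xb); apply/eqP => -[].
  by rewrite e1 e2 /iC /=; ring.
Qed.

Lemma tprod_tupd (al : K -> R -> R) x t : exists q : C, forall p,
  tprod (tupd al x p) t = (p (if x.2 then complex.Im (sco x.1 t) else complex.Re (sco x.1 t)))%:C * q.
Proof.
case: x => m b.
exists ((if b then (al (m, false) (complex.Re (sco m t)))%:C else (al (m, true) (complex.Im (sco m t)))%:C) *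
  \prod_(i < n | i != m) tens (al (i, false)) (al (i, true)) (sco i t)).
move=> p; rewrite /tprod (bigD1 m) //= mulrA; congr (_ * _).
  rewrite /tens /tupd; case: b => /=; rewrite ?eqxx.
    have -> : ((m, false) == (m, true)) = false by apply/eqP => -[].
    exact: mulrC.
  by have -> : ((m, true) == (m, false)) = false by apply/eqP => -[].
apply: eq_bigr => i im; rewrite /tupd.
have nx b' : ((i, b') == (m, b)) = false by apply/negbTE; apply: contraNneq im => -[->].
by rewrite !nx.
Qed.

Lemma tupd_id (al : K -> R -> R) x : tupd al x (al x) = al.
Proof. by apply/funext => y; rewrite /tupd; case: eqP => [->|]. Qed.

(** The combination [J * al x - I x * p] has integral zero, so [tfun0]
    applies to it. *)
Lemma tfun_swap (al : K -> R -> R) I x p J : (forall y, is_test (al y) (I y)) -> is_test p J ->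
  J%:C * tfun al = (I x)%:C * tfun (tupd al x p).
Proof.
move=> ta tp; pose c u := J * al x u + (- I x) * p u.
have tc : is_test c 0.
  have := is_testD (is_testZ J (ta x)) (is_testZ (- I x) tp).
  by have -> : J * I x + - I x * J = 0 by ring.
pose I' K0 y := if y == x then K0 else I y.
have tu q K0 : is_test q K0 -> forall y, is_test (tupd al x q y) (I' K0 y).
  by move=> tq y; rewrite /tupd /I'; case: eqP.
have c0 : tfun (tupd al x c) = 0.
  by apply: (@tfun0 _ (I' 0) x); [exact: tu|rewrite /I' eqxx].
have i1 := tfun_integrable ta; have i2 := tfun_integrable (tu _ _ tp).
apply/eqP; rewrite -subr_eq0 -mulNr; apply/eqP; rewrite -[RHS]c0 /tfun.
rewrite -(cintZ measurableT J%:C i1) -(cintZ measurableT (- (I x)%:C) i2).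
rewrite -(cintD measurableT (cintegrableZ measurableT J%:C i1)
  (cintegrableZ measurableT (- (I x)%:C) i2)).
apply: eq_cint => t _; have [q qE] := tprod_tupd al x t.
rewrite -{1}(tupd_id al x) !qE.
  have -> : (c (if x.2 then complex.Im (sco x.1 t) else complex.Re (sco x.1 t)))%:C =
    J%:C * (al x (if x.2 then complex.Im (sco x.1 t) else complex.Re (sco x.1 t)))%:C
    + - (I x)%:C * (p (if x.2 then complex.Im (sco x.1 t) else complex.Re (sco x.1 t)))%:C.
    by rewrite /c (rmorphD (real_complex R)) !(rmorphM (real_complex R)) (rmorphN (real_complex R)).
  by move: (dens t) (_%:C) (_%:C) => a b d; ring.
Qed.

(** The functions are exchanged for [p] one at a time: [tfun] is
    the product functional of the integrals, up to one constant. *)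
Lemma tfun_prod (al : K -> R -> R) I p : (forall y, is_test (al y) (I y)) -> is_test p 1 ->
  tfun al = (\prod_x I x)%:C * tfun (fun=> p).
Proof.
move=> ta tp; pose als s (y : K) := if y \in (s : seq K) then p else al y.
have key s : uniq s -> tfun al = (\prod_(x <- s) I x)%:C * tfun (als s).
  elim: s => [_|x s IH /= /andP[xs us]].
    rewrite big_nil mul1r; congr tfun.
  rewrite IH // big_cons mulrC (rmorphM (real_complex R)) /= [(I x)%:C * _]mulrC -mulrA mulrC.
  congr (_ * _); have tas y : is_test (als s y) (if y \in s then 1 else I y).
    by rewrite /als; case: ifP.
  have := tfun_swap x tas tp; rewrite mul1r (negbTE xs) => ->; congr (_ * tfun _).
  by apply/funext => y; rewrite /tupd /als inE; case: eqP.
rewrite (key (index_enum K)); last exact: index_enum_uniq.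
by congr (_ * tfun _); apply/funext => y; rewrite /als mem_index_enum.
Qed.

End functional.
End TensorTests.

(** * Measures with a density *)

Section DensityMeasure.
Context d (T : measurableType d) (R : realType).
Variables (mu : {measure set T -> \bar R}) (g : T -> \bar R).
Hypotheses (mg : measurable_fun setT g) (g0 : forall x, (0 <= g x)%E).
Hypothesis gfin : forall x, g x \is a fin_num.
Local Open Scope ereal_scope.
Import HBNNSimple.

(** Packages a density as a measure, for the uniqueness theorem for
    measures. *)
Lemma density_measure : exists m : {measure set T -> \bar R},
  forall A, m A = \int[mu]_(x in A) g x.
Proof.
pose nu (A : set T) := \int[mu]_(x in A) g x.
have nu0 : nu set0 = 0 by rewrite /nu integral_set0.
have nu_ge0 A : 0 <= nu A by apply: integral_ge0.
have nus : semi_sigma_additive nu.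
  move=> F mF tF mUF; rewrite /nu ge0_integral_bigcup //; last exact: measurable_funTS.
  by apply: is_cvg_nneseries => i _ _; exact: nu_ge0.
pose m0 := isMeasure.Build _ _ _ nu nu0 nu_ge0 nus.
by pose m : measure T R := HB.pack nu m0; exists m.
Qed.

(** Both sides are continuous along increasing sequences, and agree on simple
    functions. *)
Lemma density_integral (m : {measure set T -> \bar R}) (f : T -> \bar R) :
  (forall A, measurable A -> m A = \int[mu]_(x in A) g x) ->
  measurable_fun setT f -> (forall x, 0 <= f x) ->
  \int[m]_x f x = \int[mu]_x (f x * g x).
Proof.
move=> mE mf f0; pose h := nnsfun_approx measurableT mf.
have hf x : (EFin \o h n) x @[n --> \oo] --> f x by exact: cvg_nnsfun_approx.
have fE x : f x = lim ((EFin \o h n) x @[n --> \oo]) by apply/esym/cvg_lim.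
have fgE x : f x * g x = lim ((EFin \o h n) x * g x @[n --> \oo]).
  by apply/esym/cvg_lim => //; apply: cvgeZr.
under eq_integral do rewrite fE.
under [RHS]eq_integral do rewrite fgE.
rewrite monotone_convergence //; last 3 first.
- by move=> n; apply/measurable_EFinP.
- by move=> n x _; rewrite lee_fin.
- by move=> x _ a b ab; rewrite lee_fin; exact/lefP/nd_nnsfun_approx.
rewrite monotone_convergence //; last 3 first.
- by move=> n; apply: emeasurable_funM => //; exact/measurable_EFinP.
- by move=> n x _; rewrite mule_ge0 // lee_fin.
- by move=> x _ a b ab; rewrite lee_wpmul2r // lee_fin; exact/lefP/nd_nnsfun_approx.
congr (lim (_ @[n --> \oo])); apply/funext => n.
under eq_integral do rewrite /= fimfunE -fsumEFin //.
under [RHS]eq_integral => x _.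
  rewrite /= fimfunE -fsumEFin // ge0_mule_fsuml; last by move=> y; exact: nnfun_muleindic_ge0.
  over.
have indich r : measurable_fun setT (fun x => (r * \1_(h n @^-1` [set r]) x)%:E).
  by apply/measurable_EFinP; exact: measurable_funM.
rewrite ge0_integral_fsum //; last by move=> y x _; exact: nnfun_muleindic_ge0.
rewrite ge0_integral_fsum //; last 2 first.
- by move=> y; apply: emeasurable_funM.
- by move=> y x _; rewrite mule_ge0 // nnfun_muleindic_ge0.
apply: eq_fsbigr => r rhn.
under eq_integral do rewrite EFinM.
rewrite integralZl_indic_nnsfun // integral_indic // setIT mE //.
under [RHS]eq_integral do rewrite EFinM -muleA.
have [r0|r0] := leP 0%R r; last first.
  by rewrite preimage_nnfun0 // indic0 integral_set0 mule0 integral0_eq // => x _; rewrite mul0e mule0.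
rewrite ge0_integralZl //.
- congr (_ * _); rewrite integral_mkcond; apply: eq_integral => x _.
  by rewrite muleC epatch_indic.
- by apply: emeasurable_funM => //; exact/measurable_EFinP.
- by move=> x _; rewrite mule_ge0 // lee_fin.
Qed.

End DensityMeasure.

Section PowerLimit.
Context {R : realType}.
Lemma bernoulli_ineq (x : R) N : 0 <= x <= 1 -> 1 - x *+ N <= (1 - x) ^+ N <= 1.
Proof.
move=> /andP[x0 x1]; have y0 : 0 <= 1 - x by rewrite subr_ge0.
elim: N => [|N /andP[IH1 IH2]]; first by rewrite mulr0n subr0 expr0 lexx.
rewrite exprS; apply/andP; split; last by rewrite mulr_ile1 ?exprn_ge0 // lerBlDr lerDl.
apply: le_trans (ler_wpM2l y0 IH1); rewrite mulrSr.
have : 0 <= x * (x *+ N) by rewrite mulr_ge0 // mulrn_wge0.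
by move: (x *+ N) => u; lra.
Qed.
End PowerLimit.

(** * The image measure of a box *)

Section BoxIntegral.
Context {R : realType} (n : nat).
Local Notation C := R[i].
Local Notation mu := (@lebesgue_measure R).
Local Notation mu2 := (mu \x mu)%E.
Local Notation L n := (@lebesgue_Cn R n).
Local Notation K := ('I_n * bool)%type.
Local Hint Extern 0 (is_true (0 <= cabs _)) => (exact: cabs_ge0) : core.
Implicit Types (a b : K -> R) (x : K) (t : n.-tuple (plane R)).

Definition rx x t : R := if x.2 then complex.Im (sco x.1 t) else complex.Re (sco x.1 t).

(** A normalization: this trapezoid has integral 1. *)
Definition kappa : C := tfun (fun _ : K => trap 0 2 1).

(** Preimage of a box of the target. *)
Definition sbox a b : set (n.-tuple (plane R)) := [set t | forall x, a x < rx x t < b x].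

Lemma tprod1 (al : K -> R -> R) t : (forall x, al x (rx x t) = 1) -> tprod al t = 1.
Proof.
move=> al1; rewrite /tprod big1 // => i _; rewrite tens_real.
by have := al1 (i, false); have := al1 (i, true); rewrite /rx /= => -> ->; rewrite mulr1.
Qed.

Lemma tprod_eq0 (al : K -> R -> R) t x : al x (rx x t) = 0 -> tprod al t = 0.
Proof.
move=> al0; rewrite /tprod (bigD1 x.1) //= tens_real.
have -> : al (x.1, false) (complex.Re (sco x.1 t)) * al (x.1, true) (complex.Im (sco x.1 t)) = 0.
  by case: x al0 => i b0; rewrite /rx /=; case: b0 => /= ->; rewrite ?mulr0 ?mul0r.
exact: mul0r.
Qed.

Lemma tprod_le1 (al : K -> R -> R) t : (forall x y, `|al x y| <= 1) -> cabs (tprod al t) <= 1.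
Proof.
move=> al1; rewrite /tprod; elim/big_rec: _ => [|i z _ H]; first by rewrite cabs1.
rewrite cabsM mulr_ile1 // tens_real cabs_real normrM mulr_ile1 //; exact: al1.
Qed.

Lemma measurable_rx x : measurable_fun setT (rx x).
Proof. by have [[mR mI] _ _] := @nice_sco R n x.1; rewrite /rx; case: x.2. Qed.

Lemma measurable_sbox a b : measurable (sbox a b).
Proof.
rewrite (_ : sbox a b = \bigcap_(x in [set: K]) rx x @^-1` `]a x, b x[%classic); last first.
  apply/seteqP; split=> t H x; first by move=> _; have := H x; rewrite /= ?in_itv.
  by have := H x I; rewrite /= ?in_itv.
apply: fin_bigcap_measurable => // x _; rewrite -[X in measurable X]setTI.
by apply: measurable_rx => //; exact: measurable_itv.
Qed.

Lemma nice_dens : nice (fun t : n.-tuple (plane R) => dens t).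
Proof. by apply: niceM; [exact: nice_vdm|apply: niceJ; exact: nice_vdm]. Qed.

Section box.
Variables a b : K -> R.
Hypothesis ab : forall x, a x < b x.
Let h k x : R := (b x - a x) / k.+2%:R.
Let al k x := trap (a x) (b x) (h k x).
Let f t : C := if t \in sbox a b then dens t else 0.

Let ba0 x : 0 < b x - a x. Proof. by rewrite subr_gt0. Qed.
Let h0 k x : 0 < h k x. Proof. by rewrite divr_gt0. Qed.
Let hab k x : h k x <= b x - a x.
Proof. by rewrite /h ler_pdivrMr // ler_peMr ?(ltW (ba0 x)) // ler1n. Qed.

Let al_test k x : is_test (al k x) (b x - a x - h k x).
Proof. by have [al' [A H]] := trap_test (h0 k x) (hab k x); exact: is_test_of H. Qed.

Let tfun_al k : tfun (al k) = (\prod_x (b x - a x) * (1 - k.+2%:R^-1) ^+ #|{: K}|)%:C * kappa.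
Proof.
have p1 : is_test (trap 0 2 1) (1 : R).
  have [al' [A H]] := @trap_test R 0 2 1 ltr01 ltac:(lra).
  by apply: (@is_test_of R _ al' A _ 0 2); move: H; have -> : (2 - 0 - 1 : R) = 1 by ring.
rewrite (tfun_prod (al_test k) p1) /kappa; congr (_%:C * _)%C.
by rewrite -prodr_const -big_split /=; apply: eq_bigr => x _; rewrite /h; ring.
Qed.

Let tfun_cvg : ccvg (fun k => tfun (al k)) ((\prod_x (b x - a x))%:C * kappa).
Proof.
move=> e e0; set P := \prod_x (b x - a x); set N := #|{: K}|.
pose c := `|P| * cabs kappa * N%:R + 1.
have c0 : 0 < c by rewrite ltr_wpDl // mulr_ge0 // mulr_ge0.
have [k0 Hk] := inv_approx (divr_gt0 e0 c0); exists k0 => k kk; rewrite tfun_al -/P -/N -mulrBl.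
rewrite -(rmorphB (real_complex R)) /= cabsM cabs_real.
have i1 : 0 <= (k.+2%:R^-1 : R) <= 1 by rewrite invr_ge0 ler0n invf_le1 ?ltr0n // ler1n.
have /andP[b1 b2] := bernoulli_ineq N i1.
have -> : P * (1 - k.+2%:R^-1) ^+ N - P = - (P * (1 - (1 - k.+2%:R^-1) ^+ N)) by ring.
rewrite normrN normrM (ger0_norm (x := 1 - _)) ?subr_ge0 //.
have ki : k.+2%:R^-1 <= k0.+1%:R^-1 :> R.
  by rewrite lef_pV2 ?posrE ?ltr0n // ler_nat; lia.
have Hk' : k0.+1%:R^-1 * c < e by rewrite -ltr_pdivlMr.
apply: le_lt_trans Hk'.
have : 1 - (1 - k.+2%:R^-1) ^+ N <= N%:R * k0.+1%:R^-1 :> R.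
  have b1' : 1 - N%:R * k.+2%:R^-1 <= (1 - k.+2%:R^-1) ^+ N :> R by rewrite mulr_natl.
  have : N%:R * k.+2%:R^-1 <= N%:R * k0.+1%:R^-1 :> R by rewrite ler_wpM2l.
  move=> hh; rewrite lerBlDr; apply: (@le_trans _ _ (N%:R * k.+2%:R^-1 + (1 - k.+2%:R^-1) ^+ N)).
    by rewrite -lerBlDl.
  by rewrite lerD2r.
move=> /(ler_wpM2l (mulr_ge0 (normr_ge0 P) (cabs_ge0 kappa))) H.
rewrite mulrAC; apply: le_trans H _; rewrite /c.
have : 0 <= k0.+1%:R^-1 :> R by rewrite invr_ge0.
move: (k0.+1%:R^-1) (`|P|) (cabs kappa) N%:R => u v w z u0.
have -> : v * w * (z * u) = u * (v * w * z) by ring.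
by rewrite mulrDr mulr1 lerDl.
Qed.

Let f_cvg t : ccvg (fun k => tprod (al k) t * dens t) (f t).
Proof.
rewrite /f; case: ifPn => [/set_mem tB|tB].
  have [N HN] : exists N : K -> nat, forall x k, (N x <= k)%N -> al k x (rx x t) = 1.
    suff C0 x : exists N : nat, forall k, (N <= k)%N -> al k x (rx x t) = 1.
      by have [N HN] := choice C0; exists N => x k; exact: HN.
    have /andP[h1 h2] := tB x; pose d0 := Num.min (rx x t - a x) (b x - rx x t).
    have d00 : 0 < d0 by rewrite lt_min !subr_gt0 h1.
    have [k0 Hk] := inv_approx (divr_gt0 d00 (ba0 x)); exists k0 => k kk.
    have hd : h k x <= d0.
      rewrite /h mulrC -ler_pdivlMr ?ba0 //; apply: le_trans (ltW Hk).
      by rewrite lef_pV2 ?posrE ?ltr0n // ler_nat; lia.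
    move: hd; rewrite le_min => /andP[d1 d2].
    by apply: trap_plateau => //; lra.
  move=> e e0; exists (\max_x N x)%N => k kN.
  rewrite tprod1 ?mul1r ?subrr ?cabs0 // => x; apply: HN.
  by apply: leq_trans kN; exact: leq_bigmax.
move=> e e0; exists 0%N => k _; have [x Hx] : exists x, ~ (a x < rx x t < b x).
  by apply: contrapT => N; move/negP: tB; apply; apply/mem_set => x; apply: contrapT => H; apply: N; exists x.
rewrite (@tprod_eq0 _ _ x) ?mul0r ?subrr ?cabs0 //.
have [al' [A [_ _ _ lo hi]]] := trap_test (h0 k x) (hab k x).
have [r1|r1] := leP (rx x t) (a x); first by case: (lo _ r1).
have [r2|r2] := leP (b x) (rx x t); first by case: (hi _ r2).
by case: Hx; rewrite r1 r2.
Qed.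

(** The symmetrization map is proper, so one box of the source contains all
    the supports. *)
Let dominator : exists g : n.-tuple (plane R) -> R,
  (L n).-integrable setT (EFin \o g) /\ forall k t, cabs (tprod (al k) t * dens t) <= g t.
Proof.
pose M := 1 + \sum_x (`|a x| + `|b x|).
have M1 : 0 < M by rewrite ltr_pwDl // sumr_ge0 // => x _; rewrite addr_ge0.
have MM : 0 < M + M by rewrite addr_gt0.
pose M' := n%:R * (M + M) + 1.
have [_ bd _] := nice_dens; have [K0 HK] := bd (M' + M').
pose B := [set t : n.-tuple (plane R) | forall i, box (0, 0) M' (tnth t i)].
exists (fun t => `|K0| * \1_B t); split.
  have mB := @measurable_lam_box R n M'.
  have H : (L n).-integrable B (EFin \o (fun=> `|K0|)).
    exact: (integrable_cst_fin _ mB (lam_box_fin n M')).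
  have := iffLR (integrable_mkcond _ mB) H; congr (integrable _ _ _).
  apply/funext => t; rewrite patchE /= indicE; by case: (t \in _); rewrite /= ?mulr1 ?mulr0.
move=> k t; rewrite indicE; case: (boolP (t \in B)) => [/set_mem tB|/lam_boxN[i Mi]] /=.
  rewrite mulr1 cabsM -[leRHS]mul1r; apply: ler_pM => //.
    by apply: tprod_le1 => x y; exact: trap_bound.
  apply: le_trans (ler_norm K0); apply: HK => i; apply: le_trans (cabs_le_ReIm _) _.
  by have := tB i; rewrite /box /= !subr0 => -[u v]; rewrite lerD // ltW.
rewrite mulr0; have [m Mm] := sco_support MM Mi.
have [x Mx] : exists x, M <= `|rx x t|.
  have [m1|m1] := leP M `|complex.Re (sco m t)|; first by exists (m, false).
  have [m2|m2] := leP M `|complex.Im (sco m t)|; first by exists (m, true).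
  by have := le_lt_trans (le_trans Mm (cabs_le_ReIm _)) (ltrD m1 m2); rewrite ltxx.
rewrite (@tprod_eq0 _ _ x) ?mul0r ?cabs0 //.
have [al' [A [_ _ _ lo hi]]] := trap_test (h0 k x) (hab k x).
have Mab : `|a x| + `|b x| <= M.
  rewrite /M (bigD1 x) //= addrCA lerDl addr_ge0 // sumr_ge0 // => y _; exact: addr_ge0.
have na := ler_norm (- a x); have nb := ler_norm (b x); rewrite normrN in na.
have [r0|r0] := leP 0 (rx x t).
  rewrite ger0_norm // in Mx; case: (hi (rx x t)) => //.
  by have := normr_ge0 (a x); lra.
rewrite ltr0_norm // in Mx; case: (lo (rx x t)) => //.
by have := normr_ge0 (b x); lra.
Qed.

(** The trapezoids [al k] tend to the indicator of the box and their
    integrals are known by [tfun_prod]. *)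
Lemma box_integral : (\int[L n]_(t in sbox a b) ((cabs (vdm (lam t))) ^+ 2)%:E =
  (\prod_x (b x - a x) * complex.Re kappa)%:E)%E.
Proof.
have [g [ig gb]] := dominator.
have mB := measurable_sbox a b; have [[mdR mdI] _ _] := nice_dens.
have ReE t : complex.Re (f t) = ((fun t => complex.Re (dens t)) \_ (sbox a b)) t.
  by rewrite /f patchE; case: ifP.
have mf : cmeasurable setT f.
  split; last first.
    have -> : (fun t => complex.Im (f t)) = cst 0.
      by apply/funext => t; rewrite /f; case: ifP => // _; rewrite dens_real.
    exact: measurable_cst.
  have -> : (fun t => complex.Re (f t)) = (fun t => complex.Re (dens t)) \_ (sbox a b).
    by apply/funext.
  by apply/(measurable_restrictT _ mB); exact: measurable_funTS mdR.
have mk k : cmeasurable setT (fun t => tprod (al k) t * dens t).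
  exact: (cintegrable_measurable (tfun_integrable (al_test k))).
have fg t : cabs (f t) <= g t.
  apply/ler_addgt0Pr => e e0; have [k Hk] := f_cvg t e0.
  have := cabsD (tprod (al k) t * dens t) (f t - tprod (al k) t * dens t).
  rewrite addrC subrK => H; apply: le_trans H _; apply: lerD; first exact: gb.
  by rewrite cabs_distC ltW // Hk.
have intf : cintegrable (L n) setT f.
  exact: (cintegrable_le measurableT mf ig (fun t _ => fg t)).
have ReZ (r : R) : complex.Re (r%:C * kappa) = r * complex.Re kappa.
  by case: kappa => u v /=; ring.
have D := dominated_cint measurableT mk mf ig (fun k t _ => gb k t) (fun t _ => f_cvg t) tfun_cvg.
have E := etrans (congr1 (@complex.Re R) D) (ReZ _); rewrite /= /Rintegral in E.
rewrite -E fineK; last by apply: integrable_fin_num => //; case: intf.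
rewrite [LHS]integral_mkcond; congr (integral _ _ _); apply/funext => t.
by rewrite patchE /f; case: ifP => //= _; rewrite dens_real.
Qed.

End box.
End BoxIntegral.

(** * Change of variables for the symmetrization map *)

Section ChangeOfVariables.
Context {R : realType} (n : nat).
Local Notation C := R[i].
Local Notation mu := (@lebesgue_measure R).
Local Notation mu2 := (mu \x mu)%E.
Local Notation L n := (@lebesgue_Cn R n).
Local Notation K := ('I_n * bool)%type.
Local Notation T := (n.-tuple (plane R)).
Local Hint Extern 0 (is_true (0 <= cabs _)) => (exact: cabs_ge0) : core.
Implicit Types (a b : K -> R) (x : K) (t : T).

Definition rcoord x t : R := if x.2 then (tnth t x.1).2 else (tnth t x.1).1.

Definition obox a b : set T := [set t | forall x, a x < rcoord x t < b x].

Lemma measurable_rcoord x : measurable_fun setT (rcoord x).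
Proof.
have mj := @measurable_tnth _ (plane R) n x.1; rewrite /rcoord; case: x.2.
  exact: (measurableT_comp measurable_snd mj).
exact: (measurableT_comp measurable_fst mj).
Qed.

Lemma measurable_obox a b : measurable (obox a b).
Proof.
rewrite (_ : obox a b = \bigcap_(x in [set: K]) rcoord x @^-1` `]a x, b x[%classic); last first.
  apply/seteqP; split=> t H x; first by move=> _; have := H x; rewrite /= ?in_itv.
  by have := H x I; rewrite /= ?in_itv.
apply: fin_bigcap_measurable => // x _; rewrite -[X in measurable X]setTI.
by apply: measurable_rcoord => //; exact: measurable_itv.
Qed.

Lemma obox_measure a b : (forall x, a x < b x) -> L n (obox a b) = (\prod_x (b x - a x))%:E.
Proof.
move=> ab; pose A i : set (plane R) :=
  `]a (i, false), b (i, false)[%classic `*` `]a (i, true), b (i, true)[%classic.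
have -> : obox a b = [set t | forall i, A i (tnth t i)].
  apply/seteqP; split=> t H.
    move=> i; split; rewrite /= in_itv; [exact: (H (i, false))|exact: (H (i, true))].
  by move=> [i []]; have [] := H i; rewrite /= !in_itv.
rewrite lebesgue_Cn_box; last by move=> i; apply: measurableX; exact: measurable_itv.
rewrite (eq_bigr (fun i : 'I_n => (\prod_(c : bool) (b (i, c) - a (i, c)))%:E)); last first.
  move=> i _; rewrite product_measure1E; [|exact: measurable_itv..].
  have e u v : u < v -> mu `]u, v[%classic = (v - u)%:E.
    by move=> uv; rewrite lebesgue_measure_itv /= lte_fin uv -EFinB.
  apply: (etrans (y := ((b (i, false) - a (i, false))%:E * (b (i, true) - a (i, true))%:E)%E)).
    by congr (_ * _)%E; exact: (e _ _ (ab _)).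
  by rewrite big_bool /= -EFinM mulrC.
have -> : \prod_x (b x - a x) = \prod_i \prod_(c : bool) (b (i, c) - a (i, c)).
  by rewrite pair_big /=; apply: eq_bigr => -[].
by apply/esym; apply: big_morph => // x y; rewrite EFinM.
Qed.

Lemma obox_empty a b x : b x <= a x -> obox a b = set0.
Proof.
move=> ba; apply/seteqP; split=> // t /(_ x) /andP[h1 h2].
by have := lt_le_trans (lt_trans h1 h2) ba; rewrite ltxx.
Qed.

Definition oboxes : set (set T) := [set A | exists a b, A = obox a b].

Let cubes (k : nat) := obox (fun=> - k.+1%:R) (fun=> k.+1%:R).

Let cubes_cover : \bigcup_k cubes k = [set: T].
Proof.
apply/seteqP; split=> // t _; pose M := \sum_x `|rcoord x t|.
have [k Hk] : exists k : nat, M < k%:R.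
  by exists (Num.bound M); have := archi_boundP (x := M); apply; rewrite sumr_ge0.
exists k => // x; rewrite -ltr_norml; apply: (@le_lt_trans _ _ M); last first.
  by apply: lt_trans Hk _; rewrite ltr_nat.
by rewrite /M (bigD1 x) //= lerDl sumr_ge0.
Qed.

(** Half-lines in one coordinate are increasing unions of open boxes. *)
Lemma oboxes_generate : measurable = <<s oboxes >> :> set (set T).
Proof.
apply/seteqP; split=> [A mA|]; last first.
  apply: smallest_sub; first exact: sigma_algebra_measurable.
  by move=> _ [a [b ->]]; exact: measurable_obox.
pose T' := g_sigma_algebraType oboxes.
have mob a b : measurable (obox a b : set T').
  by apply: sub_sigma_algebra; exists a, b.
have mc x : measurable_fun setT (rcoord x : T' -> measurableTypeR R).
  apply: (measurability _ (RGenOInfty.measurableE R)) => _ [_ [c ->] <-].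
  rewrite setTI; pose lo (k : nat) y := if y == x then c else - k.+1%:R.
  have -> : rcoord x @^-1` `]c, +oo[%classic = \bigcup_k obox (lo k) (fun=> k.+1%:R).
    apply/seteqP; split=> t; rewrite /= in_itv /= andbT.
      move=> ct; have : [set: T] t by []; rewrite -cubes_cover => -[k _ Hk].
      exists k => // y; have /andP[h1 h2] := Hk y; rewrite h2 andbT /lo.
      by case: eqP => [->|].
    by move=> [k _ /(_ x)]; rewrite /lo eqxx => /andP[].
  exact: bigcupT_measurable.
have mid : measurable_fun setT (idfun : T' -> T).
  apply/measurable_fun_tnthP => i; apply/measurable_fun_pairP; split.
    exact: (mc (i, false)).
  exact: (mc (i, true)).
by have := mid measurableT A mA; rewrite setTI.
Qed.

Lemma oboxes_setI : setI_closed oboxes.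
Proof.
move=> _ _ [a [b ->]] [a' [b' ->]].
exists (fun x => Num.max (a x) (a' x)), (fun x => Num.min (b x) (b' x)).
apply/seteqP; split=> t.
  by move=> [H H'] x; rewrite gt_max lt_min; have /andP[-> ->] := H x; have /andP[-> ->] := H' x.
by move=> H; split=> x; have := H x; rewrite gt_max lt_min => /andP[/andP[h1 h2] /andP[h3 h4]];
  apply/andP; split.
Qed.

(** The symmetrization map on tuples of points of the plane. *)
Definition sig t : T := [tuple pc (sco (rev_ord k) t) | k < n].

Lemma measurable_sig : measurable_fun setT sig.
Proof.
apply/measurable_fun_tnthP => i; apply/measurable_fun_pairP.
have [[mR mI] _ _] := @nice_sco R n (rev_ord i).
split; [move: mR|move: mI]; congr measurable_fun; apply/funext => t;
  by rewrite /= tnth_mktuple.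
Qed.

Lemma rcoord_sig x t : rcoord x (sig t) = rx (rev_ord x.1, x.2) t.
Proof. by rewrite /rcoord /rx tnth_mktuple; case: x.2. Qed.

Lemma sig_obox a b : sig @^-1` obox a b =
  sbox (fun x => a (rev_ord x.1, x.2)) (fun x => b (rev_ord x.1, x.2)).
Proof.
apply/seteqP; split=> t H x.
  have := H (rev_ord x.1, x.2); rewrite rcoord_sig /= rev_ordK.
  by case: x.
rewrite rcoord_sig; have := H (rev_ord x.1, x.2); rewrite /= rev_ordK; by case: x.
Qed.

Definition jac t : \bar R := ((cabs (vdm (lam t))) ^+ 2)%:E.

Lemma measurable_jac : measurable_fun setT jac.
Proof.
apply/measurable_EFinP; apply: measurable_funX; apply: measurable_cabs.
by have [] := @nice_vdm R n.
Qed.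

Lemma jac_ge0 t : (0 <= jac t)%E. Proof. by rewrite lee_fin exprn_ge0. Qed.

(** The constant of the change of variables; its value [n`!] would count the
    preimages of a generic point. *)
Definition kap : R := complex.Re (kappa n).

Lemma kap_ge0 : 0 <= kap.
Proof.
have H : (forall x : K, 0 < (1 : R)) by [].
have := box_integral (a := fun=> 0) (b := fun=> 1) H.
rewrite big1 ?mul1r => [E|x _]; last by rewrite subr0.
rewrite -lee_fin -E; apply: integral_ge0 => t _; exact: jac_ge0.
Qed.

(** Both sides are measures in [A]; they agree on boxes. *)
Lemma sig_measure A : measurable A ->
  (\int[L n]_(t in sig @^-1` A) jac t = kap%:E * L n A)%E.
Proof.
have [m mE] := density_measure (L n) measurable_jac jac_ge0.
pose nu := measure_function_pushforward__canonical__measure_function_Measure m measurable_sig.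
have nuE B : nu B = (\int[L n]_(t in sig @^-1` B) jac t)%E by rewrite -mE.
pose k := NngNum kap_ge0.
have agree B : oboxes B -> nu B = mscale k (L n) B.
  move=> [a [b ->]]; rewrite nuE sig_obox /mscale /=.
  have [[x ba]|nab] := pselect (exists x, b x <= a x).
    have -> : sbox (fun x0 => a (rev_ord x0.1, x0.2)) (fun x0 => b (rev_ord x0.1, x0.2)) = set0.
      by rewrite -sig_obox (obox_empty ba) preimage_set0.
    by rewrite (obox_empty ba) integral_set0 measure0 mule0.
  have ab x : a x < b x by rewrite ltNge; apply/negP => H; apply: nab; exists x.
  rewrite obox_measure // (box_integral (fun x => ab (rev_ord x.1, x.2))) -EFinM mulrC; congr (_ * _)%:E.
  rewrite [RHS](reindex_inj (h := fun x : K => (rev_ord x.1, x.2))) //=.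
  move=> u v E; have /= /rev_ord_inj e1 := congr1 fst E; have /= e2 := congr1 snd E.
  by case: u v e1 e2 {E} => ? ? [? ?] /= -> ->.
have H1 i : oboxes (cubes i) by exists (fun=> - i.+1%:R), (fun=> i.+1%:R).
have H2 i : (nu (cubes i) < +oo)%E.
  rewrite agree // /mscale /= /cubes obox_measure; first by rewrite -EFinM ltry.
  by move=> _; apply: (@lt_trans _ _ 0); rewrite ?oppr_lt0 ltr0Sn.
move=> mA; rewrite -nuE.
exact: (measure_unique oboxes cubes oboxes_generate oboxes_setI H1 cubes_cover nu
  (mscale k (L n)) agree H2 A mA).
Qed.

Lemma sig_integral (f : T -> \bar R) : measurable_fun setT f -> (forall t, 0 <= f t)%E ->
  (\int[L n]_t (f (sig t) * jac t) = kap%:E * \int[L n]_t f t)%E.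
Proof.
move=> mf f0; have [m mE] := density_measure (L n) measurable_jac jac_ge0.
have mfs : measurable_fun setT (f \o sig) by exact: measurableT_comp mf measurable_sig.
have fin t : jac t \is a fin_num by [].
rewrite -(density_integral measurable_jac jac_ge0 fin (fun A _ => mE A) mfs (fun t => f0 (sig t))).
pose k := NngNum kap_ge0.
have H : {in [set: _], forall y, 0 <= f y}%E by move=> y _; exact: f0.
have := ge0_integral_pushforward measurable_sig m measurableT mf H.
rewrite preimage_setT => <-.
have := ge0_integral_mscale (L n) measurableT k mf (fun t _ => f0 t); rewrite /= => <-.
pose nu := measure_function_pushforward__canonical__measure_function_Measure m measurable_sig.
apply/esym; apply: (eq_measure_integral nu) => A mA _; apply/esym.
exact: (etrans (mE (sig @^-1` A)) (sig_measure mA)).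
Qed.

End ChangeOfVariables.

(** * The Bergman kernel of the polydisc *)

Section Slices.
Context {R : realType} d1 d2 (T1 : measurableType d1) (T2 : measurableType d2).
Variables (m1 : {sigma_finite_measure set T1 -> \bar R}).
Variables (m2 : {sigma_finite_measure set T2 -> \bar R}).

(** Slices of an integrable function are integrable almost everywhere
    only, so the inner integrals are compared almost everywhere. *)
Lemma fubini_slice (g : T1 * T2 -> \bar R) (phi : T2 -> R) :
  (m1 \x m2)%E.-integrable setT g -> measurable_fun setT phi ->
  {ae m2, forall y, \int[m1]_x g (x, y) = (phi y)%:E}%E ->
  m2.-integrable setT (EFin \o phi) /\
  (\int[m1 \x m2]_p g p = \int[m2]_y (phi y)%:E)%E.
Proof.
move=> ig mphi ae.
have mg : measurable_fun setT g by case/integrableP: ig.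
have mG : measurable_fun setT (fubini_G m1 g) by exact: measurable_fubini_G ig.
have ma : measurable_fun setT (abse \o g) by exact: measurableT_comp.
have a0 p : (0 <= (abse \o g) p)%E by exact: abse_ge0.
have iG : m2.-integrable setT (fubini_G m1 g).
  apply/integrableP; split=> //.
  apply: (@le_lt_trans _ _ (\int[m2]_y \int[m1]_x `|g (x, y)|)%E).
    apply: ge0_le_integral => //.
    - exact: measurableT_comp.
    - exact: (measurable_fun_fubini_tonelli_G (abse \o g) ma a0).
    - move=> y _; apply: le_abse_integral => //.
      exact: (measurableT_comp mg (pair2_measurable y)).
  by case/integrableP: ig => _; rewrite (fubini_tonelli2 (abse \o g) ma a0).
have mE : measurable_fun setT (EFin \o phi) by exact/measurable_EFinP.
have aeq : ae_eq m2 setT (fubini_G m1 g) (EFin \o phi).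
  by apply: filterS ae => y H _; exact: H.
have E := ae_eq_integral (EFin \o phi) (fubini_G m1 g) measurableT mG mE aeq.
split; last by rewrite -E; apply/esym; exact: integral21_prod_meas1.
apply/integrableP; split => //; case/integrableP: iG => _; congr (_ < _)%E.
apply: ae_eq_integral => //; [exact: measurableT_comp|exact: measurableT_comp|].
by apply: filterS aeq => y H Ty; rewrite /= H.
Qed.

Lemma ae_slices (g : T1 * T2 -> \bar R) : (m1 \x m2)%E.-integrable setT g ->
  {ae m2, forall y, m1.-integrable setT (fun x => g (x, y))}.
Proof. exact: ae_integrable2. Qed.

End Slices.

Section Polydisc.
Context {R : realType}.
Local Notation C := R[i].
Local Notation mu := (@lebesgue_measure R).
Local Notation mu2 := (mu \x mu)%E.
Local Notation L n := (@lebesgue_Cn R n).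
Local Hint Extern 0 (is_true (0 <= cabs _)) => (exact: cabs_ge0) : core.

Definition pdisc n : set (n.-tuple (plane R)) := [set t | forall i, cabs (lam t i) < 1].

Lemma disc_area_neq0 : disc_area != 0 :> C.
Proof.
suff : (1 <= mu2 (@disc R))%E.
  have fd := @disc_fin R; have : mu2 (@disc R) \is a fin_num by rewrite ge0_fin_numE ?measure_ge0.
  move=> /fineK <-; rewrite lee_fin /disc_area => d1.
  rewrite -cabs_gt0 cabs_real gtr0_norm //; exact: lt_le_trans ltr01 d1.
have sub : box (0, 0) (2^-1) `<=` @disc R.
  move=> p [p1 p2]; rewrite /disc /=; apply: le_lt_trans (cabs_le_ReIm _) _.
  by move: p1 p2; rewrite /= !subr0 => p1 p2; rewrite [1]splitr mul1r ltrD.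
apply: (@le_trans _ _ ((mu2 (box (0, 0)%R (2^-1)%R))%E)); last first.
  by apply: le_measure; rewrite ?inE //; [exact: measurable_box|exact: measurable_disc].
have -> : box (0, 0) (2^-1 : R) = `]0 - 2^-1, 0 + 2^-1[%classic `*` `]0 - 2^-1, 0 + 2^-1[%classic.
  by rewrite -!ball_itvE.
have e : mu `]0 - 2^-1, 0 + 2^-1[%classic = 1%:E.
  have h : (0 - 2^-1 < 0 + 2^-1 :> R) by lra.
  by rewrite lebesgue_measure_itv /= lte_fin h -EFinB; congr EFin; field.
rewrite product_measure1E; [|exact: measurable_itv..].
have -> : (1 : \bar R)%E = (1 * 1)%E by rewrite mule1.
rewrite le_eqVlt; apply/orP; left; apply/eqP; apply: f_equal2; apply/esym; exact: e.
Qed.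

Lemma measurable_pdisc n : measurable (@pdisc n).
Proof.
rewrite (_ : @pdisc n = \bigcap_(i in [set: 'I_n]) (fun t => tnth t i) @^-1` @disc R); last first.
  by apply/seteqP; split=> /= t At i; [move=> _; exact: At|exact: At].
apply: fin_bigcap_measurable => // i _.
by rewrite -[X in measurable X]setTI; apply: measurable_tnth => //; exact: measurable_disc.
Qed.

Lemma pdisc_cons n z (t : n.-tuple (plane R)) :
  pdisc (tuple_cons (z, t)) <-> disc z /\ pdisc t.
Proof.
split=> [H|[Hz Ht] i]; first by split; [exact: (H ord0)|move=> i; have := H (lift ord0 i); rewrite /lam tnthS].
by case: (unliftP ord0 i) => [k ->|->]; [rewrite /lam tnthS; exact: Ht|exact: Hz].
Qed.

(** Holomorphy in each variable separately, as Fubini's theorem treats one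
    variable at a time. *)
Definition sephol n (F : n.-tuple (plane R) -> C) := forall t j, pdisc t ->
  forall z, cabs z < 1 -> exists l, cdiff (fun w => F (tset t j (pc w))) z l.

(** Extension by zero, which replaces integrals over the polydisc by integrals
    over a product space. *)
Definition zext n (F : n.-tuple (plane R) -> C) t : C := if t \in @pdisc n then F t else 0.

Lemma zext_cmeasurable n (F : n.-tuple (plane R) -> C) :
  cmeasurable (@pdisc n) F -> cmeasurable setT (zext F).
Proof.
have mD := @measurable_pdisc n; move=> [mR mI]; split.
  have -> : (fun t => complex.Re (zext F t)) = (fun t => complex.Re (F t)) \_ (@pdisc n).
    by apply/funext => t; rewrite /zext patchE; case: ifP.
  by apply/(measurable_restrictT _ mD).
have -> : (fun t => complex.Im (zext F t)) = (fun t => complex.Im (F t)) \_ (@pdisc n).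
  by apply/funext => t; rewrite /zext patchE; case: ifP.
by apply/(measurable_restrictT _ mD).
Qed.

Lemma zext_restrict n (F : n.-tuple (plane R) -> C) (c : C -> R) : c 0 = 0 ->
  (EFin \o (fun t => c (zext F t))) = (EFin \o (fun t => c (F t))) \_ (@pdisc n).
Proof. by move=> c0; apply/funext => t; rewrite /zext patchE /=; case: ifP => //; rewrite c0. Qed.

Lemma zext_integrable n (F : n.-tuple (plane R) -> C) :
  cintegrable (L n) (@pdisc n) F <-> cintegrable (L n) setT (zext F).
Proof.
have mD := @measurable_pdisc n; rewrite /cintegrable !zext_restrict //.
by split=> -[h1 h2]; split; [apply/(integrable_mkcond _ mD)|apply/(integrable_mkcond _ mD)|
  apply/(integrable_mkcond _ mD)|apply/(integrable_mkcond _ mD)].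
Qed.

Lemma zext_cint n (F : n.-tuple (plane R) -> C) :
  cint (L n) (@pdisc n) F = cint (L n) setT (zext F).
Proof.
rewrite /cint /Rintegral; congr Complex; congr fine; rewrite [LHS]integral_mkcond.
  by congr (integral _ _ _); rewrite -(zext_restrict F (c := @complex.Re R)).
by congr (integral _ _ _); rewrite -(zext_restrict F (c := @complex.Im R)).
Qed.

Lemma cmeasurable_slice n (G : n.+1.-tuple (plane R) -> C) z :
  cmeasurable setT G -> cmeasurable setT (fun t => G (tuple_cons (z, t))).
Proof.
have mc : measurable_fun setT (fun t : n.-tuple (plane R) => tuple_cons (z, t)).
  exact: (measurableT_comp (@measurable_tuple_cons R n) (pair1_measurable z)).
by move=> [mR mI]; split; [exact: (measurableT_comp mR mc)|exact: (measurableT_comp mI mc)].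
Qed.

(** Fubini's theorem and the reproducing property of the disc in the first
    variable. The factor [h] collects the kernels in the other variables. *)
Lemma slice_repro n (F : n.+1.-tuple (plane R) -> C) (a : plane R)
    (h : n.-tuple (plane R) -> C) (B : R) :
  disc a -> cintegrable (L n.+1) (@pdisc n.+1) F -> sephol F ->
  cmeasurable (@pdisc n) h -> (forall t, pdisc t -> cabs (h t) <= B) ->
  cintegrable (L n) (@pdisc n) (fun t => disc_area * (F (tuple_cons (a, t)) * h t)) /\
  cint (L n.+1) (@pdisc n.+1)
    (fun t => F t * bkernel (cp a) (lam t ord0) * h [tuple of behead t]) =
  cint (L n) (@pdisc n) (fun t => disc_area * (F (tuple_cons (a, t)) * h t)).
Proof.
move=> a1 iF hF mh hB; have mD1 := @measurable_pdisc n.+1; have mD := @measurable_pdisc n.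
pose G (t : n.+1.-tuple (plane R)) := F t * bkernel (cp a) (lam t ord0) * h [tuple of behead t].
pose Phi (t : n.-tuple (plane R)) := disc_area * (F (tuple_cons (a, t)) * h t) : C.
have behead_cons z t : [tuple of behead (@tuple_cons R n (z, t))] = t by exact: val_inj.
have tail_in (t : n.+1.-tuple (plane R)) : pdisc t -> pdisc ([tuple of behead t] : n.-tuple (plane R)).
  by move=> Ht i; have := Ht (lift ord0 i); rewrite /lam [t in X in X -> _]tuple_eta tnthS.
have mh' : cmeasurable (@pdisc n.+1) (fun t => h [tuple of behead t]).
  have [mR mI] := zext_cmeasurable mh.
  have mb := @measurable_behead _ (plane R) n.
  have E (c : C -> R) (t : n.+1.-tuple (plane R)) : pdisc t -> c (h [tuple of behead t]) = c (zext h [tuple of behead t]).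
    by move=> /tail_in Ht; rewrite /zext mem_set.
  split.
    apply: (eq_measurable_fun (fun t : n.+1.-tuple (plane R) => complex.Re (zext h [tuple of behead t]))).
      by move=> t /set_mem Ht; rewrite (E (@complex.Re R)).
    by apply: measurable_funTS; exact: (measurableT_comp mR mb).
  apply: (eq_measurable_fun (fun t : n.+1.-tuple (plane R) => complex.Im (zext h [tuple of behead t]))).
    by move=> t /set_mem Ht; rewrite (E (@complex.Im R)).
  by apply: measurable_funTS; exact: (measurableT_comp mI mb).
have mk : cmeasurable (@pdisc n.+1) (fun t => bkernel (cp a) (lam t ord0)).
  have [mR mI] := bkernel_measurable a1.
  have m0 : measurable_fun (@pdisc n.+1) (fun t => tnth t ord0).
    by apply: measurable_funTS; exact: measurable_tnth.
  have sub : (fun t => tnth t ord0) @` @pdisc n.+1 `<=` @disc R.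
    by move=> _ [t Ht <-]; exact: (Ht ord0).
  by split; [exact: (measurable_comp (@measurable_disc R) sub mR m0)
    |exact: (measurable_comp (@measurable_disc R) sub mI m0)].
have iFk : cintegrable (L n.+1) (@pdisc n.+1) (fun t => F t * bkernel (cp a) (lam t ord0)).
  apply: (cintegrableM_bounded mD1 iF mk (K := (1 - cabs (cp a))^-1 ^+ 2)).
  by move=> t Ht; apply: bkernel_bounded => //; exact: Ht.
have iG : cintegrable (L n.+1) (@pdisc n.+1) G.
  by apply: (cintegrableM_bounded mD1 iFk mh' (K := B)) => t /tail_in; exact: hB.
move/zext_integrable: (iG) => [iGR iGI]; move/zext_integrable: (iF) => [iFR iFI].
have mF := zext_cmeasurable (cintegrable_measurable iF).
have mPhi : cmeasurable setT (zext Phi).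
  apply: zext_cmeasurable.
  apply: (cmeasurableM (cmeasurable_cst (@pdisc n) disc_area)).
  apply: (cmeasurableM _ mh); have [mR mI] := cmeasurable_slice a mF.
  have E (c : C -> R) t : pdisc t -> c (F (tuple_cons (a, t))) = c (zext F (tuple_cons (a, t))).
    by move=> Ht; rewrite /zext mem_set //; apply/pdisc_cons.
  split.
    apply: (eq_measurable_fun (fun t => complex.Re (zext F (tuple_cons (a, t))))).
      by move=> t /set_mem Ht; rewrite (E (@complex.Re R)).
    exact: measurable_funTS.
  apply: (eq_measurable_fun (fun t => complex.Im (zext F (tuple_cons (a, t))))).
    by move=> t /set_mem Ht; rewrite (E (@complex.Im R)).
  exact: measurable_funTS.
have [iGR' EGR] := integral_tuple_cons iGR; have [iGI' EGI] := integral_tuple_cons iGI.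
have [iFR' _] := integral_tuple_cons iFR; have [iFI' _] := integral_tuple_cons iFI.
move: iGR' EGR iGI' EGI iFR' iFI'; have [m mE] := @mu2_sigma_finite R; rewrite mE.
move=> iGR' EGR iGI' EGI iFR' iFI'.
have aeF : {ae L n, forall t, cintegrable mu2 setT (fun z => zext F (tuple_cons (z, t)))}.
  apply: filterS2 (ae_slices iFR') (ae_slices iFI') => t h1 h2.
  by split; [move: h1|move: h2]; rewrite -mE; exact.
have aeG : {ae L n, forall t, cintegrable mu2 setT (fun z => zext G (tuple_cons (z, t)))}.
  apply: filterS2 (ae_slices iGR') (ae_slices iGI') => t h1 h2.
  by split; [move: h1|move: h2]; rewrite -mE; exact.
have inner : {ae L n, forall t, cint mu2 setT (fun z => zext G (tuple_cons (z, t))) = zext Phi t}.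
  apply: filterS aeF => t iFt.
  case: (pselect (pdisc t)) => tD; last first.
    have ntD : (t \in @pdisc n) = false by apply/negbTE/negP => /set_mem.
    rewrite /zext ntD; transitivity (cint mu2 setT (fun _ : plane R => (0 : C))).
      apply: eq_cint => z _; case: ifP => // /set_mem /pdisc_cons[_]; by [].
    by apply: eq_ReIm; rewrite /cint /=; exact: Rintegral0_eq.
  have Ez z f : zext f (tuple_cons (z, t)) = if z \in @disc R then f (tuple_cons (z, t)) else 0.
    rewrite /zext; case: (boolP (z \in _)) => zD.
      by rewrite mem_set //; apply/pdisc_cons; split => //; exact: set_mem.
    by case: ifP => // /set_mem /pdisc_cons[zd _]; rewrite (mem_set zd) in zD.
  have EF : cintegrable mu2 (@disc R) (fun z => F (tuple_cons (z, t))).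
    have [h1 h2] := iFt; have mdd := @measurable_disc R; split; apply/(integrable_mkcond _ mdd).
      move: h1; congr integrable; apply/funext => z; rewrite patchE /= Ez; by case: ifP.
    move: h2; congr integrable; apply/funext => z; rewrite patchE /= Ez; by case: ifP.
  have := @bergman_disc R (cp a) (fun w => F (tuple_cons (pc w, t))) a1 _ _.
  have -> : (fun p => F (tuple_cons (pc (cp p), t))) = (fun p => F (tuple_cons (p, t))).
    by apply/funext => p; rewrite pcK.
  have hol z : cabs z < 1 -> exists l, cdiff (fun w => F (tuple_cons (pc w, t))) z l.
    move=> z1; have aD : pdisc (tuple_cons (a, t)) by apply/pdisc_cons.
    have [l Hl] := hF _ ord0 aD z z1; exists l; move: Hl.
    by under eq_fun do rewrite tset_cons0.
  move=> /(_ hol EF) Hb.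
  have -> : cint mu2 setT (fun z => zext G (tuple_cons (z, t))) =
      cint mu2 (@disc R) (fun z => h t * (F (tuple_cons (z, t)) * bkernel (cp a) (cp z))).
    rewrite (cint_mkcond _ (@measurable_disc R)); apply: eq_cint => z _; rewrite Ez.
    by case: ifP => // _; rewrite /G behead_cons mulrC.
  have iFb : cintegrable mu2 (@disc R) (fun z => F (tuple_cons (z, t)) * bkernel (cp a) (cp z)).
    apply: (cintegrableM_bounded (@measurable_disc R) EF (bkernel_measurable a1) (K := (1 - cabs (cp a))^-1 ^+ 2)).
    by move=> z zd; exact: bkernel_bounded.
  rewrite (cintZ (@measurable_disc R) _ iFb).
  have -> : cint mu2 (@disc R) (fun z => F (tuple_cons (z, t)) * bkernel (cp a) (cp z)) =
     F (tuple_cons (a, t)) * disc_area.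
    by rewrite -[a in RHS]pcK -Hb; apply: eq_cint => z _; rewrite pcK.
  by rewrite /zext mem_set // /Phi; ring.
have innerR : {ae L n, forall t, (\int[m]_z (EFin \o (fun t => complex.Re (zext G t)) \o (@tuple_cons R n)) (z, t) =
    (complex.Re (zext Phi t))%:E)%E}.
  apply: filterS2 aeG inner => t [h1 _] H.
  have fin : (\int[mu2]_z (complex.Re (zext G (tuple_cons (z, t))))%:E)%E \is a fin_num.
    by apply: integrable_fin_num => //; exact: h1.
  by rewrite -mE -H; exact: (esym (fineK fin)).
have innerI : {ae L n, forall t, (\int[m]_z (EFin \o (fun t => complex.Im (zext G t)) \o (@tuple_cons R n)) (z, t) =
    (complex.Im (zext Phi t))%:E)%E}.
  apply: filterS2 aeG inner => t [_ h1] H.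
  have fin : (\int[mu2]_z (complex.Im (zext G (tuple_cons (z, t))))%:E)%E \is a fin_num.
    by apply: integrable_fin_num => //; exact: h1.
  by rewrite -mE -H; exact: (esym (fineK fin)).
have [mPR mPI] := mPhi.
have [r1 r2] := fubini_slice iGR' mPR innerR; have [s1 s2] := fubini_slice iGI' mPI innerI.
split; first by apply/zext_integrable.
rewrite !zext_cint /cint /Rintegral; congr Complex; congr fine.
  exact: (etrans EGR r2).
exact: (etrans EGI s2).
Qed.

Lemma cint0_tuple (f : 0.-tuple (plane R) -> C) t : cint (L 0) (@pdisc 0) f = f t.
Proof.
have D : @pdisc 0 = setT by apply/seteqP; split=> // t' _ [].
have E (g : 0.-tuple (plane R) -> R) : (\int[L 0]_t g t)%R = g t.
  rewrite /Rintegral (@eq_integral _ _ _ _ _ (cst (g t)%:E)); last first.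
    by move=> t' _; rewrite (tuple0 t') (tuple0 t).
  have L1 : L 0 [set: 0.-tuple (plane R)] = 1%E by exact: diracT.
  by rewrite integral_cst //; apply: (etrans (congr1 fine (congr1 (mule _) L1))); rewrite mule1.
by rewrite D; apply: eq_ReIm; rewrite /cint /= E.
Qed.

(** One variable at a time, by [slice_repro]. *)
Lemma bergman_polydisc n (F : n.-tuple (plane R) -> C) (a : n.-tuple (plane R)) :
  pdisc a -> cintegrable (L n) (@pdisc n) F -> sephol F ->
  cint (L n) (@pdisc n) (fun t => F t * \prod_j bkernel (lam a j) (lam t j)) =
  F a * disc_area ^+ n.
Proof.
elim: n F a => [|n IH] F a pa iF hF.
  by rewrite (cint0_tuple _ a) big_ord0 expr0.
case/tupleP: a pa => a0 a pa; have {}pa : pdisc (tuple_cons (a0, a)) by [].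
have [pa0 pa'] := iffLR (pdisc_cons _ _) pa.
have mD := @measurable_pdisc n.
have k1 := slice_repro (h := fun=> 1) (B := 1) pa0 iF hF (cmeasurable_cst _ 1) _.
have {k1} [k1 _] : cintegrable (L n) (@pdisc n) (fun t => disc_area * (F (tuple_cons (a0, t)) * 1)) /\ True.
  by split=> //; apply: (proj1 (k1 _)) => t _; rewrite cabs1.
have mk j : cmeasurable (@pdisc n) (fun t => bkernel (lam a j) (lam t j)).
  have [mR mI] := bkernel_measurable (pa' j).
  have m0 : measurable_fun (@pdisc n) (fun t => tnth t j).
    by apply: measurable_funTS; exact: measurable_tnth.
  have sub : (fun t => tnth t j) @` @pdisc n `<=` @disc R.
    by move=> _ [t Ht <-]; exact: (Ht j).
  by split; [exact: (measurable_comp (@measurable_disc R) sub mR m0)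
    |exact: (measurable_comp (@measurable_disc R) sub mI m0)].
pose h (t : n.-tuple (plane R)) := \prod_j bkernel (lam a j) (lam t j).
have mh : cmeasurable (@pdisc n) h by apply: cmeasurable_prod => // j _; exact: mk.
have hB t : pdisc t -> cabs (h t) <= \prod_j (1 - cabs (lam a j))^-1 ^+ 2.
  move=> tD; rewrite /h; elim/big_rec2: _ => [|j x y _ H]; first by rewrite cabs1.
  by rewrite cabsM ler_pM // bkernel_bounded.
have A0 : disc_area != 0 :> C.
  have := @cint_bkernel R 0; rewrite cabs0 => /(_ ltr01) _.
  exact: disc_area_neq0.
have [k2 E2] := slice_repro pa0 iF hF mh hB.
transitivity (cint (L n.+1) (@pdisc n.+1)
    (fun t => F t * bkernel (cp a0) (lam t ord0) * h [tuple of behead t])).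
  apply: eq_cint => t _; rewrite -mulrA; congr (_ * _); rewrite big_ord_recl; congr (_ * _).
  apply: eq_bigr => j _; rewrite [in LHS](tuple_eta t) /lam !tnthS /=.
  by congr (bkernel (cp _) (cp (tnth _ _))); apply: val_inj.
have iFa : cintegrable (L n) (@pdisc n) (fun t => F (tuple_cons (a0, t))).
  have := cintegrableZ mD (disc_area^-1) k1; congr cintegrable.
  by apply/funext => t; rewrite mulKf // mulr1.
have hFa : sephol (fun t => F (tuple_cons (a0, t))).
  move=> t j tD z z1; have tD' : pdisc (tuple_cons (a0, t)) by apply/pdisc_cons.
  have [l Hl] := hF _ (lift ord0 j) tD' z z1; exists l; move: Hl.
  by under eq_fun do rewrite tset_consS.
rewrite E2 (cintZ mD disc_area); last first.
  exact: (cintegrableM_bounded mD iFa mh hB).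
by rewrite (IH _ a pa' iFa hFa) exprS; ring.
Qed.

End Polydisc.

(** * The symmetrized polydisc as a measurable set *)

Section Domain.
Context {R : realType} (n : nat).
Local Notation C := R[i].
Local Notation L n := (@lebesgue_Cn R n).
Local Notation K := ('I_n * bool)%type.
Local Notation T := (n.-tuple (plane R)).
Local Notation Gn := (symmetrized_polydisc R n).
Local Hint Extern 0 (is_true (0 <= cabs _)) => (exact: cabs_ge0) : core.
Implicit Types (t : T) (z w : 'rV[C]_n).

Lemma vpol_coef (y : 'I_n -> C) m : (vpol y)`_m =
  \sum_(J : {set 'I_n} | #|J| == m) \prod_(i in ~: J) y i.
Proof.
rewrite /vpol (@bigA_distr _ _ _ _ _ _ (fun=> 'X) (fun i => (y i)%:P)) /= coef_sum.
rewrite [RHS]big_mkcond /=; apply: eq_bigr => J _.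
have -> : \prod_i (if i \in J then 'X else (y i)%:P) = 'X^#|J| * (\prod_(i in ~: J) y i)%:P.
  rewrite (bigID (mem J)) /=; congr (_ * _).
    by rewrite (eq_bigr (fun=> 'X)) ?prodr_const // => i ->.
  rewrite rmorph_prod; apply: eq_big => [i|i /negbTE ->] //; by rewrite inE.
by rewrite mulrC coefCM coefXn eq_sym; case: eqP => _; rewrite ?mulr1 ?mulr0.
Qed.

Lemma elementary_symmetricE (y : 'rV[C]_n) (k : 'I_n) :
  elementary_symmetric y k.+1 = (vpol (y ord0))`_(rev_ord k).
Proof.
rewrite vpol_coef /elementary_symmetric (reindex_inj (@finset.setC_inj 'I_n)) /=.
apply: eq_bigl => J; have := cardsC J; rewrite card_ord => H.
by have := ltn_ord k; move: H; rewrite /=; move: #|J| #|~: J| => a b; case: eqP; case: eqP; lia.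
Qed.

Lemma Cn_of_tupleE t j : Cn_of_tuple t ord0 j = lam t j.
Proof. by rewrite mxE. Qed.

Lemma symm_coef (y : 'rV[C]_n) k : symmetrization y ord0 k = (vpol (y ord0))`_(rev_ord k).
Proof. by rewrite mxE elementary_symmetricE. Qed.

Lemma vpol_ext (y y' : 'I_n -> C) : y =1 y' -> vpol y = vpol y'.
Proof. by move=> E; apply: eq_bigr => l _; rewrite E. Qed.

Lemma symm_sig t : symmetrization (Cn_of_tuple t) = Cn_of_tuple (sig t).
Proof.
apply/rowP => k; rewrite symm_coef Cn_of_tupleE /lam tnth_mktuple cpK /sco.
by rewrite (@vpol_ext _ (lam t)) // => j; exact: Cn_of_tupleE.
Qed.

Lemma vpol_monic_size (y : 'I_n -> C) : vpol y \is monic /\ size (vpol y) = n.+1.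
Proof.
split; first by apply: monic_prod => l _; rewrite -[(y l)%:P]opprK -polyCN; exact: monicXsubC.
rewrite /vpol (eq_bigr (fun l => 'X - (- y l)%:P)); last by move=> l _; rewrite polyCN opprK.
by rewrite size_prod_XsubC -sum1_size big_const_ord iter_addn_0 mul1n.
Qed.

(** A point of the target is the coefficient vector of a monic polynomial. *)
Definition qpol z : {poly C} := 'X^n + \sum_(k < n) z ord0 k *: 'X^(rev_ord k).

Lemma qpol_coef z (m : 'I_n) : (qpol z)`_m = z ord0 (rev_ord m).
Proof.
rewrite coefD coefXn ltn_eqF // add0r coef_sum (bigD1 (rev_ord m)) // big1 ?addr0.
  transitivity ((z ord0 (rev_ord m) *: 'X^(rev_ord (rev_ord m)))`_m); first exact: addr0.
  by rewrite coefZ coefXn rev_ordK eqxx mulr1.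
move=> k km; rewrite coefZ coefXn; case: eqP => [E|_]; last by rewrite mulr0.
by case/eqP: km; rewrite -[k]rev_ordK; congr rev_ord; exact: val_inj.
Qed.

Lemma qpol_size z : size (qpol z) = n.+1.
Proof.
rewrite size_polyDl size_polyXn // ltnS; apply: (leq_trans (size_sum _ _ _)).
apply/bigmax_leqP => k _; apply: leq_trans (size_scale_leq _ _) _.
by rewrite size_polyXn.
Qed.

Lemma qpol_lead z : (qpol z)`_n = 1.
Proof.
rewrite coefD coefXn eqxx coef_sum big1 ?addr0 // => k _.
by rewrite coefZ coefXn gtn_eqF ?mulr0 // (leq_trans (ltn_ord (rev_ord k))).
Qed.

Lemma qpol_symm (y : 'rV[C]_n) : qpol (symmetrization y) = vpol (y ord0).
Proof.
have [vm vs] := vpol_monic_size (y ord0).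
apply/polyP => m; have [mn|nm|->] := ltngtP m n.
- by rewrite -[m]/(nat_of_ord (Ordinal mn)) qpol_coef symm_coef rev_ordK.
- by rewrite !nth_default // ?vs ?qpol_size.
- by rewrite qpol_lead; move/monicP: vm; rewrite lead_coefE vs.
Qed.

Lemma symm_inj_qpol z w : qpol z = qpol w -> z = w.
Proof.
move=> E; apply/rowP => k; have := congr1 (fun p : {poly C} => p`_(rev_ord k)) E.
by rewrite !qpol_coef rev_ordK.
Qed.

Lemma symm_surj z : exists y : 'rV[C]_n, symmetrization y = z.
Proof.
have [r rE] := closed_field_poly_normal (qpol z).
have l1 : lead_coef (qpol z) = 1 by rewrite lead_coefE qpol_size qpol_lead.
rewrite l1 scale1r in rE.
have sr : size r = n by have := congr1 (fun p : {poly C} => size p) rE; rewrite qpol_size size_prod_XsubC => -[].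
exists (\row_j - r`_j); apply: symm_inj_qpol; rewrite qpol_symm rE /vpol.
rewrite (big_nth 0) big_mkord sr; apply: eq_bigr => j _.
by rewrite mxE polyCN.
Qed.

Lemma polydiscP (y : 'rV[C]_n) : polydisc y <-> forall j, cabs (y ord0 j) < 1.
Proof. by split=> H j; have := H j; rewrite cabs_lt1. Qed.

Lemma symm_polydisc (y : 'rV[C]_n) : Gn (symmetrization y) <-> polydisc y.
Proof.
split=> [[y' y'1 E]|]; last by exists y.
have Eq := congr1 qpol E; rewrite !qpol_symm in Eq.
apply/polydiscP => j; have : (vpol (y ord0)).[- y ord0 j] = 0.
  by rewrite (vpolE _ j) hornerM !(hornerD, hornerX, hornerC) addNr mul0r.
rewrite -Eq /vpol horner_prod => /eqP /prodf_eq0[l _].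
rewrite !(hornerD, hornerX, hornerC) addrC subr_eq0 => /eqP <-.
by have /polydiscP := y'1; exact.
Qed.

Definition DG : set T := @Cn_of_tuple R n @^-1` Gn.

(** A point of the symmetrized polydisc has no preimages outside the
    polydisc: the entries of a preimage are determined up to order. *)
Lemma DG_sig t : DG (sig t) <-> pdisc t.
Proof.
rewrite /DG /= -symm_sig symm_polydisc polydiscP.
by split=> H j; have := H j; rewrite Cn_of_tupleE.
Qed.

Lemma qpol_horner z x : (qpol z).[x] = x ^+ n + \sum_(k < n) z ord0 k * x ^+ (rev_ord k).
Proof.
rewrite hornerD hornerXn horner_sum; congr (_ + _); apply: eq_bigr => k _.
by rewrite hornerZ hornerXn.
Qed.

Lemma nice_qpol x : nice (fun t : T => (qpol (Cn_of_tuple t)).[x]).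
Proof.
under eq_fun do rewrite qpol_horner; apply: niceD; first exact: nice_cst.
apply: nice_sum => k _; apply: niceM; last exact: nice_cst.
under eq_fun do rewrite Cn_of_tupleE; exact: nice_lam.
Qed.

Definition qpt (q : rat * rat) : C := (ratr q.1 +i* ratr q.2)%C.

(** All roots of a polynomial lie in the open disc if and only if it is
    bounded away from zero outside the closed disc. By continuity it suffices to
    look at points with rational coordinates, so the condition is countable. *)
Lemma DG_char t : DG t <-> exists m : nat, forall q : rat * rat,
  1 < cabs (qpt q) ->
  m.+1%:R^-1 <= cabs (qpol (Cn_of_tuple t)).[(qpt q)].
Proof.
have [y yE] := symm_surj (Cn_of_tuple t); rewrite /DG /= -yE symm_polydisc polydiscP.
have hE x : (qpol (symmetrization y)).[x] = \prod_l (x + y ord0 l).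
  rewrite qpol_symm horner_prod; apply: eq_bigr => l _.
  by rewrite !(hornerD, hornerX, hornerC).
split=> [y1|[m Hm] j].
  have p0 : 0 < \prod_l (1 - cabs (y ord0 l)) by apply: prodr_gt0 => l _; rewrite subr_gt0.
  have [m Hm] := inv_approx p0; exists m => q q1; apply: le_trans (ltW Hm) _.
  rewrite hE (big_morph _ (@cabsM R) (@cabs1 R)); apply: ler_prod => l _.
  rewrite subr_ge0 (ltW (y1 l)) /=; move: (qpt q) q1 => x x1.
  have := cabsD (x + y ord0 l) (- y ord0 l); rewrite addrK cabsN.
  by move: (cabs _) (cabs _) (cabs _) x1 => u v w; lra.
rewrite ltNge; apply/negP => yj1; pose al := - y ord0 j.
have al1 : 1 <= cabs al by rewrite cabsN.
have r0 : (qpol (symmetrization y)).[al] = 0 by rewrite hE (bigD1 j) //= addNr mul0r.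
have m0 : 0 < (m.+1%:R^-1 : R) by rewrite invr_gt0.
have [d d0 Hd] := wirt_cont (cdiff_poly (qpol (symmetrization y)) al) m0.
pose tau := d / (4 * cabs al).
have ca0 : 0 < cabs al by exact: lt_le_trans al1.
have tau0 : 0 < tau by rewrite divr_gt0 // mulr_gt0.
pose al' := (1 + tau)%:C * al.
have cal' : cabs al' = cabs al + d / 4.
  rewrite /al' cabsM cabs_real gtr0_norm ?addr_gt0 // mulrDl mul1r /tau; congr (_ + _).
  by field; rewrite gt_eqF.
have dal : cabs (al' - al) = d / 4.
  have -> : al' - al = tau%:C * al by rewrite /al' (rmorphD (real_complex R)) /= mulrDl mul1r addrAC subrr add0r.
  by rewrite cabsM cabs_real gtr0_norm // /tau; field; rewrite gt_eqF.
have d8 : 0 < d / 8 by rewrite divr_gt0.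
have [q1 Hq1] := rat_approx (complex.Re al') d8; have [q2 Hq2] := rat_approx (complex.Im al') d8.
pose x : C := qpt (q1, q2).
have dx : cabs (x - al') < d / 4.
  apply: le_lt_trans (cabs_le_ReIm _) _; rewrite ReD ImD ReN ImN /= ![`|ratr _ - _|]distrC.
  by have := ltrD Hq1 Hq2; have -> : d / 8 + d / 8 = d / 4 by field.
have x1 : 1 < cabs x.
  have := cabsD x (al' - x); rewrite addrC subrK cabs_distC cal'.
  by move: dx al1; move: (cabs _) (cabs _) (cabs _) => u v w; lra.
have xd : cabs (x - al) < d.
  have := cabsD (x - al') (al' - al); rewrite addrA subrK dal.
  by move: dx; move: (cabs _) (cabs _) => u v; lra.
have := Hm (q1, q2) x1; have := Hd x xd; rewrite r0 subr0 -/x => h1 h2.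
by have := lt_le_trans h1 h2; rewrite ltxx.
Qed.

Lemma measurable_DG : measurable DG.
Proof.
pose Fm (m : nat) (q : rat * rat) : set T := [set t | 1 < cabs (qpt q) ->
  m.+1%:R^-1 <= cabs (qpol (Cn_of_tuple t)).[(qpt q)]].
have mF m q : measurable (Fm m q).
  have [mq _ _] := nice_qpol (qpt q).
  case: (boolP (1 < cabs (qpt q))) => q1; last first.
    rewrite (_ : Fm m q = setT) //; apply/seteqP; split=> // t _ /=.
    by rewrite /Fm /= (negbTE q1).
  have := measurable_cabs mq measurableT (measurable_itv `[m.+1%:R^-1, +oo[).
  rewrite setTI; congr measurable; apply/seteqP; split=> t /=; rewrite in_itv /= andbT.
    by move=> H _.
  by move=> H; exact: (H q1).
have -> : DG = \bigcup_m \bigcap_(q in [set: rat * rat]) Fm m q.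
  apply/seteqP; split=> t; first by move=> /DG_char[m Hm]; exists m => // q _; exact: Hm.
  by move=> [m _ Hm]; apply/DG_char; exists m => q; exact: (Hm q I).
apply: bigcupT_measurable => m.
have -> : \bigcap_(q in [set: rat * rat]) Fm m q =
    ~` \bigcup_(q in [set: rat * rat]) ~` Fm m q.
  by rewrite setC_bigcup; apply: eq_bigcapr => q _; rewrite setCK.
apply: measurableC; apply: (@countable_cover_measurable _ _ (rat * rat)%type (fun q => ~` Fm m q)).
  by move=> q; apply: measurableC.
by move=> t [q _ tq]; exists q; split=> // t' tq'; exists q.
Qed.

(** Around points of the domain the preimage of an open set contains
    rational boxes; their union meets the domain in exactly this preimage. *)
Lemma measurable_on_DG (g : T -> R) :
  (forall t, DG t -> forall e, 0 < e -> exists2 d, 0 < d & forall t',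
     (forall j, cabs (lam t' j - lam t j) < d) -> `|g t' - g t| < e) ->
  measurable_fun DG g.
Proof.
move=> cg; apply: measurable_open_preimage; first exact: measurable_DG.
move=> U oU.
pose I0 := {ffun K -> rat * rat}.
pose B (i : I0) := obox (fun x => ratr (i x).1) (fun x => ratr (i x).2) : set T.
pose B' (i : I0) := if `[< B i `<=` g @^-1` U >] then B i else set0.
pose O := \bigcup_(i in [set i : I0 | B i `<=` g @^-1` U]) B i.
have -> : DG `&` g @^-1` U = DG `&` O; last first.
  apply: measurableI; first exact: measurable_DG.
  apply: (@countable_cover_measurable _ _ I0 B').
    by move=> i; rewrite /B'; case: asboolP => _; [exact: measurable_obox|exact: measurable0].
  move=> t' [i iU Bi]; exists i; rewrite /B'; case: asboolP => // _; split=> // s' Bs.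
  by exists i.
apply/seteqP; split=> t [tD]; last by move=> [i iU iB]; split=> //; exact: iU.
move=> gU; split=> //.
have [e e0 He] : exists2 e, 0 < e & forall y, `|y - g t| < e -> U y.
  have := oU (g t) gU; rewrite -nbhs_ballE => -[e e0 He]; exists e => // y ye.
  by apply: He; rewrite /ball /= distrC.
have [d d0 Hd] := cg t tD e e0.
have d4 : 0 < d / 4 by rewrite divr_gt0.
pose lo (x : K) := xget (0%R : rat) [set q : rat | rcoord x t - d / 2 < ratr q < rcoord x t].
pose hi (x : K) := xget (0%R : rat) [set q : rat | rcoord x t < ratr q < rcoord x t + d / 2].
have Plo x : rcoord x t - d / 2 < ratr (lo x) < rcoord x t.
  rewrite /lo; case: xgetP => [q -> //|/(_ _)] H; exfalso.
  have [q Hq] := rat_approx (rcoord x t - d / 4) d4; apply: (H q) => /=.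
  by move: Hq; rewrite ltr_norml => /andP[? ?]; apply/andP; split; lra.
have Phi x : rcoord x t < ratr (hi x) < rcoord x t + d / 2.
  rewrite /hi; case: xgetP => [q -> //|/(_ _)] H; exfalso.
  have [q Hq] := rat_approx (rcoord x t + d / 4) d4; apply: (H q) => /=.
  by move: Hq; rewrite ltr_norml => /andP[? ?]; apply/andP; split; lra.
exists [ffun x => (lo x, hi x)]; last first.
  by move=> x; rewrite ffunE /=; have /andP[_ ->] := Plo x; have /andP[-> _] := Phi x.
move=> t' Ht'; apply: He; apply: Hd => j; apply: le_lt_trans (cabs_le_ReIm _) _.
have c x : `|rcoord x t' - rcoord x t| < d / 2.
  have := Ht' x; rewrite ffunE /= => /andP[h1 h2].
  have /andP[h3 h4] := Plo x; have /andP[h5 h6] := Phi x.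
  by rewrite ltr_norml; apply/andP; split; lra.
rewrite ReD ImD ReN ImN [d]splitr; exact: ltrD (c (j, false)) (c (j, true)).
Qed.

Lemma DG_bounded : exists2 M, 0 < M & forall t, DG t -> forall j, cabs (lam t j) <= M.
Proof.
have [f Hf] := choice (fun k : 'I_n => let: And3 _ b _ := @nice_sco R n k in b 1).
exists (1 + \sum_k `|f k|) => [|t].
  by rewrite ltr_pwDl // sumr_ge0.
move=> tD j; have [y yE] := symm_surj (Cn_of_tuple t).
have yD : polydisc y by apply/symm_polydisc; rewrite yE.
pose ty : T := [tuple pc (y ord0 i) | i < n].
have ly i : lam ty i = y ord0 i by rewrite /lam tnth_mktuple cpK.
have -> : lam t j = sco (rev_ord j) ty.
  have E : vpol (lam ty) = vpol (y ord0) by apply: vpol_ext => i; rewrite ly.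
  by rewrite -Cn_of_tupleE -yE symm_coef /sco E.
apply: (@le_trans _ _ (f (rev_ord j))).
  by apply: Hf => i; rewrite ly; apply: ltW; have /polydiscP := yD; exact.
apply: le_trans (ler_norm _) _; rewrite (bigD1 (rev_ord j)) //= addrCA lerDl addr_ge0 //.
by rewrite sumr_ge0.
Qed.

Lemma DG_fin : (L n DG < +oo)%E.
Proof.
have [M M0 HM] := DG_bounded.
apply: (@le_lt_trans _ _ (L n [set t : T | forall i, box (0, 0)%R (M + 1)%R (tnth t i)])).
  apply: le_measure; rewrite ?inE //; [exact: measurable_DG|exact: measurable_lam_box|].
  move=> t /HM H i; have Hi : cabs (lam t i) < M + 1 by apply: le_lt_trans (H i) _; rewrite ltrDl.
  rewrite /box /= !subr0; split; first exact: le_lt_trans (abs_Re_le _) Hi.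
  exact: le_lt_trans (abs_Im_le _) Hi.
exact: lam_box_fin.
Qed.

End Domain.

(** * The kernel function and its holomorphy *)

Section Kernel.
Context {R : realType} (n : nat).
Local Notation C := R[i].
Local Notation T := (n.-tuple (plane R)).
Local Notation Gn := (symmetrized_polydisc R n).
Local Hint Extern 0 (is_true (0 <= cabs _)) => (exact: cabs_ge0) : core.
Implicit Types (t : T) (z w : 'rV[C]_n) (nu y : 'I_n -> C) (p : {poly C}).

Definition proots p : seq C := sval (closed_field_poly_normal p).

Lemma prootsE p : p = lead_coef p *: \prod_(a <- proots p) ('X - a%:P).
Proof. exact: svalP (closed_field_poly_normal p). Qed.

(** The product of the values of [p] at the entries of [y], as a function of
    the symmetrization [z] of [y]: a resultant. *)
Definition pnorm p z : C := lead_coef p ^+ n * \prod_(a <- proots p) (qpol z).[- a].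

Lemma pnormE p (y : 'rV[C]_n) : pnorm p (symmetrization y) = \prod_k p.[y ord0 k].
Proof.
have E x : p.[x] = lead_coef p * \prod_(a <- proots p) (x - a).
  rewrite {1}[p]prootsE hornerZ horner_prod; congr (_ * _); apply: eq_bigr => a _.
  by rewrite !hornerE.
under [RHS]eq_bigr do rewrite E.
rewrite big_split /= prodr_const card_ord exchange_big /=; congr (_ * _).
apply: eq_bigr => a _; rewrite qpol_symm horner_prod; apply: eq_bigr => k _.
by rewrite !(hornerD, hornerX, hornerC) addrC.
Qed.

Definition dpol nu : {poly C} := \prod_j (1 - nu j *: 'X).
(** The numerator of [\sum_(j in S) 1 / (1 - nu j * X)] over the common
    denominator [dpol nu]. *)
Definition apol nu (S : {set 'I_n}) : {poly C} :=
  \sum_(j in S) \prod_(i | i != j) (1 - nu i *: 'X).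

Lemma dpolE nu x : (dpol nu).[x] = \prod_j (1 - nu j * x).
Proof. by rewrite horner_prod; apply: eq_bigr => j _; rewrite !hornerE. Qed.

Lemma apolE nu (S : {set 'I_n}) x : (forall j, 1 - nu j * x != 0) ->
  \sum_(j in S) (1 - nu j * x)^-1 = (apol nu S).[x] / (dpol nu).[x].
Proof.
move=> nx; rewrite /apol horner_sum mulr_suml; apply: eq_bigr => j _.
have D : \prod_i (1 - nu i * x) = (1 - nu j * x) * \prod_(i | i != j) (1 - nu i * x).
  by rewrite (bigD1 j).
have N : (\prod_(i | i != j) (1 - nu i *: 'X)).[x] = \prod_(i | i != j) (1 - nu i * x).
  by rewrite horner_prod; apply: eq_bigr => i _; rewrite !hornerE.
have P0 : \prod_(i | i != j) (1 - nu i * x) != 0 by apply/prodf_neq0 => i _; exact: nx.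
rewrite dpolE D N; move: P0 (nx j); move: (\prod_(i | i != j) _) => P P0 nj.
by rewrite invfM mulrCA mulfV // mulr1.
Qed.

(** The kernel, up to a constant; [nu] is the conjugate of a preimage of the
    second point. *)
Definition sker nu z : C :=
  (\sum_(S : {set 'I_n}) (-1) ^+ #|finset.setC S| * pnorm (apol nu S) z) / pnorm (dpol nu) z ^+ 2.

(** The kernel in terms of a preimage [y] of its first argument. *)
Definition kerQ nu y : C :=
  permanent (\matrix_(k < n, j < n) (1 - nu j * y k)^-1) / \prod_j \prod_k (1 - nu j * y k).

Lemma disc_mul_neq0 (a b : C) : cabs a < 1 -> cabs b < 1 -> 1 - a * b != 0.
Proof.
move=> a1 b1; rewrite subr_eq0 eq_sym; apply/eqP => /(congr1 (@cabs R)).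
rewrite cabsM cabs1 => E; have := mulr_ilt1 (cabs_ge0 a) (cabs_ge0 b) a1 b1.
by rewrite E ltxx.
Qed.

(** Ryser's formula for the permanent in [kerQ]; every product over [k] that
    occurs in it is a [pnorm]. *)
Lemma skerE nu (y : 'rV[C]_n) : (forall j, cabs (nu j) < 1) -> (forall k, cabs (y ord0 k) < 1) ->
  sker nu (symmetrization y) = kerQ nu (y ord0).
Proof.
move=> nu1 y1; have nz j k : 1 - nu j * y ord0 k != 0 by exact: disc_mul_neq0.
have dn : \prod_k (dpol nu).[y ord0 k] != 0.
  by apply/prodf_neq0 => k _; rewrite dpolE; apply/prodf_neq0 => j _.
rewrite /sker /kerQ permanent_Ryser pnormE.
have -> : \prod_j \prod_k (1 - nu j * y ord0 k) = \prod_k (dpol nu).[y ord0 k].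
  by rewrite exchange_big; apply: eq_bigr => k _; rewrite dpolE.
have -> : \sum_(S : {set 'I_n}) (-1) ^+ #|finset.setC S| * pnorm (apol nu S) (symmetrization y) =
    (\sum_(S : {set 'I_n}) (-1) ^+ #|finset.setC S| *
      \prod_k \sum_(j in S) (\matrix_(k < n, j < n) (1 - nu j * y ord0 k)^-1) k j) *
    \prod_k (dpol nu).[y ord0 k].
  rewrite mulr_suml; apply: eq_bigr => S _; rewrite -mulrA pnormE; congr (_ * _).
  rewrite -big_split /=; apply: eq_bigr => k _.
  under eq_bigr do rewrite mxE.
  rewrite apolE // divfK // dpolE; apply/prodf_neq0 => j _; exact: nz.
by move: dn; move: (\prod_k _) (\sum_S _) => D N dn; field.
Qed.

Lemma pnorm_dpol_neq0 nu z : (forall j, cabs (nu j) < 1) -> Gn z -> pnorm (dpol nu) z != 0.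
Proof.
move=> nu1 [y yD <-]; rewrite pnormE; apply/prodf_neq0 => k _; rewrite dpolE.
apply/prodf_neq0 => j _; apply: disc_mul_neq0 => //; by move/polydiscP: yD.
Qed.

Lemma differentiable_qpol x z : differentiable (fun z : 'rV[C]_n => (qpol z).[x]) z.
Proof.
under eq_fun do rewrite qpol_horner.
apply: differentiableD; first exact: differentiable_cst.
have -> : (fun x0 : 'rV[C]_n => \sum_(k < n) x0 ord0 k * x ^+ rev_ord k) =
   \sum_(k < n) (fun x0 : 'rV[C]_n => x0 ord0 k * x ^+ rev_ord k).
  by apply/funext => v; rewrite fct_sumE.
apply: differentiable_sum => k.
apply: differentiableM; last exact: differentiable_cst.
exact: differentiable_coord.
Qed.

Lemma differentiable_pnorm p z : differentiable (pnorm p) z.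
Proof.
apply: differentiableM; first exact: differentiable_cst.
elim: (proots p) => [|a s IH].
  by under eq_fun do rewrite big_nil; exact: differentiable_cst.
under eq_fun do rewrite big_cons; apply: differentiableM => //; exact: differentiable_qpol.
Qed.

Lemma differentiable_sker nu z : (forall j, cabs (nu j) < 1) -> Gn z ->
  differentiable (sker nu) z.
Proof.
move=> nu1 zG; have nz := pnorm_dpol_neq0 nu1 zG.
apply: differentiableM.
  have -> : (fun x : 'rV[C]_n => \sum_(S : {set 'I_n}) (-1) ^+ #|finset.setC S| * pnorm (apol nu S) x) =
    \sum_(S : {set 'I_n}) (fun x => (-1) ^+ #|finset.setC S| * pnorm (apol nu S) x).
    by apply/funext => v; rewrite fct_sumE.
  elim: (index_enum _) => [|S s IH]; first by rewrite big_nil; exact: differentiable_cst.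
  rewrite big_cons; apply: differentiableD => //; apply: differentiableM; first exact: differentiable_cst.
  exact: differentiable_pnorm.
apply: differentiableV; last by rewrite expf_neq0.
under eq_fun do rewrite expr2.
by apply: differentiableM; exact: differentiable_pnorm.
Qed.

Lemma holo_continuous (f : 'rV[C]_n -> C) t : differentiable f (Cn_of_tuple t) ->
  forall e, 0 < e -> exists2 d, 0 < d & forall t',
    (forall j, cabs (lam t' j - lam t j) < d) -> cabs (f (Cn_of_tuple t') - f (Cn_of_tuple t)) < e.
Proof.
move=> /differentiable_continuous cf e e0.
have e0C : 0 < e%:C :> C by rewrite ltcR.
have /cvgrPdist_lt /(_ _ e0C) := cf; move=> /nbhs_ballP[d d0 Hd].
have dE : d = (cabs d)%:C by rewrite -normC_cabs gtr0_norm.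
exists (cabs d) => [|t' Ht]; first by rewrite cabs_gt0 gt_eqF.
have := Hd (Cn_of_tuple t'); rewrite distrC normC_cabs ltcR; apply.
split=> // i j; rewrite /ball /= !mxE distrC normC_cabs dE ltcR.
exact: Ht.
Qed.

Lemma holo_line (f : 'rV[C]_n -> C) (A B : 'rV[C]_n) (z : C) : differentiable f (A + z *: B) ->
  exists l, cdiff (fun u : C => f (A + u *: B)) z l.
Proof.
move=> /(@diff_derivable _ _ _ _ _ B) df; exists ('D_B f (A + z *: B)) => e e0.
have e0C : 0 < e%:C :> C by rewrite ltcR.
move: df => /cvg_ex[l Hl]; have El : 'D_B f (A + z *: B) = l by exact: cvg_lim Hl.
rewrite El; move/cvgrPdist_lt: Hl => /(_ _ e0C); rewrite /dnbhs /within /= => /nbhs_ballP[d d0 Hd].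
have dE : d = (cabs d)%:C by rewrite -normC_cabs gtr0_norm.
exists (cabs d) => [|u wz]; first by rewrite cabs_gt0 gt_eqF.
have [->|wz0] := eqVneq u z; first by rewrite !subrr conjC0 !mulr0 !subr0 cabs0 mulr0.
have wz0' : u - z != 0 by rewrite subr_eq0.
have := Hd (u - z); rewrite /ball /= sub0r normrN normC_cabs dE ltcR => /(_ wz wz0').
have -> : (u - z) *: B + (A + z *: B) = A + u *: B.
  by rewrite addrCA -scalerDl subrK.
rewrite normC_cabs ltcR => H.
have -> : f (A + u *: B) - f (A + z *: B) - l * (u - z) - 0 * (u - z)^* =
   - (u - z) * (l - (u - z)^-1 *: (f (A + u *: B) - f (A + z *: B))).
  by rewrite mul0r subr0 /GRing.scale /=; field.
by rewrite cabsM cabsN mulrC ler_wpM2r // ltW.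
Qed.

End Kernel.

(** * Change of variables for complex integrands *)

Section CovComplex.
Context {R : realType} (n : nat).
Local Notation C := R[i].
Local Notation L n := (@lebesgue_Cn R n).
Local Notation T := (n.-tuple (plane R)).
Local Hint Extern 0 (is_true (0 <= cabs _)) => (exact: cabs_ge0) : core.
Implicit Types (t : T).

Lemma cov_ge0 (p : T -> R) : (forall t, 0 <= p t) -> (L n).-integrable setT (EFin \o p) ->
  (L n).-integrable setT (EFin \o (fun t => p (sig t) * cabs (vdm (lam t)) ^+ 2)) /\
  (\int[L n]_t (p (sig t) * cabs (vdm (lam t)) ^+ 2) = kap n * \int[L n]_t p t)%R.
Proof.
move=> p0 ip; have mp : measurable_fun setT (EFin \o p) by case/integrableP: ip.
have E : (\int[L n]_t ((p (sig t))%:E * jac t) = (kap n)%:E * \int[L n]_t (p t)%:E)%E.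
  by apply: (sig_integral mp) => t; rewrite lee_fin.
have fin : (\int[L n]_t (p t)%:E)%E \is a fin_num by exact: integrable_fin_num ip.
have EE : (\int[L n]_t (p (sig t) * cabs (vdm (lam t)) ^+ 2)%:E)%E =
    (kap n * fine (\int[L n]_t (p t)%:E)%E)%:E.
  transitivity (\int[L n]_t ((p (sig t))%:E * jac t))%E.
    by apply: eq_integral => t _; rewrite EFinM.
  by rewrite EFinM (fineK fin) -E.
split; last by rewrite /Rintegral EE.
have mps : measurable_fun setT (fun t => p (sig t) * cabs (vdm (lam t)) ^+ 2).
  apply: measurable_funM; last by have /measurable_EFinP := @measurable_jac R n.
  by apply: (measurableT_comp _ (@measurable_sig R n)); exact/measurable_EFinP.
apply/integrableP; split; first exact/measurable_EFinP.
rewrite (eq_integral (fun t => (p (sig t) * cabs (vdm (lam t)) ^+ 2)%:E)) ?EE ?ltry // => t _.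
by rewrite /= ger0_norm // mulr_ge0 // exprn_ge0.
Qed.

(** The change of variables for nonnegative functions, applied to
    [|h| + h] and [|h|]. *)
Lemma cov_real (h : T -> R) : (L n).-integrable setT (EFin \o h) ->
  (L n).-integrable setT (EFin \o (fun t => h (sig t) * cabs (vdm (lam t)) ^+ 2)) /\
  (\int[L n]_t (h (sig t) * cabs (vdm (lam t)) ^+ 2) = kap n * \int[L n]_t h t)%R.
Proof.
move=> ih; have ia : (L n).-integrable setT (EFin \o (fun t => `|h t|)).
  by have := integrable_abse ih; congr integrable.
have is1 : (L n).-integrable setT (EFin \o (fun t => `|h t| + h t)).
  exact: (integrableD measurableT ia ih).
have s0 t : 0 <= `|h t| + h t by have := ler_norm (- h t); rewrite normrN; lra.
have [i1 e1] := cov_ge0 s0 is1; have [i2 e2] := cov_ge0 (fun t => normr_ge0 (h t)) ia.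
have E t : h (sig t) * cabs (vdm (lam t)) ^+ 2 =
    (`|h (sig t)| + h (sig t)) * cabs (vdm (lam t)) ^+ 2 - `|h (sig t)| * cabs (vdm (lam t)) ^+ 2 by ring.
split.
  have := integrableB measurableT i1 i2; congr integrable.
  by apply/funext => t; rewrite /= -EFinB -E.
transitivity (\int[L n]_t ((`|h (sig t)| + h (sig t)) * cabs (vdm (lam t)) ^+ 2 -
    `|h (sig t)| * cabs (vdm (lam t)) ^+ 2))%R.
  by apply: eq_Rintegral => t _; exact: E.
rewrite RintegralB // e1 e2 -mulrBr; congr (_ * _).
rewrite -RintegralB //; apply: eq_Rintegral => t _; by rewrite addrAC subrr add0r.
Qed.

Definition gext (F : T -> C) t : C := if t \in @DG R n then F t else 0.

Lemma gext_restrict (F : T -> C) (c : C -> R) : c 0 = 0 ->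
  (EFin \o (fun t => c (gext F t))) = (EFin \o (fun t => c (F t))) \_ (@DG R n).
Proof. by move=> c0; apply/funext => t; rewrite /gext patchE /=; case: ifP => //; rewrite c0. Qed.

Lemma gext_sig (F : T -> C) t : gext F (sig t) = zext (fun t => F (sig t)) t.
Proof.
rewrite /gext /zext; have -> // : (sig t \in @DG R n) = (t \in @pdisc R n).
by apply/idP/idP => /set_mem H; apply/mem_set; apply/DG_sig.
Qed.

Lemma cov_cint (phi : T -> C) : cintegrable (L n) (@DG R n) phi ->
  cintegrable (L n) (@pdisc R n) (fun t => phi (sig t) * dens t) /\
  cint (L n) (@pdisc R n) (fun t => phi (sig t) * dens t) = (kap n)%:C * cint (L n) (@DG R n) phi.
Proof.
have mD := @measurable_DG R n; move=> [iR iI].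
have {}iR : (L n).-integrable setT (EFin \o (fun t => complex.Re (gext phi t))).
  by rewrite gext_restrict //; apply/(integrable_mkcond _ mD).
have {}iI : (L n).-integrable setT (EFin \o (fun t => complex.Im (gext phi t))).
  by rewrite gext_restrict //; apply/(integrable_mkcond _ mD).
have [jR eR] := cov_real iR; have [jI eI] := cov_real iI.
have ER t : complex.Re (gext phi (sig t)) * cabs (vdm (lam t)) ^+ 2 =
    complex.Re (zext (fun t => phi (sig t) * dens t) t).
  rewrite gext_sig /zext; case: ifP => _; last by rewrite mul0r.
  by rewrite dens_real; case: (phi _) => u v /=; ring.
have EI t : complex.Im (gext phi (sig t)) * cabs (vdm (lam t)) ^+ 2 =
    complex.Im (zext (fun t => phi (sig t) * dens t) t).
  rewrite gext_sig /zext; case: ifP => _; last by rewrite mul0r.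
  by rewrite dens_real; case: (phi _) => u v /=; ring.
have ZR : (\int[L n]_t complex.Re (zext (fun t => phi (sig t) * dens t) t) =
    kap n * \int[L n]_t complex.Re (gext phi t))%R.
  by rewrite -eR; apply: eq_Rintegral => t _; rewrite ER.
have ZI : (\int[L n]_t complex.Im (zext (fun t => phi (sig t) * dens t) t) =
    kap n * \int[L n]_t complex.Im (gext phi t))%R.
  by rewrite -eI; apply: eq_Rintegral => t _; rewrite EI.
split.
  apply/zext_integrable; split.
    by move: jR; congr integrable; apply/funext => t; rewrite /= ER.
  by move: jI; congr integrable; apply/funext => t; rewrite /= EI.
have cE (c : C -> R) : c 0 = 0 -> (\int[L n]_(t in @DG R n) c (phi t) = \int[L n]_t c (gext phi t))%R.
  move=> c0; rewrite /Rintegral; congr fine; rewrite [LHS]integral_mkcond.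
  by congr (integral _ _ _); rewrite -(gext_restrict phi c0).
rewrite zext_cint; apply: eq_ReIm; rewrite {1}/cint /=.
  rewrite ZR -(cE (@complex.Re R)) //; rewrite /cint.
  by move: (kap n) (\int[L n]_(t in _) _)%R (\int[L n]_(t in _) _)%R => a b c /=; ring.
rewrite ZI -(cE (@complex.Im R)) //; rewrite /cint.
by move: (kap n) (\int[L n]_(t in _) _)%R (\int[L n]_(t in _) _)%R => a b c /=; ring.
Qed.

Lemma sco_affine t j m w : sco m (tset t j (pc w)) =
  sco m (tset t j (pc 0)) + w * (vpol' (lam t) j)`_m.
Proof.
have E x : vpol' (lam (tset t j (pc x))) j = vpol' (lam t) j.
  by apply: vpol'_const => l lj; exact: lam_tset_neq.
rewrite /sco; case: m => [|m].
  by rewrite !(coef_vpol0 _ j) !E !lam_tset eqxx mul0r add0r.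
by rewrite !(coef_vpol _ j) !E !lam_tset eqxx mul0r addr0.
Qed.

Lemma pdisc_fin : (L n (@pdisc R n) < +oo)%E.
Proof.
apply: (@le_lt_trans _ _ (L n [set t : T | forall i, box (0, 0)%R 1%R (tnth t i)])).
  apply: le_measure; rewrite ?inE //; [exact: measurable_pdisc|exact: measurable_lam_box|].
  move=> t H i; rewrite /box /= !subr0; split; first exact: le_lt_trans (abs_Re_le _) (H i).
  exact: le_lt_trans (abs_Im_le _) (H i).
exact: lam_box_fin.
Qed.

End CovComplex.

Section L2L1.
Context {R : realType} d (U : measurableType d) (m : {measure set U -> \bar R}) (D : set U).
Local Hint Extern 0 (is_true (0 <= cabs _)) => (exact: cabs_ge0) : core.

(** On a set of finite measure, since [c <= 1 + c^2]. *)
Lemma cintegrable_L2 (f : U -> R[i]) : measurable D -> (m D < +oo)%E -> cmeasurable D f ->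
  (\int[m]_(x in D) (cabs (f x) ^+ 2)%:E < +oo)%E -> cintegrable m D f.
Proof.
move=> mD fD mf f2; have mc := measurable_cabs mf.
have i2 : m.-integrable D (EFin \o (fun x => cabs (f x) ^+ 2)).
  apply/integrableP; split; first by apply/measurable_EFinP; exact: measurable_funX.
  apply: le_lt_trans f2; rewrite le_eqVlt; apply/orP; left; apply/eqP.
  by apply: eq_integral => x _; rewrite /= ger0_norm // exprn_ge0.
have i1 : m.-integrable D (EFin \o (fun=> 1 : R)) by exact: (integrable_cst_fin _ mD fD).
have := integrableD mD i1 i2 => i3.
apply: (cintegrable_le mD mf (g := fun x => 1 + cabs (f x) ^+ 2)).
  by move: i3; congr integrable.
by move=> x _; have := sqr_ge0 (cabs (f x) - 1); have := cabs_ge0 (f x); rewrite sqrrB; move: (cabs (f x)) => u; nra.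
Qed.
End L2L1.

(** * The reproducing property on the symmetrized polydisc *)

Section Reproducing.
Context {R : realType} (n : nat).
Local Notation C := R[i].
Local Notation L n := (@lebesgue_Cn R n).
Local Notation T := (n.-tuple (plane R)).
Local Notation Gn := (symmetrized_polydisc R n).
Local Hint Extern 0 (is_true (0 <= cabs _)) => (exact: cabs_ge0) : core.
Implicit Types (t a : T).

Lemma cmeasurable_DG (f : 'rV[C]_n -> C) : holomorphic_on Gn f ->
  cmeasurable (@DG R n) (fun t => f (Cn_of_tuple t)).
Proof.
move=> hf; have c t (tD : DG t) := holo_continuous (hf _ tD).
split; apply: measurable_on_DG => t tD e e0; have [d d0 Hd] := c t tD e e0; exists d => // t' /Hd;
  apply: le_lt_trans.
  by have := abs_Re_le (f (Cn_of_tuple t') - f (Cn_of_tuple t)); rewrite ReD ReN.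
by have := abs_Im_le (f (Cn_of_tuple t') - f (Cn_of_tuple t)); rewrite ImD ImN.
Qed.

Lemma kerQ_bound (r : R) : r < 1 -> exists2 B, 0 <= B & forall nu y : 'I_n -> C,
  (forall j, cabs (nu j) <= r) -> (forall k, cabs (y k) < 1) -> cabs (kerQ nu y) <= B.
Proof.
move=> r1; have r0 : 0 < 1 - r by rewrite subr_gt0.
pose rho := (1 - r)^-1; have rho0 : 0 <= rho by rewrite invr_ge0 ltW.
exists ((\sum_(s : 'S_n) rho ^+ n) * \prod_(j < n) \prod_(k < n) rho).
  by rewrite mulr_ge0 ?sumr_ge0 ?prodr_ge0 // => *; rewrite ?exprn_ge0 ?prodr_ge0.
move=> nu y Hnu Hy.
have b j k : cabs (1 - nu j * y k)^-1 <= rho.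
  have : 1 - r <= cabs (1 - nu j * y k).
    have := cabsD (1 - nu j * y k) (nu j * y k); rewrite subrK cabs1 cabsM => H.
    have : cabs (nu j) * cabs (y k) <= r.
      by rewrite -[r]mulr1; apply: ler_pM => //; exact: ltW.
    by move: H; move: (cabs _) (cabs _ * _) => u v; lra.
  by move=> H; rewrite cabsV lef_pV2 // posrE // (lt_le_trans r0).
have pb (I : finType) (f : I -> C) (g : I -> R) : (forall i, cabs (f i) <= g i) ->
    cabs (\prod_i f i) <= \prod_i g i.
  move=> fg; elim/big_rec2: _ => [|i u v _ H]; first by rewrite cabs1.
  by rewrite cabsM ler_pM.
rewrite /kerQ cabsM; apply: ler_pM => //.
  rewrite /permanent; apply: le_trans (cabs_sum _ _ _) _; apply: ler_sum => s _.
  rewrite -[n in rho ^+ n]card_ord -prodr_const; apply: (pb _ _ _) => i; rewrite mxE; exact: b.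
rewrite -prodfV; apply: (pb _ _ _) => j; rewrite -prodfV; apply: (pb _ _ _) => k; exact: b.
Qed.

Lemma conj_prod (I : Type) (s : seq I) (P : pred I) (h : I -> C) :
  (\prod_(i <- s | P i) h i)^* = \prod_(i <- s | P i) (h i)^*.
Proof. by apply: big_morph; [move=> x y; exact: conjM|exact: conjC1]. Qed.

Lemma kerQ_conj (nu y : 'I_n -> C) : kerQ (fun j => (nu j)^*) y = (kerQ nu (fun k => (y k)^*))^*.
Proof.
have cE u v : (1 - u * v^*)^* = 1 - u^* * v :> C by rewrite conjB conjC1 conjM conjCK.
rewrite /kerQ conjM fmorphV; congr (_ / _).
  rewrite /permanent conj_sum; apply: eq_bigr => s _; rewrite conj_prod.
  by apply: eq_bigr => i _; rewrite !mxE fmorphV /= cE.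
rewrite [RHS]conj_prod; apply: eq_bigr => i _; rewrite conj_prod; apply: eq_bigr => k _.
by rewrite cE.
Qed.

Lemma sker_tuple (nu : 'I_n -> C) t : (forall j, cabs (nu j) < 1) -> pdisc t ->
  sker nu (Cn_of_tuple (sig t)) = kerQ nu (lam t).
Proof.
move=> nu1 tD; rewrite -symm_sig skerE // => [|k]; last by rewrite Cn_of_tupleE.
by congr kerQ; apply/funext => k; rewrite Cn_of_tupleE.
Qed.

Lemma DG_pdisc t : DG t -> exists2 t', pdisc t' & t = sig t'.
Proof.
move=> tD; have [y yE] := symm_surj (Cn_of_tuple t).
pose ty : T := [tuple pc (y ord0 i) | i < n].
have lyE : Cn_of_tuple ty = y by apply/rowP => i; rewrite Cn_of_tupleE /lam tnth_mktuple cpK.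
have E : t = sig ty.
  have := symm_sig ty; rewrite lyE yE => /rowP H; apply: eq_from_tnth => i.
  by have := H i; rewrite !Cn_of_tupleE /lam => /(congr1 pc); rewrite !pcK.
by exists ty => //; apply/DG_sig; rewrite -E.
Qed.

Lemma sker_bound (r : R) : r < 1 -> exists2 B, 0 <= B & forall (nu : 'I_n -> C) t,
  (forall j, cabs (nu j) <= r) -> DG t -> cabs (sker nu (Cn_of_tuple t)) <= B.
Proof.
move=> r1; have [B B0 HB] := kerQ_bound r1; exists B => // nu t Hnu /DG_pdisc[t' tD ->].
by rewrite sker_tuple //; [exact: HB|move=> j; exact: le_lt_trans (Hnu j) r1].
Qed.

Lemma sker_holo (nu : 'I_n -> C) : (forall j, cabs (nu j) < 1) -> holomorphic_on Gn (sker nu).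
Proof. by move=> nu1 z zG; exact: differentiable_sker. Qed.

Lemma lam_max a : pdisc a -> exists2 r : R, r < 1 & forall j, cabs (lam a j) <= r.
Proof.
move=> aD; exists (\big[Num.max/0]_j cabs (lam a j)).
  elim/big_rec: _ => [|j x _ x1]; first exact: ltr01.
  by rewrite gt_max x1 andbT; exact: aD.
by move=> j; rewrite (bigD1 j) //= le_max lexx.
Qed.

Section fixed.
Variable f : 'rV[C]_n -> C.
Hypothesis Bf : bergman_space Gn f.
Let g t := f (Cn_of_tuple t).
Let F t := g (sig t) * vdm (lam t).

Let hf : holomorphic_on Gn f. Proof. by case: Bf. Qed.
Let mg : cmeasurable (@DG R n) g. Proof. exact: cmeasurable_DG. Qed.
Let g2 : (\int[L n]_(t in @DG R n) (cabs (g t) ^+ 2)%:E < +oo)%E. Proof. by case: Bf. Qed.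

Let ig : cintegrable (L n) (@DG R n) g.
Proof. by apply: cintegrable_L2 => //; [exact: measurable_DG|exact: DG_fin]. Qed.

Let mF : cmeasurable (@pdisc R n) F.
Proof.
apply: cmeasurableM; last first.
  have [[mR mI] _ _] := @nice_vdm R n.
  by split; exact: measurable_funTS.
have ms := @measurable_sig R n.
have sub : @sig R n @` @pdisc R n `<=` @DG R n by move=> _ [t tD <-]; apply/DG_sig.
have msD : measurable_fun (@pdisc R n) (@sig R n) by exact: measurable_funTS.
by case: mg => mR mI; split; [exact: (measurable_comp (@measurable_DG R n) sub mR msD)
  |exact: (measurable_comp (@measurable_DG R n) sub mI msD)].
Qed.

Let iF : cintegrable (L n) (@pdisc R n) F.
Proof.
apply: cintegrable_L2 => //; [exact: measurable_pdisc|exact: pdisc_fin|].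
have mD := @measurable_DG R n.
pose p t : \bar R := ((fun t => (cabs (g t) ^+ 2)%:E) \_ (@DG R n)) t.
have mp : measurable_fun setT p.
  apply/(measurable_restrictT _ mD); apply/measurable_EFinP; apply: measurable_funX.
  exact: measurable_cabs.
have p0 t : (0 <= p t)%E by rewrite /p patchE; case: ifP => // _; rewrite lee_fin exprn_ge0.
have := sig_integral mp p0; rewrite /p -integral_mkcond => E.
have fin : (\int[L n]_(t in @DG R n) (cabs (g t) ^+ 2)%:E)%E \is a fin_num.
  by rewrite ge0_fin_numE // integral_ge0 // => t _; rewrite lee_fin exprn_ge0.
apply: (@le_lt_trans _ _ ((kap n)%:E * \int[L n]_(t in @DG R n) (cabs (g t) ^+ 2)%:E)%E); last first.
  by rewrite -(fineK fin) -EFinM ltry.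
rewrite -E [leLHS]integral_mkcond le_eqVlt; apply/orP; left; apply/eqP.
apply: eq_integral => t _; rewrite !patchE.
have -> : (sig t \in @DG R n) = (t \in @pdisc R n).
  by apply/idP/idP => /set_mem H; apply/mem_set; apply/DG_sig.
by case: ifP => _; rewrite ?mul0e // /F cabsM exprMn EFinM.
Qed.

Let hF : sephol F.
Proof.
move=> t j tD z z1.
pose A : 'rV[C]_n := \row_k sco (rev_ord k) (tset t j (pc 0)).
pose B : 'rV[C]_n := \row_k (vpol' (lam t) j)`_(rev_ord k).
have E w : Cn_of_tuple (sig (tset t j (pc w))) = A + w *: B.
  apply/rowP => k; rewrite Cn_of_tupleE /lam tnth_mktuple cpK sco_affine !mxE; congr (_ + _).
have zD : pdisc (tset t j (pc z)) by move=> i; rewrite lam_tset; case: ifP.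
have df : differentiable f (A + z *: B) by rewrite -E; apply: hf; move/DG_sig: zD.
have [l Hl] := holo_line df; have [l' Hl'] := cdiff_vdm t j z.
have := cdiffM Hl Hl'; rewrite /F /g => H; eexists.
by under eq_fun do rewrite E; exact: H.
Qed.

Let perm_tuple a (s : 'S_n) : T := [tuple tnth a (s j) | j < n].

Let lam_perm a s j : lam (perm_tuple a s) j = lam a (s j).
Proof. by rewrite /lam tnth_mktuple. Qed.

Lemma vdm_perm (y : 'I_n -> C) (s : 'S_n) : vdm (fun j => y (s j)) = (-1) ^+ s * vdm y.
Proof.
rewrite !vdmE mulrC -odd_permV -det_perm -det_mulmx -col_permE.
by congr determinant; apply/matrixP => i j; rewrite !mxE.
Qed.

Let F_perm a s : F (perm_tuple a s) = (-1) ^+ s * F a.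
Proof.
have E : sig (perm_tuple a s) = sig a.
  have Ev : vpol (lam (perm_tuple a s)) = vpol (lam a).
    rewrite /vpol [RHS](reindex_inj (@perm_inj _ s)) /=; apply: eq_bigr => j _.
    by rewrite lam_perm.
  by apply: eq_from_tnth => k; rewrite !tnth_mktuple /sco Ev.
rewrite /F E (_ : lam (perm_tuple a s) = fun j => lam a (s j)); last first.
  by apply/funext => j; exact: lam_perm.
by rewrite vdm_perm mulrCA.
Qed.

Let pdisc_perm a s : pdisc a -> pdisc (perm_tuple a s).
Proof. by move=> aD j; rewrite lam_perm. Qed.

(** Since [F] is antisymmetric, each of the [n`!] terms of the determinant
    reproduces the same value. *)
Let repro_det a : pdisc a -> cint (L n) (@pdisc R n) (fun t =>
    F t * \det (\matrix_(j, k) (1 - lam a j * (lam t k)^*)^-1 ^+ 2)) =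
  n`!%:R * (F a * disc_area ^+ n).
Proof.
move=> aD.
have int s : cintegrable (L n) (@pdisc R n) (fun t =>
    F t * \prod_k bkernel (lam (perm_tuple a s) k) (lam t k)).
  have pD := pdisc_perm s aD.
  apply: (cintegrableM_bounded (@measurable_pdisc R n) iF
    (K := \prod_k (1 - cabs (lam (perm_tuple a s) k))^-1 ^+ 2)).
    apply: cmeasurable_prod => k _.
    have [mR mI] := bkernel_measurable (pD k).
    have m0 : measurable_fun (@pdisc R n) (fun t => tnth t k).
      by apply: measurable_funTS; exact: measurable_tnth.
    have sub : (fun t => tnth t k) @` @pdisc R n `<=` @disc R.
      by move=> _ [t Ht <-]; exact: (Ht k).
    by split; [exact: (measurable_comp (@measurable_disc R) sub mR m0)
      |exact: (measurable_comp (@measurable_disc R) sub mI m0)].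
  move=> t tD; elim/big_rec2: _ => [|j x y _ H]; first by rewrite cabs1.
  by rewrite cabsM ler_pM // bkernel_bounded.
transitivity (cint (L n) (@pdisc R n) (fun t => \sum_(s : 'S_n) (-1) ^+ s *
    (F t * \prod_k bkernel (lam (perm_tuple a s^-1%g) k) (lam t k)))).
  apply: eq_cint => t _; rewrite /determinant mulr_sumr; apply: eq_bigr => s _.
  rewrite mulrCA; congr (_ * (_ * _)).
  rewrite (reindex_inj (@perm_inj _ s^-1%g)) /=; apply: eq_bigr => k _.
  by rewrite mxE permKV lam_perm.
rewrite (cint_sum (@measurable_pdisc R n)); last first.
  by move=> s _; apply: (cintegrableZ (@measurable_pdisc R n)); exact: int.
rewrite (eq_bigr (fun=> F a * disc_area ^+ n)) => [|s _].
  by rewrite sumr_const card_Sn mulr_natl.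
rewrite (cintZ (@measurable_pdisc R n) _ (int _)) (bergman_polydisc (pdisc_perm _ aD) iF hF).
by rewrite F_perm odd_permV -mulrA signrMK.
Qed.

Let phi a t := g t * (sker (fun j => (lam a j)^*) (Cn_of_tuple t))^*.

Let iphi a : pdisc a -> cintegrable (L n) (@DG R n) (phi a).
Proof.
move=> aD; have [r r1 Hr] := lam_max aD; have [B B0 HB] := sker_bound r1.
have nu1 j : cabs ((lam a j)^*) < 1 by rewrite cabsJ.
apply: (cintegrableM_bounded (@measurable_DG R n) ig (K := B)).
  by apply: cmeasurableJ; apply: cmeasurable_DG; exact: sker_holo.
by move=> t tD; rewrite cabsJ HB // => j; rewrite cabsJ.
Qed.

(** Dividing by [vdm (lam a)] requires distinct entries, and
    [det_bergman_factor] nonzero ones. *)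
Lemma repro_generic a : pdisc a -> injective (lam a) -> (forall j, lam a j != 0) ->
  (kap n)%:C * cint (L n) (@DG R n) (phi a) = n`!%:R * disc_area ^+ n * g (sig a).
Proof.
move=> aD ainj a0; have va := vdm_neq0 ainj.
have [iphi' <-] := cov_cint (iphi aD).
apply: (mulfI va); rewrite -(cintZ (@measurable_pdisc R n) _ iphi').
transitivity (n`!%:R * (F a * disc_area ^+ n)); last by rewrite /F; ring.
rewrite -(repro_det aD); apply: eq_cint => t tD.
have nz j k : 1 - lam a j * (lam t k)^* != 0 by apply: disc_mul_neq0 => //; rewrite cabsJ.
have := @det_bergman_factor _ n (lam a) (fun k => (lam t k)^*) ainj a0 nz => ->.
have -> : vdm (fun k => (lam t k)^*) = (vdm (lam t))^*.
  rewrite /vdm conj_prod; apply: eq_bigr => i _; rewrite conj_prod; apply: eq_bigr => j _.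
  by rewrite conjB.
rewrite -/(kerQ (lam a) (fun k => (lam t k)^*)) /phi /F /dens sker_tuple //; last first.
  by move=> j; rewrite cabsJ.
rewrite kerQ_conj conjCK.
by move: (kerQ _ _) (vdm (lam a)) (g (sig t)) (vdm (lam t)) ((vdm (lam t))^*) => u v w x y; ring.
Qed.

End fixed.

(** With [kap = 0] the function 1 would be reproduced as 0 at a generic
    point. *)
Lemma kap_neq0 : (0 < n)%N -> (kap n : R) != 0.
Proof.
move=> n0; pose a : T := [tuple pc ((j.+1%:R / n.+1%:R : R)%:C) | j < n].
have laE j : lam a j = (j.+1%:R / n.+1%:R : R)%:C by rewrite /lam tnth_mktuple cpK.
have n1 : 0 < (n.+1%:R : R) by rewrite ltr0n.
have aD : pdisc a.
  move=> j; rewrite laE cabs_real gtr0_norm ?divr_gt0 ?ltr0n //.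
  by rewrite ltr_pdivrMr // mul1r ltr_nat ltnS ltn_ord.
have ainj : injective (lam a).
  move=> i j; rewrite !laE => /(congr1 (@complex.Re R)) /= /(mulIf _) H.
  apply: val_inj; have /eqP := H (invr_neq0 (lt0r_neq0 n1)); rewrite eqr_nat eqSS.
  by move/eqP.
have a0 j : lam a j != 0.
  by rewrite laE -cabs_gt0 cabs_real normr_gt0 gt_eqF // divr_gt0 // ltr0n.
have B1 : bergman_space Gn (fun _ : 'rV[C]_n => 1).
  split; first by move=> z _; exact: differentiable_cst.
  rewrite (eq_integral (cst 1%E)); last first.
    by move=> t _; rewrite -/(cabs 1) cabs1 expr1n.
  rewrite integral_cst ?mul1e; [exact: DG_fin|exact: measurable_DG].
have := repro_generic B1 aD ainj a0; apply: contra_eqN => /eqP ->.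
rewrite mul0r eq_sym mulr1 mulf_neq0 ?expf_neq0 ?disc_area_neq0 //.
Qed.

Lemma cdiff_sum (I : Type) (s : seq I) (P : pred I) (h : I -> C -> C) z :
  (forall i, P i -> exists l, cdiff (h i) z l) ->
  exists l, cdiff (fun w => \sum_(i <- s | P i) h i w) z l.
Proof.
move=> fb; elim: s => [|x s [l Hl]].
  by exists 0; under eq_fun do rewrite big_nil; exact: wirt_cst.
case Px: (P x); last by exists l; under eq_fun do rewrite big_cons Px.
have [m Hm] := fb x Px; eexists; under eq_fun do rewrite big_cons Px.
exact: cdiffD Hm Hl.
Qed.

Lemma cdiff_kerQ (nu v y : 'I_n -> C) : (forall j k, 1 - nu j * y k != 0) ->
  exists l, cdiff (fun w => kerQ (fun j => nu j + w * v j) y) 0 l.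
Proof.
move=> nz.
have D j k : exists l, cdiff (fun w => 1 - (nu j + w * v j) * y k) 0 l.
  exists (- (v j * y k)); have := cdiff_lin (1 - nu j * y k) (- (v j * y k)) 0.
  by congr cdiff; apply/funext => w; ring.
have nz0 j k : 1 - (nu j + 0 * v j) * y k != 0 by rewrite mul0r addr0.
have V (h : C -> C) : (exists l, cdiff h 0 l) -> h 0 != 0 -> exists l, cdiff (fun w => (h w)^-1) 0 l.
  by move=> [l Hl] h0; eexists; exact: cdiffV h0 Hl.
have [l1 H1] : exists l, cdiff (fun w => permanent (\matrix_(k < n, j < n) (1 - (nu j + w * v j) * y k)^-1)) 0 l.
  have -> : (fun w => permanent (\matrix_(k < n, j < n) (1 - (nu j + w * v j) * y k)^-1)) =
      (fun w => \sum_(s : 'S_n) \prod_i (1 - (nu (s i) + w * v (s i)) * y i)^-1).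
    apply/funext => w; rewrite /permanent; apply: eq_bigr => s _; apply: eq_bigr => i _.
    by rewrite mxE.
  by apply: cdiff_sum => s _; apply: cdiff_prod => i _; exact: V.
have [l2 H2] : exists l, cdiff (fun w => (\prod_j \prod_k (1 - (nu j + w * v j) * y k))^-1) 0 l.
  apply: V; first by apply: cdiff_prod => j _; apply: cdiff_prod => k _; exact: D.
  by apply/prodf_neq0 => j _; apply/prodf_neq0 => k _; exact: nz0.
by eexists; exact: cdiffM H1 H2.
Qed.

(** The perturbation [a + x (1, 2, ..., n)] has distinct nonzero entries for all
    but finitely many [x]. *)
Definition shift a (x : R) : T := [tuple pc (lam a j + x%:C * j.+1%:R) | j < n].

Lemma lam_shift a x j : lam (shift a x) j = lam a j + x%:C * j.+1%:R.
Proof. by rewrite /lam tnth_mktuple cpK. Qed.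

Lemma shift_generic a : exists2 d : R, 0 < d & forall x, 0 < x < d ->
  injective (lam (shift a x)) /\ forall j, lam (shift a x) j != 0.
Proof.
have fin (I : finType) (c : I -> C) : exists2 d : R, 0 < d & forall x i, 0 < x < d -> x%:C != c i.
  exists (\big[Num.min/1]_(i | c i != 0) cabs (c i)).
    by elim/big_rec: _ => [|i x ci x0]; rewrite ?ltr01 // lt_min x0 andbT cabs_gt0.
  move=> x i /andP[x0 xd]; apply/eqP => E.
  have ci : c i != 0 by rewrite -E -cabs_gt0 cabs_real normr_gt0 gt_eqF.
  move: xd; rewrite (bigD1 i) //= lt_min -E cabs_real gtr0_norm // ltxx.
  by [].
have [d1 d10 H1] := fin 'I_n (fun j => - lam a j / j.+1%:R).
have [d2 d20 H2] := fin ('I_n * 'I_n)%type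
  (fun p => (lam a p.1 - lam a p.2) / (p.2.+1%:R - p.1.+1%:R)).
exists (Num.min d1 d2) => [|x]; first by rewrite lt_min d10.
rewrite lt_min => /andP[x0 /andP[x1 x2]]; split=> [i j|j].
  rewrite !lam_shift => E; apply: contrapT => /eqP ij.
  have nij : (j.+1%:R - i.+1%:R : C) != 0.
    by rewrite subr_eq0 eqr_nat eqSS eq_sym (inj_eq val_inj).
  have := H2 x (i, j); rewrite x0 x2 => /(_ isT) /eqP; apply; apply: (mulIf nij).
  rewrite /= divfK // mulrBr; have -> : lam a i = lam a j + x%:C * j.+1%:R - x%:C * i.+1%:R.
    by rewrite -E addrK.
  by ring.
rewrite lam_shift; apply/eqP => E; have := H1 x j; rewrite x0 x1 => /(_ isT) /eqP; apply.
have nj : (j.+1%:R : C) != 0 by rewrite pnatr_eq0.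
apply: (mulIf nj); rewrite divfK //; apply/eqP; rewrite -subr_eq0 opprK addrC; exact/eqP.
Qed.

Lemma sig_shift_cvg a e : 0 < e -> exists2 d, 0 < d & forall x : R, `|x| < d ->
  forall k, cabs (lam (sig (shift a x)) k - lam (sig a) k) < e.
Proof.
move=> e0.
have key (k : 'I_n) : exists2 d, 0 < d & forall x : R, `|x| < d ->
    cabs (lam (sig (shift a x)) k - lam (sig a) k) < e.
  pose h (w : C) := \sum_(J : {set 'I_n} | #|J| == rev_ord k) \prod_(i in finset.setC J) (lam a i + w * i.+1%:R).
  have hE x : lam (sig (shift a x)) k = h x%:C.
    rewrite /lam tnth_mktuple cpK /sco vpol_coef; apply: eq_bigr => J _; apply: eq_bigr => i _.
    by rewrite lam_shift.
  have h0 : lam (sig a) k = h 0.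
    rewrite /lam tnth_mktuple cpK /sco vpol_coef; apply: eq_bigr => J _; apply: eq_bigr => i _.
    by rewrite mul0r addr0.
  have [l Hl] : exists l, cdiff h 0 l.
    by apply: cdiff_sum => J _; apply: cdiff_prod => i _; eexists; exact: cdiff_lin.
  have [d d0 Hd] := wirt_cont Hl e0; exists d => // x xd.
  by rewrite hE h0; apply: Hd; rewrite subr0 cabs_real.
have [f Hf] : exists f : 'I_n -> R, forall k, 0 < f k /\ forall x : R, `|x| < f k ->
    cabs (lam (sig (shift a x)) k - lam (sig a) k) < e.
  have C0 k : exists d, 0 < d /\ forall x : R, `|x| < d ->
    cabs (lam (sig (shift a x)) k - lam (sig a) k) < e by have [d d0 Hd] := key k; exists d.
  by have [f Hf] := choice C0; exists f.
exists (\big[Num.min/1]_k f k).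
  by elim/big_rec: _ => [|i x _ x0]; rewrite ?ltr01 // lt_min x0 andbT; case: (Hf i).
move=> x + k; rewrite (bigD1 k) //= lt_min => /andP[xk _]; by case: (Hf k) => _; apply.
Qed.

Lemma shift_pdisc a (r : R) : r < 1 -> (forall j, cabs (lam a j) <= r) ->
  exists2 d, 0 < d & forall x : R, `|x| < d -> forall j, cabs (lam (shift a x) j) <= (1 + r) / 2.
Proof.
move=> r1 Hr; have d0 : 0 < (1 - r) / 2 / n.+1%:R by rewrite !divr_gt0 ?subr_gt0 ?ltr0n.
exists ((1 - r) / 2 / n.+1%:R) => // x xd j; rewrite lam_shift.
apply: le_trans (cabsD _ _) _; rewrite cabsM cabs_real.
have -> : cabs (j.+1%:R : C) = j.+1%:R.
  by have := cabs_real (j.+1%:R : R); rewrite (rmorph_nat (real_complex R)) normr_nat.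
have : `|x| * j.+1%:R <= (1 - r) / 2.
  apply: (@le_trans _ _ (`|x| * n.+1%:R)); first by rewrite ler_wpM2l // ler_nat ltnS ltnW // ltn_ord.
  by rewrite -ler_pdivlMr ?ltr0n // ltW.
have := Hr j; move: (cabs (lam a j)) (`|x| * _) => u v; lra.
Qed.

(** Both sides are continuous in [a] along the generic perturbations [shift];
    the kernels are bounded uniformly on compact sets, so dominated convergence
    applies to the left side. *)
Lemma repro (f : 'rV[C]_n -> C) a : (0 < n)%N -> bergman_space Gn f -> pdisc a ->
  (kap n)%:C * cint (L n) (@DG R n) (fun t => f (Cn_of_tuple t) *
    (sker (fun j => (lam a j)^*) (Cn_of_tuple t))^*) =
  n`!%:R * disc_area ^+ n * f (Cn_of_tuple (sig a)).
Proof.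
move=> n0 Bf aD; have [hf f2] := Bf.
have [r r1 Hr] := lam_max aD; have r'1 : (1 + r) / 2 < 1 by lra.
have [B B0 HB] := sker_bound r'1.
have [d1 d10 H1] := shift_generic a; have [d2 d20 H2] := shift_pdisc r1 Hr.
have [N1 HN1] : exists N : nat, forall k, (N <= k)%N -> k.+1%:R^-1 < Num.min d1 d2.
  have d12 : 0 < Num.min d1 d2 by rewrite lt_min d10.
  have [N HN] := inv_approx d12; exists N => k Nk; apply: le_lt_trans HN.
  by rewrite lef_pV2 ?posrE ?ltr0n // ler_nat.
pose x (k : nat) : R := (k + N1).+1%:R^-1.
have x0 k : 0 < x k by rewrite invr_gt0 ltr0n.
have xx k : 0 < x k < d1 /\ `|x k| < d2.
  have := HN1 (k + N1)%N (leq_addl _ _); rewrite lt_min => /andP[h1 h2].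
  by rewrite gtr0_norm // x0.
pose ak k := shift a (x k).
have akB k j : cabs (lam (ak k) j) <= (1 + r) / 2 by apply: H2; case: (xx k).
have akD k : pdisc (ak k) by move=> j; exact: le_lt_trans (akB k j) r'1.
pose phi k t := f (Cn_of_tuple t) * (sker (fun j => (lam (ak k) j)^*) (Cn_of_tuple t))^*.
have E k : (kap n)%:C * cint (L n) (@DG R n) (phi k) =
    n`!%:R * disc_area ^+ n * f (Cn_of_tuple (sig (ak k))).
  by have [h1 _] := xx k; have [inj nz] := H1 _ h1; exact: repro_generic.
have kn0 : (kap n)%:C != 0 :> C by rewrite -cabs_gt0 cabs_real normr_gt0 kap_neq0.
pose c : C := n`!%:R * disc_area ^+ n / (kap n)%:C.
have Ec k : cint (L n) (@DG R n) (phi k) = c * f (Cn_of_tuple (sig (ak k))).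
  by apply: (mulfI kn0); rewrite E /c; field.
have mg : cmeasurable (@DG R n) (fun t => f (Cn_of_tuple t)) by exact: cmeasurable_DG.
have ig : cintegrable (L n) (@DG R n) (fun t => f (Cn_of_tuple t)).
  by apply: cintegrable_L2 => //; [exact: measurable_DG|exact: DG_fin].
have mphi (b : T) : pdisc b -> cmeasurable (@DG R n) (fun t => f (Cn_of_tuple t) *
    (sker (fun j => (lam b j)^*) (Cn_of_tuple t))^*).
  move=> bD; apply: cmeasurableM => //; apply: cmeasurableJ; apply: cmeasurable_DG.
  by apply: sker_holo => j; rewrite cabsJ.
have xe (e : R) : 0 < e -> exists N, forall k, (N <= k)%N -> `|x k| < e.
  move=> e0; have [N HN] := inv_approx e0; exists N => k Nk; rewrite gtr0_norm //.
  by apply: le_lt_trans HN; rewrite lef_pV2 ?posrE ?ltr0n // ler_nat; lia.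
have ibound : (L n).-integrable (@DG R n) (EFin \o (fun t => B * cabs (f (Cn_of_tuple t)))).
  have := integrableZl (@measurable_DG R n) B (integrable_cabs (@measurable_DG R n) ig).
  by congr integrable.
have -> : cint (L n) (@DG R n) (fun t => f (Cn_of_tuple t) *
    (sker (fun j => (lam a j)^*) (Cn_of_tuple t))^*) = c * f (Cn_of_tuple (sig a)).
  apply: (dominated_cint (@measurable_DG R n) (f_ := phi) _ (mphi a aD) ibound).
  - by move=> k; exact: mphi.
  - by move=> k t tD; rewrite cabsM cabsJ mulrC ler_wpM2r // HB // => j; rewrite cabsJ.
  - move=> t /DG_pdisc[t' t'D ->]; rewrite /phi.
    have nu1 k j : cabs ((lam (ak k) j)^*) < 1 by rewrite cabsJ; exact: akD.
    have nu1' j : cabs ((lam a j)^*) < 1 by rewrite cabsJ.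
    have [l Hl] := @cdiff_kerQ (fun j => (lam a j)^*) (fun j => j.+1%:R) (lam t')
      (fun j k => disc_mul_neq0 (nu1' j) (t'D k)).
    move=> e e0; pose G := cabs (f (Cn_of_tuple (sig t'))) + 1.
    have G0 : 0 < G by rewrite ltr_wpDl.
    have [d d0 Hd] := wirt_cont Hl (divr_gt0 e0 G0); have [N HN] := xe d d0.
    exists N => k Nk; rewrite (sker_tuple (nu1 k) t'D) (sker_tuple nu1' t'D) -mulrBr cabsM -conjB cabsJ.
    have := Hd (x k)%:C; rewrite subr0 cabs_real => /(_ (HN k Nk)).
    have -> : (fun j : 'I_n => (lam a j)^* + (x k)%:C * j.+1%:R) = (fun j => (lam (ak k) j)^*).
      apply/funext => j; rewrite lam_shift conjD conjM; congr (_ + _ * _).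
        by apply: eq_ReIm; rewrite ?ReJ ?ImJ /= ?oppr0.
      by rewrite conjC_nat.
    have -> : (fun j : 'I_n => (lam a j)^* + 0 * j.+1%:R) = (fun j => (lam a j)^*).
      by apply/funext => j; rewrite mul0r addr0.
    move=> H; apply: (@le_lt_trans _ _ (G * cabs (kerQ (fun j => (lam (ak k) j)^*) (lam t') -
        kerQ (fun j => (lam a j)^*) (lam t')))); first by rewrite ler_wpM2r // lerDl.
    by rewrite mulrC -ltr_pdivlMr.
  - move=> e e0; pose G := cabs c + 1; have G0 : 0 < G by rewrite ltr_wpDl.
    have aDG : Gn (Cn_of_tuple (sig a)) by apply/DG_sig.
    have [d d0 Hd] := holo_continuous (hf _ aDG) (divr_gt0 e0 G0).
    have [d' d'0 Hd'] := sig_shift_cvg a d0; have [N HN] := xe d' d'0.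
    exists N => k Nk; rewrite Ec -mulrBr cabsM.
    have H := Hd (sig (ak k)) (fun j => Hd' _ (HN k Nk) j).
    apply: (@le_lt_trans _ _ (G * cabs (f (Cn_of_tuple (sig (ak k))) - f (Cn_of_tuple (sig a))))).
      by rewrite ler_wpM2r // lerDl.
    by rewrite mulrC -ltr_pdivlMr.
by rewrite /c; move: kn0; move: ((kap n)%:C) => w kn0; field.
Qed.

End Reproducing.

(** * A zero of the permanent *)

Section Zero.
Context {R : realType}.
Local Notation C := R[i].
Local Hint Extern 0 (is_true (0 <= cabs _)) => (exact: cabs_ge0) : core.

(** [A] and [B] have the same image under Newton's map of the polynomial
    [z^m (z^2 - 1)]; that is the vanishing condition for the permanent. *)
Lemma newton_condition (m A B : C) : m + 1 != 0 -> A != 0 -> B != 0 ->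
  A ^+ 2 != 1 -> B ^+ 2 != 1 ->
  A * B = - (m / (m + 1)) ^+ 2 -> (A + B) ^+ 2 = - (m + 1)^-1 ^+ 4 ->
  ((A + 1)^-1 + ((A - 1)^-1 + m * A^-1)) * ((B + 1)^-1 + ((B - 1)^-1 + m * B^-1)) -
  ((A + 1)^-1 * (B + 1)^-1 + ((A - 1)^-1 * (B - 1)^-1 + m * (A^-1 * B^-1))) = 0.
Proof.
move=> m0 A0 B0 A1 B1 ABp ABs.
have Am : A - 1 != 0 by apply: contra_neq A1 => /eqP; rewrite subr_eq0 => /eqP ->; rewrite expr1n.
have Ap : A + 1 != 0 by apply: contra_neq A1 => /eqP; rewrite addr_eq0 => /eqP ->; rewrite sqrrN expr1n.
have Bm : B - 1 != 0 by apply: contra_neq B1 => /eqP; rewrite subr_eq0 => /eqP ->; rewrite expr1n.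
have Bp : B + 1 != 0 by apply: contra_neq B1 => /eqP; rewrite addr_eq0 => /eqP ->; rewrite sqrrN expr1n.
have N : (m + 1) * (m + 2) * (A * B) ^+ 2 - m * (m + 1) * (A + B) ^+ 2 +
    (A * B) * (2 * m ^+ 2 + 2 * m - 2) + m ^+ 2 - m = 0.
  by rewrite ABp ABs; field.
transitivity (((m + 1) * (m + 2) * (A * B) ^+ 2 - m * (m + 1) * (A + B) ^+ 2 +
    (A * B) * (2 * m ^+ 2 + 2 * m - 2) + m ^+ 2 - m) /
    (A * B * (A - 1) * (A + 1) * (B - 1) * (B + 1))).
  by field; rewrite A0 B0 Am Ap Bm Bp.
by rewrite N mul0r.
Qed.

Lemma cabs_sqr_ReIm (z : C) : cabs z ^+ 2 = complex.Re z ^+ 2 + complex.Im z ^+ 2.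
Proof. by have := cabs_sqr z. Qed.

Lemma cabs_lt_sqr (z : C) (r : R) : 0 <= r ->
  complex.Re z ^+ 2 + complex.Im z ^+ 2 < r ^+ 2 -> cabs z < r.
Proof. by move=> r0; rewrite -cabs_sqr_ReIm ltr_pXn2r // nnegrE. Qed.

Lemma sqr_lt_cabs (z : C) (r : R) : 0 <= r ->
  r ^+ 2 < complex.Re z ^+ 2 + complex.Im z ^+ 2 -> r < cabs z.
Proof. by move=> r0; rewrite -cabs_sqr_ReIm ltr_pXn2r // nnegrE. Qed.

(** The points [-1, 1, 0, ..., 0] of a disc with centre [c] and radius
    [Rad] are moved to the unit disc; two rows have their poles at points [A] and
    [B] outside this disc, the other rows are constant. *)
Lemma permanent_zero (k : nat) : exists l mm : 'I_k.+3 -> C,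
  [/\ forall j, cabs (l j) < 1, forall j, cabs (mm j) < 1 &
    permanent (\matrix_(i < k.+3, j < k.+3) (1 - l j * (mm i)^*)^-1) = 0].
Proof.
pose m : R := k.+1%:R; have m1 : 1 <= m by rewrite ler1n.
pose q := (m + 1) ^+ 2; have q4 : 4 <= q by rewrite /q expr2; nra.
pose eta := (2 * q)^-1; pose rho := 2 * q.
have er : eta * rho = 1 by rewrite /eta /rho mulVf // mulf_neq0 // gt_eqF //; lra.
have q0 : 0 < q by lra.
have xx0 : 0 <= m ^+ 2 / q - eta ^+ 2.
  have -> : m ^+ 2 / q - eta ^+ 2 = (4 * m ^+ 2 * q - 1) / (4 * q ^+ 2).
    by rewrite /eta; field; rewrite gt_eqF.
  rewrite divr_ge0 //; last by rewrite mulr_ge0 // sqr_ge0.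
  have : 1 <= m ^+ 2 by rewrite expr2; nra.
  by move: (m ^+ 2) => u; nra.
pose x := Num.sqrt (m ^+ 2 / q - eta ^+ 2).
have xE : x ^+ 2 = m ^+ 2 / q - eta ^+ 2 by rewrite sqr_sqrtr.
pose Rad := Num.sqrt (rho ^+ 2 + 3 / 2).
have RadE : Rad ^+ 2 = rho ^+ 2 + 3 / 2 by rewrite sqr_sqrtr // addr_ge0 ?sqr_ge0 // divr_ge0.
have Rad0 : 0 < Rad by rewrite sqrtr_gt0 ltr_wpDl ?sqr_ge0 // divr_gt0.
(* [x] and [eta] solve the equations of [newton_condition]. The constant 3/2 in
   [Rad] lies between [1], which puts -1 and 1 inside the disc, and
   [2 * eta * rho = 2], which keeps [A] and [B] outside. *)
pose A : C := (x +i* - eta)%C; pose B : C := (- x +i* - eta)%C.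
pose c : C := (0 +i* rho)%C.
pose lr (j : 'I_k.+3) : R := if j == ord0 then -1 else if j == lift ord0 ord0 then 1 else 0.
pose l j : C := ((lr j)%:C - c) / Rad%:C.
pose mm (i : 'I_k.+3) : C := if i == ord0 then (Rad%:C / (A - c))^* else
  if i == lift ord0 ord0 then (Rad%:C / (B - c))^* else 0.
have RadC : Rad%:C != 0 :> C by rewrite -cabs_gt0 cabs_real gtr0_norm.
have eta0 : 0 < eta by rewrite invr_gt0 mulr_gt0.
have big (y : R) : y ^+ 2 = x ^+ 2 -> Rad < cabs ((y +i* - eta)%C - c).
  move=> yx; apply: sqr_lt_cabs; first exact: ltW.
  rewrite ReD ImD ReN ImN /= subr0 yx xE RadE.
  have -> : m ^+ 2 / q - eta ^+ 2 + (- eta - rho) ^+ 2 = m ^+ 2 / q + 2 * (eta * rho) + rho ^+ 2 by ring.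
  rewrite er; have : 0 <= m ^+ 2 / q by rewrite divr_ge0 ?sqr_ge0 // ltW.
  by move: (m ^+ 2 / q) (rho ^+ 2) => u v; lra.
have bigA : Rad < cabs (A - c) by exact: big.
have bigB : Rad < cabs (B - c) by apply: big; rewrite sqrrN.
have Ac0 : A - c != 0 by rewrite -cabs_gt0; exact: lt_trans bigA.
have Bc0 : B - c != 0 by rewrite -cabs_gt0; exact: lt_trans bigB.
have nA : A != 0 by apply/eqP => /(congr1 (@complex.Im R)) /= /eqP; rewrite oppr_eq0 gt_eqF.
have nB : B != 0 by apply/eqP => /(congr1 (@complex.Im R)) /= /eqP; rewrite oppr_eq0 gt_eqF.
have nr (z : C) (r : R) : complex.Im z = - eta -> z != r%:C.
  by move=> zi; apply/eqP => /(congr1 (@complex.Im R)); rewrite zi /= => /eqP; rewrite oppr_eq0 gt_eqF.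
have nz (z : C) : complex.Im z = - eta -> z ^+ 2 != 1.
  move=> zi; rewrite sqrf_eq1 negb_or; apply/andP; split; first exact: (nr z 1).
  by have := nr z (-1) zi; rewrite (rmorphN1 (real_complex R)).
exists l, mm; split.
- move=> j; rewrite /l cabsM cabsV cabs_real gtr0_norm // ltr_pdivrMr // mul1r.
  apply: cabs_lt_sqr; first exact: ltW.
  rewrite ReD ImD ReN ImN /= subr0 sub0r sqrrN RadE addrC ltrD2l /lr.
  by case: ifP => _; [|case: ifP => _]; rewrite ?sqrrN ?expr1n ?expr0n /=; lra.
- move=> j; rewrite /mm; case: ifP => _; [|case: ifP => _]; last by rewrite cabs0.
    by rewrite cabsJ cabsM cabsV cabs_real gtr0_norm // ltr_pdivrMr ?mul1r // (lt_trans Rad0).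
  by rewrite cabsJ cabsM cabsV cabs_real gtr0_norm // ltr_pdivrMr ?mul1r // (lt_trans Rad0).
pose u (Z : C) (j : 'I_k.+3) := (Z - c) * (Z - (lr j)%:C)^-1.
have uE (Z : C) j : Z - c != 0 -> complex.Im Z = - eta -> (1 - l j * (Rad%:C / (Z - c)))^-1 = u Z j.
  move=> Zc Zi; have := nr Z (lr j) Zi; rewrite -subr_eq0 => Zl; rewrite /l /u.
  have -> : 1 - ((lr j)%:C - c) / Rad%:C * (Rad%:C / (Z - c)) = (Z - (lr j)%:C) / (Z - c).
    by move: ((lr j)%:C) => w; field; rewrite RadC Zc.
  by rewrite invf_div.
rewrite (@permanent_two_rows _ _ (u A) (u B)); last 3 first.
- by move=> j; rewrite !mxE /mm eqxx conjCK uE.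
- by move=> j; rewrite !mxE /mm -[_ == ord0]/false eqxx conjCK uE.
- by move=> i j /negbTE i0 /negbTE i1; rewrite !mxE /mm i0 i1 conjC0 mulr0 subr0 invr1.
have lr0 : lr ord0 = -1 by rewrite /lr eqxx.
have lr1 : lr (lift ord0 ord0) = 1 by rewrite /lr -[_ == ord0]/false eqxx.
have lr2 i : lr (lift ord0 (lift ord0 i)) = 0 by rewrite /lr -[_ == ord0]/false.
have sumE (f : R -> C) : \sum_j f (lr j) = f (-1) + (f 1 + k.+1%:R * f 0).
  rewrite big_ord_recl lr0 big_ord_recl lr1; congr (_ + (_ + _)).
  under eq_bigr do rewrite lr2.
  by rewrite sumr_const card_ord mulr_natl.
have C1 : (1 : R)%:C = 1 :> C by [].
have CN1 : (-1 : R)%:C = -1 :> C by rewrite (rmorphN1 (real_complex R)).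
have C0 : (0 : R)%:C = 0 :> C by [].
rewrite /u (sumE (fun y => (A - c) * (A - y%:C)^-1)) (sumE (fun y => (B - c) * (B - y%:C)^-1)).
rewrite (sumE (fun y => (A - c) * (A - y%:C)^-1 * ((B - c) * (B - y%:C)^-1))).
rewrite C1 CN1 C0 !opprK !subr0.
have mC : (k.+1%:R : C) = m%:C by rewrite /m (rmorph_nat (real_complex R)).
have mC1 : (k.+1%:R + 1 : C) = (m + 1)%:C by rewrite (rmorphD (real_complex R)) /= -mC.
have m10 : (k.+1%:R + 1 : C) != 0 by rewrite natr1 pnatr_eq0.
have imA : complex.Im A = - eta by []. have imB : complex.Im B = - eta by [].
have AB : A * B = - (k.+1%:R / (k.+1%:R + 1)) ^+ 2.
  rewrite mC1 mC; rewrite -(fmorph_div (real_complex R)) -(rmorphXn (real_complex R)) -(rmorphN (real_complex R)) /=.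
  apply: eq_ReIm; rewrite ?ReM ?ImM /=; last by ring.
  have -> : x * - x - - eta * - eta = - (x ^+ 2 + eta ^+ 2) by ring.
  by rewrite xE /q; field; rewrite gt_eqF //; lra.
have ABs : (A + B) ^+ 2 = - (k.+1%:R + 1)^-1 ^+ 4.
  rewrite mC1 -(fmorphV (real_complex R)).
  rewrite -(rmorphXn (real_complex R)) -(rmorphN (real_complex R)) /=.
  apply: eq_ReIm; rewrite expr2 ?ReM ?ImM ?ReD ?ImD /=; last by ring.
  by rewrite /eta /q; field; rewrite gt_eqF //; lra.
have := newton_condition m10 nA nB (nz A imA) (nz B imB) AB ABs.
move: (permanent _) (k.+1%:R : C) ((A + 1)^-1) ((A - 1)^-1) (A^-1) ((B + 1)^-1) ((B - 1)^-1) (B^-1) (A - c) (B - c)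
  => P0 mC' a1 a2 a3 b1 b2 b3 a b H.
by rewrite -[RHS](mulr0 (P0 * a * b)) -H; ring.
Qed.
End Zero.

(** * The Bergman kernel of the symmetrized polydisc *)

Section BergmanKernel.
Context {R : realType} (n : nat).
Hypothesis n0 : (0 < n)%N.
Local Notation C := R[i].
Local Notation L n := (@lebesgue_Cn R n).
Local Notation T := (n.-tuple (plane R)).
Local Notation Gn := (symmetrized_polydisc R n).
Local Hint Extern 0 (is_true (0 <= cabs _)) => (exact: cabs_ge0) : core.

(** Conjugated because the kernel enters the inner product in the second
    argument. *)
Definition kconst : C := ((kap n)%:C / (n`!%:R * disc_area ^+ n))^*.

(** The kernel needs a preimage of its second argument; [r] chooses one. *)
Lemma is_bergman_kernel_sker (r : 'rV[C]_n -> T) :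
  (forall w, Gn w -> pdisc (r w) /\ Cn_of_tuple (sig (r w)) = w) ->
  is_bergman_kernel Gn (fun z w => kconst * sker (fun j => (lam (r w) j)^*) z).
Proof.
move=> Hr; split=> [w wG|f w Bf wG]; have [rD rE] := Hr w wG.
  have [rr rr1 Hrr] := lam_max rD.
  have nu1 j : cabs ((lam (r w) j)^*) < 1 by rewrite cabsJ; exact: rD.
  have hol : holomorphic_on Gn (fun z => kconst * sker (fun j => (lam (r w) j)^*) z).
    move=> z zG; apply: differentiableM; first exact: differentiable_cst.
    exact: differentiable_sker.
  split=> //; have [B B0 HB] := sker_bound n rr1.
  have mk := measurable_cabs (cmeasurable_DG hol).
  pose M := (cabs kconst * B) ^+ 2.
  apply: (@le_lt_trans _ _ (\int[L n]_(t in @DG R n) M%:E)%E); last first.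
    rewrite integral_cst; last exact: measurable_DG.
    by apply: lte_mul_pinfty; rewrite ?lee_fin ?sqr_ge0 //; exact: DG_fin.
  apply: ge0_le_integral; rewrite ?measurable_DG //.
  - exact: measurable_DG.
  - by move=> t _; rewrite lee_fin exprn_ge0 // (cabs_ge0 _).
  - by apply/measurable_EFinP; apply: measurable_funX; exact: mk.
  - move=> t tD; rewrite lee_fin -/(cabs _) /M ler_pXn2r ?nnegrE ?mulr_ge0 //.
    rewrite cabsM ler_wpM2l // HB // => j; by rewrite cabsJ.
have E := repro n0 Bf rD; rewrite rE in E.
have kn0 : (kap n)%:C != 0 :> C by rewrite -cabs_gt0 cabs_real normr_gt0 kap_neq0.
have f0 : (n`!%:R * disc_area ^+ n : C) != 0.
  by rewrite mulf_neq0 ?expf_neq0 ?disc_area_neq0 // pnatr_eq0 -lt0n fact_gt0.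
pose phi (t : T) := f (Cn_of_tuple t) * (sker (fun j => (lam (r w) j)^*) (Cn_of_tuple t))^*.
have [hf f2] := Bf; have [rr rr1 Hrr] := lam_max rD; have [B B0 HB] := sker_bound n rr1.
have iphi : cintegrable (L n) (@DG R n) phi.
  apply: (cintegrableM_bounded (@measurable_DG R n) (K := B)).
  - by apply: cintegrable_L2 => //; [exact: measurable_DG|exact: DG_fin|exact: cmeasurable_DG].
  - apply: cmeasurableJ; apply: cmeasurable_DG; apply: sker_holo => j; rewrite cabsJ; exact: rD.
  - by move=> t tD; rewrite cabsJ HB // => j; rewrite cabsJ.
transitivity (cint (L n) (@DG R n) (fun t => kconst^* * phi t)); last first.
  rewrite /L2_inner /Cintegral -/(cint _ _ _).
  transitivity (cint (L n) (@DG R n) (fun t => f (Cn_of_tuple t) *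
     (kconst * sker (fun j => (lam (r w) j)^*) (Cn_of_tuple t))^*)); last by [].
  by apply: eq_cint => t _; rewrite conjM /phi mulrCA.
rewrite (cintZ (@measurable_DG R n) _ iphi) /kconst conjCK.
apply: (mulfI f0); rewrite -E; move: kn0 f0; rewrite -/phi.
by move: ((kap n)%:C) (n`!%:R * _) (cint _ _ _) => u v X u0 v0; field.
Qed.

End BergmanKernel.

Theorem theorem3p2 (R : realType) (n : nat) (hn : (3 <= n)%N) :
  ~ lu_qi_keng (symmetrized_polydisc R n) /\
  exists K : 'rV[R[i]]_n -> 'rV[R[i]]_n -> R[i],
    is_bergman_kernel (symmetrized_polydisc R n) K /\
    exists z w : 'rV[R[i]]_n,
      [/\ symmetrized_polydisc R n z, symmetrized_polydisc R n w & K z w = 0].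
Proof.
suff H : exists K : 'rV[R[i]]_n -> 'rV[R[i]]_n -> R[i],
    is_bergman_kernel (symmetrized_polydisc R n) K /\
    exists z w : 'rV[R[i]]_n,
      [/\ symmetrized_polydisc R n z, symmetrized_polydisc R n w & K z w = 0].
  split=> // lqk; have [K [KB [z [w [zG wG Kzw]]]]] := H.
  by have := lqk K KB z w zG wG; rewrite Kzw eqxx.
case: n hn => [|[|[|k]]] // _.
have n0 : (0 < k.+3)%N by [].
have [l [mm [l1 mm1 P0]]] := permanent_zero (R := R) k.
pose tl : k.+3.-tuple (plane R) := [tuple pc (l j) | j < k.+3].
pose tm : k.+3.-tuple (plane R) := [tuple pc (mm j) | j < k.+3].
have lE j : lam tl j = l j by rewrite /lam tnth_mktuple cpK.
have mE j : lam tm j = mm j by rewrite /lam tnth_mktuple cpK.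
have tlD : pdisc tl by move=> j; rewrite lE.
have tmD : pdisc tm by move=> j; rewrite mE.
pose z0 := Cn_of_tuple (sig tl); pose w0 := Cn_of_tuple (sig tm).
have [r0 Hr0] : exists r : 'rV[R[i]]_k.+3 -> k.+3.-tuple (plane R),
    forall w, symmetrized_polydisc R k.+3 w -> pdisc (r w) /\ Cn_of_tuple (sig (r w)) = w.
  suff C0 w : exists t : k.+3.-tuple (plane R),
      symmetrized_polydisc R k.+3 w -> pdisc t /\ Cn_of_tuple (sig t) = w.
    by have [r Hr] := choice C0; exists r.
  have [[y yD yE]|nw] := pselect (symmetrized_polydisc R k.+3 w); last by exists tm.
  pose ty : k.+3.-tuple (plane R) := [tuple pc (y ord0 i) | i < k.+3].
  have lyE : Cn_of_tuple ty = y by apply/rowP => i; rewrite Cn_of_tupleE /lam tnth_mktuple cpK.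
  exists ty => _; split; last by rewrite -symm_sig lyE.
  by move=> j; rewrite -Cn_of_tupleE lyE; move/polydiscP: yD.
(* The preimage chosen for [w0] is the one for which the permanent vanishes. *)
pose r w := if w == w0 then tm else r0 w.
have Hr w : symmetrized_polydisc R k.+3 w -> pdisc (r w) /\ Cn_of_tuple (sig (r w)) = w.
  by rewrite /r; case: eqP => [-> _|_]; [|exact: Hr0].
exists (fun z w => kconst k.+3 * sker (fun j => (lam (r w) j)^*) z); split.
  exact: is_bergman_kernel_sker.
exists z0, w0; split; [exact/DG_sig|exact/DG_sig|].
have nu1 j : cabs ((lam (r w0) j)^*) < 1 by rewrite /r eqxx cabsJ mE.
rewrite /z0 (sker_tuple nu1 tlD) /kerQ -permanent_tr.
have -> : (\matrix_(i, j) (1 - (lam (r w0) j)^* * lam tl i)^-1)^T =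
    \matrix_(i < k.+3, j < k.+3) (1 - l j * (mm i)^*)^-1.
  by apply/matrixP => i j; rewrite !mxE /r eqxx mE lE mulrC.
by rewrite P0 mul0r mulr0.
Qed.
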